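(* Let $\alpha$ be an integer with $0<\alpha<n$ and let $p\ge1$. There exists a constant $C$ such that for every $u\in W^{\alpha,\frac n\alpha,p}(\mathbb{R}^n)$ with $\|\nabla^\alpha u\|_{n/\alpha}\le1$ we have $$\int_{\mathbb{R}^n}\frac{\exp_{\lceil p\frac{n-\alpha}{n}-1\rceil}\Big[\gamma_{n,\alpha}|u|^{\frac{n}{n-\alpha}}\Big]}{1+|u|^{\frac{p\alpha}{n-\alpha}}}\,dx\le C\|u\|_p^p,$$ and the constant $\gamma_{n,\alpha}$ is sharp, i.e. the inequality fails (for every $C$) if $\gamma_{n,\alpha}$ is replaced by any larger constant.
   Context: $\nabla^\alpha=(-\Delta)^{\alpha/2}$ if $\alpha$ is even and $\nabla^\alpha=\nabla(-\Delta)^{(\alpha-1)/2}$ if $\alpha$ is odd. The mixed Sobolev space is $W^{\alpha,q,p}(\mathbb{R}^n)=\{u\in L^p(\mathbb{R}^n): |\nabla^\alpha u|\in L^q(\mathbb{R}^n)\}$. $\exp_N(t)=e^t-\sum_{j=0}^N\frac{t^j}{j!}$ for an integer $N\ge0$. With $|B_1|$ the Lebesgue measure of the unit ball of $\mathbb{R}^n$ and $$c_\alpha=\frac{2^{-\alpha}\Gamma(\frac{n-\alpha}2)}{\pi^{n/2}\Gamma(\frac\alpha2)},\qquad \tilde c_\alpha=\frac{2^{-\alpha}\Gamma(\frac{n-\alpha+1}2)}{\pi^{n/2}\Gamma(\frac{\alpha+1}2)},$$ put $\gamma_{n,\alpha}=c_\alpha^{-\frac n{n-\alpha}}|B_1|^{-1}$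 if $\alpha$ is even and $\gamma_{n,\alpha}=\tilde c_\alpha^{\,-\frac n{n-\alpha}}|B_1|^{-1}$ if $\alpha$ is odd. *)

(* Defs.v *)
From HB Require Import structures.
From mathcomp Require Import all_boot all_order all_algebra.
From mathcomp Require Import all_classical all_reals all_analysis.

Set Implicit Arguments.
Unset Strict Implicit.
Unset Printing Implicit Defensive.

Import Order.TTheory GRing.Theory Num.Theory.
Import numFieldNormedType.Exports.

Local Open Scope classical_set_scope.
Local Open Scope ring_scope.

(* The sigma-algebra on row vectors is the one generated by the coordinate
   maps, exactly as the library does for n.-tuple T; over a realType it is the
   Borel sigma-algebra of R^n. *)
Definition measure_rV_display : measure_display -> measure_display.
Proof. exact. Qed.

Section measurable_rV.
Context {d} {T : sigmaRingType d}.
Variable n : nat.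

Let coors : 'I_n -> 'rV[T]_n -> T := fun i v => v ord0 i.

Let rV_set0 : g_sigma_preimage coors set0.
Proof. exact: sigma_algebra0. Qed.

Let rV_setC A : g_sigma_preimage coors A -> g_sigma_preimage coors (~` A).
Proof. exact: sigma_algebraC. Qed.

Let rV_bigcup (F : _^nat) : (forall i, g_sigma_preimage coors (F i)) ->
  g_sigma_preimage coors (\bigcup_i (F i)).
Proof. exact: sigma_algebra_bigcup. Qed.

HB.instance Definition _ := @isMeasurable.Build (measure_rV_display d)
  'rV[T]_n (g_sigma_preimage coors) rV_set0 rV_setC rV_bigcup.

End measurable_rV.

Section rV_measurability.
Context d (T : measurableType d).

Lemma measurable_coord_rV n (i : 'I_n) :
  measurable_fun [set: 'rV[T]_n] (fun v => v ord0 i).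
Proof.
move=> _ Y mY; rewrite setTI; apply: sub_sigma_algebra => /=.
rewrite -bigcup_seq/=; exists i => /=; first by rewrite mem_index_enum.
by exists Y => //; rewrite setTI.
Qed.

Lemma measurable_fun_rV d' (X : measurableType d') n (f : X -> 'rV[T]_n) :
  (forall i, measurable_fun [set: X] (fun x => f x ord0 i)) ->
  measurable_fun [set: X] f.
Proof.
move=> mf _ A mA; rewrite setTI.
pose G : set (set 'rV[T]_n) := [set B | measurable (f @^-1` B)].
suff : @measurable _ 'rV[T]_n `<=` G by move/(_ A mA).
apply: smallest_sub.
  split => [|B GB|F GF]; rewrite /G/=.
  - by rewrite preimage_set0.
  - by rewrite setTD preimage_setC; exact: measurableC.
  - by rewrite preimage_bigcup; apply: bigcupT_measurable => k; exact: GF.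
rewrite -bigcup_seq/=; apply: bigcup_sub => i _.
move=> _ [B mB <-]; rewrite /G/= setTI -[X in measurable X]setTI; exact: mf.
Qed.

Definition rV_rcons n (z : 'rV[T]_n * T) : 'rV[T]_n.+1 :=
  \row_(i < n.+1) if unlift ord_max i is Some j then z.1 ord0 j else z.2.

Lemma measurable_rV_rcons n : measurable_fun [set: 'rV[T]_n * T] (@rV_rcons n).
Proof.
apply: measurable_fun_rV => i.
case: (unliftP ord_max i) => [j|] ->; under eq_fun do rewrite mxE.
- under eq_fun do rewrite liftK.
  exact: (measurableT_comp (measurable_coord_rV j) measurable_fst).
- under eq_fun do rewrite unlift_none.
  exact: measurable_snd.
Qed.

End rV_measurability.

Definition pushforward_measure d d' (T1 : measurableType d)
    (T2 : measurableType d') (R : realType) (m : {measure set T1 -> \bar R})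
    (f : T1 -> T2) (mf : measurable_fun [set: T1] f) :
    {measure set T2 -> \bar R} :=
  measure_function_pushforward__canonical__measure_function_Measure m mf.

Section lebesgue_Rn.
Context {R : realType}.

(* n-dimensional Lebesgue measure, restricted to Borel sets. *)
Fixpoint lebesgue_rV (n : nat) : {measure set 'rV[R]_n -> \bar R} :=
  match n with
  | 0 => \d_ (0 : 'rV[R]_0)
  | k.+1 => pushforward_measure
      (product_measure1 (lebesgue_rV k) (@lebesgue_measure R))
      (@measurable_rV_rcons _ R k)
  end.
End lebesgue_Rn.

Section differential_operators.
Context {R : realType}.
Variable n : nat.
Implicit Types (phi u : 'rV[R]_n -> R) (x : 'rV[R]_n).

Definition partial (i : 'I_n) phi : 'rV[R]_n -> R :=
  fun x => 'D_(delta_mx ord0 i) phi x.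

Definition iter_partial (s : seq 'I_n) phi := foldr partial phi s.

Definition smooth phi := forall s x, differentiable (iter_partial s phi) x.

Definition test_function phi :=
  smooth phi /\ compact (closure [set x | phi x != 0]).

Definition gradient phi : 'rV[R]_n -> 'rV[R]_n :=
  fun x => \row_i partial i phi x.

Definition neg_laplacian phi : 'rV[R]_n -> R :=
  fun x => - \sum_(i < n) partial i (partial i phi) x.

(* nabla^alpha is scalar valued (a vector of length 1) for even alpha, and
   vector valued for odd alpha. *)
Definition nabla_dim (alpha : nat) : nat := if odd alpha then n else 1%N.

Definition nabla (alpha : nat) phi : 'rV[R]_n -> 'rV[R]_(nabla_dim alpha) :=
  let psi := iter alpha./2 neg_laplacian phi in
  if odd alpha as b return 'rV[R]_n -> 'rV[R]_(if b then n else 1%N)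
  then gradient psi
  else fun x => const_mx (psi x).

Definition locally_integrable_rV u :=
  measurable_fun [set: 'rV[R]_n] u /\
  forall K : set 'rV[R]_n, compact K ->
    (\int[lebesgue_rV n]_(x in K) `|u x|%:E < +oo)%E.

(* F represents the distribution nabla^alpha u.  Integrating by parts alpha
   times gives the sign (-1)^alpha, since (-Delta)^k is formally self-adjoint
   and the gradient is formally skew-adjoint. *)
Definition weak_nabla (alpha : nat) u
    (F : 'rV[R]_n -> 'rV[R]_(nabla_dim alpha)) :=
  [/\ locally_integrable_rV u,
      forall j, locally_integrable_rV (fun x => F x ord0 j)
    & forall phi, test_function phi -> forall j,
        \int[lebesgue_rV n]_x (F x ord0 j * phi x) =
        (-1) ^+ alpha * \int[lebesgue_rV n]_x (u x * nabla alpha phi x ord0 j)].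

End differential_operators.
Arguments weak_nabla {R n} alpha u F.

Definition enorm {R : realType} {m : nat} (v : 'rV[R]_m) : R :=
  Num.sqrt (\sum_(j < m) v ord0 j ^+ 2).

Definition mixed_sobolev {R : realType} {n : nat} (alpha : nat) (q p : R) :
    set ('rV[R]_n -> R) :=
  [set u | u \in Lfun (lebesgue_rV n) p%:E /\
     exists2 F, weak_nabla alpha u F &
       (fun x => enorm (F x)) \in Lfun (lebesgue_rV n) q%:E].

Definition exp_remainder {R : realType} (N : nat) (t : R) : R :=
  expR t - \sum_(0 <= j < N.+1) t ^+ j / j`!%:R.

Section constants.
Context {R : realType}.

Definition Gamma (a : R) : R :=
  \int[lebesgue_measure]_(t in `]0, +oo[) (t `^ (a - 1) * expR (- t)).

Definition unit_ball_volume (n : nat) : R :=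
  fine (lebesgue_rV n [set x : 'rV[R]_n | enorm x < 1]).

Definition c_even (n alpha : nat) : R :=
  2 ^- alpha * Gamma ((n%:R - alpha%:R) / 2) /
  (pi `^ (n%:R / 2) * Gamma (alpha%:R / 2)).

Definition c_odd (n alpha : nat) : R :=
  2 ^- alpha * Gamma ((n%:R - alpha%:R + 1) / 2) /
  (pi `^ (n%:R / 2) * Gamma ((alpha%:R + 1) / 2)).

Definition gamma_const (n alpha : nat) : R :=
  (if odd alpha then c_odd n alpha else c_even n alpha)
    `^ (- (n%:R / (n%:R - alpha%:R))) * (unit_ball_volume n)^-1.

End constants.

(* |nabla^alpha u| is determined up to a null set, so ranging over all
   representatives F of nabla^alpha u amounts to taking any one of them.  The
   order of the exponential remainder is nonnegative for p >= 1 and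
   0 < alpha < n, hence unchanged by the absolute value int -> nat. *)
Definition adams_exact_growth {R : realType} (n alpha : nat) (p gamma C : R) :=
  forall u : 'rV[R]_n -> R, mixed_sobolev alpha (n%:R / alpha%:R) p u ->
  forall F, weak_nabla alpha u F ->
    ('N[lebesgue_rV n]_((n%:R / alpha%:R)%:E)[(fun x => (enorm (F x))%:E)]
       <= 1)%E ->
    let N := `|Num.ceil (p * ((n%:R - alpha%:R) / n%:R) - 1)|%N in
    (\int[lebesgue_rV n]_x
       (exp_remainder N (gamma * `|u x| `^ (n%:R / (n%:R - alpha%:R))) /
        (1 + `|u x| `^ (p * alpha%:R / (n%:R - alpha%:R))))%:E
     <= C%:E * 'N[lebesgue_rV n]_(p%:E)[(fun x => (u x)%:E)] `^ p)%E.

(* Main.v *)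
(* Write q = n/alpha, 1/q + 1/q' = 1, gamma = gamma_{n,alpha}, and let V be the
   volume of the unit ball.

   Upper bound.  Testing the weak gradient F of u against a cut-off parametrix
   of the fundamental solution of nabla^alpha, and letting the regularisation
   vanish, bounds |u| almost everywhere by the convolution of |F| with
   k(z) <= (gamma V |z|^n)^(-1/q') plus a term controlled by the L^p norm of u.
   Let S_k = {k <= gamma |u|^q' < k + 1}, let tau_k be the multiple of
   k^(-p/q) |u|_p^p by which Chebyshev's inequality bounds the measure s_k of
   S_k, and T_k = ln (tau_k / s_k) >= 0; it suffices to bound
   sum_k e^(k - T_k).  Average the representation over S_k, and split |F| into
   its largest values, on a set of measure s_j (j <= k) carrying the energy
   e_j^q, and the rest, of energy at most 1 - e_j^q.  By Hoelder's inequality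
     k^(1/q') <= K k^(-1/q) + K e_j + e_j ((T_k - T_j)^+ + K)^(1/q')
                 + (1 - e_j^q)^(1/q) (T_j + P ln (k/j) + K)^(1/q'),
   where the values of |u| have been multiplied by gamma^(1/q').  With j = k
   this gives T_k >= k - B and shows that e_k is small when T_k - k is bounded;
   inserting this for j < k shows that the indices with T_k - k <= lambda
   number O(1 + lambda), which makes the sum converge.

   Sharpness.  For u = - A ln (|x|^2 + d) cut off at |x| = 1, nabla^alpha u is
   explicit: its norm is at most A (|x|^2 + d)^(-alpha/2) (L + C d/(|x|^2 + d))
   near 0 with L = 2 / (c_alpha n V), so its energy is A^q L^q (n V / 2) ln (1/d)
   to leading order.  Normalising A makes gamma |u|^q' close to
   (n/2) ln (1/d) on |x|^2 < d, a set of measure V d^(n/2); hence for a larger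
   constant the left-hand side grows like a negative power of d whereas |u|_p^p
   is at most a power of ln (1/d). *)

From HB Require Import structures.
Require Import Defs.
From mathcomp Require Import all_boot all_order all_algebra.
From mathcomp Require Import all_classical all_reals all_analysis.
From mathcomp Require Import measurable_realfun.
From mathcomp Require Import ring lra zify.

Set Implicit Arguments.
Unset Strict Implicit.
Unset Printing Implicit Defensive.

Import Order.TTheory GRing.Theory Num.Theory.
Import numFieldNormedType.Exports.

Local Open Scope classical_set_scope.
Local Open Scope ring_scope.

(** * Lebesgue measure and radial integrals *)

Section measure_Rn.
Context {R : realType}.
Notation leb := (@lebesgue_measure R).

(** The bound T_k >= k - B controls each term of the sum but not the sum: nearly extremal levels
    have to be sparse. They are because F has only one unit of energy. If level j is nearly
    extremal, the energy outside the top part has already been spent to reach height j, and only the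
    small e_j is left to climb from j to k over the volumes between s_k and s_j. Averaging over S_k
    takes the place of a rearrangement: near the diagonal the convolution is unbounded pointwise,
    but its mean over a set of measure s_k is under control. The kernel at level k is cut off on a
    ball of volume tau_k = lambda Q k^(p/q), where Q bounds the p-th power of the norm. Then the
    cut-off error (Q/tau_k)^(1/p) is at most k^(-1/q), hence bounded after multiplication by
    k^(1/q), and the factor k^(p/q) cancels against the denominator of the integrand on S_k. Radial
    functions are handled as profiles in s = |x|^2 listed with all their derivatives. Powers of s +
    d are mapped to combinations of such powers by the iterated Laplacian, so the parametrix and the
    logarithm both have explicit images, for odd and even alpha alike. *)

Definition cube (n : nat) (k : R) : set 'rV[R]_n := [set x | forall i, `|x ord0 i| <= k].

Arguments cube : clear implicits.

Lemma measurable_cube n (k : R) : measurable (cube n k).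
Proof.
have -> : cube n k = \bigcap_(i in [set: 'I_n]) ((fun x : 'rV[R]_n => x ord0 i) @^-1` `[- k, k]).
  apply/seteqP; split=> x /= H i => [_|]; rewrite /= ?in_itv/= -?ler_norml.
    exact: H.
  by move: (H i I); rewrite /= in_itv/= -ler_norml.
apply: fin_bigcap_measurable => // i _.
rewrite -[X in measurable X]setTI; exact: measurable_coord_rV.
Qed.

Lemma rV_rcons_lift n (x : 'rV[R]_n) (t : R) (j : 'I_n) :
  rV_rcons (x, t) ord0 (lift ord_max j) = x ord0 j.
Proof. by rewrite /rV_rcons mxE liftK. Qed.

Lemma rV_rcons_last n (x : 'rV[R]_n) (t : R) : rV_rcons (x, t) ord0 ord_max = t.
Proof. by rewrite /rV_rcons mxE unlift_none. Qed.

Lemma lebesgue_cube n (k : R) : 0 <= k -> lebesgue_rV n (cube n k) = ((k *+ 2) ^+ n)%:E.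
Proof.
move=> k0; elim: n => [|n IH].
  rewrite /= diracE expr0 mem_set// => -[].
  by [].
rewrite [LHS]/= /pushforward.
have -> : @rV_rcons _ R n @^-1` cube n.+1 k = cube n k `*` `[- k, k].
  apply/seteqP; split=> [[x t] /= H|[x t] /= [H1 H2] i].
    split; last first.
      by rewrite in_itv/= -ler_norml; move: (H ord_max); rewrite rV_rcons_last.
    by move=> i; move: (H (lift ord_max i)); rewrite rV_rcons_lift.
  case: (unliftP ord_max i) => [j|] ->; first by rewrite rV_rcons_lift; exact: H1.
  rewrite rV_rcons_last; by move: H2; rewrite /= in_itv/= -ler_norml.
rewrite product_measure1E//; last exact: measurable_cube.
have E : leb `[- k, k] = (k *+ 2)%:E.
  rewrite lebesgue_measure_itv/= lte_fin; case: (ltP (-k) k) => h.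
    by rewrite -EFinB opprK mulr2n.
  have -> : k = 0 by apply/eqP; rewrite eq_le k0 andbT; lra.
  by rewrite mul0rn.
by rewrite [X in (_ * X)%E]E IH -EFinM exprSr.
Qed.

Lemma sigma_finite_lebesgue_rV n : sigma_finite setT (@lebesgue_rV R n).
Proof.
exists (fun k => cube n k%:R); last first.
  move=> k; split; first exact: measurable_cube.
  by rewrite lebesgue_cube// ltry.
apply/seteqP; split=> // x _.
pose m := \sum_(i < n) `|x ord0 i|.
exists (Num.truncn m).+1 => //= i.
apply: le_trans (ltW (truncnS_gt _)).
by rewrite /m (bigD1 i)//= lerDl sumr_ge0.
Qed.

(** A copy of [lebesgue_rV n] that carries the sigma-finite structure required by Tonelli's
    theorem. *)
Definition lebesgue_rVs n : set 'rV[R]_n -> \bar R := lebesgue_rV n.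
HB.instance Definition _ n := Measure.on (@lebesgue_rVs n).
HB.instance Definition _ n := @Measure_isSigmaFinite.Build _ _ _ (@lebesgue_rVs n)
  (@sigma_finite_lebesgue_rV n).

Lemma tonelli_rV n m (f : 'rV[R]_n * 'rV[R]_m -> \bar R) :
  measurable_fun [set: 'rV[R]_n * 'rV[R]_m] f -> (forall x, 0 <= f x)%E ->
  (\int[lebesgue_rV n]_x \int[lebesgue_rV m]_y f (x, y) =
   \int[lebesgue_rV m]_y \int[lebesgue_rV n]_x f (x, y))%E.
Proof.
exact: (@fubini_tonelli _ _ _ _ R (@lebesgue_rVs n) (@lebesgue_rVs m)).
Qed.

Lemma integral_rVS n (f : 'rV[R]_n.+1 -> \bar R) :
  measurable_fun setT f -> (forall x, 0 <= f x)%E ->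
  (\int[lebesgue_rV n.+1]_x f x =
   \int[lebesgue_rV n]_x \int[leb]_t f (rV_rcons (x, t)))%E.
Proof.
move=> mf f0; rewrite [LHS]/=.
rewrite ge0_integral_pushforward//; last exact: measurable_rV_rcons.
rewrite preimage_setT.
rewrite (@fubini_tonelli1 _ _ _ _ R (@lebesgue_rVs n) leb)//; last by move=> x; exact: f0.
by apply: measurableT_comp => //; exact: measurable_rV_rcons.
Qed.

Lemma measurable_integral_rcons n (f : 'rV[R]_n.+1 -> \bar R) :
  measurable_fun setT f -> (forall x, 0 <= f x)%E ->
  measurable_fun setT (fun x => \int[leb]_t f (rV_rcons (x, t)))%E.
Proof.
move=> mf f0.
apply: (@measurable_fun_fubini_tonelli_F _ _ _ _ R leb (fun xt => f (rV_rcons xt))) => //.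
by apply: measurableT_comp => //; exact: measurable_rV_rcons.
Qed.

(** The image of [leb] under the affine map, multiplied by [a], gives every interval ]x, y] its
    length, so by uniqueness it is [leb]. *)
Lemma integral_affine_R (a b : R) (f : R -> \bar R) : 0 < a ->
  measurable_fun setT f -> (forall x, 0 <= f x)%E ->
  (\int[leb]_x f (a * x + b)%R = (a^-1)%:E * \int[leb]_x f x)%E.
Proof.
move=> a0 mf f0.
have mphi : measurable_fun setT ((fun x : measurableTypeR R => a * x + b) : measurableTypeR R -> measurableTypeR R).
  by apply: measurable_funD => //; exact: measurable_funM.
have H : forall A, measurable A -> leb A = mscale (NngNum (ltW a0)) (pushforward_measure leb mphi) A.
  apply: lebesgue_measure_unique => X [[x y] _ <-].
  rewrite /mscale/= /pushforward_measure/= /pushforward.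
  have E : (fun z : measurableTypeR R => a * z + b) @^-1` [set` `]x, y]] = [set` `](x - b) / a, (y - b) / a] ].
    apply/seteqP; split => z /=; rewrite !in_itv/= ltr_pdivrMr// ler_pdivlMr// [a * z]mulrC.
      by rewrite ltrBlDr lerBrDr.
    by rewrite ltrBlDr lerBrDr.
  have -> : mscale (NngNum (ltW a0)) (pushforward_measure leb mphi) [set` `]x, y]] =
    (a%:E * leb ((fun z : measurableTypeR R => a * z + b)%R @^-1` [set` `]x, y]]))%E by [].
  rewrite E !lebesgue_measure_itv/= !lte_fin ltr_pM2r ?invr_gt0// ltrD2r.
  case: ifP => _; last by rewrite mule0.
  rewrite -!EFinB -EFinM; congr EFin; field.
  by rewrite gt_eqF.
have -> : (\int[leb]_x f x = \int[mscale (NngNum (ltW a0)) (pushforward_measure leb mphi)]_x f x)%E.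
  by apply: eq_measure_integral => A mA _; apply: H.
rewrite ge0_integral_mscale//= ge0_integral_pushforward//=.
rewrite preimage_setT muleA -EFinM mulVf ?gt_eqF// mul1e//.
Qed.

Lemma rV_rconsD n (x : 'rV[R]_n) t (a : R) (v : 'rV[R]_n.+1) :
  a *: rV_rcons (x, t) + v =
  rV_rcons (a *: x + \row_i v ord0 (lift ord_max i), a * t + v ord0 ord_max).
Proof.
apply/rowP => i; rewrite !mxE; case: (unliftP ord_max i) => [j|] ->.
  by rewrite ?liftK/= !mxE.
by rewrite ?unlift_none.
Qed.

Lemma measurable_affine_rV n (a : R) (v : 'rV[R]_n) :
  measurable_fun setT (fun x : 'rV[R]_n => a *: x + v).
Proof.
apply: measurable_fun_rV => i.
under eq_fun do rewrite !mxE.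
by apply: measurable_funD => //; apply: measurable_funM => //; exact: measurable_coord_rV.
Qed.

Lemma integral_affine_rV n (a : R) (v : 'rV[R]_n) (f : 'rV[R]_n -> \bar R) : 0 < a ->
  measurable_fun setT f -> (forall x, 0 <= f x)%E ->
  (\int[lebesgue_rV n]_x f (a *: x + v)%R = ((a ^- n))%:E * \int[lebesgue_rV n]_x f x)%E.
Proof.
move=> a0; elim: n => [|n IH] in v f * => mf f0.
  by rewrite expr0 invr1 mul1e; apply: eq_integral => x _; congr f; apply/rowP => -[].
rewrite !integral_rVS//; last first.
  by apply: measurableT_comp => //; exact: measurable_affine_rV.
under eq_integral => x _.
  under eq_integral => t _ do rewrite rV_rconsD.
  rewrite (integral_affine_R (v ord0 ord_max) (f := fun t => f (rV_rcons (a *: x + \row_i v ord0 (lift ord_max i), t))))//; last first.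
    apply: measurableT_comp => //.
    exact: (measurableT_comp (@measurable_rV_rcons _ R n)).
  over.
have mI : measurable_fun setT (fun x : 'rV[R]_n => \int[leb]_t f (rV_rcons ((a *: x + \row_i v ord0 (lift ord_max i))%R, t)))%E.
  apply: (measurableT_comp (f := fun x => \int[leb]_t f (rV_rcons (x, t)))%E).
    exact: measurable_integral_rcons.
  exact: measurable_affine_rV.
have nI (x : 'rV[R]_n) : setT x -> (0 <= \int[leb]_t f (rV_rcons ((a *: x + \row_i v ord0 (lift ord_max i))%R, t)))%E.
  by move=> _; apply: integral_ge0.
have ai : (0 <= (a^-1)%:E)%E by rewrite lee_fin invr_ge0 ltW.
rewrite (ge0_integralZl (lebesgue_rV n) measurableT mI nI ai).
rewrite (IH _ (fun x => \int[leb]_t f (rV_rcons (x, t)))%E).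
- by rewrite muleA -EFinM exprS invfM.
- exact: measurable_integral_rcons.
- by move=> x; apply: integral_ge0.
Qed.

(** The sigma-algebra is generated by coordinates, so an open set has to be written as a countable
    union: it is the union of the closed cubes with rational centres and half-sides 1/(k+1) that it
    contains. *)
Lemma open_measurable_rV n (U : set 'rV[R]_n) : open U -> measurable U.
Proof.
move=> oU.
pose B (i : 'rV[rat]_n * nat) : set 'rV[R]_n :=
  [set x | forall j, `|x ord0 j - ratr (i.1 ord0 j)| <= i.2.+1%:R^-1].
pose F i := if `[< B i `<=` U >] then B i else set0.
have mB i : measurable (B i).
  have -> : B i = (fun x : 'rV[R]_n => 1 *: x + (- \row_j ratr (i.1 ord0 j))) @^-1` (cube n i.2.+1%:R^-1).
    apply/seteqP; split => x /= H j; move: (H j); by rewrite !mxE mul1r.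
  rewrite -[X in measurable X]setTI; apply: measurable_affine_rV => //; exact: measurable_cube.
have -> : U = \bigcup_i F i.
  apply/seteqP; split => [x Ux|x [i _]]; last first.
    by rewrite /F; case: asboolP => // BU Bx; exact: BU.
  have /nbhs_ballP[e /= e0 eU] : nbhs x U by exact: open_nbhs_nbhs.
  have [k ke] : exists k : nat, k.+1%:R^-1 < e / 2.
    exists (Num.truncn (2 / e)); rewrite -[X in _ < X]invrK ltf_pV2 ?posrE ?invr_gt0 ?divr_gt0//.
    by rewrite invf_div; exact: truncnS_gt.
  have k0 : 0 < k.+1%:R^-1 :> R by rewrite invr_gt0 ltr0n.
  have [d dE] : exists d : R, d = k.+1%:R^-1 by eexists.
  rewrite -dE in ke k0.
  have /choice[q qP] : forall j, exists q : rat, `|x ord0 j - ratr q| <= d.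
    move=> j.
    have /rat_in_itvoo[q] : x ord0 j - d < x ord0 j + d by lra.
    rewrite in_itv/= => /andP[h1 h2]; exists q.
    by rewrite ler_norml; apply/andP; split; lra.
  exists (\row_j q j, k) => //; rewrite /F; case: asboolP => [_ j|[]].
    by rewrite /= mxE; rewrite -dE; exact: qP.
  move=> y By; apply: eU; split=> // i j; rewrite ord1 /ball/=.
  have := By j; rewrite /= mxE -dE => Hy; have := qP j => Hq.
  have -> : x ord0 j - y ord0 j = (x ord0 j - ratr (q j)) - (y ord0 j - ratr (q j)) by ring.
  by apply: (le_lt_trans (ler_normB _ _)); lra.
apply: countable_bigcupT_measurable => // i.
by rewrite /F; case: asboolP.
Qed.

Lemma continuous_measurable_rV n (f : 'rV[R]_n -> R) : continuous f ->
  measurable_fun setT f.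
Proof.
move=> /continuousP cf; apply: (measurability _ (@measurable_realfun.RGenOpens.measurableE R)).
move=> _ [_ [a [b ->] <-]]; rewrite setTI; apply: open_measurable_rV.
exact/cf/interval_open.
Qed.

End measure_Rn.
Arguments cube {R} n k.

Section radial.
Context {R : realType}.
Notation leb := (@lebesgue_measure R).

Definition sqn n (x : 'rV[R]_n) : R := \sum_(i < n) x ord0 i ^+ 2.

Lemma sqn_ge0 n (x : 'rV[R]_n) : 0 <= sqn x.
Proof. by apply: sumr_ge0 => i _; exact: sqr_ge0. Qed.

Lemma sqnZ n (a : R) (x : 'rV[R]_n) : sqn (a *: x) = a ^+ 2 * sqn x.
Proof. by rewrite /sqn mulr_sumr; apply: eq_bigr => i _; rewrite mxE exprMn. Qed.

Lemma sqnN n (x : 'rV[R]_n) : sqn (- x) = sqn x.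
Proof. by rewrite -scaleN1r sqnZ sqrrN expr1n mul1r. Qed.

Lemma measurable_sqn n : measurable_fun setT (@sqn n).
Proof.
apply: measurable_sum => i; apply: measurable_funX; exact: measurable_coord_rV.
Qed.

Lemma measurable_sqn_lt n (r : R) : measurable [set x : 'rV[R]_n | sqn x < r].
Proof.
rewrite (_ : [set x | _] = @sqn n @^-1` [set` `]-oo, r[]); last first.
  by apply/seteqP; split=> x /=; rewrite in_itv.
rewrite -[X in measurable X]setTI; exact: measurable_sqn.
Qed.

Lemma coord_le_sqn n (x : 'rV[R]_n) i : x ord0 i ^+ 2 <= sqn x.
Proof. by rewrite /sqn (bigD1 i)//= lerDl sumr_ge0// => j _; exact: sqr_ge0. Qed.

Notation V := (@unit_ball_volume R).

Lemma unit_ballE n : [set x : 'rV[R]_n | enorm x < 1] = [set x | sqn x < 1].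
Proof.
apply/seteqP; split => x /=; rewrite /enorm -/(sqn x) => h.
  by rewrite -(sqr_sqrtr (sqn_ge0 x)) expr_lt1// sqrtr_ge0.
by rewrite -sqrtr1 ltr_sqrt.
Qed.

Lemma lebesgue_unit_ball n : lebesgue_rV n [set x : 'rV[R]_n | sqn x < 1] = (V n)%:E.
Proof.
rewrite /unit_ball_volume unit_ballE fineK// ge0_fin_numE ?measure_ge0//.
suff H : (lebesgue_rV n [set x : 'rV[R]_n | (sqn x < 1)%R] <= lebesgue_rV n (cube n 1))%E.
  by apply: (le_lt_trans H); rewrite lebesgue_cube// ltry.
apply: le_measure; rewrite ?inE.
- exact: measurable_sqn_lt.
- exact: measurable_cube.
- move=> x /= x1 i; rewrite -(@expr_le1 _ 2)// real_normK ?num_real//.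
  exact: le_trans (coord_le_sqn x i) (ltW x1).
Qed.

Lemma lebesgue_ball n (r : R) : 0 < r ->
  lebesgue_rV n [set x : 'rV[R]_n | sqn x < r] = (V n * r `^ (n%:R / 2))%:E.
Proof.
move=> r0; set a := Num.sqrt r.
have a0 : 0 < a by rewrite sqrtr_gt0.
have mI (t : R) : measurable_fun setT (fun x : 'rV[R]_n => (\1_[set x : 'rV[R]_n | (sqn x < t)%R] x : R)%:E).
  by apply/measurable_EFinP/measurable_indic; exact: measurable_sqn_lt.
have IE (t : R) : (\int[lebesgue_rV n]_x (\1_[set x : 'rV[R]_n | (sqn x < t)%R] x : R)%:E =
    lebesgue_rV n [set x : 'rV[R]_n | (sqn x < t)%R])%E.
  by rewrite integral_indic ?setIT//; exact: measurable_sqn_lt.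
have := integral_affine_rV 0 a0 (mI r) (fun x => ltac:(by rewrite lee_fin)).
rewrite IE; under eq_integral => x _.
  rewrite (_ : \1_ _ _ = \1_[set x : 'rV[R]_n| sqn x < 1] x); last first.
    rewrite !indicE addr0.
    suff -> : (a *: x \in [set x0 | sqn x0 < r]) = (x \in [set x0 | sqn x0 < 1]) by [].
    have E : (sqn (a *: x) < r) = (sqn x < 1).
      by rewrite sqnZ sqr_sqrtr ?ltW// -ltr_pdivlMl// mulVf ?gt_eqF.
    by apply/idP/idP; rewrite !inE/= E.
  over.
rewrite IE lebesgue_unit_ball => /(congr1 (fun z => (a ^+ n)%:E * z)%E).
rewrite muleA -!EFinM mulfV ?mul1e ?expf_neq0 ?gt_eqF// => <-; congr EFin.
rewrite mulrC; congr (_ * _).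
by rewrite mulrC powRrM powR12_sqrt ?ltW// powR_mulrn// ltW.
Qed.

Lemma V_gt0 n : 0 < V n.
Proof.
pose k : R := n.+1%:R^-1.
have k0 : 0 < k by rewrite invr_gt0 ltr0n.
rewrite -lte_fin -lebesgue_unit_ball.
suff H : (lebesgue_rV n (cube n k) <= lebesgue_rV n [set x : 'rV[R]_n | (sqn x < 1)%R])%E.
  by apply: lt_le_trans H; rewrite lebesgue_cube ?ltW// lte_fin exprn_gt0// mulrn_wgt0.
apply: le_measure; rewrite ?inE.
- exact: measurable_cube.
- exact: measurable_sqn_lt.
- move=> x /= xk; rewrite /sqn.
  apply: (@le_lt_trans _ _ (\sum_(i < n) k ^+ 2)).
    apply: ler_sum => i _; rewrite -real_normK ?num_real// ler_sqr ?nnegrE//; exact: ltW.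
  rewrite sumr_const card_ord -mulr_natl /k.
  rewrite exprVn -ltr_pdivlMr ?invr_gt0 ?exprn_gt0 ?ltr0n// invrK mul1r -natrX ltr_nat.
  by rewrite expnS expn1; nia.
Qed.

(** The volume of the ball of radius |x|. In this variable Lebesgue measure becomes [leb] on ]0,
    +oo[, so radial integrals have no Jacobian. *)
Definition bvol n (x : 'rV[R]_n) : R := V n * sqn x `^ (n%:R / 2).

Lemma bvol_ge0 n (x : 'rV[R]_n) : 0 <= bvol x.
Proof. by rewrite mulr_ge0 ?powR_ge0// ltW// V_gt0. Qed.

Lemma measurable_bvol n : measurable_fun setT (@bvol n).
Proof.
apply: measurable_funM => //.
exact: (measurableT_comp (measurable_powR _) (@measurable_sqn n)).
Qed.

(* inverse of the volume of the ball of radius [sqrt s] *)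
Definition bvol_inv n (t : R) : R := (t / V n) `^ (2 / n%:R).

Let halfK n : (0 < n)%N -> 2 / n%:R * (n%:R / 2) = 1 :> R.
Proof. by move=> n0; field; rewrite pnatr_eq0 -lt0n. Qed.

Lemma bvol_lt n (x : 'rV[R]_n) t : (0 < n)%N -> 0 <= t ->
  (bvol x < t) = (sqn x < bvol_inv n t).
Proof.
move=> n0 t0; have n0' : (0:R) < n%:R / 2 by rewrite divr_gt0 ?ltr0n.
rewrite /bvol /bvol_inv mulrC -ltr_pdivlMr ?V_gt0//.
have q0 : 0 <= t / V n by rewrite divr_ge0// ltW// V_gt0.
have [E] : t / V n = (t / V n) `^ (2 / n%:R) `^ (n%:R / 2).
  by rewrite -powRrM halfK// powRr1.
rewrite [in LHS]E; apply/idP/idP => h.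
  rewrite ltNge; apply/negP => h'.
  by move: h; rewrite ltNge => /negP; apply; apply: ge0_ler_powR => //; rewrite ?nnegrE ?powR_ge0 ?sqn_ge0// ltW.
by apply: gt0_ltr_powR => //; rewrite nnegrE ?powR_ge0 ?sqn_ge0.
Qed.

Lemma lebesgue_bvol n t : (0 < n)%N -> 0 < t ->
  lebesgue_rV n [set x : 'rV[R]_n | bvol x < t] = t%:E.
Proof.
move=> n0 t0.
have -> : [set x : 'rV[R]_n | bvol x < t] = [set x | sqn x < bvol_inv n t].
  by apply/seteqP; split => x /=; rewrite bvol_lt// ltW.
have q0 : 0 < t / V n by rewrite divr_gt0// V_gt0.
rewrite lebesgue_ball ?powR_gt0// /bvol_inv -powRrM halfK// powRr1 ?ltW//.
by rewrite mulrC divfK// gt_eqF// V_gt0.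
Qed.

(** The two measures agree on the half-lines ]-oo, x[, which are stable under intersection and
    generate the Borel sets, and both are finite on each ]-oo, k[. *)
Lemma pushforward_bvol n (A : set R) : (0 < n)%N -> measurable A ->
  lebesgue_rV n (@bvol n @^-1` A) = leb (A `&` `]0, +oo[).
Proof.
move=> n0 mA.
have mD : measurable (`]0, +oo[%classic : set R) by [].
have mb : measurable_fun setT (@bvol n : _ -> measurableTypeR R) by exact: measurable_bvol.
apply: (@g_sigma_algebra_measure_unique _ R (measurableTypeR R) (@measurable_realfun.RGenInftyO.G R)
  _ (fun k => `]-oo, k%:R[%classic) _ _ (pushforward_measure (lebesgue_rV n) mb) (mrestr leb mD)) => //.
- by move=> _ [x ->]; exact: measurable_itv.
- by move=> i; exists i%:R.
- apply/seteqP; split => // x _; exists (Num.truncn `|x|).+1 => //=.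
  by rewrite in_itv/=; apply: le_lt_trans (ler_norm x) _; exact: truncnS_gt.
- move=> _ _ [x ->] [y ->]; exists (Num.min x y).
  by apply/seteqP; split => z /=; rewrite !in_itv/= lt_min => /andP.
- move=> _ [x ->]; rewrite /= /pushforward /mrestr.
  have -> : `]-oo, x[%classic `&` `]0, +oo[%classic = `]0, x[%classic :> set R.
    apply/seteqP; split => z /=; rewrite !in_itv/= andbT; first by case=> -> ->.
    by case/andP=> -> ->.
  rewrite lebesgue_measure_itv/= lte_fin; case: ltP => h.
    by rewrite sube0 -(lebesgue_bvol n0 h).
  rewrite (_ : _ @^-1` _ = set0) ?measure0//; apply/seteqP; split => // z /=.
  by rewrite in_itv/= => /(le_lt_trans (bvol_ge0 z)); rewrite ltNge h.
- move=> k; rewrite /= /pushforward.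
  apply: (@le_lt_trans _ _ (lebesgue_rV n [set x | bvol x < k.+1%:R])); last first.
    by rewrite lebesgue_bvol ?ltry ?ltr0n.
  apply: le_measure; rewrite ?inE.
  + by rewrite -[X in measurable X]setTI; exact: mb.
  + rewrite (_ : [set x | _] = @bvol n @^-1` `]-oo, k.+1%:R[); last first.
      by apply/seteqP; split=> x /=; rewrite in_itv.
    by rewrite -[X in measurable X]setTI; exact: mb.
  + by move=> x /=; rewrite in_itv/= => /lt_le_trans; apply; rewrite ler_nat.
- have E := @measurable_realfun.RGenInftyO.measurableE R.
  suff : (measurable_realfun.RGenInftyO.G (R:=R)).-sigma.-measurable A by [].
  by rewrite -E.
Qed.

Lemma integral_bvol n (g : R -> \bar R) : (0 < n)%N ->
  measurable_fun setT g -> (forall t, 0 <= g t)%E ->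
  (\int[lebesgue_rV n]_x g (bvol x) = \int[leb]_(t in `]0%R, +oo[) g t)%E.
Proof.
move=> n0 mg g0.
have mb : measurable_fun setT (@bvol n : _ -> measurableTypeR R) by exact: measurable_bvol.
have := @ge0_integral_pushforward _ _ _ _ R _ mb (lebesgue_rV n) setT g measurableT mg (fun t _ => g0 t).
rewrite preimage_setT /= => <-.
rewrite -(setUv (`]0, +oo[%classic : set R)) ge0_integral_setU//; last 3 first.
- exact: measurableC.
- exact: measurable_funTS.
- by apply/disj_setPS => z [].
rewrite [X in (_ + X)%E]null_set_integral//; last 3 first.
- by apply: measurableC.
- exact: measurable_funTS.
- by rewrite /= /pushforward pushforward_bvol ?setICl ?measure0//; exact: measurableC.
rewrite adde0; apply: eq_measure_integral => A mA AD.
apply: etrans (pushforward_bvol n0 mA) _.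
by rewrite (setIidl AD).
Qed.

End radial.

Lemma mem_setb (T : Type) (b : pred T) (x : T) : (x \in [set x | b x]) = b x.
Proof. by apply/idP/idP; rewrite inE. Qed.

(** * The Gamma function at half-integers *)

Section gamma_half.
Context {R : realType}.
Notation leb := (@lebesgue_measure R).
Notation V := (@unit_ball_volume R).

(** [Gamma] is the [fine] part of this integral and would be 0 if it diverged; finiteness is only
    obtained in [Gamma_half]. *)
Definition eGamma (a : R) : \bar R :=
  (\int[leb]_(t in `]0%R, +oo[) (t `^ (a - 1) * expR (- t))%:E)%E.

Lemma measurable_expRN : measurable_fun setT (fun y : R => expR (- y)).
Proof. by apply: measurableT_comp. Qed.

Lemma integral_expRN_tail (s : R) : (\int[leb]_(y in `]s, +oo[) (expR (- y))%:E = (expR (- s))%:E)%E.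
Proof.
rewrite integral_itv_obnd_cbnd; last first.
  by apply: measurable_funTS; apply/measurable_EFinP; exact: measurable_expRN.
have cE : continuous (fun y : R => expR (- y)).
  move=> x; apply: continuous_comp; last exact: continuous_expR.
  exact: opp_continuous.
rewrite (@ge0_continuous_FTC2y _ _ (fun y : R => - expR (- y)) _ 0).
- by rewrite -EFinB opprK add0r.
- by move=> x _; exact: expR_ge0.
- exact: continuous_subspaceT.
- rewrite -oppr0; apply: cvgN; exact: cvgr_expR.
- by move=> x _; exact: ex_derive.
- by apply: cvg_at_right_filter; apply: cvgN; exact: cE.
- move=> x _; rewrite derive1E; apply: derive_val.
  apply: is_derive_eq.
  by rewrite mulrN1 opprK.
Qed.

(* Tonelli on [t < y], writing [expR (- t)] as the integral of [expR (- y)] over [y > t] *)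
Lemma layer_cake_expRN d (T : measurableType d) (mu : {sigma_finite_measure set T -> \bar R})
    (h : T -> R) (w : T -> \bar R) :
  measurable_fun setT h -> measurable_fun setT w -> (forall x, 0 <= w x)%E ->
  (forall x, 0 <= h x) ->
  (\int[mu]_x (w x * (expR (- h x))%:E) =
   \int[leb]_(y in `]0%R, +oo[) ((expR (- y))%:E * \int[mu]_(x in [set x | h x < y]%R) w x))%E.
Proof.
move=> mh mw w0 h0.
pose f (xy : T * R) : \bar R := if (h xy.1 < xy.2)%R then (w xy.1 * (expR (- xy.2))%:E)%E else 0%E.
have mf : measurable_fun [set: T * R] f.
  apply: measurable_fun_ifT => //.
  - apply: measurable_fun_ltr => //; exact: (measurableT_comp mh).
  - apply: emeasurable_funM; first exact: (measurableT_comp mw).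
    by apply/measurable_EFinP; apply: (measurableT_comp measurable_expRN).
have f0 xy : (0 <= f xy)%E.
  by rewrite /f; case: ifP => // _; rewrite mule_ge0// lee_fin expR_ge0.
have := fubini_tonelli (m1 := mu) (m2 := leb) f mf f0.
under eq_integral => x _.
  rewrite (_ : (fun y => f (x, y)) = (fun y => w x * (expR (- y))%:E)%E \_ `]h x, +oo[); last first.
    by apply/funext => y; rewrite patchE /f/=; rewrite mem_setb in_itv/= andbT.
  rewrite -integral_mkcond ge0_integralZl//; last first.
    by apply: measurable_funTS; apply/measurable_EFinP; exact: measurable_expRN.
  rewrite integral_expRN_tail; over.
move=> ->; rewrite [RHS]integral_mkcond; apply: eq_integral => y _.
rewrite patchE.
rewrite (_ : (fun x => f (x, y)) = (fun x => (expR (- y))%:E * w x)%E \_ [set x | h x < y]); last first.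
  by apply/funext => x; rewrite patchE /f/= mem_setb muleC.
have mD : measurable [set x | h x < y].
  rewrite (_ : [set x | _] = h @^-1` `]-oo, y[); last by apply/seteqP; split=> x /=; rewrite in_itv.
  by rewrite -[X in measurable X]setTI; exact: mh.
rewrite -integral_mkcond; case: ifPn => [_|].
  by rewrite ge0_integralZl//; exact: measurable_funTS.
rewrite notin_setE/= in_itv/= andbT => /negP; rewrite -leNgt => y0.
rewrite (_ : [set x | h x < y] = set0) ?integral_set0//.
by apply/seteqP; split => // x /= /(le_lt_trans (h0 x)); rewrite ltNge y0.
Qed.

Lemma integral_powR_itv0 (a y : R) : 0 < a -> 0 < y ->
  (\int[leb]_(t in `]0%R, y[) (t `^ (a - 1))%:E = (y `^ a / a)%:E)%E.
Proof.
move=> a0 y0.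
(* The integrand may blow up at 0, so the fundamental theorem of calculus is applied on
   [y/(k+2), y], followed by monotone convergence; k+2 keeps these intervals nondegenerate. *)
pose F (k : nat) : set R := `]y / k.+2%:R, y[%classic.
have F1 (k : nat) : y / k.+2%:R < y by rewrite ltr_pdivrMr ?ltr0n// ltr_pMr// ltr1n.
have F0 (k : nat) : 0 < y / k.+2%:R by rewrite divr_gt0 ?ltr0n.
have UF : \bigcup_k F k = `]0, y[%classic.
  apply/seteqP; split => [t [k _]|t]; rewrite /F/= !in_itv/= => /andP[t0 ty].
    by rewrite ty andbT; exact: lt_trans t0.
  pose k := Num.truncn (y / t).
  exists k => //; rewrite /F/= in_itv/= ty andbT ltr_pdivrMr ?ltr0n// mulrC -ltr_pdivrMr//.
  by apply: (lt_trans (truncnS_gt _)); rewrite ltr_nat.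
have E k : (\int[leb]_(t in F k) (t `^ (a - 1))%:E = ((y `^ a - (y / k.+2%:R) `^ a) / a)%:E)%E.
  rewrite /F.
  have dF (x : R) : 0 < x -> is_derive x 1 (fun t : R => t `^ a / a) (x `^ (a - 1)).
    move=> x0; rewrite (_ : (fun t => _) = a^-1 \*: (@powR R ^~ a)); last first.
      by apply/funext => t; rewrite /= mulrC.
    apply: DeriveDef; first by apply: derivableZ; apply: derivable_powR; rewrite in_itv/= x0.
    rewrite deriveZ; last by apply: derivable_powR; rewrite in_itv/= x0.
    rewrite -derive1E powR_derive1 ?in_itv/= ?x0//.
    by rewrite /GRing.scale/= mulrA mulVf ?gt_eqF// mul1r.
  have cF (x : R) : 0 < x -> {for x, continuous (fun t : R => t `^ a / a)}.
    by move=> x0; have [d _] := dF x x0; apply: differentiable_continuous; apply/derivable1_diffP.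
  have cf (x : R) : 0 < x -> {for x, continuous (@powR R ^~ (a - 1))}.
    move=> x0; apply: differentiable_continuous; apply/derivable1_diffP.
    by apply: derivable_powR; rewrite in_itv/= x0.
  rewrite -(@integral_itv_bndoo _ _ _ _ true false); last by apply: measurable_funTS; apply/measurable_EFinP.
  rewrite (@continuous_FTC2 _ (@powR R ^~ (a - 1)) (fun t : R => t `^ a / a))//.
  - by rewrite -EFinB mulrBl.
  - apply: derivable_within_continuous => x; rewrite in_itv/= => /andP[h _].
    by apply: derivable_powR; rewrite in_itv/= (lt_le_trans _ h).
  - split.
    + by move=> x; rewrite in_itv/= => /andP[h _]; have [] := dF x (lt_trans (F0 k) h).
    + exact/cvg_at_right_filter/cF.
    + exact/cvg_at_left_filter/cF.
  - move=> x; rewrite in_itv/= => /andP[h _]; rewrite derive1E.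
    by have [] := dF x (lt_trans (F0 k) h).
have C : (\int[leb]_(t in F k) (t `^ (a - 1))%:E @[k --> \oo] --> \int[leb]_(t in \bigcup_k F k) (t `^ (a - 1))%:E)%E.
  apply: ge0_nondecreasing_set_cvg_integral => //.
  - move=> i j ij; apply/subsetPset => t; rewrite /F/= !in_itv/= => /andP[h ->]; rewrite andbT.
    by apply: le_lt_trans h; rewrite ler_pM2l// lef_pV2 ?posrE ?ltr0n// ler_nat.
  - by move=> k; exact: measurable_itv.
  - by move=> k; apply: measurable_funTS; apply/measurable_EFinP.
  - by move=> k t _; rewrite lee_fin powR_ge0.
rewrite (funext E) in C; rewrite -UF; apply: (cvg_unique _ C) => //.
apply: cvg_EFin; first exact: nearW.
rewrite -[in X in _ --> X](subr0 (y `^ a)); apply: cvgMl; apply: cvgB; first exact: cvg_cst.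
have /cvg_at_rightP := powR_cvg0 a0; apply; split => [k|]; first exact: F0.
rewrite -(mulr0 y); apply: cvgMr.
have := @cvg_harmonic R; rewrite -cvg_shiftS; exact.
Qed.

(** The layer-cake formula with weight t^(a-1) gives the recursion in the extended reals, before
    either side is known to be finite. *)
Lemma eGammaS (a : R) : 0 < a -> eGamma (a + 1) = (a%:E * eGamma a)%E.
Proof.
move=> a0.
pose w (t : R) : \bar R := (if 0 < t then t `^ (a - 1) else 0)%:E.
have mw : measurable_fun setT w.
  by apply/measurable_EFinP; apply: measurable_fun_ifT => //; exact: measurable_fun_ltr.
have w0 t : (0 <= w t)%E by rewrite lee_fin /w; case: ifP => // _; rewrite powR_ge0.
have := @layer_cake_expRN _ _ leb (fun t => Num.max t 0) w _ mw w0 _.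
rewrite (_ : (\int[leb]_x _)%E = eGamma a); last first.
  rewrite /eGamma [RHS]integral_mkcond; apply: eq_integral => t _; rewrite patchE /w.
  case: ltP => t0; last by rewrite mem_setb in_itv/= ltNge t0 mul0e.
  by rewrite mem_setb in_itv/= t0 EFinM.
move=> ->; last 2 first.
- exact: measurable_maxr.
- by move=> t; rewrite le_max lexx orbT.
have -> : (\int[leb]_(y in `]0%R, +oo[)
      ((expR (- y))%:E * \int[leb]_(x in [set x | (Num.max x 0 < y)%R]) w x) =
    \int[leb]_(y in `]0%R, +oo[) (a^-1 * (y `^ (a + 1 - 1) * expR (- y)))%:E)%E.
  apply: eq_integral => y; rewrite inE/= in_itv/= andbT => y0.
  rewrite (_ : (\int[leb]_(x in _) w x)%E = (y `^ a / a)%:E)%E; last first.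
    rewrite -(integral_powR_itv0 a0 y0) integral_mkcond [RHS]integral_mkcond; apply: eq_integral => t _.
    rewrite !patchE /w; case: (ltP 0 t) => t0.
      by rewrite !mem_setb in_itv/= t0 gt_max y0 andbT.
    by rewrite if_same mem_setb in_itv/= ltNge t0.
  by rewrite -EFinM addrK; congr EFin; rewrite mulrC -mulrA mulrCA.
under eq_integral do rewrite EFinM.
rewrite ge0_integralZl//; last 3 first.
- apply/measurable_EFinP; apply: measurable_funM.
    by apply: measurable_funTS.
  by apply: measurable_funTS; exact: measurable_expRN.
- by move=> t _; rewrite lee_fin mulr_ge0 ?powR_ge0 ?expR_ge0.
- by rewrite lee_fin invr_ge0 ltW.
by rewrite muleA -EFinM divff ?mul1e// gt_eqF.
Qed.

Lemma gaussian_rV n : (\int[lebesgue_rV n]_x (expR (- sqn x))%:E = (@pi R `^ (n%:R / 2))%:E)%E.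
Proof.
elim: n => [|n IH].
  rewrite /= integral_dirac//; last first.
    by apply/measurable_EFinP; apply: (measurableT_comp measurable_expRN); exact: measurable_sqn.
  rewrite diracE in_setT mul1e /sqn big_ord0 oppr0 expR0 mul0r powRr0//.
rewrite integral_rVS; last 2 first.
- by apply/measurable_EFinP; apply: (measurableT_comp measurable_expRN); exact: measurable_sqn.
- by move=> x; rewrite lee_fin expR_ge0.
have E (x : 'rV[R]_n) (t : R) : (expR (- sqn (rV_rcons (x, t))))%:E = ((expR (- sqn x))%:E * (gauss_fun t)%:E)%E.
  rewrite -EFinM /gauss_fun -expRD -opprD; congr (expR (- _))%:E.
  rewrite /sqn big_ord_recr/= rV_rcons_last; congr (_ + _); apply: eq_bigr => i _.
  rewrite -[in RHS](rV_rcons_lift x t); congr ((_ : R) ^+ 2); congr (rV_rcons _ _ _).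
  by apply/val_inj; rewrite /= /bump leqNgt ltn_ord.
under eq_integral => x _.
  under eq_integral => t _ do rewrite E.
  rewrite ge0_integralZl//; last 2 first.
  - by apply/measurable_EFinP; exact: measurable_gauss_fun.
  - by move=> t _; rewrite lee_fin gauss_fun_ge0.
  rewrite integralT_gauss muleC; over.
rewrite ge0_integralZl//; last first.
  by apply/measurable_EFinP; apply: (measurableT_comp measurable_expRN); exact: measurable_sqn.
rewrite IH -EFinM; congr EFin.
rewrite -powR12_sqrt ?pi_ge0// -powRD; last by rewrite gt_eqF ?pi_gt0// implybT.
by congr powR; rewrite -natr1; field.
Qed.

Lemma gaussian_eGamma n : (0 < n)%N -> ((@pi R `^ (n%:R / 2))%:E = (V n)%:E * eGamma (n%:R / 2 + 1))%E.
Proof.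
move=> n0; rewrite -gaussian_rV.
have := @layer_cake_expRN _ _ (@lebesgue_rVs R n) (@sqn R n) (cst 1%E) (@measurable_sqn R n) _ _ (@sqn_ge0 R n).
rewrite (_ : (\int[_]_x _)%E = (\int[lebesgue_rV n]_x (expR (- sqn x))%:E)%E); last first.
  by apply: eq_integral => x _; rewrite mul1e.
move=> /(_ (measurable_cst _) (fun=> lee01)) ->.
rewrite -[in RHS]ge0_integralZl//; last 3 first.
- apply/measurable_EFinP; apply: measurable_funM.
    by apply: measurable_funTS.
  by apply: measurable_funTS; exact: measurable_expRN.
- by move=> t _; rewrite lee_fin mulr_ge0 ?powR_ge0 ?expR_ge0.
- by rewrite lee_fin ltW// V_gt0.
apply: eq_integral => y; rewrite inE/= in_itv/= andbT => y0.
rewrite integral_cst; last exact: measurable_sqn_lt.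
rewrite mul1e [X in (_ * X)%E](lebesgue_ball n y0) -!EFinM addrK; congr EFin.
by rewrite mulrC mulrA.
Qed.

(** By the layer-cake formula for exp(-|x|^2), the number pi^(n/2) is n/2 times V n times this
    integral; being finite and positive, it excludes both +oo and 0. *)
Lemma Gamma_half n : (0 < n)%N ->
  eGamma (n%:R / 2) = (Gamma (n%:R / 2 : R))%:E /\ 0 < Gamma (n%:R / 2 : R).
Proof.
move=> n0; have n2 : 0 < n%:R / 2 :> R by rewrite divr_gt0 ?ltr0n.
have := gaussian_eGamma n0; rewrite eGammaS// muleA -EFinM.
have g0 : (0 <= eGamma (n%:R / 2))%E.
  by apply: integral_ge0 => t _; rewrite lee_fin mulr_ge0 ?powR_ge0 ?expR_ge0.
have c0 : 0 < V n * (n%:R / 2) by rewrite mulr_gt0 ?V_gt0.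
rewrite /Gamma /Rintegral -/(eGamma _).
case: (eGamma _) g0 => [r|_|//].
  move=> _ /= [E]; split=> //.
  by have := powR_gt0 (n%:R / 2) (pi_gt0 R); rewrite E pmulr_rgt0.
by rewrite gt0_muley ?lte_fin.
Qed.

Lemma GammaS_half n : (0 < n)%N -> Gamma (n%:R / 2 + 1 : R) = n%:R / 2 * Gamma (n%:R / 2).
Proof.
move=> n0; have n2 : 0 < n%:R / 2 :> R by rewrite divr_gt0 ?ltr0n.
rewrite {1}/Gamma /Rintegral -/(eGamma _) eGammaS//.
by rewrite (Gamma_half n0).1.
Qed.

Lemma pi_Gamma n : (0 < n)%N -> @pi R `^ (n%:R / 2) = n%:R / 2 * V n * Gamma (n%:R / 2).
Proof.
move=> n0; have n2 : 0 < n%:R / 2 :> R by rewrite divr_gt0 ?ltr0n.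
have := gaussian_eGamma n0; rewrite eGammaS// (Gamma_half n0).1 => -[->].
by rewrite mulrA [V n * _]mulrC.
Qed.

End gamma_half.

(** * Iterated Laplacians of radial functions *)

Section is_derive_real.
Context {R : realType} {V : normedModType R}.
Implicit Types (f g : V -> R) (x v : V).

Lemma is_derive_mulR f g x v (df dg : R) : is_derive x v f df -> is_derive x v g dg ->
  is_derive x v (fun y => f y * g y) (df * g x + f x * dg).
Proof.
move=> hf hg; apply: (is_derive_eq (is_deriveM hf hg)).
by rewrite addrC [df * _]mulrC.
Qed.

Lemma is_derive_scaleR (c : R) f x v (df : R) : is_derive x v f df ->
  is_derive x v (fun y => c * f y) (c * df).
Proof. by move=> hf; apply: (is_derive_eq (is_deriveZ c hf)). Qed.

Lemma is_derive_addR f g x v (df dg : R) : is_derive x v f df -> is_derive x v g dg ->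
  is_derive x v (fun y => f y + g y) (df + dg).
Proof. by move=> hf hg; exact: is_deriveD. Qed.

Lemma is_derive_oppR f x v (df : R) : is_derive x v f df ->
  is_derive x v (fun y => - f y) (- df).
Proof. by move=> hf; exact: is_deriveN. Qed.

Lemma is_derive_value f x v (a b : R) : is_derive x v f a -> a = b -> is_derive x v f b.
Proof. by move=> h <-. Qed.

End is_derive_real.

Section jets.
Context {R : realType}.
Implicit Types (H G A : nat -> R -> R) (s d b N : R).

(* A jet lists a function on [0, +oo[ and all its derivatives; the derivatives
   are two-sided, also at 0. *)
Definition jet H := forall k s, 0 <= s -> is_derive s 1 (H k) (H k.+1 s).

Definition jshift H : nat -> R -> R := fun k => H k.+1.
Definition jscale (c : R) H : nat -> R -> R := fun k s => c * H k s.

(** Leibniz' rule in the recursive form (HG)^(k+1) = (H'G)^(k) + (HG')^(k), which suits induction on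
    [k]. *)
Fixpoint jmul_rec (k : nat) H G : R -> R :=
  if k is j.+1 then fun s => jmul_rec j (jshift H) G s + jmul_rec j H (jshift G) s
  else fun s => H 0%N s * G 0%N s.
Definition jmul H G : nat -> R -> R := fun k => jmul_rec k H G.

(* If h has jet H then the radial function h(|z|^2) on R^N has minus Laplacian
   -(4 s h'' + 2 N h')(|z|^2). *)
Definition Ljet N H : nat -> R -> R := fun k s =>
  - (4 * s * H k.+2 s + (2 * N + 4 * k%:R) * H k.+1 s).

(* the divergence of z h(|z|^2) is (N h + 2 s h')(|z|^2) *)
Definition divjet N H : nat -> R -> R := fun k s =>
  (N + 2 * k%:R) * H k s + 2 * s * H k.+1 s.

Lemma jet_shift H : jet H -> jet (jshift H).
Proof. by move=> jH k s s0; exact: jH. Qed.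

Lemma jet_scale c H : jet H -> jet (jscale c H).
Proof.
move=> jH k s s0; have h := jH k s s0.
exact: is_derive_scaleR.
Qed.

Lemma jet_mul H G : jet H -> jet G -> jet (jmul H G).
Proof.
move=> jH jG k s s0; elim: k H G jH jG => [|k IH] H G jH jG.
  have h := jH 0%N s s0; have g := jG 0%N s s0.
  exact: is_derive_mulR h g.
exact: (is_deriveD (IH _ _ (jet_shift jH) jG) (IH _ _ jH (jet_shift jG))).
Qed.

Lemma jet_Ljet N H : jet H -> jet (Ljet N H).
Proof.
move=> jH k s s0.
have h1 := jH k.+1 s s0; have h2 := jH k.+2 s s0.
have i4 := is_derive_scaleR 4 (is_derive_id s (1 : R)).
apply: (is_derive_value (is_derive_oppR (is_derive_addR (is_derive_mulR i4 h2)
  (is_derive_scaleR (2 * N + 4 * k%:R) h1)))).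
rewrite /Ljet -!natr1; ring.
Qed.

Lemma jet_divjet N H : jet H -> jet (divjet N H).
Proof.
move=> jH k s s0.
have h1 := jH k s s0; have h2 := jH k.+1 s s0.
have i4 := is_derive_scaleR 2 (is_derive_id s (1 : R)).
apply: (is_derive_value (is_derive_addR (is_derive_scaleR (N + 2 * k%:R) h1) (is_derive_mulR i4 h2))).
rewrite /divjet -!natr1; ring.
Qed.

Lemma iter_jet_Ljet N m H : jet H -> jet (iter m (Ljet N) H).
Proof. by move=> jH; elim: m => [//|m IH]; rewrite iterS; exact: jet_Ljet. Qed.

(** The radial form of the fact that -Delta commutes with the divergence: on fields z h(|z|^2) in
    dimension N, -Delta acts on the profile h as in dimension N + 2. *)
Lemma Ljet_divjet N H : Ljet N (divjet N H) = divjet N (Ljet (N + 2) H).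
Proof.
apply/funext => k; apply/funext => s; rewrite /Ljet /divjet -!natr1; ring.
Qed.

Lemma Ljet_div N H : Ljet N H = divjet N (jscale (- 2) (jshift H)).
Proof.
apply/funext => k; apply/funext => s; rewrite /Ljet /divjet /jscale /jshift; ring.
Qed.

(** Any positive power of -Delta applied to a radial function is thus the divergence of a field z
    h(|z|^2). Both parities of alpha end in a divergence, whose integral over a ball is a flux. *)
Lemma iter_Ljet_div N m H :
  iter m.+1 (Ljet N) H = divjet N (iter m (Ljet (N + 2)) (jscale (- 2) (jshift H))).
Proof.
by elim: m => [|m IH]; [exact: Ljet_div|rewrite iterS IH Ljet_divjet -iterS].
Qed.

(* [(s + d)^(-b)] *)
Fixpoint pow_jet_coef b k : R :=
  if k is j.+1 then pow_jet_coef b j * - (b + j%:R) else 1.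

Definition pow_jet b d : nat -> R -> R := fun k s =>
  pow_jet_coef b k * (s + d) `^ (- (b + k%:R)).

Lemma jet_pow b d : 0 < d -> jet (pow_jet b d).
Proof.
move=> d0 k s s0; have sd : 0 < s + d by rewrite ltr_wpDl.
have h1 : is_derive (s + d) 1 (@powR R ^~ (- (b + k%:R))) (- (b + k%:R) * (s + d) `^ (- (b + k%:R) - 1)).
  apply: DeriveDef; first by apply: derivable_powR; rewrite in_itv/= sd.
  by rewrite -derive1E powR_derive1 ?in_itv/= ?sd.
have h2 := is_derive_addR (is_derive_id s (1 : R)) (is_derive_cst d s (1 : R)).
apply: (is_derive_value (is_derive_scaleR (pow_jet_coef b k) (@is_derive1_comp R _ (fun y => y + d) s _ _ h1 h2))).
rewrite /pow_jet /= addr0 mulr1 mulrA; congr (_ * _ `^ _).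
rewrite -natr1; ring.
Qed.

Lemma pow_jet_coefS b k : pow_jet_coef b k.+1 = - b * pow_jet_coef (b + 1) k.
Proof.
elim: k => [|k IH]; first by rewrite /=; ring.
rewrite [LHS]/= -/(pow_jet_coef b k.+1) IH /= -natr1; ring.
Qed.

(** Writing s = (s + d) - d expresses the result in powers of s + d again; what distinguishes it
    from the case d = 0 is the term with the factor d. *)
Lemma Ljet_pow N b d k s : 0 < s + d ->
  Ljet N (pow_jet b d) k s = 2 * b * (N - 2 * b - 2) * pow_jet (b + 1) d k s
    + 4 * b * (b + 1) * d * pow_jet (b + 2) d k s.
Proof.
move=> sd; rewrite /Ljet /pow_jet.
set c := pow_jet_coef b.
have E1 : pow_jet_coef (b + 1) k * - b = c k.+1 by rewrite /c pow_jet_coefS mulrC.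
have E2 : pow_jet_coef (b + 2) k * (b * (b + 1)) = c k.+2.
  by rewrite /c pow_jet_coefS [in RHS]pow_jet_coefS -addrA; ring.
have E3 : c k.+2 = c k.+1 * - (b + k.+1%:R) by [].
set x := (s + d) `^ (- (b + 2 + k%:R)).
have X1 : (s + d) `^ (- (b + k.+2%:R)) = x by rewrite /x; congr powR; rewrite -!natr1; ring.
have X2 : (s + d) `^ (- (b + k.+1%:R)) = x * (s + d).
  rewrite -[X in _ * X]powRr1 ?ltW// /x -powRD; last by rewrite (gt_eqF sd) implybT.
  by congr powR; rewrite -!natr1; ring.
have X3 : (s + d) `^ (- (b + 1 + k%:R)) = x * (s + d).
  by rewrite -X2; congr powR; rewrite -!natr1; ring.
rewrite X1 X2 X3 -/c.
have -> : 2 * b * (N - 2 * b - 2) * (pow_jet_coef (b + 1) k * (x * (s + d))) =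
  - 2 * (N - 2 * b - 2) * ((pow_jet_coef (b + 1) k * - b) * (x * (s + d))) by ring.
have -> : 4 * b * (b + 1) * d * (pow_jet_coef (b + 2) k * x) =
  4 * d * ((pow_jet_coef (b + 2) k * (b * (b + 1))) * x) by ring.
rewrite E1 E2 E3 -!natr1; ring.
Qed.

(* coefficients of L^m (s + d)^(-b) = sum_(i <= m) coef d^i (s + d)^(-(b + m + i)) *)
Fixpoint iter_coef N b m i : R :=
  if m is l.+1 then
    2 * (b + l%:R + i%:R) * (N - 2 * (b + l%:R + i%:R) - 2) * iter_coef N b l i +
    (if i is j.+1 then 4 * (b + l%:R + j%:R) * (b + l%:R + j%:R + 1) * iter_coef N b l j else 0)
  else (i == 0%N)%:R.

Lemma iter_coef_gt N b m i : (m < i)%N -> iter_coef N b m i = 0.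
Proof.
elim: m i => [|m IH] [|i]//= mi; rewrite (IH i.+1) ?(ltnW mi)// (IH i)// !mulr0 addr0//.
Qed.

Lemma iter_coef0 N b m : iter_coef N b m 0 = \prod_(l < m) (2 * (b + l%:R) * (N - 2 * (b + l%:R) - 2)).
Proof.
elim: m => [|m IH]; first by rewrite big_ord0.
by rewrite big_ord_recr/= addr0 -IH !addr0 mulrC.
Qed.

(** The operator only uses the values of the jet at the same [s]. The hypothesis is therefore made
    at one [s] for all orders, and the formula applies to a cut-off power wherever the cut-off is
    1. *)
Lemma iter_Ljet_pow N b d m c H s : 0 < s + d ->
  (forall k, H k s = c * pow_jet b d k s) ->
  forall k, iter m (Ljet N) H k s =
    c * \sum_(i < m.+1) iter_coef N b m i * d ^+ i * pow_jet (b + m%:R + i%:R) d k s.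
Proof.
move=> sd HE; elim: m => [|m IH] k.
  by rewrite big_ord_recr big_ord0/= HE expr0 !addr0 add0r !mul1r.
rewrite iterS {1}/Ljet !IH.
transitivity (c * \sum_(i < m.+1) iter_coef N b m i * d ^+ i * Ljet N (pow_jet (b + m%:R + i%:R) d) k s).
  rewrite /Ljet; 
  rewrite !mulr_sumr -big_split/= -sumrN; apply: eq_bigr => i _; ring.
congr (_ * _).
under eq_bigr do rewrite Ljet_pow// mulrDr.
rewrite big_split/=.
under [in RHS]eq_bigr do rewrite /= -mulrA mulrDl.
rewrite [in RHS]big_split/=; congr (_ + _).
  rewrite [in RHS]big_ord_recr/= iter_coef_gt// mulr0 mul0r addr0.
  apply: eq_bigr => i _; rewrite -[m.+1%:R]natr1.
  rewrite (_ : b + (m%:R + 1) + i%:R = b + m%:R + i%:R + 1); ring.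
rewrite [in RHS]big_ord_recl/= !mul0r add0r; apply: eq_bigr => i _.
rewrite /bump/= add1n exprS -[m.+1%:R]natr1 -[i.+1%:R]natr1.
rewrite (_ : b + (m%:R + 1) + (i%:R + 1) = b + m%:R + i%:R + 2); ring.
Qed.

End jets.

Section radial_calculus.
Context {R : realType}.
Variable n : nat.
Implicit Types (H A : nat -> R -> R) (y x v : 'rV[R]_n).

Definition rad H (k : nat) y : 'rV[R]_n -> R := fun x => H k (sqn (x - y)).
Definition coord_at (j : 'I_n) y : 'rV[R]_n -> R := fun x => x ord0 j - y ord0 j.

Lemma is_derive_coord_at j y x v : is_derive x v (coord_at j y) (v ord0 j).
Proof.
apply: DeriveDef.
  by apply/diff_derivable/differentiableB => //; exact: differentiable_coord.
apply/cvg_lim => //; apply: cvg_near_cst.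
near=> h; rewrite /coord_at /= !mxE.
rewrite (_ : h * v ord0 j + x ord0 j - y ord0 j - (x ord0 j - y ord0 j) = h * v ord0 j); last by ring.
rewrite /GRing.scale/= mulrA mulVf ?mul1r//.
by near: h; exact: nbhs_dnbhs_neq.
Unshelve. all: by end_near. Qed.

Lemma differentiable_coord_at j y x : differentiable (coord_at j y) x.
Proof. by apply: differentiableB => //; exact: differentiable_coord. Qed.

Lemma sqn_atE y : (fun x => sqn (x - y)) = (fun x => \sum_j coord_at j y x * coord_at j y x).
Proof. by apply/funext => x; apply: eq_bigr => j _; rewrite /coord_at !mxE expr2. Qed.

Lemma differentiable_sqn_at y x : differentiable (fun x => sqn (x - y)) x.
Proof.
rewrite sqn_atE (_ : (fun x => _) = \sum_j (coord_at j y * coord_at j y)); last first.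
  by apply/funext => z; rewrite fct_sumE.
by apply: differentiable_sum => j; apply: differentiableM; exact: differentiable_coord_at.
Qed.

Lemma is_derive_sqn_at y x (i : 'I_n) :
  is_derive x (delta_mx ord0 i) (fun x => sqn (x - y)) (2 * coord_at i y x).
Proof.
rewrite sqn_atE (_ : (fun x => _) = \sum_j (coord_at j y * coord_at j y)); last first.
  by apply/funext => z; rewrite fct_sumE.
have h j : is_derive x (delta_mx ord0 i) (coord_at j y * coord_at j y)
    (((j == i)%:R * coord_at j y x) *+ 2).
  have h1 := is_derive_coord_at j y x (delta_mx ord0 i).
  apply: (is_derive_value (is_derive_mulR h1 h1)); rewrite mxE eqxx/= mulr2n; congr (_ + _).
  by rewrite mulrC.
apply: (is_derive_value (is_derive_sum h)).
rewrite (bigD1 i)//= eqxx mul1r big1 ?addr0 ?mulr_natl// => j /negPf ->.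
by rewrite mul0r mul0rn.
Qed.

Lemma differentiable_rad H k y x : jet H -> differentiable (rad H k y) x.
Proof.
move=> jH; apply: (@differentiable_comp _ _ _ _ (fun x => sqn (x - y)) (H k)).
  exact: differentiable_sqn_at.
by apply/derivable1_diffP; have [] := jH k _ (sqn_ge0 (x - y)).
Qed.

Lemma is_derive_rad H k y x (i : 'I_n) : jet H ->
  is_derive x (delta_mx ord0 i) (rad H k y) (2 * coord_at i y x * rad H k.+1 y x).
Proof.
move=> jH; apply: DeriveDef; first exact/diff_derivable/differentiable_rad.
have [d1 e1] := jH k _ (sqn_ge0 (x - y)).
have D1 : differentiable (H k) (sqn (x - y)) by exact/derivable1_diffP.
rewrite deriveE; last exact: differentiable_rad.
rewrite (_ : rad H k y = H k \o (fun x => sqn (x - y)))//.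
rewrite diff_comp//; last exact: differentiable_sqn_at.
set v := delta_mx _ _.
transitivity ('d (H k) (sqn (x - y)) ('d (fun x => sqn (x - y)) x v)) => //.
have -> : 'd (fun x => sqn (x - y)) x v = (2 * coord_at i y x) *: (1 : R).
  rewrite -deriveE; last exact: differentiable_sqn_at.
  have [_ ->] := is_derive_sqn_at y x i.
  by rewrite /GRing.scale/= mulr1.
by rewrite linearZ/= -deriveE// e1.
Qed.

(* a class of functions closed under partial derivatives *)
Inductive radial_poly H y : ('rV[R]_n -> R) -> Prop :=
 | radial_poly_rad k : radial_poly H y (rad H k y)
 | radial_poly_coord j : radial_poly H y (coord_at j y)
 | radial_poly_cst c : radial_poly H y (cst c)
 | radial_poly_add f g : radial_poly H y f -> radial_poly H y g -> radial_poly H y (fun x => f x + g x)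
 | radial_poly_mul f g : radial_poly H y f -> radial_poly H y g -> radial_poly H y (fun x => f x * g x).

Lemma radial_poly_diff H y f : jet H -> radial_poly H y f ->
  (forall x, differentiable f x) /\ forall i, radial_poly H y (partial i f).
Proof.
move=> jH; elim=> [k|j|c|f1 f2 c1 [d1 p1] c2 [d2 p2]|f1 f2 c1 [d1 p1] c2 [d2 p2]].
- split=> [x|i]; first exact: differentiable_rad.
  rewrite (_ : partial i _ = fun x => (cst 2 x * coord_at i y x) * rad H k.+1 y x).
    do !constructor.
  by apply/funext => x; rewrite /partial; have [_ ->] := is_derive_rad k y x i jH.
- split=> [x|i]; first exact: differentiable_coord_at.
  rewrite (_ : partial i _ = cst (j == i)%:R); first by constructor.
  by apply/funext => x; rewrite /partial; have [_ ->] := is_derive_coord_at j y x (delta_mx ord0 i); rewrite mxE eqxx.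
- split=> [x|i]; first exact: differentiable_cst.
  rewrite (_ : partial i _ = cst 0); first by constructor.
  by apply/funext => x; rewrite /partial derive_cst.
- split=> [x|i]; first exact: differentiableD.
  rewrite (_ : partial i _ = fun x => partial i f1 x + partial i f2 x); first by constructor.
  apply/funext => x; rewrite /partial.
  by have [_ ->] := is_derive_addR (derivableP (diff_derivable (d1 x) : derivable f1 x (delta_mx ord0 i))) (derivableP (diff_derivable (d2 x) : derivable f2 x (delta_mx ord0 i))).
- split=> [x|i]; first exact: differentiableM.
  rewrite (_ : partial i _ = fun x => partial i f1 x * f2 x + f1 x * partial i f2 x).
    by do !constructor.
  apply/funext => x; rewrite /partial.
  by have [_ ->] := is_derive_mulR (derivableP (diff_derivable (d1 x) : derivable f1 x (delta_mx ord0 i))) (derivableP (diff_derivable (d2 x) : derivable f2 x (delta_mx ord0 i))).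
Qed.

Lemma radial_poly_smooth H y f : jet H -> radial_poly H y f -> smooth f.
Proof.
move=> jH cf s x; have : radial_poly H y (iter_partial s f).
  by elim: s => [//|i s IH]; have [_] := radial_poly_diff jH IH; exact.
by case/(radial_poly_diff jH).
Qed.

Lemma neg_laplacian_rad H y : jet H -> neg_laplacian (rad H 0 y) = rad (Ljet n%:R H) 0 y.
Proof.
move=> jH; apply/funext => x; rewrite /neg_laplacian /rad /Ljet.
set s := sqn _.
have E i : partial i (rad H 0 y) = fun x => 2 * coord_at i y x * rad H 1 y x.
  by apply/funext => z; rewrite /partial; have [_ ->] := is_derive_rad 0 y z i jH.
rewrite (eq_bigr (fun i => 2 * H 1%N s + 4 * (coord_at i y x * coord_at i y x) * H 2%N s)); last first.
  move=> i _; rewrite E /partial.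
  have h1 := is_derive_scaleR 2 (is_derive_coord_at i y x (delta_mx ord0 i)).
  have [_ ->] := is_derive_mulR h1 (is_derive_rad 1 y x i jH).
  rewrite mxE !eqxx/= /rad -/s; ring.
rewrite big_split/= sumr_const card_ord -mulr_suml -mulr_sumr -(congr1 (fun f => f x) (sqn_atE y)) -/s.
rewrite -mulr_natl; ring.
Qed.

(** The cross term of the product rule, twice the derivative of the coordinate times the j-th
    derivative of h, contributes 4 h', which is the effect of two more dimensions. *)
Lemma neg_laplacian_coord_rad H j y : jet H ->
  neg_laplacian (fun x => coord_at j y x * rad H 0 y x) =
  fun x => coord_at j y x * rad (Ljet (n%:R + 2) H) 0 y x.
Proof.
move=> jH; apply/funext => x; rewrite /neg_laplacian /rad /Ljet.
set s := sqn _.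
have E i : partial i (fun x => coord_at j y x * rad H 0 y x) =
    fun x => (j == i)%:R * rad H 0 y x + coord_at j y x * (2 * coord_at i y x * rad H 1 y x).
  apply/funext => z; rewrite /partial.
  have [_ ->] := is_derive_mulR (is_derive_coord_at j y z (delta_mx ord0 i)) (is_derive_rad 0 y z i jH).
  by rewrite mxE eqxx.
rewrite (eq_bigr (fun i => (j == i)%:R * (4 * coord_at i y x * H 1%N s) +
  (2 * (coord_at j y x * H 1%N s) + 4 * (coord_at i y x * coord_at i y x) * (coord_at j y x * H 2%N s)))); last first.
  move=> i _; rewrite E /partial.
  have h0 := is_derive_scaleR (j == i)%:R (is_derive_rad 0 y x i jH).
  have hj := is_derive_coord_at j y x (delta_mx ord0 i).
  have h1 := is_derive_scaleR 2 (is_derive_coord_at i y x (delta_mx ord0 i)).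
  have [_ ->] := is_derive_addR h0 (is_derive_mulR hj (is_derive_mulR h1 (is_derive_rad 1 y x i jH))).
  rewrite !mxE !eqxx/= /rad -/s; ring.
rewrite big_split/= (bigD1 j)//= eqxx mul1r big1 ?addr0; last first.
  by move=> i ij; rewrite eq_sym (negPf ij) mul0r.
rewrite big_split/= sumr_const card_ord -mulr_suml -mulr_sumr -(congr1 (fun f => f x) (sqn_atE y)) -/s.
rewrite -mulr_natl; ring.
Qed.

Lemma divergence_rad H y x : jet H ->
  \sum_j partial j (fun x => coord_at j y x * rad H 0 y x) x = rad (divjet n%:R H) 0 y x.
Proof.
move=> jH; rewrite /rad /divjet; set s := sqn _.
rewrite (eq_bigr (fun j => H 0%N s + 2 * (coord_at j y x * coord_at j y x) * H 1%N s)); last first.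
  move=> j _; rewrite /partial.
  have [_ ->] := is_derive_mulR (is_derive_coord_at j y x (delta_mx ord0 j)) (is_derive_rad 0 y x j jH).
  rewrite mxE !eqxx/= /rad -/s; ring.
rewrite big_split/= sumr_const card_ord -mulr_suml -mulr_sumr -(congr1 (fun f => f x) (sqn_atE y)) -/s.
rewrite -mulr_natl; ring.
Qed.

Lemma iter_neg_laplacian_rad H y m : jet H ->
  iter m (@neg_laplacian R n) (rad H 0 y) = rad (iter m (Ljet n%:R) H) 0 y.
Proof.
move=> jH; elim: m => [//|m IH]; rewrite !iterS IH neg_laplacian_rad//.
exact: iter_jet_Ljet.
Qed.

Lemma iter_neg_laplacian_coord_rad H j y m : jet H ->
  iter m (@neg_laplacian R n) (fun x => coord_at j y x * rad H 0 y x) =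
  fun x => coord_at j y x * rad (iter m (Ljet (n%:R + 2)) H) 0 y x.
Proof.
move=> jH; elim: m => [//|m IH]; rewrite !iterS IH neg_laplacian_coord_rad//.
exact: iter_jet_Ljet.
Qed.

End radial_calculus.

(** * A smooth cut-off and bounds by homogeneity *)

Section cutoff.
Context {R : realType}.

(** The functions x^(-m) exp(-1/x), extended by 0: the derivative of each is a linear combination of
    two others. *)
Definition flat (m : nat) (x : R) : R := if 0 < x then x ^- m * expR (- x^-1) else 0.

Lemma flat_le0 m x : x <= 0 -> flat m x = 0.
Proof. by rewrite /flat => x0; rewrite ltNge x0. Qed.

Lemma flat_ge0 m x : 0 <= flat m x.
Proof. by rewrite /flat; case: ifP => // x0; rewrite mulr_ge0 ?expR_ge0// invr_ge0 exprn_ge0// ltW. Qed.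

(** Quadratic decay makes the difference quotient at 0 vanish. It follows from exp(y) >=
    (y/(m+2))^(m+2) with y = 1/x. *)
Lemma flat_le_sqr m x : flat m x <= m.+2%:R ^+ m.+2 * x ^+ 2.
Proof.
case: (ltP 0 x) => x0; last by rewrite flat_le0// mulr_ge0 ?sqr_ge0 ?exprn_ge0.
rewrite /flat x0.
have N0 : (0 : R) < m.+2%:R by rewrite ltr0n.
have h : (x^-1 / m.+2%:R) ^+ m.+2 <= expR (x^-1).
  have -> : expR (x^-1) = expR (x^-1 / m.+2%:R) ^+ m.+2.
    by rewrite -expRM_natl; congr expR; rewrite mulrC divfK// gt_eqF.
  apply: lerXn2r; rewrite ?nnegrE ?expR_ge0//; first by rewrite divr_ge0 ?invr_ge0 ?ltW.
  by apply: le_trans (expR_ge1Dx _); rewrite lerDr.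
rewrite expRN ler_pdivrMr ?expR_gt0//.
apply: le_trans (ler_wpM2l _ h); last by rewrite mulr_ge0 ?sqr_ge0 ?exprn_ge0// ltW.
rewrite le_eqVlt; apply/orP; left; apply/eqP.
have xm : x ^+ m != 0 by rewrite expf_neq0// gt_eqF.
have um : m.+2%:R ^+ m.+2 != 0 :> R by rewrite expf_neq0// gt_eqF.
rewrite exprMn !exprVn (_ : x ^+ m.+2 = x ^+ m * x ^+ 2); last by rewrite -exprD addn2.
by move: (x ^+ m) (_ ^+ m.+2) xm um => X u xm um; field; rewrite um xm gt_eqF.
Qed.

Lemma is_derive_flat m (x : R) : is_derive x 1 (flat m) (- m%:R * flat m.+1 x + flat m.+2 x).
Proof.
case: (ltgtP x 0) => x0.
- rewrite !flat_le0 ?ltW// mulr0 addr0.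
  apply: (@near_eq_is_derive _ _ _ (cst 0)) => //.
  near=> y; rewrite flat_le0// ltW//; near: y; exact: lt_nbhsl.
- have h1 : is_derive x 1 (fun x : R => x^-1) (- x ^- 2).
    apply: DeriveDef; first by apply: derivableV; rewrite // gt_eqF.
    by rewrite deriveV ?gt_eqF// derive_id /GRing.scale/= mulr1.
  have h2 : is_derive x 1 (fun y : R => y^-1 ^+ m) ((m%:R * x^-1 ^+ m.-1) * - x ^- 2).
    rewrite (_ : (fun y => _) = (fun y : R => y^-1) ^+ m); first exact: is_deriveX.
    by apply/funext => y; rewrite exprfctE.
  have h3 := @is_derive1_comp R expR (fun y => - y^-1) x _ _ (is_derive_expR (- x^-1)) (is_derive_oppR h1).
  apply: (@near_eq_is_derive _ R^o R^o (fun y : R => (y^-1) ^+ m * expR (- y^-1))).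
    near=> y; rewrite /flat exprVn ifT//; near: y; exact: lt_nbhsr.
  apply: (is_derive_value (is_derive_mulR h2 (h3 : is_derive x 1 (fun y => expR (- y^-1)) _))); rewrite /flat x0 -!exprVn /GRing.scale/=.
  by case: m {h2} => [|m]; rewrite /= ?exprS ?expr0; ring.
- rewrite x0 !flat_le0// mulr0 addr0.
  set q := fun h : R => h^-1 *: ((flat m \o shift (0:R)) (h *: (1 : R)) - flat m 0).
  suff cv : q h @[h --> 0^'] --> (0 : R).
    by apply: DeriveDef; [exact: cvgP cv|exact: cvg_lim cv].
  apply/cvgrPdist_le => eps eps0.
  pose N : R := m.+2%:R ^+ m.+2.
  have N0 : 0 < N by rewrite exprn_gt0// ltr0n.
  near=> h.
  have h0 : h != 0 by near: h; exact: nbhs_dnbhs_neq.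
  rewrite sub0r normrN /q /= (flat_le0 _ (lexx 0)) subr0 addr0 /GRing.scale/= mulr1.
  rewrite normrM normfV ler_pdivrMl ?normr_gt0// ger0_norm ?flat_ge0//.
  apply: (le_trans (flat_le_sqr m h)); rewrite -/N -[h ^+ 2]real_normK ?num_real// expr2 mulrCA.
  apply: ler_wpM2l => //; rewrite -ler_pdivlMl// mulrC.
  by near: h; apply: dnbhs0_le; rewrite divr_gt0.
Unshelve. all: by end_near. Qed.

(** Expressions with a symbolic derivative: iterating [cderive] produces the whole jet of a
    composition of flat functions. *)
Inductive cexp := CVar | CCst of R | CAdd of cexp & cexp | CMul of cexp & cexp | CFlat of nat & cexp.

Fixpoint ceval (e : cexp) (x : R) : R :=
  match e with
  | CVar => x | CCst c => c
  | CAdd e1 e2 => ceval e1 x + ceval e2 x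
  | CMul e1 e2 => ceval e1 x * ceval e2 x
  | CFlat m e => flat m (ceval e x)
  end.

Fixpoint cderive (e : cexp) : cexp :=
  match e with
  | CVar => CCst 1 | CCst c => CCst 0
  | CAdd e1 e2 => CAdd (cderive e1) (cderive e2)
  | CMul e1 e2 => CAdd (CMul (cderive e1) e2) (CMul e1 (cderive e2))
  | CFlat m e => CMul (CAdd (CMul (CCst (- m%:R)) (CFlat m.+1 e)) (CFlat m.+2 e)) (cderive e)
  end.

Lemma is_derive_ceval e (x : R) : is_derive x 1 (ceval e) (ceval (cderive e) x).
Proof.
elim: e => [|c|e1 h1 e2 h2|e1 h1 e2 h2|m e h] /=.
- exact: is_derive_id.
- exact: is_derive_cst.
- exact: is_derive_addR.
- exact: is_derive_mulR.
- exact: (is_derive1_comp (is_derive_flat m (ceval e x)) h).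
Qed.

(** A derivative that exists is determined from one side. This carries the vanishing of the
    derivatives of the cut-off up to the end points 1/4 and 1. *)
Lemma is_derive_cst_left (f : R -> R) (x l c : R) : is_derive x 1 f l ->
  (forall y, y <= x -> f y = c) -> l = 0.
Proof.
move=> [df <-] fc.
have h : (h^-1 *: ((f \o shift x) (h *: (1 : R)) - f x)) @[h --> 0^'-] --> 'D_1 f x.
  exact: cvg_dnbhs_at_left.
apply: (cvg_unique _ h) => //; apply: cvg_near_cst.
near=> t; rewrite /= !fc ?subrr ?scaler0// /GRing.scale/= mulr1 -lerBrDr subrr.
by apply/ltW.
Unshelve. all: by end_near. Qed.

Lemma is_derive_cst_right (f : R -> R) (x l c : R) : is_derive x 1 f l ->
  (forall y, x <= y -> f y = c) -> l = 0.
Proof.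
move=> [df <-] fc.
have h : (h^-1 *: ((f \o shift x) (h *: (1 : R)) - f x)) @[h --> 0^'+] --> 'D_1 f x.
  exact: cvg_dnbhs_at_right.
apply: (cvg_unique _ h) => //; apply: cvg_near_cst.
near=> t; rewrite /= !fc ?subrr ?scaler0// /GRing.scale/= mulr1 -lerBlDr subrr.
by apply/ltW.
Unshelve. all: by end_near. Qed.

Lemma flat0_le (x y : R) : 0 < x -> x <= y -> flat 0 x <= flat 0 y.
Proof.
move=> x0 xy; rewrite /flat x0 (lt_le_trans x0 xy) expr0 invr1 !mul1r ler_expR lerN2.
by rewrite lef_pV2 ?posrE// (lt_le_trans x0 xy).
Qed.

(** With f = [flat 0], the cut-off is e f(1 - f(s - 1/4) / f(3/4)). For s <= 1/4 the inner f
    vanishes and e f(1) = 1; for s >= 1 monotonicity of f makes the outer argument nonpositive. *)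
Lemma exists_cutoff_jet : exists X : nat -> R -> R,
  [/\ forall k (x : R), is_derive x 1 (X k) (X k.+1 x),
      forall s, s <= 4^-1 -> X 0%N s = 1,
      forall k s, s <= 4^-1 -> X k.+1 s = 0
    & forall k s, 1 <= s -> X k s = 0].
Proof.
pose c := (flat 0 (1 - 4^-1))^-1.
pose e := CMul (CCst (expR 1)) (CFlat 0 (CAdd (CCst 1) (CMul (CCst (- c)) (CFlat 0 (CAdd CVar (CCst (- 4^-1))))))).
pose X k := ceval (iter k cderive e).
have dX k (x : R) : is_derive x 1 (X k) (X k.+1 x) by exact: is_derive_ceval.
have X0 s : s <= 4^-1 -> X 0%N s = 1.
  move=> s4; rewrite /X/= (flat_le0 _ (x := s - 4^-1)) ?subr_le0// mulr0 addr0.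
  by rewrite /flat ltr01 expr0 invr1 mul1r -expRD subrr expR0.
exists X; split => // k s.
- elim: k s => [|k IH] s s4; apply: (is_derive_cst_left (dX _ s)) => y ys.
    by apply: X0; exact: le_trans s4.
  by apply: IH; exact: le_trans s4.
- have q0 : 0 < 1 - 4^-1 :> R by lra.
  have c0 : 0 < flat 0 (1 - 4^-1) by rewrite /flat q0 mulr_gt0 ?expR_gt0// expr0 invr1.
  elim: k s => [|k IH] s s1; last first.
    by apply: (is_derive_cst_right (dX _ s)) => y sy; apply: IH; exact: le_trans sy.
  rewrite /X/= (@flat_le0 _ (1 + _)) ?mulr0// mulNr subr_le0 /c mulrC ler_pdivlMr// mul1r.
  by apply: flat0_le => //; lra.
Qed.

Lemma derive_continuous (f : R -> R) (x l : R) : is_derive x 1 f l -> {for x, continuous f}.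
Proof. by move=> [d _]; apply: differentiable_continuous; apply/derivable1_diffP. Qed.

Lemma cutoff_bounded (X : nat -> R -> R) : (forall k (x : R), is_derive x 1 (X k) (X k.+1 x)) ->
  forall k, exists C, forall s, 4^-1 <= s <= 1 -> `|X k s| <= C.
Proof.
move=> dX k.
have cX : {within `[4^-1, 1], continuous (fun s => `|X k s|)}.
  apply: continuous_subspaceT => x; apply: continuous_comp; last exact: norm_continuous.
  exact: derive_continuous (dX k x).
have q1 : 4^-1 <= 1 :> R by lra.
have [c _ cP] := EVT_max q1 cX.
by exists `|X k c| => s sP; apply: cP; rewrite in_itv.
Qed.

(* families of jets bounded on [r/4, r] with the homogeneity of s^w, uniformly in 0 < d <= r *)
Definition homog_bound (w : R) (H : R -> R -> nat -> R -> R) := forall k, exists C,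
  forall r d s, 0 < d -> d <= r -> r / 4 <= s <= r -> `|H r d k s| <= C * r `^ (w - k%:R).

Lemma homog_boundP (w : R) H k : homog_bound w H -> exists2 C, 0 <= C &
  forall r d s, 0 < d -> d <= r -> r / 4 <= s <= r -> `|H r d k s| <= C * r `^ (w - k%:R).
Proof.
move=> /(_ k)[C hC]; exists `|C| => // r d s d0 dr sr; apply: (le_trans (hC _ _ _ d0 dr sr)).
by rewrite ler_wpM2r ?powR_ge0// ler_norm.
Qed.

Lemma homog_bound_shift w H : homog_bound w H ->
  homog_bound (w - 1) (fun r d => jshift (H r d)).
Proof.
move=> hH k; have [C hC] := hH k.+1; exists C => r d s d0 dr sr.
apply: le_trans (hC _ _ _ d0 dr sr) _; rewrite le_eqVlt; apply/orP; left; apply/eqP.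
by congr (_ * _ `^ _); rewrite -natr1; ring.
Qed.

Lemma homog_bound_scale w c H : homog_bound w H ->
  homog_bound w (fun r d => jscale c (H r d)).
Proof.
move=> hH k; have [C hC] := hH k; exists (`|c| * C) => r d s d0 dr sr.
by rewrite normrM -mulrA ler_wpM2l//; exact: hC.
Qed.

Lemma homog_bound_mul w1 w2 H G : homog_bound w1 H -> homog_bound w2 G ->
  homog_bound (w1 + w2) (fun r d => jmul (H r d) (G r d)).
Proof.
move=> hH hG k; elim: k => [|k IH] in w1 w2 H G hH hG *.
  have [C1 c1 h1] := homog_boundP 0 hH; have [C2 c2 h2] := homog_boundP 0 hG.
  exists (C1 * C2) => r d s d0 dr sr; rewrite /jmul/= normrM.
  have r0 : r != 0 by rewrite gt_eqF// (lt_le_trans d0).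
  apply: le_trans (ler_pM _ _ (h1 _ _ _ d0 dr sr) (h2 _ _ _ d0 dr sr)) _ => //.
  rewrite mulrACA -powRD ?r0 ?implybT// !subr0//.
have [C1 h1] := IH _ _ _ _ (homog_bound_shift hH) hG.
have [C2 h2] := IH _ _ _ _ hH (homog_bound_shift hG).
exists (C1 + C2) => r d s d0 dr sr.
have E1 : w1 - 1 + w2 - k%:R = w1 + w2 - k.+1%:R by rewrite -natr1; ring.
have E2 : w1 + (w2 - 1) - k%:R = w1 + w2 - k.+1%:R by rewrite -natr1; ring.
rewrite mulrDl; apply: le_trans (ler_normD _ _) _; apply: lerD.
  by have := h1 _ _ _ d0 dr sr; rewrite E1.
by have := h2 _ _ _ d0 dr sr; rewrite E2.
Qed.

Let powR_pred w k (r s : R) : 0 < r -> r / 4 <= s <= r ->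
  s * r `^ (w - k.+1%:R) <= r `^ (w - k%:R).
Proof.
move=> r0 /andP[_ sr].
have -> : r `^ (w - k%:R) = r * r `^ (w - k.+1%:R).
  rewrite -[X in X * _](powRr1 (ltW r0)) -powRD; last by rewrite (gt_eqF r0) implybT.
  by congr powR; rewrite -natr1; ring.
by rewrite ler_wpM2r ?powR_ge0.
Qed.

Lemma homog_bound_divjet N w H : homog_bound w H -> homog_bound w (fun r d => divjet N (H r d)).
Proof.
move=> hH k; have [C1 c1 h1] := homog_boundP k hH; have [C2 c2 h2] := homog_boundP k.+1 hH.
exists (`|N + 2 * k%:R| * C1 + 2 * C2) => r d s d0 dr sr.
have r0 := lt_le_trans d0 dr.
have s0 : 0 <= s by case/andP: sr => + _; apply: le_trans; rewrite divr_ge0// ltW.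
rewrite [leRHS]mulrDl; apply: le_trans (ler_normD _ _) _; apply: lerD.
  by rewrite normrM -mulrA ler_wpM2l//; exact: h1.
rewrite normrM (ger0_norm (mulr_ge0 _ s0))// -!mulrA ler_wpM2l//.
apply: le_trans (ler_wpM2l s0 (h2 _ _ _ d0 dr sr)) _.
by rewrite mulrCA ler_wpM2l//; exact: powR_pred.
Qed.

Lemma homog_bound_Ljet N w H : homog_bound w H -> homog_bound (w - 1) (fun r d => Ljet N (H r d)).
Proof.
by move=> hH; under eq_fun do under eq_fun do rewrite Ljet_div;
  apply: homog_bound_divjet; apply: homog_bound_scale; exact: homog_bound_shift.
Qed.

Lemma homog_bound_iter N m w H : homog_bound w H ->
  homog_bound (w - m%:R) (fun r d => iter m (Ljet N) (H r d)).
Proof.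
move=> hH; elim: m => [|m IH]; first by rewrite subr0.
rewrite (_ : w - m.+1%:R = w - m%:R - 1); last by rewrite -natr1; ring.
exact: homog_bound_Ljet IH.
Qed.

Lemma homog_bound_pow b : 0 <= b -> homog_bound (- b) (fun r d => pow_jet b d).
Proof.
move=> b0 k; exists (`|pow_jet_coef b k| * 4 `^ (b + k%:R)) => r d s d0 dr /andP[rs sr].
have r0 := lt_le_trans d0 dr.
rewrite normrM (ger0_norm (powR_ge0 _ _)) -mulrA ler_wpM2l// -opprD.
have bk : 0 <= b + k%:R by rewrite addr_ge0.
rewrite !powRN -{1}[4 `^ _]invrK -invfM lef_pV2 ?posrE ?mulr_gt0 ?invr_gt0 ?powR_gt0//; last first.
  by apply: lt_le_trans (_ : r / 4 <= _); [rewrite divr_gt0|rewrite ler_wpDr// ltW].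
have -> : r `^ (b + k%:R) = 4 `^ (b + k%:R) * (r / 4) `^ (b + k%:R).
  by rewrite -powRM ?divr_ge0 ?ltW// mulrC divfK.
rewrite mulKf ?gt_eqF ?powR_gt0//; apply: ge0_ler_powR => //; rewrite ?nnegrE.
- by rewrite divr_ge0// ltW.
- by rewrite addr_ge0 ?(ltW d0)// (le_trans _ rs)// divr_ge0// ltW.
- by rewrite (le_trans rs)// lerDl ltW.
Qed.

Definition jdilate (X : nat -> R -> R) (r : R) : nat -> R -> R := fun k s => r^-1 ^+ k * X k (s / r).

Lemma jet_dilate X r : (forall k (x : R), is_derive x 1 (X k) (X k.+1 x)) -> jet (jdilate X r).
Proof.
move=> dX k s s0; rewrite /jdilate.
have h2 : is_derive s 1 (fun s => s / r) (r^-1).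
  apply: (is_derive_value (is_derive_mulR (is_derive_id s (1 : R)) (is_derive_cst r^-1 s (1 : R)))).
  by rewrite mulr0 addr0 mul1r.
apply: (is_derive_value (is_derive_scaleR (r^-1 ^+ k) (@is_derive1_comp R (X k) (fun s => s / r) s _ _ (dX k (s / r)) h2))).
rewrite exprS; ring.
Qed.

Lemma homog_bound_dilate X : (forall k (x : R), is_derive x 1 (X k) (X k.+1 x)) ->
  homog_bound 0 (fun r d => jdilate X r).
Proof.
move=> dX k; have [C hC] := cutoff_bounded dX k; exists C => r d s d0 dr /andP[rs sr].
have r0 := lt_le_trans d0 dr.
have -> : r `^ (0 - k%:R) = r^-1 ^+ k by rewrite sub0r powRN powR_mulrn ?ltW// exprVn.
have rk : 0 <= r^-1 ^+ k by rewrite exprn_ge0// invr_ge0 ltW.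
rewrite /jdilate normrM (ger0_norm rk) [leLHS]mulrC ler_wpM2r//; apply: hC.
by rewrite ler_pdivlMr// mulrC rs ler_pdivrMr// mul1r.
Qed.

Lemma jmul_cst H G (s c : R) : G 0%N s = c -> (forall k, G k.+1 s = 0) ->
  forall k, jmul H G k s = c * H k s.
Proof.
move=> G0 G1 k; elim: k => [|k IH] in H G c G0 G1 *; first by rewrite /jmul/= G0 mulrC.
transitivity (jmul (jshift H) G k s + jmul H (jshift G) k s) => //.
by rewrite (IH (jshift H) G c)// (IH H (jshift G) 0) ?mul0r ?addr0// => [|j]; exact: G1.
Qed.

End cutoff.

(** * Test functions and weak gradients *)

Section measurability.
Context {R : realType} d (T : measurableType d).

Lemma measurable_sqrt_sum (k : nat) (f : 'I_k -> T -> R) :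
  (forall j, measurable_fun setT (f j)) ->
  measurable_fun setT (fun x => Num.sqrt (\sum_j f j x ^+ 2)).
Proof.
move=> mf; apply: (measurableT_comp (continuous_measurable_fun (@sqrt_continuous R))).
by apply: measurable_sum => j; exact: measurable_funX.
Qed.

Lemma measurable_enorm (k : nat) (F : T -> 'rV[R]_k) :
  (forall j, measurable_fun setT (fun x => F x ord0 j)) ->
  measurable_fun setT (fun x => enorm (F x)).
Proof. exact: measurable_sqrt_sum. Qed.

End measurability.

Section test_functions.
Context {R : realType}.
Variables (n alpha : nat).
Implicit Types (G A : nat -> R -> R) (y : 'rV[R]_n).

(** The m with alpha = 2m+1 or alpha = 2m+2. In the even case one Laplacian is set aside, to be
    written as a divergence of a gradient. *)
Definition half_order := (alpha.-1)./2.

(* With A = [div_profile G], the formal adjoint of nabla^alpha maps the test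
   functions built from G below to the radial function with profile [adj_profile G]. *)
Definition div_profile G : nat -> R -> R :=
  if odd alpha then G else jscale (- 2) (jshift G).

Definition adj_profile G : nat -> R -> R :=
  divjet n%:R (iter half_order (Ljet (n%:R + 2)) (div_profile G)).

(** The Euclidean norm of the test family built from G, which is z_j G(|z|^2) for odd alpha and the
    single function G(|z|^2) for even alpha. *)
Definition kernel_profile G (s : R) : R :=
  if odd alpha then Num.sqrt s * `|G 0%N s| else `|G 0%N s|.

Definition vanishes_beyond (r : R) G := forall k s, r <= s -> G k s = 0.

Lemma compact_sqn_le y (r : R) : compact [set x | sqn (x - y) <= r].
Proof.
apply: bounded_closed_compact.
  exists (Num.sqrt `|r| + `|y|); split; first exact: num_real.
  move=> M Mr x /= xr; apply: le_trans (ltW Mr).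
  rewrite -[x in leLHS](subrK y); apply: le_trans (ler_normD _ _) _; rewrite lerD2r.
  rewrite /Num.norm/= mx_normrE; apply/bigmax_leP; split=> [|[i j] _ /=]; first exact: sqrtr_ge0.
  rewrite ord1 -sqrtr_sqr; apply: ler_wsqrtr; apply: le_trans (coord_le_sqn _ j) _.
  exact: le_trans xr (ler_norm r).
have -> : [set x | sqn (x - y) <= r] = (fun x => sqn (x - y)) @^-1` [set t | t <= r] by [].
apply: closed_comp; last exact: closed_le.
by move=> x _; apply: differentiable_continuous; exact: differentiable_sqn_at.
Qed.

Lemma test_function_radial (phi : 'rV[R]_n -> R) H y r : jet H -> radial_poly H y phi ->
  (forall x, r <= sqn (x - y) -> phi x = 0) -> test_function phi.
Proof.
move=> jH cphi v; split; first exact: radial_poly_smooth cphi.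
apply: (@subclosed_compact _ _ [set x | sqn (x - y) <= r]); first exact: closed_closure.
  exact: compact_sqn_le.
have C : closed [set x : 'rV[R]_n | sqn (x - y) <= r].
  apply: compact_closed; last exact: compact_sqn_le.
  exact: norm_hausdorff.
move: C => /closure_id ->; apply: closure_subset => x /= /eqP px.
by rewrite leNgt; apply/negP => /ltW/v.
Qed.

(** The sum over j pairs each component of nabla^alpha with its own test function. For odd alpha it
    turns the gradients into a divergence, so that a radial function results. *)
Lemma test_family G y r : (0 < alpha)%N -> jet G -> vanishes_beyond r G ->
  exists Phi : 'I_(nabla_dim n alpha) -> 'rV[R]_n -> R,
  [/\ forall j, test_function (Phi j),
      forall x, Num.sqrt (\sum_j Phi j x ^+ 2) = kernel_profile G (sqn (x - y)),
      forall x, \sum_j nabla alpha (Phi j) x ord0 j = adj_profile G 0 (sqn (x - y))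
    & forall j x, r <= sqn (x - y) -> Phi j x = 0].
Proof.
move=> a0 jG vG.
have ha : alpha./2 = if odd alpha then half_order else half_order.+1.
  rewrite /half_order -[in LHS](prednK a0) -uphalfE uphalf_half.
  by rewrite -[in RHS](prednK a0) /=; case: (odd _).
rewrite /nabla_dim /nabla /kernel_profile /adj_profile /div_profile; move: ha.
case: (odd alpha) => /= ->.
- exists (fun j x => coord_at j y x * rad G 0 y x); split.
  + move=> j; apply: (@test_function_radial _ G y r) => //; first by do !constructor.
    by move=> x h; rewrite /rad vG// mulr0.
  + move=> x; rewrite -sqrtr_sqr -sqrtrM ?sqn_ge0//; congr Num.sqrt.
    rewrite (eq_bigr (fun j => coord_at j y x * coord_at j y x * (rad G 0 y x) ^+ 2)).
      by rewrite -mulr_suml -(congr1 (fun f => f x) (sqn_atE y)).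
    by move=> j _; rewrite exprMn expr2.
  + move=> x; under eq_bigr => j _ do rewrite /gradient mxE iter_neg_laplacian_coord_rad//.
    rewrite (divergence_rad y x (iter_jet_Ljet _ _ _))//.
  + by move=> j x h; rewrite /rad vG// mulr0.
- exists (fun j => rad G 0 y); split.
  + move=> j; apply: (@test_function_radial _ G y r) => //; first by do !constructor.
    by move=> x h; rewrite /rad vG.
  + by move=> x; rewrite big_ord_recl big_ord0 addr0 sqrtr_sqr.
  + by move=> x; rewrite big_ord_recl big_ord0 addr0 mxE iter_neg_laplacian_rad// iter_Ljet_div.
  + by move=> j x h; rewrite /rad vG.
Qed.

Lemma test_function_continuous (phi : 'rV[R]_n -> R) : test_function phi -> continuous phi.
Proof. by case=> s _ x; apply: differentiable_continuous; exact: (s [::] x). Qed.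

Lemma compact_measurable_rV (K : set 'rV[R]_n) : compact K -> measurable K.
Proof.
move=> cK; rewrite -(setCK K); apply: measurableC; apply: open_measurable_rV.
by apply: closed_openC; apply: compact_closed => //; exact: norm_hausdorff.
Qed.

Lemma compact_support_bounded (f : 'rV[R]_n -> R) : continuous f ->
  compact (closure [set x | f x != 0]) -> exists2 M : R, 0 <= M & forall x, `|f x| <= M.
Proof.
move=> cf; set K := closure _ => cK.
have fK x : ~ K x -> f x = 0.
  by move=> nK; apply/eqP/negPn/negP => fx; apply: nK; exact: subset_closure.
have [K0|/set0P K0] := eqVneq K set0.
  by exists 0 => // x; rewrite fK ?normr0// K0.
have cnf : {within K, continuous (fun x => `|f x|)}.
  apply: continuous_subspaceT => x; apply: continuous_comp; first exact: cf.
  exact: norm_continuous.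
have [c _ hc] := EVT_max_rV K0 cK cnf.
exists `|f c| => // x; have [Kx|nKx] := pselect (K x); first by apply: hc; rewrite inE.
by rewrite fK ?normr0.
Qed.

Lemma integrable_mul_compact_support (u f : 'rV[R]_n -> R) : locally_integrable_rV u ->
  continuous f -> compact (closure [set x | f x != 0]) ->
  (lebesgue_rV n).-integrable setT (fun x => (u x * f x)%:E).
Proof.
move=> [mu lu] cf cK; have [M M0 hM] := compact_support_bounded cf cK.
set K := closure _ in cK; have mK := compact_measurable_rV cK.
have mf := continuous_measurable_rV cf.
apply/integrableP; split.
  by apply/measurable_EFinP; exact: measurable_funM.
have mnu : measurable_fun setT (fun x => (`|u x|)%:E).
  by apply/measurable_EFinP; apply: measurableT_comp.
apply: (@le_lt_trans _ _ (\int[lebesgue_rV n]_(x in K) (M%:E * (`|u x|)%:E))%E); last first.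
  rewrite ge0_integralZl//; last exact: measurable_funTS.
  by rewrite lte_mul_pinfty ?lee_fin// lu.
rewrite [leRHS]integral_mkcond; apply: ge0_le_integral => //.
- by apply: measurableT_comp => //; apply/measurable_EFinP; exact: measurable_funM.
- apply: (measurable_restrictT _ mK).1; apply: measurable_funTS.
  exact: measurable_funeM.
- move=> x _; rewrite patchE; case: ifPn => [|/negP nK].
    by rewrite -EFinM lee_fin normrM mulrC ler_wpM2r.
  suff -> : f x = 0 by rewrite mulr0 abse0.
  by apply/eqP/negPn/negP => fx; apply: nK; rewrite inE; exact: subset_closure.
Qed.

Lemma smoothD (f g : 'rV[R]_n -> R) : smooth f -> smooth g -> smooth (fun x => f x + g x).
Proof.
move=> sf sg.
have E s : iter_partial s (fun x => f x + g x) = fun x => iter_partial s f x + iter_partial s g x.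
  elim: s => [//|i s IH]; rewrite /iter_partial/= -!/(iter_partial _ _) IH.
  apply/funext => x; rewrite /partial.
  have h1 : is_derive x (delta_mx ord0 i) (iter_partial s f) (partial i (iter_partial s f) x).
    exact/derivableP/diff_derivable/sf.
  have h2 : is_derive x (delta_mx ord0 i) (iter_partial s g) (partial i (iter_partial s g) x).
    exact/derivableP/diff_derivable/sg.
  by have [_ ->] := is_derive_addR h1 h2.
by move=> s x; rewrite E; apply: differentiableD; [exact: sf|exact: sg].
Qed.

Lemma smoothN (f : 'rV[R]_n -> R) : smooth f -> smooth (fun x => - f x).
Proof.
move=> sf.
have E s : iter_partial s (fun x => - f x) = fun x => - iter_partial s f x.
  elim: s => [//|i s IH]; rewrite /iter_partial/= -!/(iter_partial _ _) IH.
  apply/funext => x; rewrite /partial.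
  have h1 : is_derive x (delta_mx ord0 i) (iter_partial s f) (partial i (iter_partial s f) x).
    exact/derivableP/diff_derivable/sf.
  by have [_ ->] := is_derive_oppR h1.
by move=> s x; rewrite E; apply: differentiableN; exact: sf.
Qed.

Lemma smooth_partial i (f : 'rV[R]_n -> R) : smooth f -> smooth (partial i f).
Proof. by move=> sf s x; have := sf (rcons s i) x; rewrite /iter_partial -cats1 foldr_cat. Qed.

Lemma closure_support_sub (f g : 'rV[R]_n -> R) :
  compact (closure [set x | f x != 0]) -> [set x | g x != 0] `<=` closure [set x | f x != 0] ->
  compact (closure [set x | g x != 0]).
Proof.
move=> cK gf; apply: (subclosed_compact _ cK); first exact: closed_closure.
have C : closed (closure [set x : 'rV[R]_n | f x != 0]) by exact: closed_closure.
by rewrite [X in _ `<=` X](closure_id _).1//; exact: closure_subset.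
Qed.

Lemma test_function_partial i (f : 'rV[R]_n -> R) : test_function f -> test_function (partial i f).
Proof.
move=> [sf cK]; split; first exact: smooth_partial.
apply: (closure_support_sub cK) => x /= px; apply: contrapT => nK; move/eqP: px; apply.
have : \near x, cst 0 x = f x.
  have O : open (~` closure [set x | f x != 0]) by apply: closed_openC; exact: closed_closure.
  have := open_nbhs_nbhs (conj O nK : open_nbhs x (~` closure [set x | f x != 0])); apply: filterS => z nz.
  by apply/esym/eqP/negPn/negP => fz; apply: nz; exact: subset_closure.
move=> h; have [_ e] := near_eq_is_derive h (is_derive_cst 0 x (delta_mx ord0 i)).
by [].
Qed.

Lemma test_functionD (f g : 'rV[R]_n -> R) : test_function f -> test_function g ->
  test_function (fun x => f x + g x).
Proof.
move=> [sf cf] [sg cg]; split; first exact: smoothD.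
apply: (@subclosed_compact _ _ (closure [set x | f x != 0] `|` closure [set x | g x != 0])).
- exact: closed_closure.
- exact: compactU.
- rewrite -closureU; apply: closure_subset => x /=; have [->|] := eqVneq (f x) 0; last by left.
  by rewrite add0r; right.
Qed.

Lemma test_functionN (f : 'rV[R]_n -> R) : test_function f -> test_function (fun x => - f x).
Proof.
move=> [sf cf]; split; first exact: smoothN.
by rewrite (_ : [set x | - f x != 0] = [set x | f x != 0])//; apply/seteqP; split=> x /=; rewrite oppr_eq0.
Qed.

Lemma test_function0 : test_function (fun _ : 'rV[R]_n => 0 : R).
Proof.
split; last first.
  rewrite (_ : [set x | _] = set0) ?closure0; first exact: compact0.
  by apply/seteqP; split => x //=; rewrite eqxx.
have E s : iter_partial s (fun _ : 'rV[R]_n => 0 : R) = fun=> 0.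
  elim: s => [//|i s IH]; rewrite /iter_partial/= -!/(iter_partial _ _) IH.
  by apply/funext => x; rewrite /partial derive_cst.
by move=> s x; rewrite E; exact: differentiable_cst.
Qed.

Lemma test_function_sum (I : Type) (r : seq I) (f : I -> 'rV[R]_n -> R) :
  (forall i, test_function (f i)) -> test_function (fun x => \sum_(i <- r) f i x).
Proof.
move=> tf; elim: r => [|i r IH].
  by under eq_fun do rewrite big_nil; exact: test_function0.
by under eq_fun do rewrite big_cons; exact: test_functionD.
Qed.

Lemma test_function_iter_neg_laplacian m (f : 'rV[R]_n -> R) : test_function f ->
  test_function (iter m (@neg_laplacian R n) f).
Proof.
move=> tf; elim: m => [//|m IH]; rewrite iterS /neg_laplacian.
by apply: test_functionN; apply: test_function_sum => i; do 2 apply: test_function_partial.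
Qed.

Lemma test_function_nabla (f : 'rV[R]_n -> R) j : test_function f ->
  test_function (fun x => nabla alpha f x ord0 j).
Proof.
move=> /(test_function_iter_neg_laplacian alpha./2).
move: j; rewrite /nabla_dim /nabla; case: (odd alpha) => /= j tf.
  by under eq_fun do rewrite /gradient mxE; exact: test_function_partial.
by under eq_fun do rewrite mxE.
Qed.

Lemma cauchy_schwarz_sum (k : nat) (a b : 'I_k -> R) :
  `|\sum_j a j * b j| <= Num.sqrt (\sum_j a j ^+ 2) * Num.sqrt (\sum_j b j ^+ 2).
Proof.
set A := \sum_j a j ^+ 2; set B := \sum_j b j ^+ 2; set S := \sum_j _.
have A0 : 0 <= A by apply: sumr_ge0 => j _; exact: sqr_ge0.
have B0 : 0 <= B by apply: sumr_ge0 => j _; exact: sqr_ge0.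
rewrite -sqrtrM// -sqrtr_sqr; apply: ler_wsqrtr.
have : 0 <= \sum_j (a j * B - b j * S) ^+ 2 by apply: sumr_ge0 => j _; exact: sqr_ge0.
rewrite (eq_bigr (fun j => B ^+ 2 * a j ^+ 2 + (- (2 * B * S) * (a j * b j) + S ^+ 2 * b j ^+ 2))); last first.
  by move=> j _; ring.
rewrite !big_split/= -!mulr_sumr -/A -/B -/S.
have -> : B ^+ 2 * A + (- (2 * B * S) * S + S ^+ 2 * B) = B * (A * B - S ^+ 2) by ring.
move: B0; rewrite le_eqVlt => /predU1P[B0 _|B0]; last by rewrite pmulr_rge0// subr_ge0.
have b0 j : b j = 0.
  have /eqP := esym B0; rewrite psumr_eq0; last by move=> i _; exact: sqr_ge0.
  by move=> /allP/(_ j (mem_index_enum _)); rewrite sqrf_eq0 => /eqP.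
by rewrite /S big1 ?expr0n ?mulr_ge0 -?B0// => j _; rewrite b0 mulr0.
Qed.

(** The sign (-1)^alpha disappears in the absolute value, and Cauchy-Schwarz over the components
    leaves only |F| and the norm of the test family. *)
Lemma weak_nabla_kernel (u : 'rV[R]_n -> R) F G y r : (0 < alpha)%N ->
  weak_nabla alpha u F -> jet G -> vanishes_beyond r G ->
  (lebesgue_rV n).-integrable setT (fun x => (u x * adj_profile G 0 (sqn (x - y)))%:E) /\
  (`| \int[lebesgue_rV n]_x (u x * adj_profile G 0 (sqn (x - y)))%R%:E | <=
   \int[lebesgue_rV n]_x (enorm (F x) * kernel_profile G (sqn (x - y)))%:E)%E.
Proof.
move=> a0 [lu lF wF] jG vG; have [Phi [tP kP nP vP]] := test_family y a0 jG vG.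
have iu j : (lebesgue_rV n).-integrable setT (fun x => (u x * nabla alpha (Phi j) x ord0 j)%:E).
  apply: integrable_mul_compact_support => //.
    exact/test_function_continuous/test_function_nabla/tP.
  by have [] := test_function_nabla j (tP j).
have iF j : (lebesgue_rV n).-integrable setT (fun x => (F x ord0 j * Phi j x)%:E).
  apply: integrable_mul_compact_support => //; first exact/test_function_continuous/tP.
  by have [] := tP j.
have Eu : (fun x => (u x * adj_profile G 0 (sqn (x - y)))%:E) =
    (fun x => \sum_j (u x * nabla alpha (Phi j) x ord0 j)%:E)%E.
  by apply/funext => x; rewrite -nP mulr_sumr sumEFin.
split; first by rewrite Eu; exact: integrable_sum.
rewrite Eu integral_sum//.
have Ej j : (\int[lebesgue_rV n]_x (u x * nabla alpha (Phi j) x ord0 j)%:E =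
    ((-1) ^+ alpha)%:E * \int[lebesgue_rV n]_x (F x ord0 j * Phi j x)%:E)%E.
  have := wF _ (tP j) j; rewrite /Rintegral => h.
  rewrite -[LHS]fineK ?integrable_fin_num// -[X in (_ * X)%E]fineK ?integrable_fin_num//.
  by rewrite -EFinM h mulrA -exprMn mulrNN mulr1 expr1n mul1r.
have fF j : (\int[lebesgue_rV n]_x (F x ord0 j * Phi j x)%:E)%E \is a fin_num by exact: integrable_fin_num.
under eq_bigr => j _ do rewrite Ej -(fineK (fF j)) -EFinM.
rewrite sumEFin -mulr_sumr abse_EFin normrM normrX normrN1 expr1n mul1r -abse_EFin -sumEFin.
under eq_bigr => j _ do rewrite (fineK (fF j)).
rewrite -integral_sum//; apply: le_trans (le_abse_integral _ _ _) _ => //.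
  by apply: emeasurable_sum => j; exact: measurable_int (iF j).
apply: ge0_le_integral => //.
- by apply: measurableT_comp => //; apply: emeasurable_sum => j; exact: measurable_int (iF j).
- apply/measurable_EFinP; apply: measurable_funM.
    by apply: measurable_enorm => j; have [] := lF j.
  under eq_fun do rewrite -kP.
  apply: measurable_sqrt_sum => j.
  by apply: continuous_measurable_rV; apply: test_function_continuous; exact: tP.
- by move=> x _; rewrite sumEFin abse_EFin lee_fin -kP; exact: cauchy_schwarz_sum.
Qed.

End test_functions.

(** * The constants and the flux of the fundamental solution *)

Section constants.
Context {R : realType}.
Notation V := (@unit_ball_volume R).

Lemma Gamma_one : Gamma (1 : R) = 1.
Proof.
rewrite /Gamma /Rintegral subrr.
under eq_integral do rewrite powRr0 mul1r.
by rewrite integral_expRN_tail oppr0 expR0.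
Qed.

Lemma Gamma_half_prod N j : (0 < N)%N ->
  Gamma (N%:R / 2 + j%:R : R) = (\prod_(l < j) (N%:R / 2 + l%:R)) * Gamma (N%:R / 2).
Proof.
move=> N0; elim: j => [|j IH]; first by rewrite big_ord0 addr0 mul1r.
rewrite big_ord_recr/= mulrAC -IH -[j.+1%:R]natr1 addrA.
have -> : N%:R / 2 + j%:R = (N + j.*2)%:R / 2 :> R by rewrite natrD -muln2 natrM; field.
by rewrite GammaS_half ?addn_gt0 ?N0// mulrC.
Qed.

Lemma Gamma_fact j : Gamma (j.+1%:R : R) = j`!%:R.
Proof.
have := @Gamma_half_prod 2 j isT; rewrite divff ?pnatr_eq0// Gamma_one mulr1 => h.
rewrite -[j.+1%:R]natr1 addrC h.
elim: j {h} => [|j IH]; first by rewrite big_ord0.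
by rewrite big_ord_recr/= IH factS natrM mulrC -natr1 addrC.
Qed.

Definition adams_c n alpha : R := if odd alpha then c_odd n alpha else c_even n alpha.

(* coefficient of the leading term of [div_profile] for the fundamental solution *)
Definition profile_coef n alpha : R :=
  if odd alpha then adams_c n alpha
  else 2 * adams_c n alpha * (n%:R / 2 - (half_order alpha)%:R - 1).

(** The exponent b from which m applications of the operator in dimension n + 2 lead, for d = 0,
    from s^(-b) to a multiple of s^(-n/2), the profile of the field z |z|^(-n) of zero divergence
    off the origin. *)
Definition profile_exp n alpha : R := n%:R / 2 - (half_order alpha)%:R.

Lemma half_order_odd alpha : odd alpha -> alpha = (half_order alpha).*2.+1.
Proof. by case: alpha => // a; rewrite /half_order /= => ao; rewrite -[in LHS](odd_double_half a) (negPf ao). Qed.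

Lemma half_order_even alpha : (0 < alpha)%N -> ~~ odd alpha -> alpha = (half_order alpha).*2.+2.
Proof. by case: alpha => // a _; rewrite /half_order /= negbK => ao; rewrite -[in LHS](odd_double_half a) ao. Qed.

Lemma half_order_lt n alpha : (0 < alpha)%N -> (alpha < n)%N -> ((half_order alpha).*2 < n)%N.
Proof.
move=> a0 an; have [ao|ao] := boolP (odd alpha).
  by have := half_order_odd ao; lia.
by have := half_order_even a0 ao; lia.
Qed.

(** For even alpha, differentiating the fundamental solution produces 2 (n/2 - m - 1) = n - alpha,
    which Gamma(x + 1) = x Gamma(x) absorbs at x = (n - alpha)/2; both parities then share one
    formula. *)
Lemma profile_coefE n alpha : (0 < alpha)%N -> (alpha < n)%N ->
  profile_coef n alpha = 2 ^- (half_order alpha).*2.+1 * Gamma (profile_exp n alpha) /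
    (pi `^ (n%:R / 2) * (half_order alpha)`!%:R).
Proof.
move=> a0 an; rewrite /profile_coef /adams_c /profile_exp.
have [ao|ao] := boolP (odd alpha).
  have := half_order_odd ao; set m := half_order alpha => E.
  rewrite /c_odd [in LHS]E -Gamma_fact.
  have -> : (n%:R - m.*2.+1%:R + 1) / 2 = n%:R / 2 - m%:R :> R.
    by rewrite -natr1 -muln2 natrM; field.
  have -> : (m.*2.+1%:R + 1) / 2 = m.+1%:R :> R by rewrite -!natr1 -muln2 natrM; field.
  by [].
have := half_order_even a0 ao; set m := half_order alpha => E.
rewrite /c_even [in LHS]E -Gamma_fact.
have -> : m.*2.+2%:R / 2 = m.+1%:R :> R by rewrite -!natr1 -muln2 natrM; field.
have n2 : (m.*2.+2 < n)%N by rewrite -E.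
pose N := (n - m.*2.+2)%N.
have NE : N%:R = n%:R - m.*2.+2%:R :> R by rewrite natrB// ltnW.
have -> : n%:R / 2 - m%:R = N%:R / 2 + 1 :> R.
  by rewrite NE -!natr1 -muln2 natrM; field.
rewrite GammaS_half; last by rewrite /N subn_gt0.
rewrite NE addrK exprS invfM.
have q0 : 2 ^+ m.*2.+1 != 0 :> R by rewrite expf_neq0// pnatr_eq0.
have p0 : pi `^ (n%:R / 2) != 0 :> R by rewrite gt_eqF// powR_gt0// pi_gt0.
have g0 : Gamma (m.+1%:R : R) != 0 by rewrite Gamma_fact pnatr_eq0 -lt0n fact_gt0.
set x := (n%:R - _) / 2; move: (Gamma x) (Gamma m.+1%:R) (pi `^ _) (2 ^+ _) q0 p0 g0 => G1 G2 P Q q0 p0 g0.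
by field; rewrite q0 p0 g0.
Qed.

Lemma profile_coef_gt0 n alpha : (0 < alpha)%N -> (alpha < n)%N -> 0 < profile_coef n alpha.
Proof.
move=> a0 an; rewrite profile_coefE// divr_gt0//.
  rewrite mulr_gt0 ?invr_gt0 ?exprn_gt0// /profile_exp.
  have h := half_order_lt a0 an.
  have -> : n%:R / 2 - (half_order alpha)%:R = (n - (half_order alpha).*2)%:R / 2 :> R.
    by rewrite natrB 1?ltnW// -muln2 natrM; field.
  by have [_] := Gamma_half (R := R) (n := n - (half_order alpha).*2) ltac:(by rewrite subn_gt0).
by rewrite mulr_gt0 ?powR_gt0 ?pi_gt0// ltr0n fact_gt0.
Qed.

Lemma profile_exp_gt0 n alpha : (0 < alpha)%N -> (alpha < n)%N -> 0 < profile_exp n alpha.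
Proof.
move=> a0 an; have := half_order_lt a0 an; rewrite /profile_exp -(ltr_nat R) -muln2 natrM.
by lra.
Qed.

(* the flux of the fundamental solution through spheres is 1 *)
Lemma profile_flux n alpha : (0 < alpha)%N -> (alpha < n)%N ->
  n%:R * V n * (profile_coef n alpha *
    iter_coef (n%:R + 2) (profile_exp n alpha) (half_order alpha) 0) = 1.
Proof.
move=> a0 an; rewrite profile_coefE// iter_coef0.
have h := half_order_lt a0 an; set m := half_order alpha in h *.
set b := profile_exp n alpha.
have n0 : (0 < n)%N by apply: leq_ltn_trans an.
pose N := (n - m.*2)%N; have N0 : (0 < N)%N by rewrite subn_gt0.
have bE : b = N%:R / 2.
  by rewrite /b /profile_exp -/m natrB 1?ltnW// -muln2 natrM; field.
(* Since n - 2b = 2m, each factor is 4 (b + l) (m - l). *)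
have -> : \prod_(l < m) (2 * (b + l%:R) * (n%:R + 2 - 2 * (b + l%:R) - 2)) =
    4 ^+ m * (\prod_(l < m) (b + l%:R)) * m`!%:R.
  have -> : m`!%:R = \prod_(l < m) (m%:R - l%:R) :> R.
    elim: (m) => [|k IH]; first by rewrite big_ord0.
    rewrite big_ord_recl subr0 factS natrM IH; congr (_ * _); apply: eq_bigr => l _.
    by rewrite lift0 -[l.+1%:R]natr1 -[k.+1%:R]natr1; ring.
  have -> : 4 ^+ m = \prod_(l < m) 4 :> R by rewrite prodr_const card_ord.
  rewrite -!big_split/=.
  by apply: eq_bigr => l _; rewrite /b /profile_exp -/m; field.
have G2 : Gamma (n%:R / 2 : R) = (\prod_(l < m) (b + l%:R)) * Gamma b.
  rewrite bE -(Gamma_half_prod m N0); congr Gamma.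
  by rewrite -bE /b /profile_exp -/m subrK.
rewrite pi_Gamma// G2.
have Gb : 0 < Gamma b by rewrite bE; have [] := Gamma_half (R := R) N0.
have P0 : 0 < \prod_(l < m) (b + l%:R).
  by apply: prodr_gt0 => l _; rewrite ltr_wpDr// bE divr_gt0 ?ltr0n.
have V0 := @V_gt0 R n.
have -> : 2 ^- m.*2.+1 = (2 * 4 ^+ m)^-1 :> R.
  by rewrite exprS -muln2 mulnC exprM; congr (_ * _ ^+ _)^-1; rewrite expr2 -natrM.
have F0 : m`!%:R != 0 :> R by rewrite pnatr_eq0 -lt0n fact_gt0.
have Q0 : 4 ^+ m != 0 :> R by rewrite expf_neq0// pnatr_eq0.
field.
by rewrite F0 Q0 !gt_eqF// ltr0n.
Qed.

Lemma adams_c_gt0 n alpha : (0 < alpha)%N -> (alpha < n)%N -> 0 < adams_c n alpha.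
Proof.
move=> a0 an; have := profile_coef_gt0 a0 an; rewrite /profile_coef.
have [//|ao] := boolP (odd alpha).
have E := half_order_even a0 ao.
have h : 0 < n%:R / 2 - (half_order alpha)%:R - 1 :> R.
  have : ((half_order alpha).*2.+2 < n)%N by rewrite -E.
  by rewrite -(ltr_nat R) -addn2 natrD -muln2 natrM; lra.
by rewrite pmulr_lgt0// pmulr_rgt0.
Qed.

End constants.

Lemma cvg_sum_ord {R : realType} {T : Type} (F : set_system T) {FF : Filter F} (k : nat)
    (f : 'I_k -> T -> R) (l : 'I_k -> R) :
  (forall i, f i x @[x --> F] --> l i) -> \sum_i f i x @[x --> F] --> \sum_i l i.
Proof.
elim: k => [|k IH] in f l * => h.
  rewrite big_ord0 (_ : (fun x => _) = cst 0); first exact: cvg_cst.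
  by apply/funext => x; rewrite big_ord0.
rewrite big_ord_recr/= (_ : (fun x => _) =
    (fun x => \sum_(i < k) f (widen_ord (leqnSn k) i) x + f ord_max x)).
  by apply: cvgD => //; apply: IH => i; exact: h.
by apply/funext => x; rewrite big_ord_recr.
Qed.

(** * The fundamental solution and its parametrix *)

Section parametrix.
Context {R : realType}.
Variables (n alpha : nat) (X : nat -> R -> R).
Hypotheses (alpha_gt0 : (0 < alpha)%N) (alpha_lt_n : (alpha < n)%N).
Hypotheses (dX : forall k (x : R), is_derive x 1 (X k) (X k.+1 x))
  (X_1 : forall s, s <= 4^-1 -> X 0%N s = 1)
  (X_0 : forall k s, s <= 4^-1 -> X k.+1 s = 0)
  (X_far : forall k s, 1 <= s -> X k s = 0).

Notation V := (@unit_ball_volume R).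
Notation m := (half_order alpha).
Notation b := (@profile_exp R n alpha).
Notation c := (@adams_c R n alpha).
Notation kA := (@profile_coef R n alpha).
Notation N2 := (n%:R / 2 : R).

(* exponent of the fundamental solution *)
Definition fund_exp : R := if odd alpha then b else b - 1.

(** The profile variable is s = |z|^2, so [r] is the square of the cut-off radius, and [d] > 0
    removes the singularity at the origin. *)
Definition parametrix (r d : R) : nat -> R -> R :=
  jscale c (jmul (pow_jet fund_exp d) (jdilate X r)).

Lemma fund_exp_ge0 : 0 <= fund_exp.
Proof.
rewrite /fund_exp; have [_|ao] := boolP (odd alpha); first exact/ltW/profile_exp_gt0.
have : ((half_order alpha).*2.+2 < n)%N by rewrite -half_order_even.
rewrite -(ltr_nat R) -addn2 natrD -muln2 natrM /profile_exp; lra.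
Qed.

Lemma fund_exp_alpha : - fund_exp + (if odd alpha then 2^-1 else 0) = (alpha%:R - n%:R) / 2.
Proof.
rewrite /fund_exp /profile_exp; have [ao|ao] := boolP (odd alpha).
  have E : alpha%:R = m%:R * 2 + 1 :> R by rewrite {1}(half_order_odd ao) -natr1 -muln2 natrM.
  by rewrite E; field.
have E : alpha%:R = m%:R * 2 + 2 :> R by rewrite {1}(half_order_even alpha_gt0 ao) -addn2 natrD -muln2 natrM.
by rewrite E; field.
Qed.

Lemma b_half : b + m%:R = N2.
Proof. by rewrite /profile_exp subrK. Qed.

Lemma jet_parametrix r d : 0 < d -> jet (parametrix r d).
Proof. by move=> d0; apply/jet_scale/jet_mul; [exact: jet_pow|exact: jet_dilate]. Qed.

Lemma parametrix_vanishes r d : 0 < r -> vanishes_beyond r (parametrix r d).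
Proof.
move=> r0 k s rs; rewrite /parametrix /jscale (@jmul_cst _ _ _ _ 0) ?mul0r ?mulr0// => [|j];
  by rewrite /jdilate X_far ?mulr0// ler_pdivlMr// mul1r.
Qed.

Lemma parametrix_near r d k s : 0 < r -> s <= r / 4 ->
  parametrix r d k s = c * pow_jet fund_exp d k s.
Proof.
move=> r0 sr; have sr4 : s / r <= 4^-1 by rewrite ler_pdivrMr// mulrC.
rewrite /parametrix /jscale (@jmul_cst _ _ _ _ 1) ?mul1r// => [|j].
  by rewrite /jdilate X_1// mulr1.
by rewrite /jdilate X_0// mulr0.
Qed.

Lemma homog_bound_parametrix : homog_bound (- fund_exp) parametrix.
Proof.
rewrite -[X in homog_bound X]addr0; apply: homog_bound_scale.
by apply: homog_bound_mul; [exact/homog_bound_pow/fund_exp_ge0|exact: homog_bound_dilate].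
Qed.

Lemma homog_bound_profile : homog_bound (- b) (fun r d => div_profile alpha (parametrix r d)).
Proof.
rewrite /div_profile; have := homog_bound_parametrix; rewrite /fund_exp.
case: (odd alpha) => // h; apply: homog_bound_scale.
by rewrite (_ : - b = - (b - 1) - 1); [exact: homog_bound_shift|ring].
Qed.

Lemma homog_bound_adj : homog_bound (- N2) (fun r d => adj_profile n alpha (parametrix r d)).
Proof.
rewrite -b_half opprD; apply: homog_bound_divjet; apply: homog_bound_iter.
exact: homog_bound_profile.
Qed.

Lemma div_profile_near r d k s : 0 < r -> 0 < d -> s <= r / 4 ->
  div_profile alpha (parametrix r d) k s = kA * pow_jet b d k s.
Proof.
move=> r0 d0 sr; have h := parametrix_near d _ r0 sr.
rewrite /div_profile /profile_coef; move: h; rewrite /fund_exp.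
case: (odd alpha) => h; first exact: h.
rewrite /jscale /jshift h /pow_jet pow_jet_coefS subrK.
rewrite (_ : b - 1 + k.+1%:R = b + k%:R); last by rewrite -natr1; ring.
rewrite /profile_exp; ring.
Qed.

Lemma iter_profile_near r d k s : 0 < r -> 0 < d -> 0 <= s -> s <= r / 4 ->
  iter m (Ljet (n%:R + 2)) (div_profile alpha (parametrix r d)) k s =
  kA * \sum_(i < m.+1) iter_coef (n%:R + 2) b m i * d ^+ i * pow_jet (N2 + i%:R) d k s.
Proof.
move=> r0 d0 s0 sr; rewrite -b_half; apply: iter_Ljet_pow; first by rewrite ltr_wpDl.
by move=> j; exact: div_profile_near.
Qed.

Lemma kernel_parametrix_near r d s : 0 < r -> 0 < d -> 0 < s -> s <= r / 4 ->
  kernel_profile alpha (parametrix r d) s <= c * s `^ ((alpha%:R - n%:R) / 2).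
Proof.
move=> r0 d0 s0 sr; have c0 := adams_c_gt0 (R := R) alpha_gt0 alpha_lt_n.
have sd : 0 < s + d by rewrite addr_gt0.
have P : `|parametrix r d 0 s| <= c * s `^ (- fund_exp).
  rewrite parametrix_near// /pow_jet/= mul1r addr0 normrM (gtr0_norm c0) ger0_norm ?powR_ge0//.
  rewrite ler_pM2l// !powRN lef_pV2 ?posrE ?powR_gt0//.
  by apply: ge0_ler_powR; rewrite ?nnegrE ?fund_exp_ge0 ?(ltW s0) ?(ltW sd)// lerDl ltW.
rewrite -fund_exp_alpha /kernel_profile; case: (odd alpha) P => P; last by rewrite addr0.
rewrite powRD; last by rewrite (gt_eqF s0) implybT.
by rewrite (powR12_sqrt (ltW s0)) [leRHS]mulrA [leLHS]mulrC ler_wpM2r ?sqrtr_ge0.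
Qed.

Lemma kernel_parametrix_far : exists2 C : R, 0 <= C &
  forall r d s, 0 < d -> d <= r -> r / 4 <= s <= r ->
  kernel_profile alpha (parametrix r d) s <= C * r `^ ((alpha%:R - n%:R) / 2).
Proof.
have [C C0 hC] := homog_boundP 0 homog_bound_parametrix.
exists C => // r d s d0 dr sr; have := hC _ _ _ d0 dr sr; rewrite subr0 => P.
have r0 := lt_le_trans d0 dr.
rewrite -fund_exp_alpha /kernel_profile; case: (odd alpha); last by rewrite addr0.
rewrite powRD; last by rewrite (gt_eqF r0) implybT.
rewrite (powR12_sqrt (ltW r0)) [leRHS]mulrA [leLHS]mulrC; apply: ler_pM; rewrite ?sqrtr_ge0//.
by apply: ler_wsqrtr; case/andP: sr.
Qed.

Lemma adj_parametrix_far : exists2 C : R, 0 <= C &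
  forall r d s, 0 < d -> d <= r -> r / 4 <= s <= r ->
  `|adj_profile n alpha (parametrix r d) 0 s| <= C * r `^ (- N2).
Proof.
have [C C0 hC] := homog_boundP 0 homog_bound_adj.
by exists C => // r d s d0 dr sr; have := hC _ _ _ d0 dr sr; rewrite subr0.
Qed.

(** As z |z|^(-n) has zero divergence off the origin, a factor d can be extracted. What remains is
    the shape d (s + d)^(-(n/2 + 1)) of an approximate identity as d tends to 0. *)
Lemma adj_parametrix_near : exists2 C : R, 0 <= C &
  forall r d s, 0 < r -> 0 < d -> 0 <= s -> s <= r / 4 ->
  `|adj_profile n alpha (parametrix r d) 0 s| <= C * d * (s + d) `^ (- (N2 + 1)).
Proof.
pose ic := iter_coef (n%:R + 2) b m.
exists (`|kA| * \sum_(i < m.+1) `|ic i| * (n%:R + 2 * i%:R)).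
  by rewrite mulr_ge0// sumr_ge0// => i _; rewrite mulr_ge0// addr_ge0// mulr_ge0.
move=> r d s r0 d0 s0 sr; have sd : 0 < s + d by rewrite ltr_wpDl.
rewrite /adj_profile {1}/divjet !iter_profile_near// mulr0 addr0 -/ic.
rewrite (_ : _ + _ = kA * \sum_(i < m.+1) ic i * d ^+ i *
    (n%:R * pow_jet (N2 + i%:R) d 0 s + 2 * s * pow_jet (N2 + i%:R) d 1 s)); last first.
  rewrite mulrCA [X in _ + X]mulrCA -mulrDr; congr (_ * _).
  by rewrite !mulr_sumr -big_split/=; apply: eq_bigr => i _; ring.
rewrite normrM -!mulrA ler_wpM2l//.
rewrite mulr_suml; apply: le_trans (ler_norm_sum _ _ _) _; apply: ler_sum => i _.
rewrite !normrM -!mulrA ler_wpM2l//.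
rewrite /pow_jet/= !mul1r addr0.
set x := (s + d) `^ (- (N2 + i%:R + 1)).
have x0 : 0 <= x by exact: powR_ge0.
have -> : (s + d) `^ (- (N2 + i%:R)) = x * (s + d).
  transitivity (x * (s + d) `^ 1); last by rewrite powRr1// ltW.
  rewrite /x -powRD; last by rewrite (gt_eqF sd) implybT.
  by congr powR; ring.
have -> : (s + d) `^ (- (N2 + 1)) = x * (s + d) ^+ i.
  rewrite -(powR_mulrn _ (ltW sd)) /x -powRD; last by rewrite (gt_eqF sd) implybT.
  by congr powR; ring.
have -> : n%:R * (x * (s + d)) + 2 * (s * (- (N2 + i%:R) * x)) = x * (n%:R * d - 2 * i%:R * s) by field.
rewrite normrM (ger0_norm x0) (ger0_norm (exprn_ge0 _ (ltW d0))).
rewrite mulrCA [leRHS](_ : _ = x * ((n%:R + 2 * i%:R) * (d * (s + d) ^+ i))); last by ring.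
rewrite ler_wpM2l//.
(* For i = 0 the terms in s cancel and n d is left; for i >= 1 the factor d is taken from d^i. *)
case: i {x x0} => -[|i] /= _.
  by rewrite !expr0 !mulr0 mul0r subr0 addr0 mul1r mulr1 ger0_norm// mulr_ge0// ltW.
set A := `|_|.
rewrite (_ : d ^+ i.+1 * A = d * (d ^+ i * A)); last by rewrite exprS mulrA.
rewrite (_ : _ * (d * _) = d * ((s + d) ^+ i * ((n%:R + 2 * i.+1%:R) * (s + d)))); last by rewrite exprS; ring.
apply: ler_wpM2l; first exact: ltW.
rewrite {}/A; apply: ler_pM; rewrite ?exprn_ge0 ?(ltW d0)//; last first.
  apply: le_trans (ler_normB _ _) _.
  rewrite !ger0_norm ?mulr_ge0 ?(ltW d0)// mulrDl !mulrDr.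
  have : 0 <= n%:R * s by rewrite mulr_ge0.
  have : 0 <= i.+1%:R * d by rewrite mulr_ge0 ?(ltW d0).
  by lra.
by apply: lerXn2r; rewrite ?nnegrE ?(ltW d0) ?(ltW sd)// lerDr.
Qed.

(** At s = r/4 the cut-off is still 1, so the profile is an explicit sum of which only the term i =
    0 survives the limit; its coefficient was normalised by [profile_flux]. *)
Lemma adj_parametrix_flux r : 0 < r ->
  n%:R * V n * ((r / 4) `^ N2 * iter m (Ljet (n%:R + 2)) (div_profile alpha (parametrix r d)) 0 (r / 4))
    @[d --> 0^'+] --> (1 : R).
Proof.
move=> r0; have r4 : 0 < r / 4 by rewrite divr_gt0.
pose ic := iter_coef (n%:R + 2) b m.
suff : n%:R * V n * ((r / 4) `^ N2 * iter m (Ljet (n%:R + 2)) (div_profile alpha (parametrix r d)) 0 (r / 4))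
    @[d --> 0^'+] --> n%:R * V n * (kA * ic 0%N) by rewrite profile_flux.
have E : \forall d \near 0^'+, n%:R * V n * ((r / 4) `^ N2 * (kA *
    \sum_(i < m.+1) ic i * d ^+ i * pow_jet (N2 + i%:R) d 0 (r / 4))) =
  n%:R * V n * ((r / 4) `^ N2 * iter m (Ljet (n%:R + 2)) (div_profile alpha (parametrix r d)) 0 (r / 4)).
  by near=> d; rewrite iter_profile_near// ltW.
apply: (cvg_trans (near_eq_cvg E)).
apply: cvgMr.
have -> : kA * ic 0%N = (r / 4) `^ N2 * (kA * (ic 0%N * (r / 4) `^ (- N2))).
  have p0 : (r / 4) `^ N2 != 0 by rewrite gt_eqF// powR_gt0.
  by rewrite powRN; field.
apply: cvgMr; apply: cvgMr.
have -> : ic 0%N * (r / 4) `^ (- N2) = \sum_(i < m.+1) ic i * 0 ^+ i * (r / 4) `^ (- (N2 + i%:R)).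
  rewrite big_ord_recl expr0 mulr1 addr0 big1 ?addr0// => i _.
  by rewrite lift0 expr0n mulr0 mul0r.
apply: cvg_sum_ord => i.
apply: cvgM.
  apply: cvgMr; apply: cvg_at_right_filter; exact: exprn_continuous.
rewrite /pow_jet /=.
under eq_fun do rewrite mul1r addr0.
have : {for r / 4 + 0, continuous (@powR R ^~ (- (N2 + i%:R)))}.
  rewrite addr0; apply: differentiable_continuous; apply/derivable1_diffP.
  by apply: derivable_powR; rewrite in_itv/= r4.
rewrite -{2}[r / 4]addr0 => h.
apply: (cvg_comp (fun d => r / 4 + d) (@powR R ^~ (- (N2 + i%:R)))); last exact: h.
by apply: cvg_at_right_filter; apply: cvgD; [exact: cvg_cst|exact: cvg_id].
Unshelve. all: by end_near. Qed.

End parametrix.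

Lemma indic_setDI (R : realType) (T : Type) (C D B : set T) (x : T) : D `<=` C ->
  \1_((C `\` D) `&` B) x = \1_(C `&` B) x - \1_(D `&` B) x :> R.
Proof.
move=> DC; rewrite !indicE !in_setI in_setC.
have : x \in D -> x \in C by rewrite !inE; exact: DC.
by case: (x \in D) => [->//|_]; rewrite ?andbF/= ?subr0 ?andbT//; case: (x \in B); rewrite ?subrr ?subr0.
Qed.

(** * Approximation of the identity *)

Section translation.
Import HBSimple.
Context {R : realType}.
Variable n : nat.
Notation leb := (@lebesgue_rV R n).

Definition translation_continuous (v : 'rV[R]_n -> R) :=
  forall e : R, 0 < e -> exists2 eta : R, 0 < eta &
    forall z, sqn z < eta -> (\int[leb]_x `|v (x + z) - v x|%:E <= e%:E)%E.

Lemma measurable_translate (v : 'rV[R]_n -> R) (z : 'rV[R]_n) : measurable_fun setT v ->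
  measurable_fun setT (fun x : 'rV[R]_n => v (x + z)).
Proof.
move=> mv; have := measurable_affine_rV 1 z => /(measurableT_comp mv).
by congr measurable_fun; apply/funext => x /=; rewrite scale1r.
Qed.

Lemma integral_translate (f : 'rV[R]_n -> \bar R) z : measurable_fun setT f ->
  (forall x, 0 <= f x)%E -> (\int[leb]_x f (x + z)%R = \int[leb]_x f x)%E.
Proof.
move=> mf f0; have := integral_affine_rV z (@ltr01 R) mf f0.
by rewrite expr1n invr1 mul1e => <-; apply: eq_integral => x _; rewrite scale1r.
Qed.

Lemma measurable_absB (v w : 'rV[R]_n -> R) : measurable_fun setT v ->
  measurable_fun setT w -> measurable_fun setT (fun x => `|v x - w x|%:E).
Proof.
by move=> mv mw; apply/measurable_EFinP; apply: measurableT_comp => //; exact: measurable_funB.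
Qed.

(** Closedness under L^1 limits: translation preserves the L^1 distance, so [e] is split into three
    equal parts. *)
Lemma translation_continuousW (v : 'rV[R]_n -> R) : measurable_fun setT v ->
  (forall e : R, 0 < e -> exists w : 'rV[R]_n -> R, [/\ measurable_fun setT w,
     translation_continuous w & (\int[leb]_x `|v x - w x|%:E <= e%:E)%E]) ->
  translation_continuous v.
Proof.
move=> mv H e e0; have e3 : 0 < e / 3 by rewrite divr_gt0.
have [w [mw cw vw]] := H _ e3; have [eta eta0 P] := cw _ e3.
exists eta => // z /P {}P.
have mvz := measurable_translate z mv; have mwz := measurable_translate z mw.
apply: (@le_trans _ _ (\int[leb]_x (`|v (x + z) - w (x + z)|%:E +
    (`|w (x + z) - w x|%:E + `|v x - w x|%:E)))%E).
  apply: ge0_le_integral => //.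
  - exact: measurable_absB.
  - by do 2?apply: emeasurable_funD; exact: measurable_absB.
  move=> x _; rewrite -!EFinD lee_fin.
  have -> : v (x + z) - v x = (v (x + z) - w (x + z)) + ((w (x + z) - w x) - (v x - w x)) by ring.
  by apply: (le_trans (ler_normD _ _)); rewrite lerD2l; exact: ler_normB.
rewrite ge0_integralD//; last 3 first.
- exact: measurable_absB.
- by move=> x _; rewrite adde_ge0 ?lee_fin.
- by apply: emeasurable_funD; exact: measurable_absB.
rewrite ge0_integralD//; [|exact: measurable_absB|exact: measurable_absB].
rewrite (integral_translate (f := fun x => `|v x - w x|%:E))//; last exact: measurable_absB.
have -> : e = e / 3 + (e / 3 + e / 3) by field.
by rewrite !EFinD; apply: leeD => //; exact: leeD.
Qed.

Lemma translation_continuousD (v w : 'rV[R]_n -> R) : measurable_fun setT v ->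
  measurable_fun setT w -> translation_continuous v -> translation_continuous w ->
  translation_continuous (fun x => v x + w x).
Proof.
move=> mv mw cv cw e e0; have e2 : 0 < e / 2 by rewrite divr_gt0.
have [a a0 A] := cv _ e2; have [b b0 B] := cw _ e2.
exists (Num.min a b); first by rewrite lt_min a0.
move=> z; rewrite lt_min => /andP[/A {}A /B {}B].
have mvz := measurable_translate z mv; have mwz := measurable_translate z mw.
apply: (@le_trans _ _ (\int[leb]_x (`|v (x + z) - v x|%:E + `|w (x + z) - w x|%:E))%E).
  apply: ge0_le_integral => //.
  - by apply: (measurable_absB (v := fun x => v (x + z) + w (x + z))) => //; exact: measurable_funD.
  - by apply: emeasurable_funD; exact: measurable_absB.
  move=> x _; rewrite -!EFinD lee_fin.
  have -> : v (x + z) + w (x + z) - (v x + w x) = (v (x + z) - v x) + (w (x + z) - w x) by ring.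
  exact: ler_normD.
rewrite ge0_integralD//; [|exact: measurable_absB|exact: measurable_absB].
have -> : e = e / 2 + e / 2 by field.
by rewrite !EFinD; exact: leeD.
Qed.

Lemma translation_continuousZ (k : R) (v : 'rV[R]_n -> R) : measurable_fun setT v ->
  translation_continuous v -> translation_continuous (fun x => k * v x).
Proof.
move=> mv cv e e0; have k0 : 0 < `|k| + 1 by rewrite ltr_wpDl.
have [a a0 A] := cv (e / (`|k| + 1)) (divr_gt0 e0 k0).
exists a => // z /A {}A; have mvz := measurable_translate z mv.
have E x : `|k * v (x + z) - k * v x|%:E = (`|k|%:E * `|v (x + z) - v x|%:E)%E.
  by rewrite -mulrBr normrM.
under eq_integral => x _ do rewrite E.
rewrite ge0_integralZl//; last exact: measurable_absB.
apply: (le_trans (lee_wpmul2l _ A)); first by rewrite lee_fin.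
rewrite -EFinM lee_fin mulrCA ger_pMr// ler_pdivrMr// mul1r.
by rewrite lerDl.
Qed.

Lemma translation_continuous0 : translation_continuous (fun _ => 0).
Proof.
by move=> e e0; exists 1 => // z _; under eq_integral => x _ do rewrite subrr normr0; rewrite integral0 lee_fin ltW.
Qed.

Lemma translation_continuousB (v w : 'rV[R]_n -> R) : measurable_fun setT v ->
  measurable_fun setT w -> translation_continuous v -> translation_continuous w ->
  translation_continuous (fun x => v x - w x).
Proof.
move=> mv mw cv cw; have -> : (fun x => v x - w x) = (fun x => v x + (-1) * w x).
  by apply/funext => x; rewrite mulN1r.
apply: translation_continuousD => //; first exact: measurable_funM.
exact: translation_continuousZ.
Qed.

Lemma open_sqn_lt (y : 'rV[R]_n) (r : R) : open [set x : 'rV[R]_n | sqn (x - y) < r].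
Proof.
have -> : [set x | sqn (x - y) < r] = (fun x => sqn (x - y)) @^-1` [set t | t < r] by [].
apply: open_comp; last exact: open_lt.
by move=> x _; apply: differentiable_continuous; exact: differentiable_sqn_at.
Qed.

Lemma open_sqn_ball (U : set 'rV[R]_n) x : open U -> U x ->
  exists2 eta : R, 0 < eta & forall z, sqn z < eta -> U (x + z).
Proof.
move=> oU Ux; have /nbhs_ballP[e /= e0 eU] : nbhs x U by exact: open_nbhs_nbhs.
exists (e ^+ 2); first exact: exprn_gt0.
move=> z ze; apply: eU; split=> // i j; rewrite ord1 /ball/= mxE.
rewrite opprD addNKr normrN -(@ltr_pXn2r _ 2)// ?nnegrE ?ltW//.
by rewrite real_normK ?num_real//; apply: le_lt_trans ze; exact: coord_le_sqn.
Qed.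

Lemma integral_indic_absB (A B C : set 'rV[R]_n) : measurable A -> measurable B ->
  measurable C -> C `<=` A -> C `<=` B -> (leb A < +oo)%E -> (leb B < +oo)%E ->
  (\int[leb]_x `|(\1_A x : R) - \1_B x|%:E <= (leb A - leb C) + (leb B - leb C))%E.
Proof.
move=> mA mB mC CA CB Af Bf.
apply: (@le_trans _ _ (\int[leb]_x ((\1_(A `\` C) x : R)%:E + (\1_(B `\` C) x : R)%:E))%E).
  apply: ge0_le_integral => //.
  - by apply: measurable_absB; exact: measurable_indic.
  - by apply: emeasurable_funD; apply/measurable_EFinP; apply: measurable_indic; exact: measurableD.
  move=> x _; rewrite -EFinD lee_fin !indicE !in_setD.
  have CA' : x \in C -> x \in A by rewrite !inE; exact: CA.
  have CB' : x \in C -> x \in B by rewrite !inE; exact: CB.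
  case: (x \in C) CA' CB' => [-> // -> //|_ _]; first by rewrite subrr normr0 addr0.
  by case: (x \in A); case: (x \in B); rewrite /= ?subrr ?subr0 ?sub0r ?normrN ?normr0 ?normr1 ?addr0 ?add0r.
have mAC := measurableD mA mC; have mBC := measurableD mB mC.
rewrite ge0_integralD//; try by apply/measurable_EFinP; exact: measurable_indic.
rewrite !integral_indic// !setIT !measureD//.
by rewrite (setIidr CA) (setIidr CB).
Qed.

Lemma measure_bigcup_approx (F : (set 'rV[R]_n)^nat) (e : R) : 0 < e ->
  (forall k, measurable (F k)) -> nondecreasing_seq F -> (leb (\bigcup_k F k) < +oo)%E ->
  exists k, (leb (\bigcup_k F k) - leb (F k) <= e%:E)%E.
Proof.
move=> e0 mF ndF Uf; set U := \bigcup_k F k in Uf *.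
have mU : measurable U by exact: bigcupT_measurable.
have Ufin : leb U \is a fin_num by rewrite ge0_fin_numE.
have := nondecreasing_cvg_mu (mu := leb) mF mU ndF.
have lt : (leb U - e%:E < leb U)%E by rewrite lteBlDr// lteDl// lte_fin.
move=> /(_ _ (open_nbhs_nbhs (conj (@open_ereal_gt_ereal _ (leb U - e%:E)%E) lt))).
move=> [k _ /(_ k (leqnn k))] /= H; exists k.
have Fk : leb (F k) \is a fin_num.
  by rewrite ge0_fin_numE//; apply: le_lt_trans Uf; apply: le_measure; rewrite ?inE//; exact: bigcup_sup.
by rewrite leeBlDr// addeC -leeBlDr//; exact: ltW.
Qed.

(** The points at squared distance at least 1/(k+1) from the complement form sets F_k increasing to
    U. For small z, F_k lies in U and in its translate, which have equal measure, so both differ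
    little from F_k. *)
Lemma translation_continuous_open (U : set 'rV[R]_n) : open U -> (leb U < +oo)%E ->
  translation_continuous (\1_U).
Proof.
move=> oU Uf e e0.
pose F (k : nat) : set 'rV[R]_n := [set x | forall z, sqn z < k.+1%:R^-1 -> U (x + z)].
have mU := open_measurable_rV oU.
have mF k : measurable (F k).
  rewrite -[F k]setCK; apply: measurableC; apply: open_measurable_rV.
  have -> : ~` F k = \bigcup_(y in ~` U) [set x | sqn (x - y) < k.+1%:R^-1].
    apply/seteqP; split => x /=.
      move=> /existsNP[z /not_implyP[zk Uz]]; exists (x + z) => //=.
      by rewrite opprD addNKr sqnN.
    move=> [y Uy /= xy] H; apply: Uy; have := H (y - x).
    by rewrite addrCA subrr addr0; apply; rewrite -sqnN opprB.
  by apply: bigcup_open => y _; exact: open_sqn_lt.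
have FU k : F k `<=` U.
  by move=> x /(_ 0); rewrite addr0; apply; rewrite -(scale0r (0 : 'rV[R]_n)) sqnZ expr0n mul0r invr_gt0.
have UF : \bigcup_k F k = U.
  apply/seteqP; split => [x [k _]|x Ux]; first exact: FU.
  have [eta eta0 H] := open_sqn_ball oU Ux.
  exists (Num.truncn (eta^-1)) => // z ze; apply: H; apply: lt_trans ze _.
  by rewrite -[X in _ < X]invrK ltf_pV2 ?posrE ?invr_gt0// truncnS_gt.
have ndF : nondecreasing_seq F.
  move=> i j ij; apply/subsetPset => x Fx z zj; apply: Fx; apply: lt_le_trans zj _.
  by rewrite lef_pV2 ?posrE// ler_nat.
have e2 : 0 < e / 2 by rewrite divr_gt0.
have [k] := measure_bigcup_approx e2 mF ndF ltac:(by rewrite UF); rewrite UF => kP.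
exists k.+1%:R^-1; first by rewrite invr_gt0.
move=> z zk; pose Uz : set 'rV[R]_n := [set x | U (x + z)].
have mUz : measurable Uz.
  rewrite -[X in measurable X]setTI.
  have -> : Uz = (fun x : 'rV[R]_n => 1 *: x + z) @^-1` U by apply/seteqP; split => x /=; rewrite scale1r.
  exact: measurable_affine_rV.
have EUz : leb Uz = leb U.
  have EI (W : set 'rV[R]_n) : measurable W -> leb W = (\int[leb]_x (\1_W x : R)%:E)%E.
    by move=> mW; rewrite integral_indic// setIT.
  rewrite (EI U)// -(integral_translate z); [|by apply/measurable_EFinP; exact: measurable_indic|by move=> x; rewrite lee_fin].
  by rewrite EI.
have -> : (\int[leb]_x `|(\1_U (x + z) : R) - \1_U x|%:E = \int[leb]_x `|(\1_Uz x : R) - \1_U x|%:E)%E by [].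
have FkUz : F k `<=` Uz by move=> x Fx; exact: Fx.
have Uzf : (leb Uz < +oo)%E by rewrite EUz.
apply: (le_trans (integral_indic_absB mUz mU (mF k) FkUz (FU k) Uzf Uf)).
rewrite EUz; have -> : e = e / 2 + e / 2 by field.
by rewrite EFinD; exact: leeD.
Qed.

Lemma sigma_algebra_open_rV (A : set 'rV[R]_n) : measurable A -> <<s open >> A.
Proof.
move=> mA.
have : measurable_fun setT (fun x : g_sigma_algebraType (@open 'rV[R]_n) => (x : 'rV[R]_n)).
  apply: (measurable_fun_rV (T := R)) => i.
  apply: (measurability _ (@measurable_realfun.RGenOpens.measurableE R)).
  move=> _ [_ [a [b ->] <-]]; rewrite setTI; apply: sub_sigma_algebra.
  move/continuousP : (@coord_continuous R 1 n ord0 i); apply; exact: interval_open.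
by move=> /(_ measurableT _ mA); rewrite setTI.
Qed.

Definition sqn_ball (L : R) : set 'rV[R]_n := [set x | sqn x < L].

Lemma mem_sqn_ball L x : (x \in sqn_ball L) = (sqn x < L).
Proof. exact: (mem_setb (fun x => sqn x < L)). Qed.

Lemma measurable_sqn_ball L : measurable (sqn_ball L).
Proof. exact: measurable_sqn_lt. Qed.

Lemma sqn_ball_fin L : (leb (sqn_ball L) < +oo)%E.
Proof.
have [L0|L0] := ltP 0 L; first by rewrite /sqn_ball lebesgue_ball// ltry.
suff -> : sqn_ball L = set0 by rewrite measure0.
by rewrite -subset0 => x /= h; have := sqn_ge0 x; rewrite leNgt (lt_le_trans h L0).
Qed.

Lemma open_sqn_ballP L : open (sqn_ball L).
Proof.
have -> : sqn_ball L = [set x | sqn (x - 0) < L] by apply/seteqP; split => x /=; rewrite subr0.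
exact: open_sqn_lt.
Qed.

(** A lambda-system argument: open sets are stable under intersection and generate the
    sigma-algebra, while the property passes to proper differences and, by L^1 closedness, to
    increasing unions. The ball keeps all measures finite. *)
Lemma translation_continuous_indic (A : set 'rV[R]_n) L : measurable A ->
  translation_continuous (\1_(A `&` sqn_ball L)).
Proof.
move=> mA; have mB := measurable_sqn_ball L; have Bf := sqn_ball_fin L.
pose H : set (set 'rV[R]_n) := [set A | measurable A /\ translation_continuous (\1_(A `&` sqn_ball L))].
suff : <<s open >> `<=` H by move=> /(_ A (sigma_algebra_open_rV mA))[].
have fin (C : set 'rV[R]_n) : measurable C -> (leb (C `&` sqn_ball L) < +oo)%E.
  by move=> mC; apply: le_lt_trans Bf; apply: le_measure; rewrite ?inE//; exact: measurableI.
have oH (U : set 'rV[R]_n) : open U -> H U.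
  move=> oU; split; first exact: open_measurable_rV.
  apply: translation_continuous_open; last by apply: fin; exact: open_measurable_rV.
  by apply: openI => //; exact: open_sqn_ballP.
apply: lambda_system_subset => //.
- by move=> U V oU oV; exact: openI.
- split => //.
  + by apply: oH; exact: openT.
  + move=> C D DC [mC cC] [mD cD]; split; first exact: measurableD.
    have -> : \1_((C `\` D) `&` sqn_ball L) = (fun x => \1_(C `&` sqn_ball L) x - \1_(D `&` sqn_ball L) x) :> ('rV[R]_n -> R).
      by apply/funext => x; exact: indic_setDI.
    by apply: translation_continuousB => //; apply: measurable_indic; exact: measurableI.
  + move=> F ndF HF; have mF k : measurable (F k) by case: (HF k).
    have mU : measurable (\bigcup_k F k) by exact: bigcupT_measurable.
    split => //; apply: translation_continuousW => [|e e0].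
      by apply: measurable_indic; exact: measurableI.
    have mFB k : measurable (F k `&` sqn_ball L) by exact: measurableI.
    have ndFB : nondecreasing_seq (fun k => F k `&` sqn_ball L).
      by move=> i j /ndF /subsetPset ij; apply/subsetPset; exact: setSI.
    have [|k] := measure_bigcup_approx e0 mFB ndFB; first by rewrite -setI_bigcupl; exact: fin.
    rewrite -setI_bigcupl => kP; exists (\1_(F k `&` sqn_ball L)); split.
    * exact: measurable_indic.
    * by case: (HF k).
    * have FU : F k `&` sqn_ball L `<=` (\bigcup_k F k) `&` sqn_ball L by apply: setSI; exact: bigcup_sup.
      apply: (le_trans (integral_indic_absB (measurableI _ _ mU mB) (mFB k) (mFB k) FU _ (fin _ mU) (fin _ (mF k)))) => //.
      by rewrite (subee (x := leb (F k `&` _))) ?adde0// ge0_fin_numE// fin.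
Qed.

Lemma translation_continuous_sum (I : Type) (s : seq I) (v : I -> 'rV[R]_n -> R) :
  (forall i, measurable_fun setT (v i)) -> (forall i, translation_continuous (v i)) ->
  translation_continuous (fun x => \sum_(i <- s) v i x).
Proof.
move=> mv cv; elim: s => [|i s IH].
  by under eq_fun do rewrite big_nil; exact: translation_continuous0.
under eq_fun do rewrite big_cons; apply: translation_continuousD => //.
exact: measurable_sum.
Qed.

Lemma integrable_translation_continuous (v : 'rV[R]_n -> R) L :
  measurable_fun setT v -> leb.-integrable (sqn_ball L) (EFin \o v) ->
  translation_continuous (v \_ (sqn_ball L)).
Proof.
move=> mv iv; have mB := measurable_sqn_ball L.
have mp (w : 'rV[R]_n -> R) : measurable_fun setT w -> measurable_fun setT (w \_ (sqn_ball L)).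
  by move=> mw; apply: (measurable_restrictT w mB).1; exact: measurable_funTS.
apply: translation_continuousW => [|e e0]; first exact: mp.
have [g [ig _ cg]] := approximation_sfun_integrable mB iv.
have := cg _ (open_nbhs_nbhs (conj (@open_ereal_lt_ereal _ e%:E) (_ : (0 < e%:E)%E))).
move=> /(_ _)[|k _ /(_ k (leqnn k)) /= H]; first by rewrite lte_fin.
have mg : measurable_fun setT (g k : 'rV[R]_n -> R) by exact: measurable_funPT.
exists ((g k : 'rV[R]_n -> R) \_ (sqn_ball L)).
split; first exact: mp.
- have -> : (g k : 'rV[R]_n -> R) \_ (sqn_ball L) = (fun x : 'rV[R]_n => \sum_(y <- finmap.enum_fset (fset_set (range (g k))))
      y * (\1_((g k : 'rV[R]_n -> R) @^-1` [set y] `&` sqn_ball L) x : R)).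
    apply/funext => x; rewrite patchE; case: ifPn => xB.
      rewrite fimfunE fsbig_finite//=; apply: eq_bigr => y _.
      by rewrite !indicE in_setI xB andbT.
    by rewrite big1// => y _; rewrite indicE in_setI (negbTE xB) andbF mulr0.
  have mi y : measurable ((g k : 'rV[R]_n -> R) @^-1` [set y] `&` sqn_ball L).
    by apply: measurableI => //; rewrite -[X in measurable X]setTI; exact: mg.
  apply: translation_continuous_sum => y.
    by apply: measurable_funM => //; exact: measurable_indic.
  apply: translation_continuousZ; first exact: measurable_indic.
  exact: translation_continuous_indic.
- apply: le_trans (ltW H); rewrite [leRHS]integral_mkcond; apply: ge0_le_integral => //.
  + by apply: measurable_absB; exact: mp.
  + apply: (measurable_restrictT _ mB).1; apply: measurable_funTS; apply/measurable_EFinP; apply: measurableT_comp => //; exact: measurable_funB.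
  + by move=> x _; rewrite !patchE; case: ifP => // _; rewrite subrr normr0.
Qed.

End translation.

(** * The divergence theorem on balls for radial fields *)

Section mass.
Context {R : realType}.
Notation leb1 := (@lebesgue_measure R).
Notation V := (@unit_ball_volume R).

Lemma jet_continuous (H : nat -> R -> R) k s : jet H -> 0 <= s -> {for s, continuous (H k)}.
Proof. by move=> jH s0; apply: derive_continuous (jH k s s0). Qed.

Lemma divjet_continuous N (B : nat -> R -> R) k s : jet B -> 0 <= s ->
  {for s, continuous (divjet N B k)}.
Proof. by move=> jB; apply: jet_continuous; exact: jet_divjet. Qed.

Lemma bounded_on_segment (h : R -> R) (r : R) : (forall s, 0 <= s -> {for s, continuous h}) ->
  exists2 K : R, 0 <= K & forall s, 0 <= s <= r -> `|h s| <= K.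
Proof.
move=> ch; have [r0|r0] := leP 0 r; last first.
  by exists 0 => // s /andP[s0 sr]; move: (lt_le_trans r0 s0); rewrite ltNge sr.
have cn : {within `[0, r], continuous (fun s => `|h s|)}.
  apply: continuous_in_subspaceT => s; rewrite inE/= in_itv/= => /andP[s0 _].
  by apply: continuous_comp; [exact: ch|exact: norm_continuous].
have [c _ hc] := EVT_max r0 cn.
by exists `|h c| => // s sr; apply: hc; rewrite in_itv.
Qed.

Lemma bvol_invK n (z : 'rV[R]_n) : (0 < n)%N -> bvol_inv n (bvol z) = sqn z.
Proof.
move=> n0; rewrite /bvol_inv /bvol mulrC mulKf ?gt_eqF ?V_gt0// -powRrM.
by rewrite (_ : _ * _ = 1) ?powRr1 ?sqn_ge0//; field; rewrite pnatr_eq0 -lt0n.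
Qed.

Lemma is_derive_bvol_inv n (t : R) : 0 < t ->
  is_derive t 1 (bvol_inv n) (2 / n%:R * (t / V n) `^ (2 / n%:R - 1) / V n).
Proof.
move=> t0; have V0 := V_gt0 (R := R) n; have tV : 0 < t / V n by rewrite divr_gt0.
have h1 := is_derive1_powR (2 / n%:R) tV.
have h2 : is_derive t 1 (fun t => t / V n) (V n)^-1.
  rewrite (_ : (fun t => t / V n) = (fun t => (V n)^-1 * t)); last by apply/funext => x; rewrite mulrC.
  by rewrite -[X in is_derive _ _ _ X]mulr1; apply: is_derive_scaleR; exact: is_derive_id.
by apply: (is_derive_value (@is_derive1_comp R _ _ t _ _ h1 h2)).
Qed.

Lemma measurable_bvol_inv n : measurable_fun setT (bvol_inv n : R -> R).
Proof.
apply: (measurableT_comp (measurable_powR _)).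
exact: measurable_funM.
Qed.

(** In the volume variable t the divergence of z B(|z|^2) has the primitive n t B([bvol_inv n t]),
    whose value at the volume of the ball is the flux. *)
Lemma integral_divjet n (B : nat -> R -> R) (rho : R) : (0 < n)%N -> jet B -> 0 < rho ->
  (lebesgue_rV n).-integrable (sqn_ball rho) (fun z => (divjet n%:R B 0 (sqn z))%:E) /\
  (\int[lebesgue_rV n]_(z in sqn_ball rho) (divjet n%:R B 0 (sqn z))%:E =
   (n%:R * V n * (rho `^ (n%:R / 2) * B 0%N rho))%:E)%E.
Proof.
move=> n0 jB rho0; set h := divjet n%:R B 0.
have n0' : (0 : R) < n%:R by rewrite ltr0n.
have V0 := V_gt0 (R := R) n.
have ch s : 0 <= s -> {for s, continuous h} by exact: divjet_continuous.
have [K K0 hK] := bounded_on_segment rho ch.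
pose t1 := V n * rho `^ (n%:R / 2); have t10 : 0 < t1 by rewrite mulr_gt0 ?powR_gt0.
have psi1 : bvol_inv n t1 = rho.
  rewrite /bvol_inv /t1 mulrC mulKf ?gt_eqF// -powRrM.
  by rewrite (_ : _ * _ = 1) ?powRr1 ?ltW//; field; rewrite pnatr_eq0 -lt0n.
have chm : continuous (fun s : R => h (Num.max 0 s)).
  move=> s; apply: (@continuous_comp _ _ _ (fun s : R => Num.max 0 s) h).
    by apply: continuous_max => //; exact: cst_continuous.
  by apply: ch; rewrite le_max lexx.
have mh : measurable_fun setT (fun s : R => h (Num.max 0 s)) by exact: continuous_measurable_fun.
have psi0 t : 0 <= bvol_inv n t :> R by exact: powR_ge0.
have mhp : measurable_fun setT (fun t => h (bvol_inv n t)).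
  rewrite (_ : (fun t => _) = (fun s : R => h (Num.max 0 s)) \o bvol_inv n); last first.
    by apply/funext => t /=; rewrite (max_idPr _).
  by apply: measurableT_comp => //; exact: measurable_bvol_inv.
have mhs : measurable_fun setT (fun z : 'rV[R]_n => h (sqn z)).
  rewrite (_ : (fun z => _) = (fun s : R => h (Num.max 0 s)) \o @sqn _ n); last first.
    by apply/funext => t /=; rewrite (max_idPr _)// sqn_ge0.
  by apply: measurableT_comp => //; exact: measurable_sqn.
have mD := @measurable_sqn_ball R n rho.
have LD : (lebesgue_rV n (sqn_ball rho) = t1%:E)%E by rewrite /sqn_ball lebesgue_ball.
have ball_bvol (z : 'rV[R]_n) : (z \in sqn_ball rho) = (bvol z < t1).
  by rewrite mem_sqn_ball bvol_lt ?(ltW t10)// psi1.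
(* Adding the bound K makes the integrand nonnegative on the ball, as the change of variables
   requires; the maximum and the indicator extend it to the whole line. K is subtracted at the
   end. *)
pose g (t : R) : \bar R := ((Num.max 0 (h (bvol_inv n t) + K) * (\1_`]-oo, t1[ t : R)))%:E.
have mg : measurable_fun setT g.
  apply/measurable_EFinP/measurable_funM; last exact: measurable_indic.
  by apply: measurable_maxr => //; exact: measurable_funD.
have hK0 s : 0 <= s < rho -> 0 <= h s + K.
  move=> /andP[s0 sr]; have := hK s; rewrite s0 (ltW sr) => /(_ isT); rewrite ler_norml => /andP[+ _].
  by rewrite lerNl => ?; rewrite -lerBlDr sub0r lerNl.
have I1 : (\int[lebesgue_rV n]_(z in sqn_ball rho) (h (sqn z) + K)%:E =
    \int[leb1]_(t in `]0%R, t1[) (h (bvol_inv n t) + K)%:E)%E.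
  transitivity (\int[lebesgue_rV n]_z g (bvol z))%E.
    rewrite integral_mkcond; apply: eq_integral => z _; rewrite patchE /g bvol_invK// indicE.
    rewrite [in RHS]mem_setE in_itv/= -ball_bvol; case: ifPn => zB; rewrite ?mulr0// mulr1.
    by rewrite (max_idPr _)// hK0// sqn_ge0 -mem_sqn_ball.
  rewrite integral_bvol//; last by move=> t; rewrite lee_fin mulr_ge0// le_max lexx.
  rewrite [RHS]integral_mkcond [LHS]integral_mkcond; apply: eq_integral => t _.
  rewrite !patchE !mem_setE !in_itv/= andbT; case: (ltP 0 t) => //= t0.
  rewrite /g indicE mem_setE in_itv/=; case: ltP => tt1; rewrite ?mulr0// mulr1 (max_idPr _)//.
  apply: hK0; rewrite psi0/= -psi1; apply: gt0_ltr_powR; rewrite ?nnegrE ?divr_ge0 ?divr_gt0 ?(ltW t0) ?(ltW t10) ?(ltW V0)//.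
  by rewrite ltr_pM2r ?invr_gt0.
pose F (t : R) : R := n%:R * (t * B 0%N (bvol_inv n t)) + K * t.
have dF (t : R) : 0 < t -> is_derive t 1 F (h (bvol_inv n t) + K).
  move=> t0; have h1 := is_derive_bvol_inv n t0.
  have h2 := @is_derive1_comp R _ _ t _ _ (jB 0%N _ (psi0 t)) h1.
  have h3 := is_derive_mulR (is_derive_id t 1) h2.
  have h4 := is_derive_addR (is_derive_scaleR n%:R h3) (is_derive_scaleR K (is_derive_id t 1)).
  apply: (is_derive_value h4).
  have E : bvol_inv n t = (t / V n) * (t / V n) `^ (2 / n%:R - 1).
    by rewrite mulr_powRB1// ?divr_gt0// divr_ge0// ltW.
  have E2 : 2 * bvol_inv n t = 2 * (t / V n * (t / V n) `^ (2 / n%:R - 1)) by rewrite -E.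
  rewrite /h /divjet E2 mulr0 addr0 /=.
  move: (B 0%N _) (B 1%N _) ((t / V n) `^ (2 / n%:R - 1)) => a b e; field.
  by rewrite !gt_eqF.
have cpsi : bvol_inv n t @[t --> 0^'+] --> (0 : R).
  have cV : (fun t => t / V n) t @[t --> 0^'+] --> (0 : R)^'+.
    move=> A [e /= e0 eA]; exists (e * V n); first exact: mulr_gt0.
    move=> t /=; rewrite sub0r normrN => te t0; apply: eA; last exact: divr_gt0.
    by rewrite /= sub0r normrN normrM (gtr0_norm (x := (V n)^-1)) ?invr_gt0// ltr_pdivrMr.
  have e0 : 0 < 2 / n%:R :> R by rewrite divr_gt0.
  by move=> A /(powR_cvg0 e0) /cV.
have ch0 : h (bvol_inv n t) @[t --> 0^'+] --> h 0.
  by move=> A /(ch 0 (lexx 0)) /cpsi.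
have cB0 : B 0%N (bvol_inv n t) @[t --> 0^'+] --> B 0%N 0.
  by move=> A /(jet_continuous (k := 0) jB (lexx 0)) /cpsi.
have psi00 : bvol_inv n 0 = 0 :> R.
  by rewrite /bvol_inv mul0r powR0// gt_eqF// divr_gt0.
have I2 : (\int[leb1]_(t in `]0%R, t1[) (h (bvol_inv n t) + K)%:E = (F t1)%:E)%E.
  rewrite -(@integral_itv_bndoo _ _ _ _ true false); last first.
    by apply: measurable_funTS; apply/measurable_EFinP; exact: measurable_funD.
  rewrite (@continuous_FTC2 _ (fun t => h (bvol_inv n t) + K) F)//.
  - by rewrite /F mul0r !mulr0 addr0 sube0.
  - apply/(continuous_within_itvP _ t10); split.
    + move=> t; rewrite in_itv/= => /andP[t0 _].
      apply: cvgD; last exact: cvg_cst.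
      apply: (@continuous_comp _ _ _ (bvol_inv n) h); last exact: ch.
      exact: derive_continuous (is_derive_bvol_inv n t0).
    + by rewrite psi00; apply: cvgD => //; exact: cvg_cst.
    + apply: cvg_at_left_filter; apply: cvgD; last exact: cvg_cst.
      apply: (@continuous_comp _ _ _ (bvol_inv n) h); last exact: ch.
      exact: derive_continuous (is_derive_bvol_inv n t10).
  - split.
    + by move=> x; rewrite in_itv/= => /andP[x0 _]; have [] := dF x x0.
    + have id0 : id t @[t --> (0 : R)^'+] --> (0 : R) by exact: cvg_at_right_filter.
      by rewrite /F psi00; apply: cvgD; apply: cvgM => //; try exact: cvg_cst; exact: cvgM.
    + by apply: cvg_at_left_filter; exact: (derive_continuous (dF _ t10)).
  - move=> x; rewrite in_itv/= => /andP[x0 _]; rewrite derive1E.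
    by have [] := dF x x0.
have iK : (lebesgue_rV n).-integrable (sqn_ball rho) (cst K%:E).
  apply/integrableP; split => //=; rewrite integral_cst//.
  by rewrite [lebesgue_rV _ _]LD -EFinM ltry.
have ih : (lebesgue_rV n).-integrable (sqn_ball rho) (fun z => (h (sqn z))%:E).
  apply: (le_integrable mD _ _ iK).
    by apply: measurable_funTS; exact/measurable_EFinP.
  move=> z zB; rewrite lee_fin (ger0_norm K0); apply: hK.
  by rewrite sqn_ge0/= ltW.
split => //.
have : (\int[lebesgue_rV n]_(z in sqn_ball rho) (h (sqn z) + K)%:E =
   \int[lebesgue_rV n]_(z in sqn_ball rho) (h (sqn z))%:E + (K * t1)%:E)%E.
  under eq_integral => z _ do rewrite EFinD.
  by rewrite integralD//= integral_cst// LD.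
rewrite I1 I2 => E.
have Efin : (\int[lebesgue_rV n]_(z in sqn_ball rho) (h (sqn z))%:E)%E \is a fin_num.
  exact: integrable_fin_num.
move: E; rewrite -(fineK Efin) -EFinD => -[/eqP]; rewrite -subr_eq => /eqP <-.
by rewrite /F psi1 addrK /t1 !mulrA.
Qed.

End mass.

Section approximate_identity.
Context {R : realType}.
Variable n : nat.
Notation leb := (@lebesgue_rV R n).

Lemma integral_translate_signed (f : 'rV[R]_n -> \bar R) (z : 'rV[R]_n) : measurable_fun setT f ->
  (\int[leb]_x f (x + z)%R = \int[leb]_x f x)%E.
Proof.
move=> mf; rewrite integralE [in RHS]integralE; congr (_ - _)%E.
- rewrite -(integral_translate z (measurable_funepos mf) (funepos_ge0 f)).
  by apply: eq_integral => x _; rewrite !funeposE.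
- rewrite -(integral_translate z (measurable_funeneg mf) (funeneg_ge0 f)).
  by apply: eq_integral => x _; rewrite !funenegE.
Qed.

Lemma measurable_translate_ereal (f : 'rV[R]_n -> \bar R) (z : 'rV[R]_n) : measurable_fun setT f ->
  measurable_fun setT (fun x : 'rV[R]_n => f (x + z)).
Proof.
move=> mf; have := measurable_affine_rV 1 z => /(measurableT_comp mf).
by congr measurable_fun; apply/funext => x /=; rewrite scale1r.
Qed.

Lemma integrable_translate (f : 'rV[R]_n -> \bar R) (z : 'rV[R]_n) : leb.-integrable setT f ->
  leb.-integrable setT (fun x : 'rV[R]_n => f (x + z)).
Proof.
move=> /integrableP[mf f1]; apply/integrableP; split; first exact: measurable_translate_ereal.
rewrite (integral_translate (f := fun x => `|f x|%E))//.
exact: measurableT_comp.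
Qed.

(** The constant u(c) is subtracted only on the ball that carries the mass M of T. Outside the ball
    the values of u themselves enter, to be estimated by the L^p norm. *)
Lemma approximate_identity_at (u T : 'rV[R]_n -> R) (c : 'rV[R]_n) (rho M : R) :
  measurable_fun setT u -> measurable_fun setT T ->
  leb.-integrable setT (fun y => (u y * T (y - c))%:E) ->
  leb.-integrable (sqn_ball rho) (fun z => (T z)%:E) ->
  (\int[leb]_(z in sqn_ball rho) (T z)%:E = M%:E)%E ->
  ((`|u c| * `|M|)%:E <= `|\int[leb]_y (u y * T (y - c))%:E| +
    \int[leb]_z (`|u c * \1_(sqn_ball rho) z - u (z + c)%R| * `|T z|)%:E)%E.
Proof.
move=> mu mT iuT iT IT; have mB := @measurable_sqn_ball R n rho.
have mi : measurable_fun setT (\1_(sqn_ball rho) : 'rV[R]_n -> R) by exact: measurable_indic.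
have E1 : (\int[leb]_y (u y * T (y - c))%:E = \int[leb]_z (u (z + c)%R * T z)%:E)%E.
  rewrite -(integral_translate_signed c); last by have /integrableP[] := iuT.
  by apply: eq_integral => z _; rewrite addrK.
have i1 : leb.-integrable setT (fun z => (u (z + c) * T z)%:E).
  by apply: eq_integrable (integrable_translate c iuT) => // z _; rewrite addrK.
have i3 : leb.-integrable setT (fun z => (\1_(sqn_ball rho) z * T z)%:E).
  have := iT; rewrite integrable_mkcond// => i3; apply: eq_integrable i3 => // z _.
  by rewrite patchE indicE; case: ifP => _; rewrite ?mul1r ?mul0r.
have i2 : leb.-integrable setT (fun z => (u c * (\1_(sqn_ball rho) z * T z))%:E).
  by under eq_fun do rewrite EFinM; apply: integrableZl.
have E2 : (\int[leb]_z (u c * (\1_(sqn_ball rho) z * T z))%:E = (u c * M)%:E)%E.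
  under eq_integral => z _ do rewrite EFinM.
  rewrite integralZl// EFinM -IT [in RHS]integral_mkcond; congr (_ * _)%E; apply: eq_integral => z _.
  by rewrite patchE indicE; case: ifP => _; rewrite ?mul1r ?mul0r.
have -> : ((`|u c| * `|M|)%:E = `|\int[leb]_z (u c * (\1_(sqn_ball rho) z * T z))%R%:E|)%E.
  by rewrite E2 /= normrM.
rewrite E1.
have -> : (\int[leb]_z (u c * (\1_(sqn_ball rho) z * T z))%:E =
    \int[leb]_z (u (z + c)%R * T z)%:E +
    \int[leb]_z ((u c * \1_(sqn_ball rho) z - u (z + c)%R) * T z)%:E)%E.
  rewrite -integralD//; last first.
    apply: eq_integrable (integrableB measurableT i2 i1) => // z _.
    by rewrite -EFinB; congr EFin; ring.
  by apply: eq_integral => z _; rewrite -EFinD; congr EFin; ring.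
apply: (le_trans (lee_abs_add _ _)); apply: leeD2l.
apply: (le_trans (le_abse_integral _ measurableT _)).
  apply/measurable_EFinP/measurable_funM => //; apply: measurable_funB.
    exact: measurable_funM.
  exact: measurable_translate.
rewrite le_eqVlt; apply/orP; left; apply/eqP; apply: eq_integral => z _.
by rewrite /= normrM.
Qed.

(** Either a <= l, or a <= a (a/l)^(p-1). This trades a first power for a constant and a p-th power,
    with [l] free to balance the two. *)
Lemma le_threshold (p l a : R) : 1 <= p -> 0 < l -> 0 <= a -> a <= l + l `^ (1 - p) * a `^ p.
Proof.
move=> p1 l0 a0; have [al|la] := leP a l.
  by apply: (le_trans al); rewrite lerDl mulr_ge0 ?powR_ge0.
have a0' := lt_trans l0 la.
apply: (@le_trans _ _ (l `^ (1 - p) * a `^ p)); last by rewrite lerDr ltW.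
have -> : a `^ p = a * a `^ (p - 1) by rewrite mulr_powRB1//; exact: lt_le_trans p1.
rewrite mulrCA -[leLHS]mulr1 ler_pM2l// -opprB powRN.
rewrite mulrC -ler_pdivrMr ?invr_gt0 ?powR_gt0// invrK mul1r.
by apply: ge0_ler_powR; rewrite ?nnegrE ?subr_ge0// ltW.
Qed.

Lemma sqnD_le (x y : 'rV[R]_n) : sqn (x + y) <= 2 * sqn x + 2 * sqn y.
Proof.
rewrite /sqn !mulr_sumr -big_split/=; apply: ler_sum => i _; rewrite mxE.
have := sqr_ge0 (x ord0 i - y ord0 i); nra.
Qed.

End approximate_identity.

(** * Kernels in the volume variable *)

Section kernel_class.
Context {R : realType}.
Notation V := (@unit_ball_volume R).

Lemma measurable_max0 (h : R -> R) : (forall s, 0 <= s -> {for s, continuous h}) ->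
  measurable_fun setT (fun s : R => h (Num.max 0 s)).
Proof.
move=> ch; apply: continuous_measurable_fun => s.
apply: (@continuous_comp _ _ _ (fun s : R => Num.max 0 s) h).
  by apply: continuous_max => //; exact: cst_continuous.
by apply: ch; rewrite le_max lexx.
Qed.

Lemma measurable_comp_ge0 d (S : measurableType d) (h : R -> R) (g : S -> R) :
  (forall s, 0 <= s -> {for s, continuous h}) -> measurable_fun setT g ->
  (forall x, 0 <= g x) -> measurable_fun setT (fun x => h (g x)).
Proof.
move=> /measurable_max0 mh mg g0; rewrite (_ : (fun x => _) = (fun s : R => h (Num.max 0 s)) \o g).
  exact: measurableT_comp.
by apply/funext => x /=; rewrite (max_idPr _).
Qed.

Lemma kernel_profile_continuous alpha (G : nat -> R -> R) s : jet G -> 0 <= s ->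
  {for s, continuous (kernel_profile alpha G)}.
Proof.
move=> jG s0; rewrite /kernel_profile.
have cG : {for s, continuous (fun s => `|G 0%N s|)}.
  by apply: continuous_comp; [exact: jet_continuous|exact: norm_continuous].
case: (odd alpha) => //.
by apply: continuousM => //; exact: sqrt_continuous.
Qed.

Lemma kernel_profile_ge0 alpha (G : nat -> R -> R) s : 0 <= kernel_profile alpha G s.
Proof. by rewrite /kernel_profile; case: ifP => _//; rewrite mulr_ge0 ?sqrtr_ge0. Qed.

Lemma jet_div_profile alpha (G : nat -> R -> R) : jet G -> jet (div_profile alpha G).
Proof.
by move=> jG; rewrite /div_profile; case: ifP => _ //; apply: jet_scale; exact: jet_shift.
Qed.

Lemma jet_adj_profile n alpha (G : nat -> R -> R) : jet G -> jet (adj_profile n alpha G).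
Proof. by move=> jG; apply: jet_divjet; apply: iter_jet_Ljet; exact: jet_div_profile. Qed.

Variable n : nat.
Hypothesis n0 : (0 < n)%N.

Let n0' : (0 : R) < n%:R. Proof. by rewrite ltr0n. Qed.

Lemma bvol_inv_lt (t t' : R) : 0 <= t -> t < t' -> bvol_inv n t < bvol_inv n t'.
Proof.
move=> t0 tt'; have V0 := V_gt0 (R := R) n; apply: gt0_ltr_powR; first by rewrite divr_gt0.
- by rewrite nnegrE divr_ge0// ltW.
- by rewrite nnegrE divr_ge0// ltW// (le_lt_trans t0).
- by rewrite ltr_pM2r ?invr_gt0.
Qed.

Lemma bvol_inv_le (t t' : R) : 0 <= t -> t <= t' -> bvol_inv n t <= bvol_inv n t'.
Proof.
by rewrite le_eqVlt (le_eqVlt t) => /orP[/eqP<-|t0] /orP[/eqP->//|tt'];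
  apply/ltW/bvol_inv_lt => //; exact: ltW.
Qed.

Lemma bvol_invM (a t : R) : 0 <= a -> 0 <= t -> bvol_inv n (a * t) = a `^ (2 / n%:R) * bvol_inv n t.
Proof.
by move=> a0 t0; rewrite /bvol_inv -mulrA powRM// divr_ge0// ltW// V_gt0.
Qed.

Lemma bvol_inv_gt0 (t : R) : 0 < t -> 0 < bvol_inv n t.
Proof. by move=> t0; rewrite powR_gt0// divr_gt0// V_gt0. Qed.

Lemma powR_bvol_inv (t : R) : 0 < t -> V n * bvol_inv n t `^ (n%:R / 2) = t.
Proof.
move=> t0; have V0 := V_gt0 (R := R) n; rewrite /bvol_inv -powRrM.
rewrite (_ : 2 / n%:R * (n%:R / 2) = 1); last by field; rewrite gt_eqF.
by rewrite powRr1 ?divr_ge0 ?ltW// mulrC divfK// gt_eqF.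
Qed.

(* volume ratio of the balls of radius r / 2 and r *)
Definition half_ratio : R := 4^-1 `^ (n%:R / 2).

Lemma half_ratio_gt0 : 0 < half_ratio. Proof. by rewrite powR_gt0// invr_gt0. Qed.

Lemma bvol_inv_half (t : R) : 0 <= t -> bvol_inv n (half_ratio * t) = bvol_inv n t / 4.
Proof.
move=> t0; rewrite bvol_invM ?powR_ge0// /half_ratio -powRrM.
rewrite (_ : n%:R / 2 * (2 / n%:R) = 1); last by field; rewrite gt_eqF.
by rewrite powRr1 ?invr_ge0// mulrC.
Qed.

Variable alpha : nat.
Hypotheses (alpha_gt0 : (0 < alpha)%N) (alpha_lt_n : (alpha < n)%N).

Notation iq' := ((n%:R - alpha%:R) / n%:R : R).
Notation gam := (@gamma_const R n alpha).

Lemma gamma_const_gt0 : 0 < gam.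
Proof.
rewrite /gamma_const mulr_gt0 ?invr_gt0 ?V_gt0// powR_gt0//.
by have := adams_c_gt0 (R := R) alpha_gt0 alpha_lt_n.
Qed.

(** The origin of gamma_{n,alpha}: it is the constant that makes the homogeneous kernel exactly
    (gamma t)^(-1/q') as a function of the volume t. *)
Lemma fundamental_kernel_bvol (t : R) : 0 < t ->
  adams_c n alpha * bvol_inv n t `^ ((alpha%:R - n%:R) / 2) = (gam * t) `^ (- iq').
Proof.
move=> t0; have c0 := adams_c_gt0 (R := R) alpha_gt0 alpha_lt_n; have V0 := V_gt0 (R := R) n.
have na : 0 < n%:R - alpha%:R :> R by rewrite subr_gt0 ltr_nat.
rewrite /gamma_const -/(adams_c n alpha) -{2}(powR_bvol_inv t0) -mulrA mulKf ?gt_eqF//.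
move: (bvol_inv n t) => s; rewrite (powRM _ (powR_ge0 _ _) (powR_ge0 _ _)) -!powRrM; congr (_ * _).
  rewrite (_ : - (n%:R / (n%:R - alpha%:R)) * - iq' = 1) ?powRr1 ?(ltW c0)//; field.
  by rewrite !gt_eqF.
by congr (_ `^ _); field; rewrite gt_eqF.
Qed.

(** Here t is a volume and tau the volume of the supporting ball. The main part carries the sharp
    constant; in the zone of the cut-off any C will do, since it only changes bounded terms. *)
Definition kernel_class (tau C : R) (k : R -> R) :=
  [/\ measurable_fun setT k, forall t, 0 <= k t,
      forall t, 0 < t -> t < half_ratio * tau -> k t <= (gam * t) `^ (- iq'),
      forall t, half_ratio * tau <= t -> k t <= C * tau `^ (- iq')
    & forall t, tau <= t -> k t = 0].

Lemma parametrix_kernel_class (X : nat -> R -> R) :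
  [/\ forall k (x : R), is_derive x 1 (X k) (X k.+1 x),
      forall s, s <= 4^-1 -> X 0%N s = 1,
      forall k s, s <= 4^-1 -> X k.+1 s = 0
    & forall k s, 1 <= s -> X k s = 0] ->
  exists2 C : R, 0 <= C & forall tau d : R, 0 < tau -> 0 < d -> d <= bvol_inv n tau ->
    kernel_class tau C
      (fun t => kernel_profile alpha (parametrix n alpha X (bvol_inv n tau) d) (bvol_inv n t)).
Proof.
move=> [dX X1 X0 Xf].
have [C C0 hC] := kernel_parametrix_far alpha_gt0 alpha_lt_n dX.
have V0 := V_gt0 (R := R) n.
have na : 0 < n%:R - alpha%:R :> R by rewrite subr_gt0 ltr_nat.
exists (C * (V n) `^ iq'); first by rewrite mulr_ge0 ?powR_ge0.
move=> tau d tau0 d0 dr; have r0 := bvol_inv_gt0 tau0.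
have jG := jet_parametrix n alpha dX (bvol_inv n tau) d0.
have b0 t : 0 <= bvol_inv n t :> R by exact: powR_ge0.
have Vf t : tau <= t -> kernel_profile alpha (parametrix n alpha X (bvol_inv n tau) d) (bvol_inv n t) = 0.
  move=> taut; have rt : bvol_inv n tau <= bvol_inv n t by apply: bvol_inv_le => //; exact: ltW.
  rewrite /kernel_profile (parametrix_vanishes _ _ Xf _ r0)// normr0.
  by case: ifP => //; rewrite mulr0.
split => //.
- apply: measurable_comp_ge0 => //; last exact: measurable_bvol_inv.
  by move=> s s0; exact: kernel_profile_continuous.
- by move=> t; exact: kernel_profile_ge0.
- move=> t t0 tt; rewrite -fundamental_kernel_bvol//.
  apply: (kernel_parametrix_near alpha_gt0 alpha_lt_n X1 X0) => //; first exact: bvol_inv_gt0.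
  by rewrite -bvol_inv_half ?(ltW tau0)//; apply: bvol_inv_le => //; exact: ltW.
- move=> t tt; have [taut|ttau] := leP tau t.
    by rewrite Vf// !mulr_ge0 ?powR_ge0.
  apply: (le_trans (hC _ _ _ d0 dr _)).
    rewrite -bvol_inv_half ?(ltW tau0)// !bvol_inv_le//.
    - by apply: le_trans tt; rewrite mulr_ge0// ltW// half_ratio_gt0.
    - exact: ltW.
    - by rewrite mulr_ge0// ltW// half_ratio_gt0.
  rewrite -mulrA ler_wpM2l// -{2}(powR_bvol_inv tau0) powRM ?powR_ge0 ?(ltW V0)//.
  move: (bvol_inv n tau) => s; rewrite -powRrM mulrA -powRD; last by rewrite (gt_eqF V0) implybT.
  rewrite subrr powRr0 mul1r le_eqVlt; apply/orP; left; apply/eqP.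
  by congr (_ `^ _); field; rewrite gt_eqF.
Qed.

End kernel_class.

(** * Representation by the kernel *)

Section key.
Context {R : realType}.
Variables (n alpha : nat).
Hypotheses (alpha_gt0 : (0 < alpha)%N) (alpha_lt_n : (alpha < n)%N).
Notation leb := (@lebesgue_rV R n).
Notation V := (@unit_ball_volume R).

Let n0 : (0 < n)%N. Proof. exact: leq_trans alpha_lt_n. Qed.
Let n0' : (0 : R) < n%:R. Proof. by rewrite ltr0n. Qed.

Lemma measurable_powR_norm (u : 'rV[R]_n -> R) (p : R) : measurable_fun setT u ->
  measurable_fun setT (fun x => (`|u x| `^ p)%:E).
Proof.
move=> mu; apply/measurable_EFinP; apply: (measurableT_comp (measurable_powR p)).
exact: measurableT_comp.
Qed.

(* the part of the convolution outside of the ball where the mass concentrates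
   is controlled by the L^p norm *)
Lemma far_error (u T : 'rV[R]_n -> R) (c : 'rV[R]_n) (p Q tau rho A : R) :
  measurable_fun setT u -> measurable_fun setT T -> 1 <= p -> 0 < Q -> 0 < tau -> 0 <= A ->
  (\int[leb]_x (`|u x| `^ p)%:E <= Q%:E)%E ->
  (forall z, rho <= sqn z -> bvol z < tau -> `|T z| <= A / tau) ->
  (forall z, tau <= bvol z -> T z = 0) ->
  (\int[leb]_z (`|u c * \1_(sqn_ball rho) z - u (z + c)%R| * `|T z|)%:E <=
   (2 * A * (Q / tau) `^ p^-1)%:E +
   \int[leb]_z (\1_(sqn_ball rho) z * (`|u (z + c)%R - u c| * `|T z|))%:E)%E.
Proof.
move=> mu mT p1 Q0 tau0 A0 uQ Tfar T0.
have p0 : 0 < p by exact: lt_le_trans p1.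
(* The truncation level at which the two contributions of [le_threshold] are equal: l tau = l^(1-p)
   Q. *)
set l := (Q / tau) `^ p^-1.
have l0 : 0 < l by rewrite powR_gt0 ?divr_gt0.
have lp : l `^ p = Q / tau by rewrite /l -powRrM mulVf ?gt_eqF// powRr1// divr_ge0// ltW.
have mB := @measurable_sqn_ball R n rho.
have mi : measurable_fun setT (\1_(sqn_ball rho) : 'rV[R]_n -> R) by exact: measurable_indic.
have muc := measurable_translate c mu.
pose D : set 'rV[R]_n := [set z | bvol z < tau].
have mD : measurable D.
  rewrite (_ : D = sqn_ball (bvol_inv n tau)); first exact: measurable_sqn_ball.
  by apply/seteqP; split => z; rewrite /D /sqn_ball/= bvol_lt// ltW.
have LD : (leb D = tau%:E)%E by exact: lebesgue_bvol.
have mDi : measurable_fun setT (\1_D : 'rV[R]_n -> R) by exact: measurable_indic.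
pose a := A / tau; have a0 : 0 <= a by rewrite divr_ge0// ltW.
apply: (@le_trans _ _ (\int[leb]_z ((a * l)%:E * (\1_D z : R)%:E +
   ((a * l `^ (1 - p))%:E * (`|u (z + c)%R| `^ p)%:E +
   (\1_(sqn_ball rho) z * (`|u (z + c)%R - u c| * `|T z|))%:E)))%E).
  have m1 : measurable_fun setT (fun z : 'rV[R]_n => (\1_(sqn_ball rho) z * (`|u (z + c)%R - u c| * `|T z|))%:E).
    apply/measurable_EFinP; apply: measurable_funM => //; apply: measurable_funM.
      by apply: measurableT_comp => //; exact: measurable_funB.
    exact: measurableT_comp.
  have mp : measurable_fun setT (fun z : 'rV[R]_n => (`|u (z + c)%R| `^ p)%:E).
    exact: (measurable_powR_norm p muc).
  apply: ge0_le_integral => //.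
  - apply/measurable_EFinP; apply: measurable_funM; last exact: measurableT_comp.
    by apply: measurableT_comp => //; apply: measurable_funB => //; exact: measurable_funM.
  - apply: emeasurable_funD; first by apply: emeasurable_funM => //; exact/measurable_EFinP.
    by apply: emeasurable_funD => //; exact: emeasurable_funM.
  move=> z _; rewrite -!EFinM -!EFinD lee_fin !indicE mem_sqn_ball.
  have [zr|rz] := ltP (sqn z) rho.
    rewrite mulr1 mul1r distrC -[leLHS]add0r -[leLHS]add0r; apply: lerD.
      by rewrite mulr_ge0// mulr_ge0// ltW.
    by rewrite lerD2r mulr_ge0 ?powR_ge0// mulr_ge0 ?powR_ge0.
  rewrite mulr0 sub0r normrN mul0r addr0 (mem_setb (fun z => bvol z < tau)).
  have [zt|tz] := ltP (bvol z) tau; last first.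
    by rewrite T0// normr0 !mulr0 add0r mulr_ge0 ?powR_ge0// mulr_ge0 ?powR_ge0.
  rewrite mulr1 (_ : _ + _ = a * (l + l `^ (1 - p) * `|u (z + c)%R| `^ p)); last by ring.
  rewrite [leLHS]mulrC; apply: ler_pM => //; first exact: Tfar.
  exact: le_threshold.
have mp : measurable_fun setT (fun z : 'rV[R]_n => (`|u (z + c)%R| `^ p)%:E).
  exact: (measurable_powR_norm p muc).
have m1 : measurable_fun setT (fun z : 'rV[R]_n => (\1_(sqn_ball rho) z * (`|u (z + c)%R - u c| * `|T z|))%:E).
  apply/measurable_EFinP; apply: measurable_funM => //; apply: measurable_funM.
    by apply: measurableT_comp => //; exact: measurable_funB.
  exact: measurableT_comp.
have al0 : 0 <= a * l by rewrite mulr_ge0// ltW.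
have alp0 : 0 <= a * l `^ (1 - p) by rewrite mulr_ge0// powR_ge0.
rewrite ge0_integralD//; last 4 first.
- by move=> z _; rewrite lee_fin mulr_ge0.
- by apply: emeasurable_funM => //; exact/measurable_EFinP.
- by move=> z _; rewrite -!EFinM -EFinD lee_fin addr_ge0// mulr_ge0// ?powR_ge0// mulr_ge0.
- by apply: emeasurable_funD => //; exact: emeasurable_funM.
rewrite ge0_integralD//; last 2 first.
- by move=> z _; rewrite -!EFinM lee_fin mulr_ge0// ?powR_ge0.
- exact: emeasurable_funM.
rewrite addeA; apply: leeD2r.
rewrite ge0_integralZl//; last exact/measurable_EFinP.
rewrite ge0_integralZl// integral_indic// setIT LD.
rewrite (integral_translate (f := fun x => (`|u x| `^ p)%:E))//; last exact: measurable_powR_norm.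
apply: (le_trans (leeD2l _ (lee_wpmul2l _ uQ))); first by rewrite lee_fin.
rewrite -!EFinM -EFinD lee_fin.
have E : l `^ (1 - p) * Q = l * tau.
  have -> : Q = l `^ p * tau by rewrite lp divfK ?gt_eqF.
  rewrite mulrA -powRD; last by rewrite (gt_eqF l0) implybT.
  by rewrite subrK powRr1// ltW.
rewrite -(mulrA a _ Q) E /a le_eqVlt; apply/orP; left; apply/eqP; field.
by rewrite gt_eqF.
Qed.

(** The integrand is the divergence of z (|z|^2 + d)^(-n/2) / n, and the flux of this field through
    any sphere is at most V. *)
Lemma integral_concentrated rho d : 0 < rho -> 0 < d ->
  (\int[leb]_z (\1_(sqn_ball rho) z * (d * (sqn z + d) `^ (- (n%:R / 2 + 1))))%:E <= (V n)%:E)%E.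
Proof.
move=> rho0 d0; have V0 := V_gt0 (R := R) n.
pose B := jscale n%:R^-1 (pow_jet (n%:R / 2) d).
have jB : jet B by apply: jet_scale; exact: jet_pow.
have [iB EB] := integral_divjet n0 jB rho0.
have E z : \1_(sqn_ball rho) z * (d * (sqn z + d) `^ (- (n%:R / 2 + 1))) =
    \1_(sqn_ball rho) z * divjet n%:R B 0 (sqn z).
  congr (_ * _); rewrite /divjet /B /jscale /pow_jet pow_jet_coefS /= mulr0 !addr0 mul1r.
  have sd : 0 < sqn z + d by rewrite ltr_wpDl ?sqn_ge0.
  have -> : (sqn z + d) `^ (- (n%:R / 2)) = (sqn z + d) * (sqn z + d) `^ (- (n%:R / 2 + 1)).
    rewrite -{2}[sqn z + d]powRr1 ?(ltW sd)// -powRD ?(gt_eqF sd) ?implybT//.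
    by congr (_ `^ _); ring.
  by field; rewrite gt_eqF.
have -> : (\int[leb]_z (\1_(sqn_ball rho) z * (d * (sqn z + d) `^ (- (n%:R / 2 + 1))))%:E =
    \int[leb]_(z in sqn_ball rho) (divjet n%:R B 0 (sqn z))%:E)%E.
  rewrite [RHS]integral_mkcond; apply: eq_integral => z _.
  by rewrite E patchE indicE; case: ifP => _; rewrite ?mul1r ?mul0r.
rewrite EB lee_fin /B /jscale /pow_jet /= mul1r addr0.
rewrite (_ : n%:R * _ * _ = V n * (rho `^ (n%:R / 2) * (rho + d) `^ (- (n%:R / 2)))); last first.
  by field; rewrite gt_eqF.
rewrite ger_pMr// powRN ler_pdivrMr ?powR_gt0 ?addr_gt0// mul1r.
apply: ge0_ler_powR; rewrite ?nnegrE ?divr_ge0 ?(ltW rho0) ?(ltW (addr_gt0 rho0 d0))// ?(ltW n0')//.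
by rewrite lerDl ltW.
Qed.

(** By Tonelli the inner integral becomes the L^1 modulus of continuity of [v]. It is small for
    |z|^2 < eta, where the kernel has bounded mass, and bounded for |z|^2 >= eta, where the kernel
    is O(d). *)
Lemma near_error (v : 'rV[R]_n -> R) (T : R -> 'rV[R]_n -> R) (rho eps A : R) :
  measurable_fun setT v -> leb.-integrable setT (EFin \o v) -> translation_continuous v ->
  (forall d, 0 < d -> measurable_fun setT (T d)) -> 0 < rho -> 0 < eps -> 0 <= A ->
  (forall d z, 0 < d -> sqn z < rho -> `|T d z| <= A * (d * (sqn z + d) `^ (- (n%:R / 2 + 1)))) ->
  \forall d \near (0 : R)^'+,
  (\int[leb]_x \int[leb]_z (\1_(sqn_ball rho) z * (`|v (z + x)%R - v x| * `|T d z|))%:E <= eps%:E)%E.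
Proof.
move=> mv iv cv mT rho0 eps0 A0 hT.
have V0 := V_gt0 (R := R) n.
have AV : 0 < 2 * (A * V n + 1) by rewrite mulr_gt0// ltr_wpDl// mulr_ge0// ltW.
have [eta eta0 hv] := cv _ (divr_gt0 eps0 AV); set e1 := eps / _ in hv.
have e10 : 0 < e1 by rewrite divr_gt0.
have mB := @measurable_sqn_ball R n rho.
have mi : measurable_fun setT (\1_(sqn_ball rho) : 'rV[R]_n -> R) by exact: measurable_indic.
pose t1 := V n * rho `^ (n%:R / 2).
have LB : (leb (sqn_ball rho) = t1%:E)%E by rewrite /sqn_ball lebesgue_ball.
have t10 : 0 <= t1 by rewrite mulr_ge0 ?powR_ge0// ltW.
have N1f : (\int[leb]_x `|v x|%:E < +oo)%E by case/integrableP: iv.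
pose N1 := fine (\int[leb]_x `|v x|%:E).
have N1E : (\int[leb]_x `|v x|%:E = N1%:E)%E by rewrite fineK// ge0_fin_numE// integral_ge0.
have N10 : 0 <= N1 by rewrite -lee_fin -N1E integral_ge0.
pose E0 := eta `^ (- (n%:R / 2 + 1)); have E00 : 0 <= E0 by exact: powR_ge0.
pose K := 2 * N1 * (A * E0) * t1; have K0 : 0 <= K := mulr_ge0 (mulr_ge0 (mulr_ge0 (ler0n _ 2) N10) (mulr_ge0 A0 E00)) t10.
have near1 : \forall d \near (0 : R)^'+, d < eps / (2 * (K + 1)).
  by apply: nbhs_right_lt; rewrite divr_gt0// mulr_gt0// ltr_wpDl.
near=> d; have d0 : 0 < d by near: d; exact: nbhs_right_gt.
have dK : d * K <= eps / 2.
  have : d < eps / (2 * (K + 1)) by near: d.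
  rewrite ltr_pdivlMr; last by rewrite mulr_gt0// ltr_wpDl.
  rewrite ler_pdivlMr//; nra.
have mTd := mT _ d0.
pose g (p : 'rV[R]_n * 'rV[R]_n) : \bar R :=
  (\1_(sqn_ball rho) p.2 * (`|v (p.2 + p.1) - v p.1| * `|T d p.2|))%:E.
have m12 : measurable_fun setT (fun p : 'rV[R]_n * 'rV[R]_n => p.2 + p.1).
  apply: measurable_fun_rV => i; under eq_fun do rewrite mxE.
  by apply: measurable_funD; apply: (measurableT_comp (measurable_coord_rV i)).
have mg : measurable_fun setT g.
  apply/measurable_EFinP; apply: measurable_funM; first exact: (measurableT_comp mi).
  apply: measurable_funM; last by apply: measurableT_comp => //; exact: (measurableT_comp mTd).
  apply: measurableT_comp => //; apply: measurable_funB; first exact: (measurableT_comp mv).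
  exact: (measurableT_comp mv).
have g0 p : (0 <= g p)%E by rewrite lee_fin mulr_ge0// mulr_ge0.
rewrite (tonelli_rV mg g0) /g /=.
pose om z := (\int[leb]_x `|v (x + z)%R - v x|%:E)%E.
have om2 z : (om z <= (2 * N1)%:E)%E.
  have mvz := measurable_translate z mv.
  apply: (@le_trans _ _ (\int[leb]_x (`|v (x + z)%R|%:E + `|v x|%:E))%E).
    apply: ge0_le_integral => //; first exact: measurable_absB.
    - by apply: emeasurable_funD; apply/measurable_EFinP; exact: measurableT_comp.
    - by move=> x _; rewrite -EFinD lee_fin; exact: ler_normB.
  rewrite ge0_integralD//; try by apply/measurable_EFinP; exact: measurableT_comp.
  rewrite (integral_translate (f := fun x => `|v x|%:E))//; last by apply/measurable_EFinP; exact: measurableT_comp.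
  by rewrite N1E -EFinD lee_fin mulr_natl mulr2n.
have Eom z : (\int[leb]_x (\1_(sqn_ball rho) z * (`|v (z + x)%R - v x| * `|T d z|))%:E =
    (\1_(sqn_ball rho) z * `|T d z|)%:E * om z)%E.
  have mo : measurable_fun setT (fun x : 'rV[R]_n => `|v (x + z)%R - v x|%:E).
    by apply: measurable_absB => //; exact: measurable_translate.
  rewrite /om -ge0_integralZl//.
  by apply: eq_integral => x _; rewrite -EFinM (addrC z x); congr EFin; ring.
under eq_integral => z _ do rewrite Eom.
have mom : measurable_fun setT om.
  apply: (measurable_fun_fubini_tonelli_F (m2 := @lebesgue_rVs R n)
    (fun p : 'rV[R]_n * 'rV[R]_n => `|v (p.2 + p.1) - v p.2|%:E)) => [|p]; last by rewrite lee_fin.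
  apply/measurable_EFinP; apply: measurableT_comp => //; apply: measurable_funB; last exact: (measurableT_comp mv).
  exact: (measurableT_comp mv).
pose P (z : 'rV[R]_n) := d * (sqn z + d) `^ (- (n%:R / 2 + 1)).
have P0 z : 0 <= P z by rewrite mulr_ge0 ?powR_ge0// ltW.
have mP : measurable_fun setT P.
  apply: measurable_funM => //; apply: (measurableT_comp (measurable_powR _)).
  by apply: measurable_funD => //; exact: measurable_sqn.
have mPi : measurable_fun setT (fun z : 'rV[R]_n => (\1_(sqn_ball rho) z * P z)%:E).
  by apply/measurable_EFinP; exact: measurable_funM.
have mib : measurable_fun setT (fun z : 'rV[R]_n => (\1_(sqn_ball rho) z : R)%:E) by exact/measurable_EFinP.
apply: (@le_trans _ _ (\int[leb]_z ((e1 * A)%:E * (\1_(sqn_ball rho) z * P z)%:E +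
   (2 * N1 * (A * E0) * d)%:E * (\1_(sqn_ball rho) z : R)%:E))%E).
  apply: ge0_le_integral => //.
  - by move=> z _; apply: mule_ge0; rewrite ?lee_fin ?mulr_ge0// integral_ge0.
  - apply: emeasurable_funM => //; apply/measurable_EFinP; apply: measurable_funM => //.
    exact: measurableT_comp.
  - by apply: emeasurable_funD; exact: emeasurable_funM.
  move=> z _; rewrite indicE mem_sqn_ball; have [zr|rz] := ltP (sqn z) rho; last first.
    by rewrite !mul0r mul0e !mule0 adde0.
  rewrite !mul1r mule1.
  have TP : `|T d z| <= A * P z by exact: hT.
  have [ze|ez] := ltP (sqn z) eta.
    apply: (@le_trans _ _ ((A * P z)%:E * e1%:E)%E).
      by apply: lee_pmul => //; [exact: integral_ge0|exact: hv].
    rewrite -!EFinM -EFinD lee_fin (_ : A * P z * e1 = e1 * A * P z); last by ring.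
    by rewrite lerDl !mulr_ge0// ltW.
  apply: (@le_trans _ _ ((A * (d * E0))%:E * (2 * N1)%:E)%E).
    apply: lee_pmul => //; first exact: integral_ge0.
    rewrite lee_fin; apply: (le_trans TP); rewrite ler_wpM2l// /P ler_pM2l// /E0.
    rewrite !powRN lef_pV2 ?posrE ?powR_gt0//; last by rewrite ltr_wpDl ?sqn_ge0.
    have nn : 0 <= n%:R / 2 + 1 :> R by rewrite addr_ge0// divr_ge0// ltW.
    have sd : 0 <= sqn z + d by rewrite addr_ge0 ?sqn_ge0// ltW.
    apply: ge0_ler_powR => //; first by rewrite nnegrE ltW.
    by apply: (le_trans ez); rewrite lerDl ltW.
  rewrite -!EFinM -EFinD lee_fin (_ : A * (d * E0) * (2 * N1) = 2 * N1 * (A * E0) * d); last by ring.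
  by rewrite lerDr; exact: (mulr_ge0 (mulr_ge0 (ltW e10) A0) (P0 z)).
have iP0 z : 0 <= \1_(sqn_ball rho) z * P z by apply: mulr_ge0.
have eA0 : 0 <= e1 * A by rewrite mulr_ge0// ltW.
have NA0 : 0 <= 2 * N1 * (A * E0) := mulr_ge0 (mulr_ge0 (ler0n _ 2) N10) (mulr_ge0 A0 E00).
have NAd0 : 0 <= 2 * N1 * (A * E0) * d := mulr_ge0 NA0 (ltW d0).
rewrite ge0_integralD//; last 4 first.
- by move=> z _; apply: mule_ge0; rewrite lee_fin.
- exact: emeasurable_funM.
- by move=> z _; apply: mule_ge0; rewrite lee_fin.
- exact: emeasurable_funM.
rewrite ge0_integralZl//; last by move=> z _; rewrite lee_fin.
rewrite ge0_integralZl//.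
rewrite integral_indic// setIT LB.
have e1A0 : (0 <= (e1 * A)%:E)%E by rewrite lee_fin mulr_ge0// ltW.
apply: (le_trans (leeD2r _ (lee_wpmul2l e1A0 (integral_concentrated rho0 d0)))).
rewrite -!EFinM -EFinD lee_fin.
have -> : 2 * N1 * (A * E0) * d * t1 = d * K by rewrite /K; ring.
have e1V : e1 * A * V n <= eps / 2.
  have w0 : 0 <= A * V n by rewrite mulr_ge0// ltW.
  have w1 : 0 < A * V n + 1 by rewrite ltr_wpDl.
  have -> : e1 * A * V n = eps / 2 * (A * V n / (A * V n + 1)).
    by rewrite /e1; field; rewrite gt_eqF.
  rewrite ger_pMr; last by rewrite divr_gt0.
  by rewrite ler_pdivrMr// mul1r lerDl.
lra.
Unshelve. all: by end_near.
Qed.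

End key.

Section representation.
Context {R : realType}.
Variables (n alpha : nat).
Hypotheses (alpha_gt0 : (0 < alpha)%N) (alpha_lt_n : (alpha < n)%N).
Notation leb := (@lebesgue_rV R n).
Notation V := (@unit_ball_volume R).

Let n0 : (0 < n)%N. Proof. exact: leq_trans alpha_lt_n. Qed.
Let n0' : (0 : R) < n%:R. Proof. by rewrite ltr0n. Qed.

Definition kernel_average (f : 'rV[R]_n -> R) (k : R -> R) (x : 'rV[R]_n) : \bar R :=
  (\int[leb]_y (f y * k (bvol (y - x)))%:E)%E.

Lemma vanishes_divjet N r (H : nat -> R -> R) : vanishes_beyond r H -> vanishes_beyond r (divjet N H).
Proof. by move=> h k s rs; rewrite /divjet !h// !mulr0 addr0. Qed.

Lemma vanishes_Ljet N r (H : nat -> R -> R) : vanishes_beyond r H -> vanishes_beyond r (Ljet N H).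
Proof. by move=> h k s rs; rewrite /Ljet !h// !mulr0 addr0 oppr0. Qed.

Lemma vanishes_adj_profile r (G : nat -> R -> R) : vanishes_beyond r G ->
  vanishes_beyond r (adj_profile n alpha G).
Proof.
move=> vG; apply: vanishes_divjet; elim: (half_order alpha) => [|m IH] /=.
  rewrite /div_profile; case: ifP => // _ k s rs.
  by rewrite /jscale /jshift vG// mulr0.
exact: vanishes_Ljet.
Qed.

Lemma measurable_bvolB : measurable_fun setT (fun p : 'rV[R]_n * 'rV[R]_n => bvol (p.2 - p.1)).
Proof.
apply: (measurableT_comp (@measurable_bvol R n)).
apply: measurable_fun_rV => i; under eq_fun do rewrite !mxE.
by apply: measurable_funB; apply: (measurableT_comp (measurable_coord_rV i)).
Qed.

Lemma measurable_kernel_pair (f : 'rV[R]_n -> R) (k : R -> R) :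
  measurable_fun setT f -> measurable_fun setT k ->
  measurable_fun setT (fun p : 'rV[R]_n * 'rV[R]_n => (f p.2 * k (bvol (p.2 - p.1)))%:E).
Proof.
move=> mf mk; apply/measurable_EFinP; apply: measurable_funM; first exact: (measurableT_comp mf).
exact: (measurableT_comp mk measurable_bvolB).
Qed.

Lemma measurable_kernel_average (f : 'rV[R]_n -> R) (k : R -> R) :
  measurable_fun setT f -> measurable_fun setT k -> (forall x, 0 <= f x) -> (forall t, 0 <= k t) ->
  measurable_fun setT (kernel_average f k).
Proof.
move=> mf mk f0 k0.
apply: (measurable_fun_fubini_tonelli_F (m2 := @lebesgue_rVs R n) _ (measurable_kernel_pair mf mk)).
by move=> p; rewrite lee_fin mulr_ge0.
Qed.

Lemma restrict_sum_ball (u : 'rV[R]_n -> R) (c z : 'rV[R]_n) (L rho : R) : sqn c < L -> sqn z < rho ->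
  (u \_ (sqn_ball (2 * L + 2 * rho))) (z + c) = u (z + c) /\
  (u \_ (sqn_ball (2 * L + 2 * rho))) c = u c.
Proof.
move=> cL zr; have c0 := sqn_ge0 c; have z0 := sqn_ge0 z; have zc := sqnD_le z c.
rewrite !patchE !mem_sqn_ball.
move: (sqn c) (sqn z) (sqn (z + c)) c0 z0 zc cL zr => a b d a0 b0 dab aL br.
have -> : d < 2 * L + 2 * rho by lra.
by have -> : a < 2 * L + 2 * rho by lra.
Qed.

(** An inequality integrated over a bounded set S avoids a pointwise limit: some d > 0 is fixed for
    which the errors integrated over S are at most eps. The kernel depends on d, but [C] is chosen
    before u, S and eps. *)
Theorem kernel_representation (p : R) : 1 <= p -> exists2 C : R, 0 <= C &
  forall u (F : 'rV[R]_n -> 'rV[R]_(nabla_dim n alpha)) (Q tau eps L : R) (S : set 'rV[R]_n),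
  weak_nabla alpha u F -> 0 < Q -> (\int[leb]_x (`|u x| `^ p)%:E <= Q%:E)%E ->
  0 < tau -> 0 < eps -> measurable S -> S `<=` sqn_ball L ->
  exists2 k : R -> R, kernel_class n alpha tau C k &
    (\int[leb]_(x in S) `|u x|%:E <= eps%:E + (C * (Q / tau) `^ p^-1)%:E * leb S +
     \int[leb]_(x in S) kernel_average (fun y => enorm (F y)) k x)%E.
Proof.
move=> p1; have [X HX] := @exists_cutoff_jet R; have [dX X1 X0 Xf] := HX.
have [C1 C10 hC1] := parametrix_kernel_class n0 alpha_gt0 alpha_lt_n HX.
have [C2 C20 hC2] := adj_parametrix_far alpha_gt0 alpha_lt_n dX.
have [C3 C30 hC3] := adj_parametrix_near n alpha X1 X0.
have V0 := V_gt0 (R := R) n.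
exists (C1 + 2 * (C2 * V n)); first by rewrite addr_ge0 ?mulr_ge0// ltW.
move=> u F Q tau eps L S wu Q0 uQ tau0 eps0 mS SL.
have [[mu locu] locF _] := wu.
set r := bvol_inv n tau; have r0 : 0 < r by exact: bvol_inv_gt0.
pose rho := r / 4; have rho0 : 0 < rho by rewrite divr_gt0.
pose G d := parametrix n alpha X r d.
pose T d (z : 'rV[R]_n) := adj_profile n alpha (G d) 0 (sqn z).
have jG d : 0 < d -> jet (G d) by exact: jet_parametrix.
have mT d : 0 < d -> measurable_fun setT (T d).
  move=> d0; apply: measurable_comp_ge0; last exact: sqn_ge0.
    by move=> s s0; apply: jet_continuous => //; exact/jet_adj_profile/jG.
  exact: measurable_sqn.
(* Since |z + x|^2 <= 2 |z|^2 + 2 |x|^2, truncating u to this ball changes nothing for x in S and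
   |z|^2 < rho, and makes u integrable. *)
pose L' := 2 * L + 2 * rho.
have iuB : leb.-integrable (sqn_ball L') (EFin \o u).
  have cB : compact [set x : 'rV[R]_n | sqn (x - 0) <= L'] by exact: compact_sqn_le.
  have mB' := compact_measurable_rV cB.
  apply: (@integrableS _ _ _ _ [set x : 'rV[R]_n | sqn (x - 0) <= L']) => //.
  - exact: measurable_sqn_ball.
  - by move=> x; rewrite /sqn_ball/= subr0 => /ltW.
  - apply/integrableP; split; first by apply: measurable_funTS; exact/measurable_EFinP.
    exact: locu.
pose v := u \_ (sqn_ball L').
have mB := @measurable_sqn_ball R n L'.
have mv : measurable_fun setT v.
  by apply: (measurable_restrictT u mB).1; exact: measurable_funTS.
have iv : leb.-integrable setT (EFin \o v).
  have := iuB; rewrite integrable_mkcond//; apply: eq_ind; congr (integrable _ _ _).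
  by apply/funext => x; rewrite /v/= !patchE; case: ifP.
have cv : translation_continuous v by exact: integrable_translation_continuous.
have hT d z : 0 < d -> sqn z < rho -> `|T d z| <= C3 * (d * (sqn z + d) `^ (- (n%:R / 2 + 1))).
  by move=> d0 zr; rewrite mulrA; apply: hC3 => //; [exact: sqn_ge0|exact: ltW].
have eps2 : 0 < eps / 2 by rewrite divr_gt0.
have near1 := near_error n0 mv iv cv mT rho0 eps2 C30 hT.
pose N1 := fine (\int[leb]_(x in S) `|u x|%:E).
have Sfin : (\int[leb]_(x in S) `|u x|%:E < +oo)%E.
  have [L0|L0] := leP L 0.
    have -> : S = set0.
      by rewrite -subset0 => x /SL; rewrite /sqn_ball/= => h; have := sqn_ge0 x; rewrite leNgt (lt_le_trans h).
    by rewrite integral_set0.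
  have SB : S `<=` sqn_ball L'.
    move=> x /SL; rewrite /sqn_ball/= => /lt_le_trans; apply; rewrite /L'; lra.
  have := integrableS mB mS SB iuB => /integrableP[_]; exact.
have N1E : (\int[leb]_(x in S) `|u x|%:E = N1%:E)%E by rewrite fineK// ge0_fin_numE// integral_ge0.
have N10 : 0 <= N1 by rewrite -lee_fin -N1E integral_ge0.
(* The tolerance for the flux M d, whose limit is 1: the loss del |u| integrates to at most eps/2
   over S. *)
pose del := eps / (2 * (N1 + 1)); have del0 : 0 < del by rewrite divr_gt0// mulr_gt0// ltr_wpDl.
have delN : del * N1 <= eps / 2.
  rewrite (_ : del * N1 = eps / 2 * (N1 / (N1 + 1))); last first.
    by rewrite /del; field; rewrite gt_eqF// ltr_wpDl.
  by rewrite ger_pMr// ler_pdivrMr ?mul1r ?lerDl// ltr_wpDl.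
pose M d := n%:R * V n * (rho `^ (n%:R / 2) *
  iter (half_order alpha) (Ljet (n%:R + 2)) (div_profile alpha (G d)) 0 rho).
have near2 : \forall d \near (0 : R)^'+, `|1 - M d| < del.
  by have /cvgrPdist_lt := adj_parametrix_flux alpha_gt0 alpha_lt_n X1 X0 r0; exact.
have near3 : \forall d \near (0 : R)^'+, d < r by exact: nbhs_right_lt.
have near4 : \forall d \near (0 : R)^'+, 0 < d by exact: nbhs_right_gt.
have [d [[dE dM] [dr d0]]] : exists d, (((\int[leb]_x \int[leb]_z
    (\1_(sqn_ball rho) z * (`|v (z + x)%R - v x| * `|T d z|))%:E <= (eps / 2)%:E)%E /\
    `|1 - M d| < del) /\ (d < r /\ 0 < d)).
  by apply: (@filter_ex _ (0 : R)^'+ _); apply: filterI; apply: filterI.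
pose k t := kernel_profile alpha (G d) (bvol_inv n t).
have [mk k0 kn kf kv] := hC1 tau d tau0 d0 (ltW dr).
exists k.
  split => // t tt; apply: (le_trans (kf _ tt)); rewrite ler_wpM2r ?powR_ge0//.
  by rewrite lerDl !mulr_ge0// ltW.
pose f y := enorm (F y).
have mf : measurable_fun setT f by apply: measurable_enorm => j; case: (locF j).
have f0 y : 0 <= f y by exact: sqrtr_ge0.
pose D := 2 * (C2 * V n) * (Q / tau) `^ p^-1.
have D0 : 0 <= D by rewrite mulr_ge0 ?powR_ge0// mulr_ge0// mulr_ge0// ltW.
pose E x := (\int[leb]_z (\1_(sqn_ball rho) z * (`|v (z + x)%R - v x| * `|T d z|))%:E)%E.
have point c : S c -> (`|u c|%:E <= kernel_average f k c + (D%:E + (E c + (del * `|u c|)%:E)))%E.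
  move=> Sc.
  have [iuT leI] := weak_nabla_kernel c alpha_gt0 wu (jG _ d0) (parametrix_vanishes n alpha Xf d r0).
  have jB : jet (iter (half_order alpha) (Ljet (n%:R + 2)) (div_profile alpha (G d))).
    by apply: iter_jet_Ljet; apply: jet_div_profile; exact: jG.
  have [iT IT] := integral_divjet n0 jB rho0.
  have H := approximate_identity_at mu (mT _ d0) iuT iT IT.
  have vG : vanishes_beyond r (G d) := parametrix_vanishes n alpha Xf d r0.
  have T0 z : tau <= bvol z -> T d z = 0.
    move=> tz; apply: (vanishes_adj_profile vG).
    by rewrite -(bvol_invK z n0); apply: bvol_inv_le => //; exact: ltW.
  have Tfar z : rho <= sqn z -> bvol z < tau -> `|T d z| <= C2 * V n / tau.
    move=> rz zt; have zr : sqn z <= r.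
      by rewrite -(bvol_invK z n0) ltW// bvol_inv_lt// bvol_ge0.
    have := hC2 r d (sqn z) d0 (ltW dr); rewrite -/rho rz zr => /(_ isT) /le_trans; apply.
    rewrite -mulrA ler_wpM2l// -{1}(powR_bvol_inv n0 tau0) -/r powRN invfM mulrA divff ?gt_eqF//.
    by rewrite mul1r.
  have A0 : 0 <= C2 * V n by rewrite mulr_ge0// ltW.
  have H2 := far_error n0 c mu (mT _ d0) p1 Q0 tau0 A0 uQ Tfar T0.
  have EE : (\int[leb]_z (\1_(sqn_ball rho) z * (`|u (z + c)%R - u c| * `|T d z|))%:E = E c)%E.
    have cL := SL _ Sc; rewrite /sqn_ball/= in cL.
    apply: eq_integral => z _; rewrite /v indicE mem_sqn_ball.
    have [zr|_] := ltP (sqn z) rho; last by rewrite !mul0r.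
    rewrite !mul1r.
    by have [-> ->] := restrict_sum_ball u cL zr.
  have KE : (\int[leb]_y (enorm (F y) * kernel_profile alpha (G d) (sqn (y - c)))%:E = kernel_average f k c)%E.
    by apply: eq_integral => y _; rewrite /k bvol_invK.
  rewrite EE in H2.
  have H3 := le_trans H (leeD leI H2); rewrite KE in H3.
  have uM : `|u c| <= `|u c| * `|M d| + del * `|u c|.
    rewrite (mulrC del) -mulrDr ler_peMr//.
    have := ler_normB 1 (1 - M d); rewrite opprB addrC subrK normr1 => h.
    have := ler_normD (M d) (1 - M d); rewrite addrC subrK normr1 => h2; lra.
  apply: (@le_trans _ _ ((`|u c| * `|M d|)%:E + (del * `|u c|)%:E)%E).
    by rewrite -EFinD lee_fin.
  rewrite (addeA D%:E) (addeA (kernel_average f k c)); exact: (leeD2r _ H3).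
have mKA : measurable_fun setT (kernel_average f k).
  exact: (measurable_kernel_average mf mk f0 k0).
have KA0 x : (0 <= kernel_average f k x)%E.
  by apply: integral_ge0 => y _; rewrite lee_fin; exact: (mulr_ge0 (f0 y) (k0 _)).
have mi : measurable_fun setT (\1_(sqn_ball rho) : 'rV[R]_n -> R).
  by apply: measurable_indic; exact: measurable_sqn_ball.
have mE : measurable_fun setT E.
  apply: (measurable_fun_fubini_tonelli_F (m2 := @lebesgue_rVs R n)
    (fun q : 'rV[R]_n * 'rV[R]_n => (\1_(sqn_ball rho) q.2 * (`|v (q.2 + q.1)%R - v q.1| * `|T d q.2|))%:E)).
    have m12 : measurable_fun setT (fun q : 'rV[R]_n * 'rV[R]_n => q.2 + q.1).
      apply: measurable_fun_rV => i; under eq_fun do rewrite mxE.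
      by apply: measurable_funD; apply: (measurableT_comp (measurable_coord_rV i)).
    apply/measurable_EFinP; apply: measurable_funM; first exact: (measurableT_comp mi).
    apply: measurable_funM; last by apply: measurableT_comp => //; exact: (measurableT_comp (mT _ d0)).
    apply: measurableT_comp => //; apply: measurable_funB; first exact: (measurableT_comp mv).
    exact: (measurableT_comp mv).
  by move=> q; rewrite lee_fin mulr_ge0// mulr_ge0.
have E0 x : (0 <= E x)%E by apply: integral_ge0 => z _; rewrite lee_fin mulr_ge0// mulr_ge0.
have mu' : measurable_fun S (fun x => `|u x|%:E).
  by apply/measurable_EFinP/measurable_funTS; exact: measurableT_comp.
have mdu : measurable_fun S (fun x => (del * `|u x|)%:E).
  by apply/measurable_EFinP/measurable_funTS; apply: measurable_funM => //; exact: measurableT_comp.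
apply: (@le_trans _ _ (\int[leb]_(x in S) (kernel_average f k x + (D%:E + (E x + (del * `|u x|)%:E))))%E).
  apply: ge0_le_integral => //.
  apply: emeasurable_funD; first exact: measurable_funTS.
  apply: emeasurable_funD => //; apply: emeasurable_funD => //; exact: measurable_funTS.
have du0 x : (0 <= (del * `|u x|)%:E)%E by rewrite lee_fin mulr_ge0// ltW.
have mEd : measurable_fun S (fun x => E x + (del * `|u x|)%:E)%E.
  by apply: emeasurable_funD => //; exact: measurable_funTS.
have Ed0 x : (0 <= E x + (del * `|u x|)%:E)%E by exact: adde_ge0.
have DEd0 x : (0 <= D%:E + (E x + (del * `|u x|)%:E))%E by apply: adde_ge0.
have mES : measurable_fun S E by exact: measurable_funTS.
have mKS : measurable_fun S (kernel_average f k) by exact: measurable_funTS.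
have mDEd : measurable_fun S (fun x => D%:E + (E x + (del * `|u x|)%:E))%E by exact: emeasurable_funD.
rewrite (ge0_integralD _ mS (fun x _ => KA0 x) mKS (fun x _ => DEd0 x) mDEd).
rewrite (ge0_integralD _ mS _ _ (fun x _ => Ed0 x) mEd)//.
rewrite (ge0_integralD _ mS (fun x _ => E0 x) mES (fun x _ => du0 x) mdu).
rewrite integral_cst// addeC; apply: leeD2r.
have E2 : (\int[leb]_(x in S) E x <= (eps / 2)%:E)%E.
  by apply: le_trans dE; apply: ge0_subset_integral.
have E3 : (\int[leb]_(x in S) (del * `|u x|)%:E <= (eps / 2)%:E)%E.
  under eq_integral => x _ do rewrite EFinM.
  by rewrite ge0_integralZl ?lee_fin ?(ltW del0)// N1E -EFinM lee_fin.
rewrite addeC; apply: leeD.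
  apply: (le_trans (leeD E2 E3)); rewrite -EFinD lee_fin; lra.
apply: lee_wpmul2r => //; rewrite lee_fin ler_wpM2r ?powR_ge0//.
by rewrite lerDr.
Qed.

End representation.

(** * The two-level inequality *)

Section hoelder_real.
Context d (T : measurableType d) (R : realType) (mu : {measure set T -> \bar R}).

Lemma hoelder_le (a b : T -> R) (p q A B : R) : measurable_fun setT a -> measurable_fun setT b ->
  (forall x, 0 <= a x) -> (forall x, 0 <= b x) -> 0 < p -> 0 < q -> p^-1 + q^-1 = 1 ->
  (\int[mu]_x (a x `^ p)%:E <= A%:E)%E -> (\int[mu]_x (b x `^ q)%:E <= B%:E)%E ->
  (\int[mu]_x (a x * b x)%:E <= (A `^ p^-1 * B `^ q^-1)%:E)%E.
Proof.
move=> ma mb a0 b0 p0 q0 pq aA bB.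
have N r (f : T -> R) D : 0 < r -> (forall x, 0 <= f x) -> (\int[mu]_x (f x `^ r)%:E <= D%:E)%E ->
    ('N[mu]_r%:E[EFin \o f] <= (D `^ r^-1)%:E)%E.
  move=> r0 f0 fD; rewrite unlock -poweR_EFin.
  have I0 : (0 <= \int[mu]_x (f x `^ r)%:E)%E by apply: integral_ge0 => x _; rewrite lee_fin powR_ge0.
  have -> : (\int[mu]_x (`|(EFin \o f) x| `^ r) = \int[mu]_x (f x `^ r)%:E)%E.
    by apply: eq_integral => x _; rewrite /= ger0_norm.
  apply: gt0_ler_poweR; rewrite ?invr_ge0 ?(ltW r0)// in_itv/= leey andbT//.
  exact: le_trans I0 fD.
have := hoelder mu ma mb p0 q0 pq; rewrite Lnorm1 => H.
have -> : (\int[mu]_x (a x * b x)%:E = \int[mu]_x `|(EFin \o (a \* b)%R) x|)%E.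
  by apply: eq_integral => x _; rewrite /= ger0_norm// mulr_ge0.
apply: (le_trans H); rewrite EFinM; apply: lee_pmul; rewrite ?Lnorm_ge0//; exact: N.
Qed.

End hoelder_real.

(** * Mass and weighted q'-energy of one kernel *)

Section kernel_estimates.
Context {R : realType}.
Variables (n alpha : nat).
Hypotheses (alpha_gt0 : (0 < alpha)%N) (alpha_lt_n : (alpha < n)%N).
Notation leb := (@lebesgue_rV R n).
Notation leb1 := (@lebesgue_measure R).
Notation gam := (@gamma_const R n alpha).
Notation iq := (alpha%:R / n%:R : R).
Notation iq' := ((n%:R - alpha%:R) / n%:R : R).
Notation q := (n%:R / alpha%:R : R).
Notation q' := (n%:R / (n%:R - alpha%:R) : R).

Let n0 : (0 < n)%N. Proof. exact: leq_trans alpha_lt_n. Qed.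
Let n0' : (0 : R) < n%:R. Proof. by rewrite ltr0n. Qed.
Let al0 : (0 : R) < alpha%:R. Proof. by rewrite ltr0n. Qed.
Let na0 : (0 : R) < n%:R - alpha%:R. Proof. by rewrite subr_gt0 ltr_nat. Qed.
Let iq0 : 0 < iq. Proof. by rewrite divr_gt0. Qed.
Let iq'0 : 0 < iq'. Proof. by rewrite divr_gt0. Qed.
Let q0 : 0 < q. Proof. by rewrite divr_gt0. Qed.
Let q'0 : 0 < q'. Proof. by rewrite divr_gt0. Qed.
Let iqB : iq - 1 = - iq'. Proof. by field; rewrite gt_eqF. Qed.
Let g0 : 0 < gam := gamma_const_gt0 alpha_gt0 alpha_lt_n.

Lemma integral_bvol_shift (g : R -> R) (x : 'rV[R]_n) : measurable_fun setT g ->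
  (forall t, 0 <= g t) ->
  (\int[leb]_y (g (bvol (y - x)))%:E = \int[leb1]_(t in `]0%R, +oo[) (g t)%:E)%E.
Proof.
move=> mg gg; transitivity (\int[leb]_y (g (bvol y))%:E)%E; last first.
  by apply: (@integral_bvol R n (EFin \o g)) => //; exact/measurable_EFinP.
apply: (integral_translate (f := fun y => (g (bvol y))%:E) (- x)).
  by apply/measurable_EFinP; apply: (measurableT_comp mg); exact: measurable_bvol.
by move=> y; rewrite lee_fin.
Qed.

Lemma measurable_bvol_shift (x : 'rV[R]_n) : measurable_fun setT (fun y : 'rV[R]_n => bvol (y - x)).
Proof. by apply: measurable_translate; exact: measurable_bvol. Qed.

Lemma integral_bvol_indic (tau : R) (x : 'rV[R]_n) : 0 < tau ->
  (\int[leb]_y (\1_(`]-oo, tau[%classic) (bvol (y - x)) : R)%:E = tau%:E)%E.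
Proof.
move=> tau0; rewrite (integral_bvol_shift (g := \1_(`]-oo, tau[%classic)))//.
rewrite integral_indic//.
have -> : `]-oo, tau[%classic `&` `]0, +oo[%classic = `]0, tau[%classic :> set R.
  by apply/seteqP; split => t /=; rewrite !in_itv/= andbT; [case=> -> ->|case/andP => -> ->].
have := @lebesgue_measure_itv R `]0, tau[; rewrite /= lte_fin tau0 sube0; exact.
Qed.

Lemma integral_inv_itv (th rho : R) : 0 < th ->
  (\int[leb1]_(t in `[th, rho[) (t `^ (-1))%:E = (Num.max 0 (ln (rho / th)))%:E)%E.
Proof.
move=> th0; have [tr|rt] := ltP th rho; last first.
  rewrite set_itv_ge ?integral_set0 -?leNgt ?bnd_simp//; congr EFin.
  by rewrite (max_idPl _)// ln_le0// ler_pdivrMr// mul1r.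
have r0 := lt_trans th0 tr.
rewrite (max_idPr _); last by rewrite ln_ge0// ler_pdivlMr// mul1r ltW.
rewrite integral_itv_bndo_bndc; last by apply: measurable_funTS; apply/measurable_EFinP.
rewrite (@continuous_FTC2 _ (fun t : R => t `^ (-1)) (@ln R))//.
- by rewrite ln_div ?posrE// EFinB.
- apply: derivable_within_continuous => x; rewrite in_itv/= => /andP[h _].
  by apply: derivable_powR; rewrite in_itv/= (lt_le_trans _ h).
- split.
  + by move=> x; rewrite in_itv/= => /andP[h _]; have [] := is_derive1_ln (lt_trans th0 h).
  + by apply/cvg_at_right_filter/(derive_continuous (is_derive1_ln th0)).
  + by apply/cvg_at_left_filter/(derive_continuous (is_derive1_ln r0)).
- move=> x; rewrite in_itv/= => /andP[h _]; have x0 := lt_trans th0 h.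
  by rewrite derive1E; have [_ ->] := is_derive1_ln x0; rewrite powR_inv1// ltW.
Qed.

Section one_kernel.
Variables (tau C : R) (k : R -> R).
Hypotheses (tau0 : 0 < tau) (C0 : 0 <= C) (kk : kernel_class n alpha tau C k).

Let mk : measurable_fun setT k. Proof. by case: kk. Qed.
Let k0 t : 0 <= k t. Proof. by case: kk. Qed.
Let kv t : tau <= t -> k t = 0. Proof. by case: kk => _ _ _ _; apply. Qed.

Lemma kernel_le_powR t : 0 < t -> k t <= (gam `^ (- iq') + C) * t `^ (- iq').
Proof.
move=> t0; have [tt|tt] := leP tau t; first by rewrite kv// mulr_ge0 ?powR_ge0// addr_ge0 ?powR_ge0.
have [h|h] := ltP t (half_ratio n * tau).
  have [_ _ kn _ _] := kk; apply: (le_trans (kn _ t0 h)).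
  rewrite powRM ?(ltW g0) ?(ltW t0)// ler_wpM2r ?powR_ge0//.
  by rewrite lerDl.
have [_ _ _ kf _] := kk; apply: (le_trans (kf _ h)).
apply: ler_pM; rewrite ?powR_ge0//; first by rewrite lerDr powR_ge0.
rewrite !powRN lef_pV2 ?posrE ?powR_gt0//.
by apply: ge0_ler_powR; rewrite ?nnegrE ?ltW.
Qed.

Lemma near_mass th x : 0 < th ->
  (\int[leb]_y (k (bvol (y - x)) * \1_(`]-oo, th[%classic) (bvol (y - x)))%:E <=
   ((gam `^ (- iq') + C) / iq * th `^ iq)%:E)%E.
Proof.
move=> th0; have mi : measurable_fun setT (\1_(`]-oo, th[%classic) : R -> R) by exact: measurable_indic.
rewrite (integral_bvol_shift (g := fun t => k t * \1_(`]-oo, th[%classic) t)); last 2 first.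
- exact: measurable_funM.
- by move=> t; rewrite mulr_ge0.
have K0 : 0 <= gam `^ (- iq') + C by rewrite addr_ge0 ?powR_ge0.
apply: (@le_trans _ _ (\int[leb1]_(t in `]0%R, th[) ((gam `^ (- iq') + C)%:E * (t `^ (iq - 1))%:E))%E).
  rewrite (_ : (\int[leb1]_(t in _) _)%E = \int[leb1]_(t in `]0%R, th[) (k t)%:E)%E; last first.
    rewrite integral_mkcond [RHS]integral_mkcond; apply: eq_integral => t _.
    rewrite !patchE !mem_setE !in_itv/= andbT indicE mem_setE in_itv/=.
    by case: (ltP 0 t) => //= t0; case: ltP => tth; rewrite ?mulr1 ?mulr0.
  apply: ge0_le_integral => //.
  - by move=> t _; rewrite lee_fin.
  - by apply: measurable_funTS; exact/measurable_EFinP.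
  - by apply: measurable_funTS; apply/measurable_EFinP; apply: measurable_funM.
  move=> t; rewrite /= in_itv/= => /andP[t0 _].
  rewrite -EFinM lee_fin iqB.
  exact: kernel_le_powR.
rewrite ge0_integralZl//; last 2 first.
- by apply: measurable_funTS; apply/measurable_EFinP.
- by move=> t _; rewrite lee_fin powR_ge0.
rewrite integral_powR_itv0// -EFinM lee_fin.
by rewrite mulrAC mulrA.
Qed.

(** On volumes in [th, rho[ the bound 1/(gamma t) integrates to the logarithm. On larger volumes it
    is at most 1/(gamma rho) and the weight has mass at most rho; the zone of the cut-off adds C^q'.
    The coefficient of the logarithm is thus exactly 1/gamma. *)
Lemma far_weight (w : 'rV[R]_n -> R) th rho x : measurable_fun setT w -> (forall y, 0 <= w y <= 1) ->
  0 < th -> 0 < rho ->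
  (\int[leb]_y (w y * \1_(`]-oo, tau[%classic) (bvol (y - x)))%:E <= rho%:E)%E ->
  (\int[leb]_y (w y * (k (bvol (y - x)) * \1_(`[th, +oo[%classic) (bvol (y - x))) `^ q')%:E <=
   (Num.max 0 (ln (rho / th)) / gam + (gam^-1 + C `^ q'))%:E)%E.
Proof.
move=> mw w01 th0 rho0 wrho.
pose it : R -> R := \1_(`[th, rho[%classic).
pose i1 : R -> R := \1_(`]-oo, tau[%classic).
have mit : measurable_fun setT it by exact: measurable_indic.
have mi1 : measurable_fun setT i1 by exact: measurable_indic.
pose g (t : R) := gam^-1 * (t `^ (-1) * it t).
pose c := (gam * rho)^-1 + C `^ q' / tau.
have c0 : 0 <= c by rewrite addr_ge0 ?divr_ge0 ?powR_ge0 ?invr_ge0 ?(ltW tau0)// mulr_ge0 ?ltW.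
have mg : measurable_fun setT g.
  by apply: measurable_funM => //; apply: measurable_funM.
have gg t : 0 <= g t.
  by rewrite /g mulr_ge0 ?invr_ge0 ?(ltW g0)// mulr_ge0// powR_ge0.
have ptw t : 0 <= t -> (k t * \1_(`[th, +oo[%classic) t) `^ q' <= g t + c * i1 t.
  move=> t0; rewrite indicE mem_setE in_itv/= andbT; have [tht|tth] := leP th t; last first.
    rewrite mulr0 powR0 ?gt_eqF//; apply: addr_ge0 => //; exact: mulr_ge0.
  have t0' : 0 < t by exact: lt_le_trans tht.
  rewrite mulr1; have [tt|tt] := leP tau t.
    rewrite kv// powR0 ?gt_eqF//; apply: addr_ge0 => //; exact: mulr_ge0.
  rewrite [i1 t]indicE mem_setE in_itv/= tt mulr1.
  have [h|h] := ltP t (half_ratio n * tau).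
    have [_ _ kn _ _] := kk; have kt := kn _ t0' h.
    have kt' : k t `^ q' <= (gam * t)^-1.
      apply: (@le_trans _ _ (((gam * t) `^ (- iq')) `^ q')).
        by apply: ge0_ler_powR; rewrite ?nnegrE ?powR_ge0// ltW.
      rewrite -powRrM (_ : - iq' * q' = -1); last by field; rewrite !gt_eqF.
      by rewrite powRN powRr1// mulr_ge0// ltW.
    rewrite /g /it indicE mem_setE in_itv/= tht/=; have [tr|rt] := ltP t rho.
      rewrite mulr1 powR_inv1// -invfM; apply: (le_trans kt').
      by rewrite lerDl.
    rewrite !mulr0 add0r /c; apply: (le_trans kt').
    apply: (@le_trans _ _ (gam * rho)^-1); last by rewrite lerDl divr_ge0 ?powR_ge0 ?ltW.
    rewrite lef_pV2 ?posrE; first by rewrite ler_pM2l.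
    - exact: mulr_gt0.
    - exact: mulr_gt0.
  have [_ _ _ kf _] := kk; have kt := kf _ h.
  apply: (@le_trans _ _ ((C * tau `^ (- iq')) `^ q')).
    by apply: (ge0_ler_powR (ltW q'0)) => //; rewrite ?nnegrE// mulr_ge0// powR_ge0.
  rewrite powRM ?powR_ge0// -powRrM (_ : - iq' * q' = -1); last by field; rewrite !gt_eqF.
  rewrite powRN powRr1 ?(ltW tau0)// /c addrA lerDr addr_ge0//.
  by rewrite invr_ge0 mulr_ge0// ltW.
have mb := measurable_bvol_shift x.
have mwi : measurable_fun setT (fun y : 'rV[R]_n => (w y * i1 (bvol (y - x)))%:E).
  by apply/measurable_EFinP; apply: measurable_funM => //; exact: (measurableT_comp mi1).
have mgb : measurable_fun setT (fun y : 'rV[R]_n => (g (bvol (y - x)))%:E).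
  by apply/measurable_EFinP; exact: (measurableT_comp mg).
have w0 y : 0 <= w y by case/andP: (w01 y).
have w1 y : w y <= 1 by case/andP: (w01 y).
apply: (@le_trans _ _ (\int[leb]_y ((g (bvol (y - x)))%:E + c%:E * (w y * i1 (bvol (y - x)))%:E))%E).
  apply: ge0_le_integral => //.
  - by move=> y _; rewrite lee_fin mulr_ge0// powR_ge0.
  - apply/measurable_EFinP; apply: measurable_funM => //.
    apply: (measurableT_comp (measurable_powR _)); apply: measurable_funM.
      exact: (measurableT_comp mk).
    by apply: (measurableT_comp _ mb); exact: measurable_indic.
  - by apply: emeasurable_funD => //; exact: measurable_funeM.
  move=> y _; rewrite -EFinM -EFinD lee_fin.
  apply: (le_trans (ler_wpM2l (w0 y) (ptw _ (bvol_ge0 _)))).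
  rewrite mulrDr; apply: lerD; last by rewrite mulrCA.
  by rewrite -[leRHS]mul1r ler_wpM2r.
have gb0 y : (0 <= (g (bvol (y - x)))%:E)%E by rewrite lee_fin.
have wb0 y : (0 <= (w y * i1 (bvol (y - x)))%:E)%E by rewrite lee_fin mulr_ge0.
have cw0 y : (0 <= c%:E * (w y * i1 (bvol (y - x)))%:E)%E by apply: mule_ge0.
rewrite (ge0_integralD _ _ (fun y _ => gb0 y) mgb (fun y _ => cw0 y) (measurable_funeM _ mwi))//.
rewrite (ge0_integralZl _ _ mwi (fun y _ => wb0 y))//.
have A1 : (\int[leb]_y (g (bvol (y - x)))%:E <= (Num.max 0 (ln (rho / th)) / gam)%:E)%E.
  rewrite integral_bvol_shift//.
  apply: (@le_trans _ _ ((gam^-1)%:E * \int[leb1]_(t in `[th, rho[) (t `^ (-1))%:E)%E).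
    have mI : measurable_fun `[th, rho[ (fun t : R => (t `^ (-1))%:E).
      by apply: measurable_funTS; apply/measurable_EFinP.
    have nI t : `[th, rho[%classic t -> (0 <= (t `^ (-1) : R)%:E)%E by rewrite lee_fin powR_ge0.
    have gV0 : (0 <= (gam^-1)%:E)%E by rewrite lee_fin invr_ge0 ltW.
    rewrite -(ge0_integralZl leb1 _ mI nI gV0)//.
    suff -> : (\int[leb1]_(t in `]0%R, +oo[) (g t)%:E =
        \int[leb1]_(t in `[th, rho[) ((gam^-1)%:E * (t `^ (-1))%:E))%E by [].
    rewrite integral_mkcond [RHS]integral_mkcond; apply: eq_integral => t _.
    rewrite !patchE !mem_setE !in_itv/= andbT /g /it indicE mem_setE in_itv/=.
    have [tht|_] /= := leP th t; last by rewrite !mulr0; case: ifP.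
    by rewrite (lt_le_trans th0 tht); case: ifP; rewrite ?mulr0 ?mulr1.
  by rewrite integral_inv_itv// -EFinM mulrC.
have J1 : (\int[leb]_y (w y * i1 (bvol (y - x)))%:E <= tau%:E)%E.
  apply: (@le_trans _ _ (\int[leb]_y (i1 (bvol (y - x)))%:E)%E).
    apply: ge0_le_integral => //.
    - by apply/measurable_EFinP; exact: (measurableT_comp mi1).
    - by move=> y _; rewrite lee_fin -[leRHS]mul1r ler_wpM2r.
  by rewrite integral_bvol_indic.
have J0 : (0 <= \int[leb]_y (w y * i1 (bvol (y - x)))%:E)%E.
  by apply: integral_ge0 => y _; rewrite lee_fin mulr_ge0.
have Jf : (\int[leb]_y (w y * i1 (bvol (y - x)))%:E)%E \is a fin_num.
  by rewrite ge0_fin_numE// (le_lt_trans J1)// ltry.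
move: J1 J0 wrho; rewrite -/i1 -(fineK Jf) -EFinM !lee_fin; move: (fine _) => J J1 J0 J2.
have A2 := lexx (c%:E * J%:E)%E.
apply: (le_trans (leeD A1 A2)); rewrite -EFinD lee_fin lerD2l.
rewrite /c mulrDl; apply: lerD.
  rewrite -[leRHS]mulr1 invfM -mulrA ler_wpM2l ?invr_ge0 ?(ltW g0)//.
  by rewrite mulrC ler_pdivrMr// mul1r.
rewrite -mulrA -[leRHS]mulr1 ler_wpM2l ?powR_ge0// mulrC.
by rewrite ler_pdivrMr// mul1r.
Qed.

End one_kernel.
End kernel_estimates.

Section level_estimate.
Context {R : realType}.
Variables (n alpha : nat).
Hypotheses (alpha_gt0 : (0 < alpha)%N) (alpha_lt_n : (alpha < n)%N).
Notation leb := (@lebesgue_rV R n).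
Notation gam := (@gamma_const R n alpha).
Notation iq := (alpha%:R / n%:R : R).
Notation iq' := ((n%:R - alpha%:R) / n%:R : R).
Notation q := (n%:R / alpha%:R : R).
Notation q' := (n%:R / (n%:R - alpha%:R) : R).

Let n0 : (0 < n)%N. Proof. exact: leq_trans alpha_lt_n. Qed.
Let n0' : (0 : R) < n%:R. Proof. by rewrite ltr0n. Qed.
Let al0 : (0 : R) < alpha%:R. Proof. by rewrite ltr0n. Qed.
Let na0 : (0 : R) < n%:R - alpha%:R. Proof. by rewrite subr_gt0 ltr_nat. Qed.
Let iq0 : 0 < iq. Proof. by rewrite divr_gt0. Qed.
Let iq'0 : 0 < iq'. Proof. by rewrite divr_gt0. Qed.
Let q0 : 0 < q. Proof. by rewrite divr_gt0. Qed.
Let q1 : 1 <= q. Proof. by rewrite ler_pdivlMr// mul1r ler_nat ltnW. Qed.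
Let q'0 : 0 < q'. Proof. by rewrite divr_gt0. Qed.
Let qE : q^-1 = iq. Proof. by rewrite invf_div. Qed.
Let q'E : q'^-1 = iq'. Proof. by rewrite invf_div. Qed.
Let iqD : iq + iq' = 1. Proof. by field; rewrite gt_eqF. Qed.
Let g0 : 0 < gam := gamma_const_gt0 alpha_gt0 alpha_lt_n.

(* [w] selects a part of measure [sigma] where [f] is largest *)
Definition top_weight (f w : 'rV[R]_n -> R) (sigma e : R) :=
  [/\ measurable_fun setT w, forall y, 0 <= w y <= 1,
      (\int[leb]_y (w y)%:E <= sigma%:E)%E,
      (\int[leb]_y (w y * f y `^ q)%:E <= (e `^ q)%:E)%E /\
      (\int[leb]_y ((1 - w y) * f y `^ q)%:E <= (1 - e `^ q)%:E)%E
    & forall y, (1 - w y) * f y <= 2 * e * sigma `^ (- iq)].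

(** Writing w = w^(1/q) w^(1/q') measures both the energy and the kernel on the part selected by
    w. *)
Lemma hoelder_weight (w f h : 'rV[R]_n -> R) (A B : R) :
  measurable_fun setT w -> measurable_fun setT f -> measurable_fun setT h ->
  (forall y, 0 <= w y) -> (forall y, 0 <= f y) -> (forall y, 0 <= h y) ->
  (\int[leb]_y (w y * f y `^ q)%:E <= A%:E)%E ->
  (\int[leb]_y (w y * h y `^ q')%:E <= B%:E)%E ->
  (\int[leb]_y (w y * f y * h y)%:E <= (A `^ iq * B `^ iq')%:E)%E.
Proof.
move=> mw mf mh w0 f0 h0 fA hB.
have mp (r : R) (g : 'rV[R]_n -> R) : measurable_fun setT g -> measurable_fun setT (fun y => w y `^ r * g y).
  by move=> mg; apply: measurable_funM => //; exact: (measurableT_comp (measurable_powR r)).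
have E (r r' : R) (g : R) y : r * r' = 1 -> 0 <= g -> (w y `^ r * g) `^ r' = w y * g `^ r'.
  by move=> rr g00; rewrite powRM ?powR_ge0// -powRrM rr powRr1.
have := @hoelder_le _ _ _ leb (fun y => w y `^ iq * f y) (fun y => w y `^ iq' * h y) q q' A B
  (mp _ _ mf) (mp _ _ mh).
rewrite qE q'E => H.
have -> : (\int[leb]_y (w y * f y * h y)%:E = \int[leb]_y ((w y `^ iq * f y) * (w y `^ iq' * h y))%:E)%E.
  apply: eq_integral => y _; congr EFin.
  rewrite mulrACA -powRD; last by rewrite iqD oner_eq0.
  by rewrite iqD powRr1 ?mulrA.
apply: H => //.
- by move=> y; rewrite mulr_ge0 ?powR_ge0.
- by move=> y; rewrite mulr_ge0 ?powR_ge0.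
- apply: le_trans fA; rewrite le_eqVlt; apply/orP; left; apply/eqP; apply: eq_integral => y _.
  by rewrite E//; field; rewrite !gt_eqF.
- apply: le_trans hB; rewrite le_eqVlt; apply/orP; left; apply/eqP; apply: eq_integral => y _.
  by rewrite E//; field; rewrite !gt_eqF.
Qed.

(** Close to x the q'-energy of the kernel diverges logarithmically, so Hoelder's inequality fails
    pointwise. Truncating f at level l and exchanging the integrals in the average over S needs only
    the mass D of the kernel. *)
Lemma near_part (w f k : 'rV[R]_n -> R) (k1 : R -> R) (s D l e : R) (S : set 'rV[R]_n) :
  measurable_fun setT w -> (forall y, 0 <= w y <= 1) -> measurable_fun setT f -> (forall y, 0 <= f y) ->
  measurable_fun setT k1 -> (forall t, 0 <= k1 t) -> measurable S -> (leb S <= s%:E)%E ->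
  0 <= D -> (forall x, (\int[leb]_y (k1 (bvol (y - x)))%:E <= D%:E)%E) -> 0 < l ->
  (\int[leb]_y (w y * f y `^ q)%:E <= (e `^ q)%:E)%E ->
  (\int[leb]_(x in S) kernel_average (fun y => (w y * f y)%R) k1 x <=
   (D * (l * s + l `^ (1 - q) * e `^ q))%:E)%E.
Proof.
move=> mw w01 mf f0 mk1 k10 mS Ss D0 kD l0 we.
have w0 y : 0 <= w y by case/andP: (w01 y).
have w1 y : w y <= 1 by case/andP: (w01 y).
have mwf : measurable_fun setT (fun y => w y * f y `^ q).
  by apply: measurable_funM => //; exact: (measurableT_comp (measurable_powR q)).
have wf0 y : 0 <= w y * f y `^ q by rewrite mulr_ge0 ?powR_ge0.
have l10 : 0 <= l `^ (1 - q) by exact: powR_ge0.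
have mk2 x : measurable_fun setT (fun y : 'rV[R]_n => k1 (bvol (y - x))).
  exact: (measurableT_comp mk1 (measurable_bvol_shift x)).
pose N1 x := kernel_average (fun y => w y * f y `^ q) k1 x.
have mN1 : measurable_fun setT N1 by exact: measurable_kernel_average.
have N10 x : (0 <= N1 x)%E by apply: integral_ge0 => y _; rewrite lee_fin mulr_ge0.
have step x : (kernel_average (fun y => w y * f y)%R k1 x <= (l * D)%:E + (l `^ (1 - q))%:E * N1 x)%E.
  apply: (@le_trans _ _ (\int[leb]_y (l%:E * (k1 (bvol (y - x)))%:E +
      (l `^ (1 - q))%:E * (w y * f y `^ q * k1 (bvol (y - x)))%:E))%E).
    apply: ge0_le_integral => //.
    - by move=> y _; rewrite lee_fin !mulr_ge0.
    - apply/measurable_EFinP; apply: measurable_funM => //; exact: measurable_funM.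
    - apply: emeasurable_funD; apply: measurable_funeM; apply/measurable_EFinP => //.
      exact: measurable_funM.
    move=> y _; rewrite -!EFinM -EFinD lee_fin mulrA -mulrDl ler_wpM2r//.
    apply: (le_trans (ler_wpM2l (w0 y) (le_threshold q1 l0 (f0 y)))).
    rewrite mulrDr; apply: lerD; first by rewrite ler_piMl// ltW.
    by rewrite mulrCA.
  have mA : measurable_fun setT (fun y : 'rV[R]_n => (k1 (bvol (y - x)))%:E) by exact/measurable_EFinP.
  have mB : measurable_fun setT (fun y : 'rV[R]_n => (w y * f y `^ q * k1 (bvol (y - x)))%:E).
    by apply/measurable_EFinP; exact: measurable_funM.
  have A0 y : (0 <= (k1 (bvol (y - x)))%:E)%E by rewrite lee_fin.
  have B0 y : (0 <= (w y * f y `^ q * k1 (bvol (y - x)))%:E)%E by rewrite lee_fin mulr_ge0.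
  have lE0 : (0 <= l%:E)%E by rewrite lee_fin ltW.
  rewrite (ge0_integralD leb _ (fun y _ => mule_ge0 lE0 (A0 y)) (measurable_funeM _ mA)
    (fun y _ => mule_ge0 _ (B0 y)) (measurable_funeM _ mB))//.
  rewrite (ge0_integralZl leb _ mA (fun y _ => A0 y) lE0)//.
  rewrite (ge0_integralZl leb _ mB (fun y _ => B0 y))//.
  by apply: leeD => //; rewrite EFinM; exact: lee_wpmul2l.
apply: (@le_trans _ _ (\int[leb]_(x in S) ((l * D)%:E + (l `^ (1 - q))%:E * N1 x))%E).
  apply: ge0_le_integral => //.
  - by move=> x _; apply: integral_ge0 => y _; rewrite lee_fin !mulr_ge0.
  - apply: measurable_funTS; apply: measurable_kernel_average => //; first exact: measurable_funM.
    by move=> y; rewrite mulr_ge0.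
  - by apply: measurable_funTS; apply: emeasurable_funD => //; exact: measurable_funeM.
have lD0 : (0 <= (l * D)%:E)%E by rewrite lee_fin mulr_ge0// ltW.
have mN1S : measurable_fun S N1 by exact: measurable_funTS.
have lN0 x : (0 <= (l `^ (1 - q))%:E * N1 x)%E by exact: mule_ge0.
rewrite (ge0_integralD leb mS (fun x _ => lD0) _ (fun x _ => lN0 x) (measurable_funeM _ mN1S))//.
rewrite integral_cst// (ge0_integralZl leb mS mN1S (fun x _ => N10 x))//.
have N1D : (\int[leb]_(x in S) N1 x <= (D * e `^ q)%:E)%E.
  apply: (@le_trans _ _ (\int[leb]_x N1 x)%E); first exact: ge0_subset_integral.
  rewrite /N1 /kernel_average.
  rewrite (tonelli_rV (f := fun p : 'rV[R]_n * 'rV[R]_n => (w p.2 * f p.2 `^ q * k1 (bvol (p.2 - p.1)))%:E)); last 2 first.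
  - exact: (measurable_kernel_pair mwf mk1).
  - by move=> p; rewrite lee_fin mulr_ge0.
  have mW : measurable_fun setT (fun y => (w y * f y `^ q)%:E) by exact/measurable_EFinP.
  have W0 y : (0 <= (w y * f y `^ q)%:E)%E by rewrite lee_fin.
  have DE0 : (0 <= D%:E)%E by rewrite lee_fin.
  rewrite /=; apply: (@le_trans _ _ (\int[leb]_y (D%:E * (w y * f y `^ q)%:E))%E).
    have I0 y : (0 <= \int[leb]_x (w y * f y `^ q * k1 (bvol (y - x)))%:E)%E.
      by apply: integral_ge0 => x _; rewrite lee_fin mulr_ge0.
    have mI : measurable_fun setT (fun y => \int[leb]_x (w y * f y `^ q * k1 (bvol (y - x)))%:E)%E.
      apply: (measurable_fun_fubini_tonelli_F (m2 := @lebesgue_rVs R n)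
        (fun p : 'rV[R]_n * 'rV[R]_n => (w p.1 * f p.1 `^ q * k1 (bvol (p.1 - p.2)))%:E)).
        apply/measurable_EFinP; apply: measurable_funM; first exact: (measurableT_comp mwf).
        apply: (measurableT_comp mk1); apply: (measurableT_comp (@measurable_bvol R n)).
        apply: measurable_fun_rV => i; under eq_fun do rewrite !mxE.
        by apply: measurable_funB; apply: (measurableT_comp (measurable_coord_rV i)).
      by move=> p; rewrite lee_fin mulr_ge0.
    apply: ge0_le_integral; [by []|by move=> y _; exact: I0|exact: mI|exact: measurable_funeM|].
    move=> y _ /=.
    have -> : (\int[leb]_x (w y * f y `^ q * k1 (bvol (y - x)))%:E =
        (w y * f y `^ q)%:E * \int[leb]_x (k1 (bvol (x - y)))%:E)%E.
      have mky : measurable_fun setT (fun x : 'rV[R]_n => (k1 (bvol (x - y)))%:E).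
        by apply/measurable_EFinP; exact: mk2.
      have ky0 x : (0 <= (k1 (bvol (x - y)))%:E)%E by rewrite lee_fin.
      rewrite -(ge0_integralZl leb measurableT mky (fun x _ => ky0 x) (W0 y)).
      by apply: eq_integral => x _; rewrite -EFinM /bvol -(sqnN (y - x)) opprB.
    rewrite muleC; exact: lee_wpmul2r.
  rewrite (ge0_integralZl leb _ mW (fun y _ => W0 y) DE0)// EFinM.
  exact: lee_wpmul2l.
rewrite mulrDr EFinD; apply: leeD.
  by rewrite mulrCA mulrA [in leRHS]EFinM; exact: lee_wpmul2l.
by rewrite mulrCA EFinM; apply: lee_wpmul2l.
Qed.

End level_estimate.

Section level_bound.
Context {R : realType}.
Variables (n alpha : nat).
Hypotheses (alpha_gt0 : (0 < alpha)%N) (alpha_lt_n : (alpha < n)%N).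
Notation leb := (@lebesgue_rV R n).
Notation gam := (@gamma_const R n alpha).
Notation iq := (alpha%:R / n%:R : R).
Notation iq' := ((n%:R - alpha%:R) / n%:R : R).
Notation q := (n%:R / alpha%:R : R).
Notation q' := (n%:R / (n%:R - alpha%:R) : R).

Let n0 : (0 < n)%N. Proof. exact: leq_trans alpha_lt_n. Qed.
Let n0' : (0 : R) < n%:R. Proof. by rewrite ltr0n. Qed.
Let al0 : (0 : R) < alpha%:R. Proof. by rewrite ltr0n. Qed.
Let na0 : (0 : R) < n%:R - alpha%:R. Proof. by rewrite subr_gt0 ltr_nat. Qed.
Let iq0 : 0 < iq. Proof. by rewrite divr_gt0. Qed.
Let iq'0 : 0 < iq'. Proof. by rewrite divr_gt0. Qed.
Let q0 : 0 < q. Proof. by rewrite divr_gt0. Qed.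
Let q1 : 1 <= q. Proof. by rewrite ler_pdivlMr// mul1r ler_nat ltnW. Qed.
Let q'0 : 0 < q'. Proof. by rewrite divr_gt0. Qed.
Let g0 : 0 < gam := gamma_const_gt0 alpha_gt0 alpha_lt_n.

(** A superlevel set of measure exactly sigma may not exist, so the indicators of {f > M} and {f >
    M/2}, of measures at most and above sigma, are mixed. The weight lives where f > M/2, hence e^q
    >= (M/2)^q sigma: this is the factor 2 in [top_weight]. *)
Lemma exists_top_weight (f : 'rV[R]_n -> R) (sigma : R) : measurable_fun setT f ->
  (forall y, 0 <= f y) -> (\int[leb]_y (f y `^ q)%:E <= 1%:E)%E -> 0 < sigma ->
  exists w e, 0 <= e <= 1 /\ top_weight alpha f w sigma e.
Proof.
move=> mf f0 f1 s0.
pose A (M : R) : set 'rV[R]_n := [set y | M < f y].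
have mA M : measurable (A M).
  rewrite (_ : A M = f @^-1` `]M, +oo[%classic).
    by rewrite -[X in measurable X]setTI; exact: mf.
  by apply/seteqP; split => y; rewrite /A/= in_itv/= andbT.
have mi M : measurable_fun setT (\1_(A M) : 'rV[R]_n -> R) by exact: measurable_indic.
have indA (M : R) (y : 'rV[R]_n) : (\1_(A M) y : R) = (M < f y)%R%:R.
  by rewrite indicE (mem_setb (fun y => M < f y)).
have II M : (\int[leb]_y (\1_(A M) y : R)%:E = leb (A M))%E by rewrite integral_indic// setIT.
have mfq : measurable_fun setT (fun y => f y `^ q) by exact: (measurableT_comp (measurable_powR q)).
(* it suffices to find a weight whose energy controls the level M *)
suff [w [mw w01 Iw [M [M0 wM Mw]]]] : exists w : 'rV[R]_n -> R, [/\ measurable_fun setT w,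
    forall y, 0 <= w y <= 1, (\int[leb]_y (w y)%:E <= sigma%:E)%E &
    exists M : R, [/\ 0 <= M, forall y, (1 - w y) * f y <= M &
      (((M / 2) `^ q * sigma)%:E <= \int[leb]_y (w y * f y `^ q)%:E)%E]].
  have w0 y : 0 <= w y by case/andP: (w01 y).
  have w1 y : 0 <= 1 - w y by rewrite subr_ge0; case/andP: (w01 y).
  have mwf : measurable_fun setT (fun y => (w y * f y `^ q)%:E).
    by apply/measurable_EFinP; exact: measurable_funM.
  have mwf1 : measurable_fun setT (fun y => ((1 - w y) * f y `^ q)%:E).
    by apply/measurable_EFinP; apply: measurable_funM => //; exact: measurable_funB.
  have a0 y : (0 <= (w y * f y `^ q)%:E)%E by rewrite lee_fin mulr_ge0 ?powR_ge0.
  have b0 y : (0 <= ((1 - w y) * f y `^ q)%:E)%E by rewrite lee_fin mulr_ge0 ?powR_ge0.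
  have sumE : (\int[leb]_y (w y * f y `^ q)%:E + \int[leb]_y ((1 - w y) * f y `^ q)%:E <= 1%:E)%E.
    apply: le_trans f1; rewrite -(ge0_integralD leb measurableT (fun y _ => a0 y) mwf (fun y _ => b0 y) mwf1).
    rewrite le_eqVlt; apply/orP; left; apply/eqP; apply: eq_integral => y _.
    by rewrite -EFinD; congr EFin; ring.
  have I0 : (0 <= \int[leb]_y (w y * f y `^ q)%:E)%E by apply: integral_ge0.
  have I1 : (0 <= \int[leb]_y ((1 - w y) * f y `^ q)%:E)%E by apply: integral_ge0.
  have Ile : (\int[leb]_y (w y * f y `^ q)%:E <= 1%:E)%E by apply: le_trans sumE; exact: leeDl.
  have Ifin : (\int[leb]_y (w y * f y `^ q)%:E)%E \is a fin_num.
    by rewrite ge0_fin_numE// (le_lt_trans Ile)// ltry.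
  move: sumE Mw I0 Ile; rewrite -(fineK Ifin); set E := fine _ => sumE; rewrite !lee_fin => ME E0 E1.
  have Eq : (E `^ iq) `^ q = E.
    by rewrite -powRrM (_ : iq * q = 1) ?powRr1//; field; rewrite !gt_eqF.
  exists w, (E `^ iq); split.
    have h1 : 1 `^ iq = 1 :> R by rewrite powR1.
    rewrite powR_ge0/= -[leRHS]h1.
    by apply: (ge0_ler_powR (ltW iq0)); rewrite ?nnegrE.
  split => //.
  - rewrite Eq; split; first by rewrite -(fineK Ifin).
    by rewrite EFinB leeBrDl// .
  - move=> y; apply: (le_trans (wM y)).
    rewrite powRN -mulrA mulrC -ler_pdivrMr// ler_pdivlMr ?powR_gt0//.
    have -> : M / 2 * sigma `^ iq = ((M / 2) `^ q * sigma) `^ iq.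
      rewrite powRM ?powR_ge0 ?(ltW s0)// -powRrM (_ : q * iq = 1) ?powRr1 ?divr_ge0//.
      by field; rewrite !gt_eqF.
    by apply: (ge0_ler_powR (ltW iq0)); rewrite ?nnegrE// mulr_ge0 ?powR_ge0// ltW.
(* If f is supported on a set of measure at most sigma, its indicator is the weight, nothing
   remains, and the level is M = 0. *)
have [As|sA] := leP (leb (A 0)) sigma%:E.
  exists (\1_(A 0)); split => //.
  - by move=> y; rewrite indA; case: ltP => _ /=; rewrite ?lexx ler01.
  - by rewrite II.
  - exists 0; split => //.
      move=> y; rewrite indA; case: ltP => [_|fy]; first by rewrite subrr mul0r.
      by rewrite subr0 mul1r.
    rewrite mul0r powR0 ?gt_eqF// mul0r; apply: integral_ge0 => y _.
    by rewrite lee_fin mulr_ge0 ?powR_ge0.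
have cheb M : 0 < M -> ((M `^ q)%:E * leb (A M) <= 1%:E)%E.
  move=> M0; apply: le_trans f1; rewrite -II.
  have mI : measurable_fun setT (fun y => (\1_(A M) y : R)%:E) by exact/measurable_EFinP.
  have nI y : (0 <= (\1_(A M) y : R)%:E)%E by rewrite lee_fin.
  have Mq0 : (0 <= (M `^ q)%:E)%E by rewrite lee_fin powR_ge0.
  rewrite -(ge0_integralZl leb measurableT mI (fun y _ => nI y) Mq0).
  apply: ge0_le_integral.
  - by [].
  - by move=> y _; exact: mule_ge0.
  - exact: measurable_funeM.
  - exact/measurable_EFinP.
  move=> y _; rewrite -EFinM lee_fin indA; case: ltP => My; last by rewrite mulr0 powR_ge0.
  by rewrite mulr1; apply: ge0_ler_powR; rewrite ?nnegrE ?ltW// (lt_trans M0).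
have Afin M : 0 < M -> leb (A M) \is a fin_num.
  move=> M0; rewrite ge0_fin_numE// ltey; apply/negP => /eqP Ay.
  by have := cheb _ M0; rewrite Ay gt0_muley ?lte_fin ?powR_gt0.
(* A positive starting level whose superlevel set is too large; it is doubled until the measure
   drops to sigma, which happens by Chebyshev's inequality. *)
have [k kP] : exists k : nat, (sigma%:E < leb (A (k.+1%:R^-1)%R))%E.
  have ndF : nondecreasing_seq (fun k : nat => A (k.+1%:R^-1)).
    move=> i j ij; apply/subsetPset => y; rewrite /A/=; apply: le_lt_trans.
    by rewrite lef_pV2 ?posrE// ler_nat.
  have UA : \bigcup_k A (k.+1%:R^-1) = A 0.
    apply/seteqP; split => y; first by move=> [k _]; rewrite /A/=; apply: lt_trans; rewrite invr_gt0.
    rewrite /A/= => fy; exists (Num.truncn (f y)^-1) => //=.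
    by rewrite -[X in _ < X]invrK ltf_pV2 ?posrE ?invr_gt0// truncnS_gt.
  have := nondecreasing_cvg_mu (mu := leb) (fun k => mA _) _ ndF; rewrite UA => /(_ (mA 0)).
  move=> /(_ _ (open_nbhs_nbhs (conj (@open_ereal_gt_ereal _ sigma%:E) sA))).
  by move=> [k _ /(_ k (leqnn k))] /= H; exists k.
pose M0 : R := k.+1%:R^-1; have M00 : 0 < M0 by rewrite invr_gt0.
pose P (j : nat) := `[< (leb (A (M0 * 2 ^+ j)%R) <= sigma%:E)%E >].
have exP : exists j, P j.
  pose B := Num.max 1 sigma^-1 / M0.
  exists (Num.truncn B).+1; apply/asboolP.
  set M := M0 * _.
  have BM : Num.max 1 sigma^-1 <= M.
    rewrite /M mulrC -ler_pdivrMr//; apply: le_trans (ltW (truncnS_gt _)) _.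
    by rewrite -natrX ler_nat ltnW// ltn_expl.
  have [M1 sM] : 1 <= M /\ sigma^-1 <= M by move: BM; rewrite ge_max => /andP.
  have M0' : 0 < M by exact: lt_le_trans M1.
  have := cheb _ M0'; rewrite -(fineK (Afin _ M0')) -EFinM !lee_fin => H.
  have MMq : M <= M `^ q by rewrite -[leLHS]powRr1 ?(ltW M0')//; exact: ler_powR.
  have a0 : 0 <= fine (leb (A M)) by exact: fine_ge0.
  rewrite -(ler_pM2l M0') (le_trans (ler_wpM2r a0 MMq))// (le_trans H)//.
  by rewrite -ler_pdivrMr// mul1r.
case: (ex_minnP exP) => -[|j] /asboolP Pj minj.
  by move: Pj; rewrite expr0 mulr1 leNgt kP.
have nPj : (sigma%:E < leb (A (M0 * 2 ^+ j)%R))%E.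
  rewrite ltNge; apply/negP => h; have /minj : P j by exact/asboolP.
  by rewrite ltnn.
set M := M0 * 2 ^+ j.+1 in Pj; have M2 : M0 * 2 ^+ j = M / 2 by rewrite /M exprS; field.
rewrite M2 in nPj; have M0' : 0 < M by rewrite mulr_gt0// exprn_gt0.
clearbody M.
have M20 : 0 < M / 2 by rewrite divr_gt0.
move: Pj nPj; rewrite -(fineK (Afin _ M0')) -(fineK (Afin _ M20)) lee_fin lte_fin.
have Ea := fineK (Afin _ M0'); have Eb := fineK (Afin _ M20).
move: (fine _) (fine _) Ea Eb => b a Ea Eb asig sigb.
have ab : a < b by exact: le_lt_trans sigb.
(* Solves (1 - th) a + th b = sigma for the measures a <= sigma < b of the two superlevel sets. *)
pose th := (sigma - a) / (b - a).
have ba0 : 0 < b - a by rewrite subr_gt0.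
have th0 : 0 <= th by rewrite divr_ge0 ?subr_ge0// ltW.
have th1 : 0 <= 1 - th by rewrite subr_ge0 ler_pdivrMr// mul1r lerD2r ltW.
pose w y : R := (1 - th) * \1_(A M) y + th * \1_(A (M / 2)) y.
have w0 y : 0 <= w y by rewrite addr_ge0// mulr_ge0.
have mw : measurable_fun setT w by apply: measurable_funD; exact: measurable_funM.
have Iw : (\int[leb]_y (w y)%:E = sigma%:E)%E.
  under eq_integral => y _ do rewrite EFinD !EFinM.
  have mIM M' : measurable_fun setT (fun y => (\1_(A M') y : R)%:E) by exact/measurable_EFinP.
  have nIM M' y : (0 <= (\1_(A M') y : R)%:E)%E by rewrite lee_fin.
  have t0 : (0 <= th%:E)%E by rewrite lee_fin.
  have t1 : (0 <= (1 - th)%:E)%E by rewrite lee_fin.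
  rewrite (ge0_integralD leb measurableT (fun y _ => mule_ge0 t1 (nIM M y)) (measurable_funeM _ (mIM M))
    (fun y _ => mule_ge0 t0 (nIM (M / 2) y)) (measurable_funeM _ (mIM (M / 2)))).
  rewrite (ge0_integralZl leb measurableT (mIM M) (fun y _ => nIM M y) t1).
  rewrite (ge0_integralZl leb measurableT (mIM (M / 2)) (fun y _ => nIM (M / 2) y) t0).
  rewrite !II -Ea -Eb -!EFinM -EFinD; congr EFin; rewrite /th; field.
  by rewrite gt_eqF.
have halfM : M / 2 <= M by lra.
exists w; split => //; first (move=> y; rewrite w0/=; rewrite /w !indA).
  have [h|h] := ltP M (f y); first by rewrite (le_lt_trans halfM h) !mulr1 subrK.
  by case: ltP => _; rewrite ?mulr0 ?mulr1 ?addr0 ?add0r//; move: th1; rewrite subr_ge0.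
- by rewrite Iw.
exists M; split; first exact: ltW.
- move=> y; rewrite /w !indA; have [h|h] := ltP M (f y).
    by rewrite (le_lt_trans halfM h) !mulr1 subrK subrr mul0r ltW.
  apply: le_trans h; rewrite ler_piMl// mulr0 add0r gerBl mulr_ge0//.
- have mwE : measurable_fun setT (fun y => (w y)%:E) by exact/measurable_EFinP.
  have nwE y : (0 <= (w y)%:E)%E by rewrite lee_fin.
  have Mq0 : (0 <= ((M / 2) `^ q)%:E)%E by rewrite lee_fin powR_ge0.
  rewrite EFinM -Iw -(ge0_integralZl leb measurableT mwE (fun y _ => nwE y) Mq0).
  apply: ge0_le_integral.
  - by [].
  - by move=> y _; exact: mule_ge0.
  - exact: measurable_funeM.
  - by apply/measurable_EFinP; exact: measurable_funM.
  move=> y _; rewrite -EFinM lee_fin mulrC /w !indA.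
  have [h|h] := ltP (M / 2) (f y).
    have := w0 y; rewrite /w !indA h => wy0; apply: ler_wpM2l => //.
    by apply: ge0_ler_powR; rewrite ?nnegrE ?ltW// (lt_trans M20).
  rewrite ltNge (le_trans h halfM)/= !mulr0 addr0 !mul0r//.
Qed.

End level_bound.

Section star.
Context {R : realType}.
Variables (n alpha : nat).
Hypotheses (alpha_gt0 : (0 < alpha)%N) (alpha_lt_n : (alpha < n)%N).
Notation leb := (@lebesgue_rV R n).
Notation gam := (@gamma_const R n alpha).
Notation iq := (alpha%:R / n%:R : R).
Notation iq' := ((n%:R - alpha%:R) / n%:R : R).
Notation q := (n%:R / alpha%:R : R).
Notation q' := (n%:R / (n%:R - alpha%:R) : R).

Let n0 : (0 < n)%N. Proof. exact: leq_trans alpha_lt_n. Qed.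
Let n0' : (0 : R) < n%:R. Proof. by rewrite ltr0n. Qed.
Let al0 : (0 : R) < alpha%:R. Proof. by rewrite ltr0n. Qed.
Let na0 : (0 : R) < n%:R - alpha%:R. Proof. by rewrite subr_gt0 ltr_nat. Qed.
Let iq0 : 0 < iq. Proof. by rewrite divr_gt0. Qed.
Let iq'0 : 0 < iq'. Proof. by rewrite divr_gt0. Qed.
Let q0 : 0 < q. Proof. by rewrite divr_gt0. Qed.
Let q1 : 1 <= q. Proof. by rewrite ler_pdivlMr// mul1r ler_nat ltnW. Qed.
Let q'0 : 0 < q'. Proof. by rewrite divr_gt0. Qed.
Let iqD : iq + iq' = 1. Proof. by field; rewrite gt_eqF. Qed.
Let g0 : 0 < gam := gamma_const_gt0 alpha_gt0 alpha_lt_n.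

Lemma ler_addgt0_mul (x y c : R) : 0 <= c -> (forall eps, 0 < eps -> x <= y + eps * c) -> x <= y.
Proof.
move=> c0 H; apply/ler_addgt0Pr => e e0; have c1 : 0 < c + 1 by rewrite ltr_wpDl.
apply: (le_trans (H (e / (c + 1)) (divr_gt0 e0 c1))); rewrite lerD2l -mulrA ger_pMr//.
by rewrite mulrC ler_pdivrMr// mul1r lerDl.
Qed.

(** The convolution is split into four parts: w f and (1 - w) f, each near to and far from the
    diagonal, the border being the volume s for w f and sigma for the rest. Far parts give the two
    main terms by Hoelder's inequality; near parts are O(e), for (1 - w) f pointwise by its bound
    and for w f in the mean over S. *)
Lemma level_bound (p : R) : 1 <= p -> exists2 K : R, 0 <= K &
  forall u (F : 'rV[R]_n -> 'rV[R]_(nabla_dim n alpha)) (Q : R) (S : set 'rV[R]_n) (tau s sigma e a : R)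
    (w : 'rV[R]_n -> R),
  weak_nabla alpha u F -> 0 < Q -> (\int[leb]_x (`|u x| `^ p)%:E <= Q%:E)%E ->
  measurable S -> (leb S = s%:E)%E -> 0 < s -> 0 < sigma -> s <= tau -> sigma <= tau ->
  top_weight alpha (fun y => enorm (F y)) w sigma e -> 0 <= e <= 1 ->
  0 <= a -> (forall x, S x -> a <= `|u x|) ->
  a <= K * (Q / tau) `^ p^-1 + K * e + e * (Num.max 0 (ln (sigma / s)) / gam + K) `^ iq' +
       (1 - e `^ q) `^ iq * (Num.max 0 (ln (tau / sigma)) / gam + K) `^ iq'.
Proof.
move=> p1; have [C C0 rep] := kernel_representation alpha_gt0 alpha_lt_n p1.
pose K1 := (gam `^ (- iq') + C) / iq; pose C3 := gam^-1 + C `^ q'.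
have K10 : 0 <= K1 by rewrite divr_ge0 ?(ltW iq0)// addr_ge0 ?powR_ge0.
have C30 : 0 <= C3 by rewrite addr_ge0 ?powR_ge0// invr_ge0 ltW.
have K40 : 0 <= 4 * K1 := mulr_ge0 (ler0n _ 4) K10.
have K20 : 0 <= 2 * K1 := mulr_ge0 (ler0n _ 2) K10.
have CK0 : 0 <= C + 4 * K1 := addr_ge0 C0 K40.
have CKC0 : 0 <= C + 4 * K1 + C3 := addr_ge0 CK0 C30.
exists (C + 4 * K1 + C3) => //.
move=> u F Q S tau s sigma e a w wu Q0 uQ mS Ss s0 sg0 stau sgtau tw /andP[e0 e1] a0 au.
have tau0 : 0 < tau by exact: lt_le_trans stau.
have [[mu _] locF _] := wu; have [mw w01 Iw [wfe wfe'] wM] := tw.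
pose f y := enorm (F y).
have mf : measurable_fun setT f by apply: measurable_enorm => j; case: (locF j).
have f0 y : 0 <= f y by exact: sqrtr_ge0.
have w0 y : 0 <= w y by case/andP: (w01 y).
have w1 y : 0 <= 1 - w y by rewrite subr_ge0; case/andP: (w01 y).
have w101 y : 0 <= 1 - w y <= 1 by rewrite w1/= gerBl.
have mw1 : measurable_fun setT (fun y => 1 - w y) by exact: measurable_funB.
pose X1 := Num.max 0 (ln (sigma / s)) / gam + C3.
pose X2 := Num.max 0 (ln (tau / sigma)) / gam + C3.
pose Y1 := e * X1 `^ iq'; pose Y2 := (1 - e `^ q) `^ iq * X2 `^ iq'.
pose D := C * (Q / tau) `^ p^-1.
have D0 : 0 <= D by rewrite mulr_ge0 ?powR_ge0.
have Y10 : 0 <= Y1 by rewrite mulr_ge0 ?powR_ge0.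
have Y20 : 0 <= Y2 by rewrite mulr_ge0 ?powR_ge0.
suff main : a <= D + 4 * K1 * e + Y1 + Y2.
  have mono Z : 0 <= Z -> (Z / gam + C3) `^ iq' <= (Z / gam + (C + 4 * K1 + C3)) `^ iq'.
    move=> Z0; have Zg : 0 <= Z / gam by rewrite divr_ge0// ltW.
    apply: (ge0_ler_powR (ltW iq'0)); rewrite ?nnegrE; [exact: addr_ge0|exact: addr_ge0|].
    by rewrite lerD2l lerDr.
  apply: (le_trans main); apply: lerD; last by apply: ler_wpM2l; [exact: powR_ge0|apply: mono; rewrite le_max lexx].
  apply: lerD; last by apply: ler_wpM2l => //; apply: mono; rewrite le_max lexx.
  apply: lerD.
    by apply: ler_wpM2r; [exact: powR_ge0|rewrite -addrA lerDl addr_ge0].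
  by apply: ler_wpM2r => //; rewrite -addrA addrCA lerDl addr_ge0.
have sE : (s `^ iq * (e * s `^ (- iq) * s)) = e * s.
  by rewrite powRN; field; rewrite gt_eqF// powR_gt0.
pose c := 1 + 2 * K1 * s + a.
have c0 : 0 <= c := addr_ge0 (addr_ge0 ler01 (mulr_ge0 K20 (ltW s0))) a0.
have step eps L : 0 < eps -> (a%:E * leb (S `&` sqn_ball L) <=
    (eps + (D + 4 * K1 * e + 2 * K1 * eps + Y1 + Y2) * s)%:E)%E.
  move=> eps0; set SL := S `&` sqn_ball L.
  have mSL : measurable SL by apply: measurableI => //; exact: measurable_sqn_ball.
  have SLs : (leb SL <= s%:E)%E by rewrite -Ss; apply: le_measure; rewrite ?inE//; exact: subIsetl.
  have [k kk repS] := rep u F Q tau eps L SL wu Q0 uQ tau0 eps0 mSL (@subIsetr _ _ _).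
  have [mk k0 _ _ _] := kk.
  pose i1 (th t : R) : R := \1_(`]-oo, th[%classic) t.
  pose i2 (th t : R) : R := \1_(`[th, +oo[%classic) t.
  have mi1 th : measurable_fun setT (i1 th) by exact: measurable_indic.
  have mi2 th : measurable_fun setT (i2 th) by exact: measurable_indic.
  have i12 th t : i1 th t + i2 th t = 1.
    by rewrite /i1 /i2 !indicE !mem_setE !in_itv/= andbT; case: ltP; rewrite ?addr0 ?add0r.
  have i10 th t : 0 <= i1 th t by [].
  have i20 th t : 0 <= i2 th t by [].
  pose k1 th t := k t * i1 th t; pose k2 th t := k t * i2 th t.
  have mk1 th : measurable_fun setT (k1 th) by exact: measurable_funM.
  have mk2 th : measurable_fun setT (k2 th) by exact: measurable_funM.
  have k10 th t : 0 <= k1 th t by rewrite mulr_ge0.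
  have k20 th t : 0 <= k2 th t by rewrite mulr_ge0.
  have mkb (g : R -> R) x : measurable_fun setT g -> measurable_fun setT (fun y : 'rV[R]_n => g (bvol (y - x))).
    by move=> mg; exact: (measurableT_comp mg (measurable_bvol_shift x)).
  have nm th x : 0 < th -> (\int[leb]_y (k1 th (bvol (y - x)))%:E <= (K1 * th `^ iq)%:E)%E.
    by move=> th0; exact: (near_mass alpha_gt0 alpha_lt_n tau0 C0 kk x th0).
  have P1 x : (\int[leb]_y (w y * f y * k2 s (bvol (y - x)))%:E <= Y1%:E)%E.
    have fw := far_weight alpha_gt0 alpha_lt_n tau0 C0 kk (x := x) mw w01 s0 sg0.
    have wle : (\int[leb]_y (w y * \1_(`]-oo, tau[%classic) (bvol (y - x)))%:E <= sigma%:E)%E.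
      apply: le_trans Iw; apply: ge0_le_integral.
      - by [].
      - by move=> y _; rewrite lee_fin mulr_ge0.
      - by apply/measurable_EFinP; apply: measurable_funM => //; exact: (mkb _ _ (mi1 tau)).
      - exact/measurable_EFinP.
      by move=> y _; rewrite lee_fin ler_piMr// indicE; case: (_ \in _).
    have H := hoelder_weight alpha_gt0 alpha_lt_n mw mf (mkb _ x (mk2 s)) w0 f0 (fun y => k20 s _) wfe (fw wle).
    apply: (le_trans H); rewrite -powRrM (_ : q * iq = 1) ?powRr1//.
    by field; rewrite !gt_eqF.
  have P3 x : (\int[leb]_y ((1 - w y) * f y * k2 sigma (bvol (y - x)))%:E <= Y2%:E)%E.
    have fw := far_weight alpha_gt0 alpha_lt_n tau0 C0 kk (x := x) mw1 w101 sg0 tau0.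
    have wle : (\int[leb]_y ((1 - w y) * \1_(`]-oo, tau[%classic) (bvol (y - x)))%:E <= tau%:E)%E.
      rewrite -(integral_bvol_indic alpha_lt_n x tau0); apply: ge0_le_integral.
      - by [].
      - by move=> y _; rewrite lee_fin mulr_ge0.
      - by apply/measurable_EFinP; apply: measurable_funM => //; exact: (mkb _ _ (mi1 tau)).
      - by apply/measurable_EFinP; exact: (mkb _ _ (mi1 tau)).
      by move=> y _; rewrite lee_fin ler_piMl// gerBl.
    exact: (hoelder_weight alpha_gt0 alpha_lt_n mw1 mf (mkb _ x (mk2 sigma)) w1 f0 (fun y => k20 sigma _) wfe' (fw wle)).
  have P4 x : (\int[leb]_y ((1 - w y) * f y * k1 sigma (bvol (y - x)))%:E <= (2 * K1 * e)%:E)%E.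
    pose M := 2 * e * sigma `^ (- iq).
    have M0 : 0 <= M by rewrite mulr_ge0 ?powR_ge0// mulr_ge0.
    apply: (@le_trans _ _ (\int[leb]_y (M%:E * (k1 sigma (bvol (y - x)))%:E))%E).
      apply: ge0_le_integral.
      - by [].
      - by move=> y _; rewrite lee_fin !mulr_ge0.
      - apply/measurable_EFinP; apply: measurable_funM; first exact: measurable_funM.
        exact: mkb.
      - by apply: measurable_funeM; apply/measurable_EFinP; exact: mkb.
      by move=> y _; rewrite -EFinM lee_fin ler_wpM2r//; exact: wM.
    rewrite (ge0_integralZl leb measurableT); last 3 first.
    - by apply/measurable_EFinP; exact: mkb.
    - by move=> y _; rewrite lee_fin.
    - by rewrite lee_fin.
    apply: (le_trans (lee_wpmul2l _ (nm sigma x sg0))); first by rewrite lee_fin.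
    rewrite -EFinM lee_fin /M powRN le_eqVlt; apply/orP; left; apply/eqP; field.
    by rewrite gt_eqF// powR_gt0.
  pose N x := kernel_average (fun y => w y * f y) (k1 s) x.
  have mN : measurable_fun setT N.
    apply: measurable_kernel_average => //; first exact: measurable_funM.
    by move=> y; rewrite mulr_ge0.
  have N0 x : (0 <= N x)%E by apply: integral_ge0 => y _; rewrite lee_fin !mulr_ge0.
  have split_kernel x : (kernel_average f k x <= N x + (Y1 + Y2 + 2 * K1 * e)%:E)%E.
    have pt y : f y * k (bvol (y - x)) = w y * f y * k1 s (bvol (y - x)) +
        (w y * f y * k2 s (bvol (y - x)) + ((1 - w y) * f y * k2 sigma (bvol (y - x)) +
        (1 - w y) * f y * k1 sigma (bvol (y - x)))).
      have h1 := i12 s (bvol (y - x)); have h2 := i12 sigma (bvol (y - x)).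
      rewrite /k1 /k2; move: (i1 s _) (i2 s _) (i1 sigma _) (i2 sigma _) h1 h2 => b1 b2 b3 b4 h1 h2.
      have -> : b1 = 1 - b2 by rewrite -h1 addrK.
      have -> : b3 = 1 - b4 by rewrite -h2 addrK.
      ring.
    have mm (v : 'rV[R]_n -> R) (g : R -> R) : measurable_fun setT v -> measurable_fun setT g ->
        measurable_fun setT (fun y => (v y * f y * g (bvol (y - x)))%:E).
      move=> mv mg; apply/measurable_EFinP; apply: measurable_funM; first exact: measurable_funM.
      exact: mkb.
    have m1 := mm w (k1 s) mw (mk1 s); have m2 := mm w (k2 s) mw (mk2 s).
    have m3 := mm _ (k2 sigma) mw1 (mk2 sigma); have m4 := mm _ (k1 sigma) mw1 (mk1 sigma).
    have nn (v g : R) y : 0 <= v -> 0 <= g -> (0 <= (v * f y * g)%:E)%E.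
      by move=> v0 g00; rewrite lee_fin !mulr_ge0.
    rewrite /kernel_average; under eq_integral => y _ do rewrite pt !EFinD.
    rewrite (ge0_integralD leb measurableT (fun y _ => nn _ _ y (w0 y) (k10 s _)) m1); last 2 first.
    - by move=> y _; rewrite !adde_ge0// nn.
    - by apply: emeasurable_funD => //; exact: emeasurable_funD.
    rewrite (ge0_integralD leb measurableT (fun y _ => nn _ _ y (w0 y) (k20 s _)) m2); last 2 first.
    - by move=> y _; rewrite !adde_ge0// nn.
    - exact: emeasurable_funD.
    rewrite (ge0_integralD leb measurableT (fun y _ => nn _ _ y (w1 y) (k20 sigma _)) m3
      (fun y _ => nn _ _ y (w1 y) (k10 sigma _)) m4).
    apply: leeD; first exact: lexx.
    apply: (le_trans (leeD (P1 x) (leeD (P3 x) (P4 x)))).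
    by rewrite -!EFinD addrA.
  (* A positive substitute for [e], so that the truncation level below is positive also for e =
     0. *)
  pose e' := e + eps; have e'0 : 0 < e' by rewrite ltr_wpDl.
  have wfe2 : (\int[leb]_y (w y * f y `^ q)%:E <= (e' `^ q)%:E)%E.
    apply: (le_trans wfe); rewrite lee_fin; apply: (ge0_ler_powR (ltW q0)); rewrite ?nnegrE ?(ltW e'0)//.
    by rewrite lerDl ltW.
  (* With this level both terms of [near_part] become e' s^(1/q'). *)
  have l0 : 0 < e' * s `^ (- iq) by rewrite mulr_gt0// powR_gt0.
  have NS : (\int[leb]_(x in SL) N x <= (2 * K1 * e' * s)%:E)%E.
    have Ks0 : 0 <= K1 * s `^ iq by rewrite mulr_ge0 ?powR_ge0.
    have np := near_part alpha_gt0 alpha_lt_n (fun=> 0) mw w01 mf f0 (mk1 s) (k10 s) mSL SLs Ks0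
      (fun x => nm s x s0) l0 wfe2.
    apply: (le_trans np); rewrite lee_fin.
    have A1 : e' * s `^ (- iq) * s = e' * s `^ iq'.
      rewrite -mulrA; congr (_ * _); have -> : iq' = - iq + 1 by field; rewrite gt_eqF.
      by rewrite powRD ?(gt_eqF s0) ?implybT// powRr1// ltW.
    have A2 : (e' * s `^ (- iq)) `^ (1 - q) * e' `^ q = e' * s `^ iq'.
      rewrite powRM ?powR_ge0 ?(ltW e'0)// -powRrM mulrAC -powRD ?(gt_eqF e'0) ?implybT// subrK powRr1 ?(ltW e'0)//.
      congr (_ * _ `^ _); field; rewrite !gt_eqF//.
    rewrite A1 A2.
    have A3 : s `^ iq * s `^ iq' = s by rewrite -powRD ?(gt_eqF s0) ?implybT// iqD powRr1// ltW.
    have -> : K1 * s `^ iq * (e' * s `^ iq' + e' * s `^ iq') = 2 * K1 * e' * (s `^ iq * s `^ iq') by ring.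
    by rewrite A3.
  have Y0 : 0 <= Y1 + Y2 + 2 * K1 * e := addr_ge0 (addr_ge0 Y10 Y20) (mulr_ge0 K20 e0).
  have aSL : (a%:E * leb SL <= \int[leb]_(x in SL) `|u x|%:E)%E.
    rewrite -integral_cst//; apply: ge0_le_integral.
    - by [].
    - by move=> x _; rewrite lee_fin.
    - exact: measurable_cst.
    - by apply/measurable_EFinP/measurable_funTS; exact: measurableT_comp.
    by move=> x [Sx _]; rewrite lee_fin; exact: au.
  apply: (le_trans aSL); apply: (le_trans repS).
  have KAS : (\int[leb]_(x in SL) kernel_average f k x <=
      (2 * K1 * e' * s)%:E + (Y1 + Y2 + 2 * K1 * e)%:E * leb SL)%E.
    apply: (@le_trans _ _ (\int[leb]_(x in SL) (N x + (Y1 + Y2 + 2 * K1 * e)%:E))%E).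
      apply: ge0_le_integral.
      - by [].
      - by move=> x _; apply: integral_ge0 => y _; rewrite lee_fin mulr_ge0.
      - by apply: measurable_funTS; exact: measurable_kernel_average.
      - by apply: emeasurable_funD; [exact: measurable_funTS|exact: measurable_cst].
      by move=> x _; exact: split_kernel.
    rewrite (ge0_integralD leb mSL (fun x _ => N0 x) (measurable_funTS mN)); last 2 first.
    - by move=> x _; rewrite lee_fin.
    - exact: measurable_cst.
    by rewrite integral_cst//; apply: leeD.
  apply: (le_trans (leeD2l _ KAS)).
  apply: (@le_trans _ _ (eps%:E + D%:E * s%:E + ((2 * K1 * e' * s)%:E + (Y1 + Y2 + 2 * K1 * e)%:E * s%:E))%E).
    apply: leeD; first by apply: leeD => //; apply: lee_wpmul2l; rewrite ?lee_fin.
    by apply: leeD => //; apply: lee_wpmul2l; rewrite ?lee_fin.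
  rewrite -!EFinM -!EFinD lee_fin /e' le_eqVlt; apply/orP; left; apply/eqP; ring.
(* [step] concerns bounded parts of S. Balls exhaust S up to measure eps, and the total error is eps
   times the fixed number [c]. *)
rewrite -(ler_pM2r s0); apply: (ler_addgt0_mul c0) => eps eps0.
have ndF : nondecreasing_seq (fun k : nat => S `&` sqn_ball k%:R).
  move=> i j ij; apply/subsetPset => x [Sx xi]; split => //; move: xi; rewrite /sqn_ball/=.
  by move=> /lt_le_trans; apply; rewrite ler_nat.
have mF k : measurable (S `&` sqn_ball k%:R).
  by apply: measurableI => //; exact: measurable_sqn_ball.
have UF : \bigcup_k (S `&` sqn_ball k%:R) = S.
  apply/seteqP; split => [x [k _ []]//|x Sx].
  by exists (Num.truncn (sqn x)).+1 => //; split => //; rewrite /sqn_ball/=; exact: truncnS_gt.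
have [|k] := measure_bigcup_approx eps0 mF ndF; first by rewrite UF Ss ltry.
rewrite UF Ss => kP.
have Ff : leb (S `&` sqn_ball k%:R) \is a fin_num.
  rewrite ge0_fin_numE// (@le_lt_trans _ _ s%:E) ?ltry// -Ss.
  by apply: le_measure; rewrite ?inE//; exact: subIsetl.
have := step eps k%:R eps0; move: kP; rewrite -(fineK Ff) -EFinM -EFinB !lee_fin.
move: (fine _) => m ms am; have := ler_wpM2l a0 ms; rewrite mulrBr => h.
rewrite /c; lra.
Qed.

End star.

(** * Counting level sets *)

Section young.
Context {R : realType}.
Implicit Types x y z u v eta c : R.

Lemma young_weighted x y u v : 0 < x -> 0 < y -> x + y = 1 -> 0 <= u -> 0 <= v ->
  u `^ x * v `^ y <= x * u + y * v.
Proof.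
move=> x0 y0 xy u0 v0.
have := @conjugate_powR R (u `^ x) (v `^ y) x^-1 y^-1 (powR_ge0 _ _) (powR_ge0 _ _).
rewrite !invr_gt0 !invrK => /(_ x0 y0 xy).
by rewrite -!powRrM !divff ?gt_eqF// !powRr1// (mulrC x) (mulrC y).
Qed.

Lemma young_eps x y eta : 0 < x -> 0 < y -> x + y = 1 -> 0 < eta ->
  exists2 D : R, 0 <= D & forall z v, 0 <= z -> 0 <= v -> z * v `^ y <= eta * v + D * z `^ x^-1.
Proof.
move=> x0 y0 xy e0; exists (eta `^ (- (y / x))); first exact: powR_ge0.
move=> z v z0 v0; pose u := eta `^ (- (y / x)) * z `^ x^-1.
have u0 : 0 <= u by rewrite mulr_ge0 ?powR_ge0.
have x1 : x <= 1 by rewrite -xy lerDl ltW.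
have y1 : y <= 1 by rewrite -xy lerDr ltW.
have -> : z * v `^ y = u `^ x * (eta * v) `^ y.
  have E1 : u `^ x = eta `^ (- y) * z.
    rewrite /u powRM ?powR_ge0// -!powRrM mulVf ?gt_eqF// powRr1//; congr (_ `^ _ * _).
    by rewrite mulNr divfK// gt_eqF.
  have E2 : (eta * v) `^ y = eta `^ y * v `^ y by rewrite powRM// ltW.
  have E3 : eta `^ (- y) * eta `^ y = 1 by rewrite powRN mulVf// gt_eqF// powR_gt0.
  by rewrite E1 E2 mulrACA E3 mul1r.
apply: (le_trans (young_weighted x0 y0 xy u0 (mulr_ge0 (ltW e0) v0))).
rewrite addrC; apply: lerD; last by rewrite ler_piMl.
by rewrite ler_piMl// mulr_ge0// ltW.
Qed.

Lemma young_linear x y eta c : 0 < x -> 0 < y -> x + y = 1 -> 0 < eta -> 0 <= c ->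
  exists2 D : R, 0 <= D & forall z, 0 <= z -> c * z <= eta * z `^ x^-1 + D.
Proof.
move=> x0 y0 xy e0 c0.
have [D D0 H] := young_eps y0 x0 (etrans (addrC _ _) xy) e0.
exists (D * c `^ y^-1); first by rewrite mulr_ge0 ?powR_ge0.
move=> z z0; have := H c (z `^ x^-1) c0 (powR_ge0 _ _).
by rewrite -powRrM mulVf ?gt_eqF// powRr1.
Qed.

End young.

Section level_counting.
Context {R : realType}.
Variables (x y K P : R).
Hypotheses (x0 : 0 < x) (y0 : 0 < y) (xy : x + y = 1) (K0 : 0 <= K) (P0 : 0 <= P).

(* [T k - k] measures how much the k-th level set is smaller than expected;
   the two-level inequality forbids many levels with a small gap *)
Definition level_system (A : pred nat) (T e : nat -> R) :=
  (forall k, A k -> [/\ (0 < k)%N, 0 <= T k & 0 <= e k <= 1]) /\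
  (forall j k, A j -> A k -> (j <= k)%N ->
    k%:R `^ y <= K * k%:R `^ (- x) + K * e j + e j * (Num.max 0 (T k - T j) + K) `^ y +
      (1 - e j `^ x^-1) `^ x * (T j + P * ln (k%:R / j%:R) + K) `^ y).

(** Multiplication by k^x turns the left-hand side into k. Young's inequality makes the last product
    linear with the weights x and y, so for small e_j the share x k can be cancelled and y k is
    compared with y T_j. *)
Lemma level_system_scaled A T e j k : level_system A T e -> A j -> A k -> (j <= k)%N ->
  k%:R <= K + K * (e j * k%:R `^ x) + e j * k%:R `^ x * (Num.max 0 (T k - T j) + K) `^ y +
    (x * ((1 - e j `^ x^-1) * k%:R) + y * (T j + P * ln (k%:R / j%:R) + K)).
Proof.
move=> [bd H] Aj Ak jk.
have [k0 _ _] := bd _ Ak; have [j0 Tj /andP[e0 e1]] := bd _ Aj.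
have kR : (0 : R) < k%:R by rewrite ltr0n.
have kx : 0 <= k%:R `^ x by exact: powR_ge0.
have := ler_wpM2r kx (H _ _ Aj Ak jk).
have -> : k%:R `^ y * k%:R `^ x = k%:R.
  by rewrite -powRD ?(gt_eqF kR) ?implybT// addrC xy powRr1// ltW.
move=> /le_trans; apply.
have kxN : k%:R `^ (- x) * k%:R `^ x = 1 :> R by rewrite powRN mulVf// gt_eqF// powR_gt0.
have L0 : 0 <= T j + P * ln (k%:R / j%:R) + K.
  by rewrite !addr_ge0// mulr_ge0// ln_ge0// ler_pdivlMr ?ltr0n// mul1r ler_nat.
have E0 : 0 <= 1 - e j `^ x^-1.
  rewrite subr_ge0; have h1 : 1 `^ x^-1 = 1 :> R by rewrite powR1.
  by rewrite -[leRHS]h1; apply: ge0_ler_powR; rewrite ?nnegrE// invr_ge0 ltW.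
have Y := young_weighted x0 y0 xy (mulr_ge0 E0 (ltW kR)) L0.
rewrite powRM ?(ltW kR)// in Y.
move: Y; move: ((Num.max 0 (T k - T j) + K) `^ y) ((1 - e j `^ x^-1) `^ x) ((T j + _ + K) `^ y) => a1 a2 a3 Y.
have -> : (K * k%:R `^ (- x) + K * e j + e j * a1 + a2 * a3) * k%:R `^ x =
  K * (k%:R `^ (- x) * k%:R `^ x) + K * (e j * k%:R `^ x) + e j * k%:R `^ x * a1 + a2 * k%:R `^ x * a3 by ring.
by rewrite kxN mulr1 lerD2l.
Qed.

Let y1 : y <= 1. Proof. by rewrite -xy lerDr ltW. Qed.

(** Take j = k: both logarithmic gaps vanish. With W = e_k k^x the linear term in W is absorbed by
    half of x W^q = x e_k^q k, and what is left is y (T_k - k) plus a constant. *)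
Lemma level_energy : exists D B : R, [/\ 0 < D, 0 <= B & forall A T e k, level_system A T e -> A k ->
  e k `^ x^-1 * k%:R <= D * (T k - k%:R + B)].
Proof.
have x2 : 0 < x / 2 by rewrite divr_gt0.
have K2 : 0 <= K + K `^ y by rewrite addr_ge0 ?powR_ge0.
have [D D0 hD] := young_linear x0 y0 xy x2 K2.
exists (2 * y / x), ((2 * K + D) / y); split.
- by rewrite divr_gt0// mulr_gt0.
- by rewrite divr_ge0 ?(ltW y0)// addr_ge0// mulr_ge0.
move=> A T e k LS Ak; have [bd _] := LS; have [k0 Tk /andP[e0 e1]] := bd _ Ak.
have := level_system_scaled LS Ak Ak (leqnn k).
set W := e k * _.
have kR : (0 : R) < k%:R by rewrite ltr0n.
have W0 : 0 <= W by rewrite mulr_ge0// powR_ge0.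
have WE : W `^ x^-1 = e k `^ x^-1 * k%:R.
  by rewrite powRM ?powR_ge0// -powRrM divff ?gt_eqF// powRr1// ltW.
have := hD W W0; rewrite WE; move: (e k `^ x^-1) => E hW.
rewrite subrr maxxx add0r divff ?gt_eqF// ln1 mulr0 addr0 => H.
have xkE : x = 1 - y by rewrite -xy addrK.
have main : x * (E * k%:R) <= 2 * ((2 * K + D) + y * (T k - k%:R)).
  have yK : y * K <= K by rewrite ler_piMl.
  have X : x * k%:R + y * k%:R = k%:R by rewrite -mulrDl xy mul1r.
  nra.
have -> : 2 * y / x * (T k - k%:R + (2 * K + D) / y) = 2 * ((2 * K + D) + y * (T k - k%:R)) / x.
  by field; rewrite !gt_eqF.
by rewrite ler_pdivlMr// mulrC.
Qed.

(** A small gap at a large index j forces e_j^q = O(1/J) by [level_energy]. Every term that grows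
    with k - j then has a small coefficient, while T_j is at most j + lam, so k cannot be far from
    j. *)
Lemma level_gap : exists B J C : R, [/\ 0 <= B, 0 <= J, 0 <= C & forall A T e, level_system A T e ->
  (forall k, A k -> - B <= T k - k%:R) /\
  forall lam j k, 0 <= lam -> A j -> A k -> (j < k)%N -> T j - j%:R <= lam -> T k - k%:R <= lam ->
    J * (lam + 1) <= j%:R -> k%:R - j%:R <= C * (lam + 1)].
Proof.
have [D1 [B [D1_gt0 B0 hE]]] := level_energy; have D10 := ltW D1_gt0.
have y8 : 0 < y / 8 by rewrite divr_gt0.
have [Dn Dn0 hn] := young_eps x0 y0 xy y8.
have [Dl Dl0 hl] := young_linear x0 y0 xy ltr01 K0.
have Dn1 : 0 <= 1 + Dn by rewrite addr_ge0.
have DB : 0 <= D1 * (1 + B) by rewrite mulr_ge0// addr_ge0.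
(* J1 and the summand 8 P of J make the energy term and the logarithmic term at most y m / 8 each,
   for m = k - j. The Young term gives another y m / 8, so more than half of y m remains on the
   left. *)
pose J1 := 8 * ((1 + Dn) * (D1 * (1 + B))) / y.
have J10 : 0 <= J1 by rewrite divr_ge0 ?(ltW y0)// mulr_ge0// mulr_ge0.
pose J := 1 + J1 + 8 * P.
have P8 : 0 <= 8 * P by rewrite mulr_ge0.
have J1' : 1 <= J by rewrite /J; lra.
have J0 : 0 < J by exact: lt_le_trans J1'.
pose Q0 := K + Dl + y * (1 + K) + (1 + Dn) * (D1 * (1 + B)) + y / 8 * (1 + B + K).
have Q00 : 0 <= Q0.
  have a1 := mulr_ge0 (ltW y0) (addr_ge0 ler01 K0).
  have a2 := mulr_ge0 Dn1 DB.
  have a3 := mulr_ge0 (ltW y8) (addr_ge0 (addr_ge0 ler01 B0) K0).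
  by rewrite /Q0 (addr_ge0 (addr_ge0 (addr_ge0 (addr_ge0 K0 Dl0) a1) a2) a3).
exists B, J, (2 * Q0 / y); split => //; first exact: ltW.
  by rewrite divr_ge0 ?(ltW y0)// mulr_ge0.
move=> A T e LS; have [bd _] := LS.
have lowb k : A k -> - B <= T k - k%:R.
  move=> Ak; have [k0 _ /andP[e0 _]] := bd _ Ak; have := hE _ _ _ _ LS Ak => h.
  have h0 : 0 <= e k `^ x^-1 * k%:R by rewrite mulr_ge0 ?powR_ge0.
  by move: (le_trans h0 h); rewrite pmulr_rge0//; lra.
split => // lam j k lam0 Aj Ak jk bj bk Jj.
have := level_system_scaled LS Aj Ak (ltnW jk); set W := e j * _ => H.
have [k0 Tk _] := bd _ Ak; have [j0 Tj /andP[e0 e1]] := bd _ Aj.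
have kR : (0 : R) < k%:R by rewrite ltr0n.
have jR : (0 : R) < j%:R by rewrite ltr0n.
have W0 : 0 <= W by rewrite mulr_ge0// powR_ge0.
have WE : W `^ x^-1 = e j `^ x^-1 * k%:R.
  by rewrite powRM ?powR_ge0// -powRrM divff ?gt_eqF// powRr1// ltW.
pose m := k%:R - j%:R : R.
have m0 : 0 <= m by rewrite subr_ge0 ler_nat ltnW.
have lam1 : 0 < lam + 1 by rewrite ltr_wpDl.
(* W^q = e^q j + e^q m, where e^q j is controlled by the gap and e^q is small *)
have Eq0 : 0 <= e j `^ x^-1 by exact: powR_ge0.
have hj := hE _ _ _ _ LS Aj.
have Ej : e j `^ x^-1 * j%:R <= D1 * (1 + B) * (lam + 1).
  apply: (le_trans hj); rewrite -mulrA ler_wpM2l//; nra.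
have Esmall : e j `^ x^-1 <= D1 * (1 + B) / J.
  rewrite ler_pdivlMr//; rewrite -(ler_pM2r lam1) -mulrA.
  by apply: le_trans Ej; rewrite ler_wpM2l.
have Wq : W `^ x^-1 <= D1 * (1 + B) * (lam + 1) + D1 * (1 + B) / J * m.
  rewrite WE (_ : k%:R = j%:R + m); last by rewrite /m addrC subrK.
  by rewrite mulrDr lerD// ler_wpM2r.
have Mle : Num.max 0 (T k - T j) + K <= m + lam + B + K.
  have h := lowb _ Aj; rewrite lerD2r ge_max; apply/andP; split; first exact: addr_ge0 (addr_ge0 m0 lam0) B0.
  rewrite /m; lra.
have M0 : 0 <= m + lam + B + K := addr_ge0 (addr_ge0 (addr_ge0 m0 lam0) B0) K0.
have t1 := hn W (m + lam + B + K) W0 M0.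
have t2 := hl W W0; rewrite mul1r in t2.
have t3 : W * (Num.max 0 (T k - T j) + K) `^ y <= W * (m + lam + B + K) `^ y.
  apply: ler_wpM2l => //; apply: ge0_ler_powR; rewrite ?nnegrE ?(ltW y0)//.
  by rewrite addr_ge0// le_max lexx.
have lnle : ln (k%:R / j%:R) <= m / J :> R.
  have -> : k%:R / j%:R = 1 + m / j%:R :> R by rewrite /m; field; rewrite gt_eqF.
  apply: (le_trans (le_ln1Dx _)); first by rewrite (@lt_le_trans _ _ 0)// divr_ge0// ltW.
  apply: ler_wpM2l => //; rewrite lef_pV2 ?posrE//; apply: le_trans Jj.
  by rewrite ler_peMr ?(ltW J0)// lerDr.
have Plnle : P * ln (k%:R / j%:R) <= P * (m / J) by exact: ler_wpM2l.
have s1 : (1 + Dn) * (D1 * (1 + B) / J * m) <= y / 8 * m.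
  rewrite !mulrA ler_wpM2r// ler_pdivrMr//.
  have -> : (1 + Dn) * D1 * (1 + B) = y / 8 * J1 by rewrite /J1; field; rewrite gt_eqF.
  by apply: ler_wpM2l; [exact: ltW|rewrite /J; lra].
have s2 : P * (m / J) <= m / 8.
  rewrite mulrCA ler_wpM2l// ler_pdivrMr// ler_pdivlMl//; rewrite /J; lra.
have Wq2 := ler_wpM2l Dn1 Wq.
have xE : 0 <= x * (e j `^ x^-1 * k%:R) by rewrite mulr_ge0 ?(ltW x0)// mulr_ge0.
have kE : k%:R = j%:R + m by rewrite /m addrC subrK.
have ys2 : y * (P * ln (k%:R / j%:R)) <= y * (m / 8) by rewrite ler_wpM2l ?(ltW y0)// (le_trans Plnle).
have yT : y * T j <= y * (j%:R + lam) by rewrite ler_wpM2l ?(ltW y0)//; lra.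
have h1 := mulr_ge0 K0 lam0; have h2 := mulr_ge0 Dl0 lam0.
have h3 := mulr_ge0 (mulr_ge0 (ltW y0) K0) lam0; have h4 := mulr_ge0 (mulr_ge0 (ltW y0) B0) lam0.
have ym := mulr_ge0 (ltW y0) m0.
rewrite -/m mulrAC ler_pdivlMr//.
move: H t1 t2 t3 Wq2 s1 ys2 yT xE; rewrite /Q0 kE.
move: (W `^ x^-1) (W * (Num.max _ _ + K) `^ y) (W * (m + lam + B + K) `^ y) (D1 * (1 + B)) (P * ln _) (e j `^ x^-1) => Wx a1 a2 DD a3 E.
move: (DD / J * m) => DJm H t1 t2 t3 Wq2 s1 ys2 yT xE.
have xE2 : x = 1 - y by rewrite -xy addrK.
rewrite xE2 in H xE; lra.
Qed.

Lemma size_filter_range (A : pred nat) (a h : nat) (s : seq nat) : uniq s ->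
  (forall k, k \in s -> A k -> (a <= k < a + h)%N) -> (size [seq k <- s | A k] <= h)%N.
Proof.
move=> us H; rewrite -[leqRHS](size_iota a); apply: uniq_leq_size; first exact: filter_uniq.
by move=> k; rewrite mem_filter mem_iota => /andP[Ak ks]; exact: H.
Qed.

(** Indices below J (lam + 1) are counted trivially; all others lie within C (lam + 1) of the
    smallest of them. *)
Lemma level_count : exists B C : R, [/\ 0 <= B, 0 <= C & forall A T e, level_system A T e ->
  (forall k, A k -> - B <= T k - k%:R) /\
  forall lam N, 0 <= lam ->
    (size [seq k <- iota 0 N | A k && (T k - k%:R <= lam)])%:R <= C * (lam + 1)].
Proof.
have [B [J [C [B0 J0 C0 H]]]] := level_gap.
exists B, (J + C + 2); split => //; first by rewrite !addr_ge0.
move=> A T e LS; have [lowb gap] := H _ _ _ LS; split => // lam N lam0.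
have lam1 : 0 <= lam + 1 by rewrite addr_ge0.
set s := [seq k <- _ | _]; have us : uniq s by rewrite filter_uniq// iota_uniq.
pose L : pred nat := fun k => k%:R < J * (lam + 1).
have -> : size s = (size [seq k <- s | L k] + size [seq k <- s | predC L k])%N by rewrite !(size_filter _ s) count_predC.
pose h1 := (Num.truncn (J * (lam + 1))).+1.
pose h2 := (Num.truncn (C * (lam + 1))).+1.
have S1 : (size [seq k <- s | L k] <= h1)%N.
  apply: (@size_filter_range _ 0) => // k _; rewrite add0n /L /= => kJ.
  by rewrite -(ltr_nat R) (lt_trans kJ)// truncnS_gt.
have S2 : (size [seq k <- s | predC L k] <= h2)%N.
  have [/eqP ->//|] := boolP ([seq k <- s | predC L k] == [::]).
  rewrite -has_filter => /hasP ex.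
  have exj : exists j, (j \in s) && ~~ L j by have [j js Lj] := ex; exists j; rewrite js.
  case: (ex_minnP exj) => j /andP[js Lj] minj.
  apply: (@size_filter_range _ j) => // k ks /= Lk.
  have jk : (j <= k)%N by apply: minj; rewrite ks.
  rewrite jk/=; move: jk; rewrite leq_eqVlt => /predU1P[<-|jk]; first by rewrite addnS ltnS leq_addr.
  move: js ks; rewrite !mem_filter => /andP[/andP[Aj bj] _] /andP[/andP[Ak bk] _].
  have := gap lam j k lam0 Aj Ak jk bj bk; rewrite leNgt => /(_ Lj) h.
  rewrite -(ltr_nat R) natrD -ltrBlDl; apply: le_lt_trans h _; exact: truncnS_gt.
have H1 : h1%:R <= J * (lam + 1) + 1 :> R by rewrite /h1 -natr1 lerD2r truncn_le// mulr_ge0.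
have H2 : h2%:R <= C * (lam + 1) + 1 :> R by rewrite /h2 -natr1 lerD2r truncn_le// mulr_ge0.
apply: (@le_trans _ _ (h1%:R + h2%:R)); first by rewrite -natrD ler_nat leq_add.
apply: (le_trans (lerD H1 H2)); nra.
Qed.

(** Summation by layers: there are O(i + 1) indices with gap at most i, and (i + 1) exp(-i) <= 2
    exp(-i/2) yields a geometric series. *)
Lemma level_sum : exists2 C : R, 0 <= C & forall A T e N, level_system A T e ->
  \sum_(k <- iota 0 N | A k) expR (k%:R - T k) <= C.
Proof.
have [B [C [B0 C0 H]]] := level_count.
pose rho : R := expR (- 2^-1).
have rho0 : 0 < rho by exact: expR_gt0.
have rho1 : rho < 1 by rewrite /rho -[ltRHS]expR0 ltr_expR oppr_lt0 invr_gt0.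
have rho1' : 0 < 1 - rho by rewrite subr_gt0.
exists (expR (B + 1) * (C * (2 / (1 - rho)))).
  by rewrite mulr_ge0 ?expR_ge0// mulr_ge0// divr_ge0// ltW.
move=> A T e N LS; have [lowb cnt] := H _ _ _ LS.
rewrite -big_filter; set s := [seq k <- _ | _].
have sA k : k \in s -> A k by rewrite mem_filter => /andP[].
pose b k : R := T k - k%:R.
(* An integer above the gap by at most 1. Negative gaps, bounded below by -B, are counted with i0 =
   1 and paid for by the factor exp(B + 1). *)
pose i0 k := (Num.truncn (Num.max 0 (b k))).+1.
pose I := (\max_(k <- s) i0 k).+1.
have iI k : k \in s -> (i0 k < I)%N by move=> ks; rewrite ltnS; exact: leq_bigmax_seq.
have m0 k : 0 <= Num.max 0 (b k) by rewrite le_max lexx.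
have bi k : b k <= (i0 k)%:R.
  by apply: (@le_trans _ _ (Num.max 0 (b k))); [rewrite le_max lexx orbT|exact/ltW/truncnS_gt].
have ib k : (i0 k)%:R <= Num.max 0 (b k) + 1 by rewrite -natr1 lerD2r truncn_le.
have ptw k : k \in s -> expR (k%:R - T k) <= expR (B + 1) * \sum_(i < I) (b k <= i%:R)%R%:R * expR (- i%:R).
  move=> ks; apply: (@le_trans _ _ (expR (B + 1) * expR (- (i0 k)%:R))).
    rewrite -expRD ler_expR; have := ib k; have := lowb _ (sA _ ks); rewrite -/(b k).
    have -> : k%:R - T k = - b k by rewrite /b opprB.
    by case: (leP 0 (b k)) => h; rewrite ?(max_idPr h) ?(max_idPl (ltW h)); lra.
  rewrite ler_pM2l ?expR_gt0// (bigD1 (Ordinal (iI _ ks)))//= bi mul1r lerDl.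
  by apply: sumr_ge0 => i _; rewrite mulr_ge0 ?expR_ge0.
apply: (@le_trans _ _ (\sum_(k <- s) (expR (B + 1) * \sum_(i < I) (b k <= i%:R)%R%:R * expR (- i%:R)))).
  by rewrite big_seq [leRHS]big_seq; apply: ler_sum => k ks; exact: ptw.
rewrite -mulr_sumr ler_pM2l ?expR_gt0// exchange_big/=.
apply: (@le_trans _ _ (\sum_(i < I) C * (2 * rho ^+ i))).
  apply: ler_sum => i _; rewrite -mulr_suml.
  have -> : \sum_(k <- s) (b k <= i%:R)%R%:R = (size [seq k <- iota 0 N | A k && (T k - k%:R <= i%:R)])%:R :> R.
    rewrite /s big_filter -natr_sum size_filter -sum1_count; congr _%:R.
    by rewrite [RHS]big_mkcondr; apply: eq_bigr => k _; rewrite /b; case: (_ <= _).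
  apply: (le_trans (ler_wpM2r (expR_ge0 _) (cnt _ N (ler0n _ i)))).
  rewrite -mulrA ler_wpM2l//.
  have E : rho ^+ i = expR (- (i%:R / 2)).
    by rewrite /rho -expRM_natl; congr expR; rewrite mulrN.
  have -> : expR (- i%:R) = rho ^+ i * rho ^+ i :> R.
    by rewrite E -expRD; congr expR; field.
  rewrite mulrA ler_wpM2r ?exprn_ge0 ?(ltW rho0)// E.
  rewrite -ler_pdivlMr ?expR_gt0// expRN invrK.
  by have := expR_ge1Dx (i%:R / 2 : R); lra.
rewrite -mulr_sumr ler_wpM2l// -mulr_sumr ler_wpM2l// -[leRHS]div1r ler_pdivlMr//.
have := subrX1 rho I; have : 0 <= rho ^+ I by rewrite exprn_ge0// ltW.
by rewrite mulrC => h1 h2; lra.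
Qed.

End level_counting.

(** * Exact growth *)

Section exp_remainder.
Context {R : realType}.

Lemma is_derive_monomial N (t : R) :
  is_derive t 1 (fun t : R => t ^+ N.+1 / N.+1`!%:R) (t ^+ N / N`!%:R).
Proof.
have h := is_derive_scaleR (N.+1`!%:R)^-1 (is_deriveX N.+1 (is_derive_id t 1)).
have -> : (fun t : R => t ^+ N.+1 / N.+1`!%:R) = (fun t => (N.+1`!%:R)^-1 * (id ^+ N.+1) t).
  by apply/funext => x; rewrite mulrC exprfctE.
apply: (is_derive_value h); rewrite factS natrM /GRing.scale/= mulr1.
have := fact_gt0 N; rewrite -(ltr_nat R) => f0.
by field; rewrite gt_eqF// gt_eqF.
Qed.

Lemma is_derive_exp_remainder N (t : R) :
  is_derive t 1 (exp_remainder N.+1) (exp_remainder N t).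
Proof.
elim: N => [|N IH].
  have -> : exp_remainder 1 = (fun t : R => expR t + (- (1 + t))).
    by apply/funext => x; rewrite /exp_remainder !big_nat_recr//= big_nil expr0 expr1 fact0 !divr1 add0r.
  have h := is_derive_addR (is_derive_expR t) (is_derive_oppR (is_derive_addR (is_derive_cst (1 : R) t 1) (is_derive_id t 1))).
  by apply: (is_derive_value h); rewrite /exp_remainder big_nat_recr//= big_nil expr0 fact0 divr1 !add0r.
have -> : exp_remainder N.+2 = (fun t : R => exp_remainder N.+1 t + (- (t ^+ N.+2 / N.+2`!%:R))).
  by apply/funext => x; rewrite /exp_remainder [in LHS]big_nat_recr//= opprD addrA.
have h := is_derive_addR IH (is_derive_oppR (is_derive_monomial N.+1 t)).
apply: (is_derive_value h).
by rewrite /exp_remainder [in RHS]big_nat_recr//= opprD addrA.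
Qed.

Lemma exp_remainder0 N : exp_remainder N 0 = 0 :> R.
Proof.
rewrite /exp_remainder big_nat_recl// expr0 fact0 divr1 expR0 big1 ?addr0 ?subrr// => i _.
by rewrite expr0n mul0r.
Qed.

(** Each remainder is the derivative of the next and vanishes at 0, so the mean value theorem gains
    one power of t at each step. *)
Lemma exp_remainder_ge0_le N (t : R) : 0 <= t ->
  0 <= exp_remainder N t /\ (t <= 1 -> exp_remainder N t <= expR 1 * t ^+ N.+1).
Proof.
elim: N t => [|N IH] t t0.
  have E s : exp_remainder 0 s = expR s - 1 :> R.
    by rewrite /exp_remainder big_nat_recr//= big_nil add0r expr0 fact0 divr1.
  rewrite E expr1; split => [|t1].
    by rewrite subr_ge0 -[leLHS]expR0 ler_expR.
  have cw : {within `[0, t], continuous (@expR R)}.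
    by apply: continuous_subspaceT => x; exact: continuous_expR.
  have [c] := MVT_segment t0 (fun x _ => is_derive_expR x) cw.
  rewrite in_itv/= => /andP[c0 ct]; rewrite subr0 expR0 => ->.
  by rewrite ler_wpM2r// ler_expR (le_trans ct).
have cw : {within `[0, t], continuous (@exp_remainder R N.+1)}.
  by apply: continuous_subspaceT => x; exact: derive_continuous (is_derive_exp_remainder N x).
have [c] := MVT_segment t0 (fun x _ => is_derive_exp_remainder N x) cw.
rewrite in_itv/= exp_remainder0 !subr0 => /andP[c0 ct] ->.
have [r0 r1] := IH _ c0; split; first by rewrite mulr_ge0.
move=> t1; rewrite [in leRHS]exprSr mulrA ler_wpM2r//.
apply: (le_trans (r1 (le_trans ct t1))); rewrite ler_wpM2l ?expR_ge0//.
by rewrite lerXn2r ?nnegrE.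
Qed.

Lemma exp_remainder_le_exp N (t : R) : 0 <= t -> exp_remainder N t <= expR t.
Proof.
move=> t0; rewrite /exp_remainder gerBl; apply: sumr_ge0 => i _.
by rewrite divr_ge0 ?exprn_ge0.
Qed.

End exp_remainder.

Section existence.
Context {R : realType}.
Variables (n alpha : nat).
Hypotheses (alpha_gt0 : (0 < alpha)%N) (alpha_lt_n : (alpha < n)%N).
Notation leb := (@lebesgue_rV R n).
Notation gam := (@gamma_const R n alpha).
Notation iq := (alpha%:R / n%:R : R).
Notation iq' := ((n%:R - alpha%:R) / n%:R : R).
Notation q := (n%:R / alpha%:R : R).
Notation q' := (n%:R / (n%:R - alpha%:R) : R).

Let n0 : (0 < n)%N. Proof. exact: leq_trans alpha_lt_n. Qed.
Let n0' : (0 : R) < n%:R. Proof. by rewrite ltr0n. Qed.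
Let al0 : (0 : R) < alpha%:R. Proof. by rewrite ltr0n. Qed.
Let na0 : (0 : R) < n%:R - alpha%:R. Proof. by rewrite subr_gt0 ltr_nat. Qed.
Let iq0 : 0 < iq. Proof. by rewrite divr_gt0. Qed.
Let iq'0 : 0 < iq'. Proof. by rewrite divr_gt0. Qed.
Let q0 : 0 < q. Proof. by rewrite divr_gt0. Qed.
Let q1 : 1 <= q. Proof. by rewrite ler_pdivlMr// mul1r ler_nat ltnW. Qed.
Let q'0 : 0 < q'. Proof. by rewrite divr_gt0. Qed.
Let iqD : iq + iq' = 1. Proof. by field; rewrite gt_eqF. Qed.
Let g0 : 0 < gam := gamma_const_gt0 alpha_gt0 alpha_lt_n.

Variable p : R.
Hypothesis p1 : 1 <= p.
Let p0 : 0 < p. Proof. exact: lt_le_trans p1. Qed.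
Let piq0 : 0 < p * iq. Proof. exact: mulr_gt0. Qed.
Let piq'0 : 0 < p * iq'. Proof. exact: mulr_gt0. Qed.

Definition level_set (u : 'rV[R]_n -> R) (k : nat) : set 'rV[R]_n :=
  [set x | k%:R <= gam * `|u x| `^ q' < k.+1%:R].

Lemma measurable_scaled_power (g : R) (u : 'rV[R]_n -> R) : measurable_fun setT u ->
  measurable_fun setT (fun x => g * `|u x| `^ q').
Proof.
move=> mu; apply: measurable_funM => //; apply: (measurableT_comp (measurable_powR q')).
exact: measurableT_comp.
Qed.

Lemma measurable_level_set u k : measurable_fun setT u -> measurable (level_set u k).
Proof.
move=> mu; have := measurable_scaled_power gam mu measurableT (measurable_itv `[k%:R, k.+1%:R[).
by rewrite setTI.
Qed.

Lemma trivIset_level_set u : trivIset setT (level_set u).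
Proof.
apply/trivIsetP => i j _ _ ij; apply/seteqP; split => // x [/= /andP[i1 i2] /andP[j1 j2]].
have : (i < j.+1)%N by rewrite -(ltr_nat R) (le_lt_trans i1).
have : (j < i.+1)%N by rewrite -(ltr_nat R) (le_lt_trans j1).
by rewrite !ltnS => ji ij'; move: ij; rewrite eqn_leq ij' ji.
Qed.

Lemma bigcup_level_set u : \bigcup_k level_set u k = setT.
Proof.
apply/seteqP; split => // x _.
have t0 : 0 <= gam * `|u x| `^ q' by rewrite mulr_ge0 ?powR_ge0// ltW.
by exists (Num.truncn (gam * `|u x| `^ q')) => //; apply/andP; split; [rewrite truncn_le|exact: truncnS_gt].
Qed.

Lemma level_set_ge u k x : level_set u k x -> (k%:R / gam) `^ iq' <= `|u x|.
Proof.
move=> /andP[h _]; have ux : 0 <= `|u x| `^ q' by exact: powR_ge0.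
have E : `|u x| = (`|u x| `^ q') `^ iq'.
  by rewrite -powRrM (_ : q' * iq' = 1) ?powRr1//; field; rewrite !gt_eqF.
have kg : k%:R / gam <= `|u x| `^ q' by rewrite ler_pdivrMr// mulrC.
have kg0 : 0 <= k%:R / gam by rewrite divr_ge0// ltW.
by rewrite E; exact: (ge0_ler_powR (ltW iq'0)).
Qed.

Lemma level_set_measure (u : 'rV[R]_n -> R) (k : nat) (Q : R) : measurable_fun setT u ->
  (\int[leb]_x (`|u x| `^ p)%:E <= Q%:E)%E -> (0 < k)%N ->
  (leb (level_set u k) <= (Q * (gam / k%:R) `^ (p * iq'))%:E)%E.
Proof.
move=> mu uQ k0; have kR : (0 : R) < k%:R by rewrite ltr0n.
have mS := measurable_level_set k mu.
have a0 : 0 < (k%:R / gam) `^ (p * iq') by rewrite powR_gt0// divr_gt0.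
have H : (((k%:R / gam) `^ (p * iq'))%:E * leb (level_set u k) <= Q%:E)%E.
  apply: le_trans uQ; rewrite -integral_cst//.
  have nn x : (0 <= (`|u x| `^ p)%:E)%E by rewrite lee_fin powR_ge0.
  apply: (@le_trans _ _ (\int[leb]_(x in level_set u k) (`|u x| `^ p)%:E)%E); last first.
    by apply: ge0_subset_integral => //; exact: measurable_powR_norm.
  apply: ge0_le_integral => //.
  - by move=> x _; rewrite lee_fin ltW.
  - by apply: measurable_funTS; exact: measurable_powR_norm.
  move=> x Sx; rewrite lee_fin (mulrC p) powRrM.
  by apply: (ge0_ler_powR (ltW p0)); rewrite ?nnegrE ?powR_ge0//; exact: level_set_ge.
have -> : (gam / k%:R) `^ (p * iq') = ((k%:R / gam) `^ (p * iq'))^-1.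
  have h0 : 0 <= k%:R / gam by rewrite divr_ge0// ltW.
  by rewrite -(invf_div k%:R gam) -(powR_inv1 h0) -powRrM mulN1r powRN.
have fin : leb (level_set u k) \is a fin_num.
  rewrite ge0_fin_numE//; case E : (leb (level_set u k)) H => [r| |]//=; first by rewrite ltry.
  by rewrite gt0_muley ?lte_fin// leye_eq.
move: H; rewrite -(fineK fin) -EFinM !lee_fin => H.
by rewrite ler_pdivlMr// mulrC.
Qed.

Notation lambda0 := (1 + gam `^ (p * iq')).

(** The scale lambda0 Q k^(p/q) bounds s_k, because Chebyshev gives Q (gamma/k)^(p/q'), lambda0 >=
    gamma^(p/q') and k >= 1. It also gives (Q/tau)^(1/p) <= k^(-1/q), and its growth in k is the
    source of the term P ln (k/j). Levels of measure 0 are left out, as T would be meaningless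
    there. *)
Lemma level_set_system : exists2 K : R, 0 <= K &
  forall u (F : 'rV[R]_n -> 'rV[R]_(nabla_dim n alpha)) (Q : R),
  weak_nabla alpha u F -> 0 < Q -> (\int[leb]_x (`|u x| `^ p)%:E <= Q%:E)%E ->
  (\int[leb]_y (enorm (F y) `^ q)%:E <= 1%:E)%E ->
  let s k := fine (leb (level_set u k)) in
  exists e, level_system iq iq' K (p * iq) (fun k => (0 < k)%N && (0 < s k))
    (fun k => ln (lambda0 * Q * k%:R `^ (p * iq) / s k)) e.
Proof.
have [K0 K00 LB] := level_bound alpha_gt0 alpha_lt_n p1.
(* [level_bound] is multiplied by gamma^(1/q'), which turns X/gamma + K0 inside the power into X +
   K0 gamma; K dominates this constant and K0 gamma^(1/q'). *)
pose K := K0 * gam `^ iq' + K0 * gam.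
have Kg0 : 0 <= K0 * gam `^ iq' by rewrite mulr_ge0 ?powR_ge0.
have Kg1 : 0 <= K0 * gam by rewrite mulr_ge0// ltW.
exists K; first exact: addr_ge0.
move=> u F Q wu Q0 uQ F1 s.
have [[mu _] locF _] := wu.
have mf : measurable_fun setT (fun y => enorm (F y)) by apply: measurable_enorm => j; case: (locF j).
have L1 : 1 <= lambda0 by rewrite lerDl powR_ge0.
have L0 : 0 < lambda0 by exact: lt_le_trans L1.
pose tau (k : nat) := lambda0 * Q * k%:R `^ (p * iq).
have LQ0 : 0 < lambda0 * Q by rewrite mulr_gt0.
have tau0 k : (0 < k)%N -> 0 < tau k by move=> k0; rewrite mulr_gt0// powR_gt0// ltr0n.
have sE k : (0 < k)%N -> (leb (level_set u k) = (s k)%:E)%E.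
  move=> k0; rewrite /s fineK// ge0_fin_numE//.
  exact: le_lt_trans (level_set_measure mu uQ k0) (ltry _).
have stau k : (0 < k)%N -> s k <= tau k.
  move=> k0; have kR : (1 : R) <= k%:R by rewrite ler1n.
  have := level_set_measure mu uQ k0; rewrite sE// lee_fin => /le_trans; apply.
  rewrite /tau (mulrC lambda0 Q) -[leRHS]mulrA (ler_pM2l Q0).
  apply: (@le_trans _ _ (gam `^ (p * iq'))).
    have k0' : (0 : R) < k%:R by rewrite ltr0n.
    have gk : gam / k%:R <= gam by rewrite ler_pdivrMr// ler_peMr// ltW.
    have gk0 : 0 <= gam / k%:R by rewrite divr_ge0// ltW.
    by apply: (ge0_ler_powR (ltW piq'0) _ _ gk); rewrite nnegrE// ltW.
  rewrite -[leLHS]mulr1; apply: ler_pM; rewrite ?powR_ge0//; first by rewrite lerDr.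
  by rewrite -[leLHS](powRr0 k%:R); apply: ler_powR => //; exact: ltW.
have f0 y : 0 <= enorm (F y) by exact: sqrtr_ge0.
(* One weight and energy for each level of positive measure; the pair (0, 0) is a default for null
   levels. *)
have /choice[we weP] : forall k : nat, exists we : ('rV[R]_n -> R) * R, 0 < s k ->
    0 <= we.2 <= 1 /\ top_weight alpha (fun y => enorm (F y)) we.1 (s k) we.2.
  move=> k; have [sk|sk] := ltP 0 (s k); last by exists (fun=> 0, 0).
  by have [w [e we]] := exists_top_weight alpha_gt0 alpha_lt_n mf f0 F1 sk; exists (w, e).
exists (fun k => (we k).2); split => [k /andP[k0 sk]|j k /andP[j0 sj] /andP[k0 sk] jk].
  split => //; last by case: (weP k sk).
  by rewrite ln_ge0// ler_pdivlMr// mul1r; exact: stau.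
have kR : (0 : R) < k%:R by rewrite ltr0n.
have jR : (0 : R) < j%:R by rewrite ltr0n.
have [e01 tw] := weP j sj; have /andP[e0 e1] := e01.
have tjk : tau j <= tau k.
  rewrite /tau ler_pM2l//; apply: (ge0_ler_powR (ltW piq0)); rewrite ?nnegrE//.
  by rewrite ler_nat.
have a0 : 0 <= (k%:R / gam) `^ iq' by exact: powR_ge0.
have := LB u F Q (level_set u k) (tau k) (s k) (s j) (we j).2 _ (we j).1 wu Q0 uQ
  (measurable_level_set k mu) (sE k k0) sk sj (stau k k0) (le_trans (stau j j0) tjk) tw e01 a0
  (fun x => @level_set_ge u k x).
rewrite -/(tau k) -/(tau j) => H.
have gi0 : 0 <= gam `^ iq' by exact: powR_ge0.
have := ler_wpM2r gi0 H.
have -> : (k%:R / gam) `^ iq' * gam `^ iq' = k%:R `^ iq'.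
  have h0 : 0 <= k%:R / gam by rewrite divr_ge0// ltW.
  by rewrite -(powRM _ h0 (ltW g0)) divfK// gt_eqF.
move=> /le_trans; apply; rewrite 3!mulrDl.
have gX X : 0 <= X -> (X / gam + K0) `^ iq' * gam `^ iq' = (X + K0 * gam) `^ iq'.
  move=> X0; have h0 : 0 <= X / gam + K0 by rewrite addr_ge0// divr_ge0// ltW.
  by rewrite -(powRM _ h0 (ltW g0)) mulrDl divfK// gt_eqF.
have E0 : 0 <= 1 - (we j).2 `^ q.
  rewrite subr_ge0; have h1 : 1 `^ q = 1 :> R by rewrite powR1.
  by rewrite -[leRHS]h1; apply: (ge0_ler_powR (ltW q0)); rewrite ?nnegrE.
have lntau : ln (tau k) - ln (tau j) = p * iq * ln (k%:R / j%:R).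
  have lnt i : (0 < i)%N -> ln (tau i) = ln (lambda0 * Q) + p * iq * ln i%:R.
    move=> i0; have iR : (0 : R) < i%:R by rewrite ltr0n.
    by rewrite /tau lnM ?posrE ?powR_gt0// ln_powR.
  rewrite (lnt k k0) (lnt j j0) ln_div ?posrE//; ring.
have mono X Y : 0 <= X -> X <= Y -> (X + K0 * gam) `^ iq' <= (Y + K) `^ iq'.
  move=> X0 XY; have KK : K0 * gam <= K by rewrite lerDr.
  have h : X + K0 * gam <= Y + K by exact: lerD.
  have h0 : 0 <= X + K0 * gam by exact: addr_ge0.
  by apply: (ge0_ler_powR (ltW iq'0) _ _ h); rewrite nnegrE// (le_trans h0).
apply: lerD; last first.
  rewrite (invf_div alpha%:R n%:R) -[_ * _ * gam `^ iq']mulrA gX; last by rewrite le_max lexx.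
  apply: ler_wpM2l; first exact: powR_ge0.
  rewrite (max_idPr _); last by rewrite ln_ge0// ler_pdivlMr// mul1r (le_trans (stau j j0)).
  rewrite -/(tau j) -lntau; apply: mono.
    by rewrite ln_ge0// ler_pdivlMr// mul1r (le_trans (stau j j0)).
  rewrite !ln_div ?posrE ?tau0//; lra.
apply: lerD; last first.
  rewrite -[_ * _ * gam `^ iq']mulrA gX; last by rewrite le_max lexx.
  apply: ler_wpM2l => //; apply: mono; first by rewrite le_max lexx.
  rewrite ge_max !le_max lexx/=; apply/orP; right.
  rewrite -/(tau j) -/(tau k) !ln_div ?posrE ?tau0//.
  have : ln (tau j) <= ln (tau k) by rewrite ler_ln ?posrE ?tau0.
  lra.
apply: lerD; last first.
  by rewrite mulrAC ler_wpM2r// lerDl.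
rewrite mulrAC; apply: ler_pM; rewrite ?powR_ge0//; first by rewrite lerDl.
have -> : Q / tau k = (lambda0 * k%:R `^ (p * iq))^-1.
  by rewrite /tau; field; rewrite !gt_eqF ?powR_gt0.
rewrite -powR_inv1 ?mulr_ge0 ?powR_ge0 ?(ltW L0)// powRM ?powR_ge0 ?(ltW L0)//.
rewrite powRM ?powR_ge0// -!powRrM -[leRHS]mul1r; apply: ler_pM; rewrite ?powR_ge0//.
  rewrite mulN1r powRN invf_le1 ?powR_gt0//.
  by rewrite -[leLHS](powRr0 lambda0); apply: ler_powR; rewrite // invr_ge0 ltW.
rewrite (_ : p * iq * (-1 * p^-1) = - iq)//; field.
by rewrite !gt_eqF.
Qed.

Lemma measurable_exp_remainder N : measurable_fun setT (exp_remainder N : R -> R).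
Proof.
rewrite /exp_remainder; apply: measurable_funB; first exact: measurable_expR.
apply: measurable_sum => j; apply: measurable_funM => //; exact: measurable_funX.
Qed.

Definition adams_integrand (g : R) (u : 'rV[R]_n -> R) (x : 'rV[R]_n) : R :=
  exp_remainder `|Num.ceil (p * iq' - 1)|%N (g * `|u x| `^ q') /
  (1 + `|u x| `^ (p * alpha%:R / (n%:R - alpha%:R))).

Lemma adams_integrand_ge0 g u x : 0 <= g -> 0 <= adams_integrand g u x.
Proof.
move=> gp; apply: divr_ge0; last by rewrite addr_ge0// powR_ge0.
by apply: (exp_remainder_ge0_le _ _).1; rewrite mulr_ge0// powR_ge0.
Qed.

Lemma measurable_adams_integrand g u : measurable_fun setT u ->
  measurable_fun setT (adams_integrand g u).
Proof.
move=> mu; apply: measurable_funM.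
  exact: (measurableT_comp (measurable_exp_remainder _) (measurable_scaled_power g mu)).
have mp : measurable_fun setT (fun x => `|u x| `^ (p * alpha%:R / (n%:R - alpha%:R))).
  by apply: (measurableT_comp (measurable_powR _)); exact: measurableT_comp.
have m1 : measurable_fun setT (fun x => 1 + `|u x| `^ (p * alpha%:R / (n%:R - alpha%:R))).
  exact: measurable_funD.
have := measurableT_comp (measurable_powR (-1)) m1; congr (measurable_fun _ _).
by apply/funext => x /=; rewrite powR_inv1// addr_ge0// powR_ge0.
Qed.

Lemma Lnorm_power_integral (r : R) (f : 'rV[R]_n -> R) : 0 < r ->
  ('N[leb]_(r%:E)[(fun x => (f x)%:E)] `^ r = \int[leb]_x (`|f x| `^ r)%:E)%E.
Proof. by move=> r0; rewrite poweR_Lnorm ?gt_eqF. Qed.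

Lemma energy_le1 m (F : 'rV[R]_n -> 'rV[R]_m) :
  ('N[leb]_(q%:E)[(fun x => (enorm (F x))%:E)] <= 1)%E ->
  (\int[leb]_y (enorm (F y) `^ q)%:E <= 1%:E)%E.
Proof.
move=> N1; have N0 := Lnorm_ge0 leb q%:E (fun x => (enorm (F x))%:E).
have h : ('N[leb]_(q%:E)[(fun x => (enorm (F x))%:E)] `^ q <= 1 `^ q)%E.
  by apply: (gt0_ler_poweR (ltW q0)); rewrite ?in_itv/= ?N0 ?leey ?lee01.
move: h; rewrite Lnorm_power_integral// poweR1r.
by under eq_integral => y _ do rewrite ger0_norm ?sqrtr_ge0//.
Qed.

(** The order of the remainder is fixed here: it behaves like t^(N+1) near 0, and N + 1 >= p/q'
    makes this at most t^(p/q'), a multiple of |u|^p. *)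
Lemma adams_integrand_le_small u x : level_set u 0 x ->
  adams_integrand gam u x <= expR 1 * gam `^ (p * iq') * `|u x| `^ p.
Proof.
move=> /andP[_ t1]; rewrite /adams_integrand; set M := absz _.
have v0 : 0 <= `|u x| `^ q' by exact: powR_ge0.
have t0 : 0 <= gam * `|u x| `^ q' by rewrite mulr_ge0// ltW.
have [E0 E1] := exp_remainder_ge0_le M t0.
have D1 : 1 <= 1 + `|u x| `^ (p * alpha%:R / (n%:R - alpha%:R)) by rewrite lerDl powR_ge0.
apply: (@le_trans _ _ (exp_remainder M (gam * `|u x| `^ q'))).
  by rewrite ler_pdivrMr ?(lt_le_trans ltr01)// ler_peMr.
apply: le_trans (E1 (ltW t1)) _; rewrite -mulrA ler_pM2l ?expR_gt0//.
have -> : gam `^ (p * iq') * `|u x| `^ p = (gam * `|u x| `^ q') `^ (p * iq').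
  rewrite powRM ?(ltW g0)// -powRrM (_ : q' * (p * iq') = p)//.
  by field; rewrite !gt_eqF.
have NM : p * iq' <= M.+1%:R.
  rewrite -[M.+1%:R]natr1 -lerBlDr /M natr_absz.
  by apply: le_trans (ceil_ge _) _; rewrite ler_int ler_norm.
set t := gam * _ in t0 t1 *.
rewrite -powR_mulrn// (_ : M.+1%:R = p * iq' + (M.+1%:R - p * iq')); last by rewrite addrC subrK.
rewrite powRD; last by rewrite addrC subrK pnatr_eq0.
rewrite -[leRHS]mulr1 ler_wpM2l ?powR_ge0//.
have h1 : 1 `^ (M.+1%:R - p * iq') = 1 :> R by rewrite powR1.
by rewrite -[leRHS]h1; apply: ge0_ler_powR; rewrite ?nnegrE ?subr_ge0 ?(ltW t1).
Qed.

(** On this level |u|^(p alpha/(n - alpha)) is at least (k/gamma)^(p/q), the power of k that cancels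
    the one in the scale of [level_set_system]. *)
Lemma adams_integrand_le_level u k x : (0 < k)%N -> level_set u k x ->
  adams_integrand gam u x <= expR k.+1%:R * (gam / k%:R) `^ (p * iq).
Proof.
move=> k0 Sx; have /andP[_ t1] := Sx; have kR : (0 : R) < k%:R by rewrite ltr0n.
have v0 : 0 <= `|u x| `^ q' by exact: powR_ge0.
have t0 : 0 <= gam * `|u x| `^ q' by rewrite mulr_ge0// ltW.
rewrite /adams_integrand; set M := absz _; set b := p * alpha%:R / _.
have b0 : 0 < b by rewrite divr_gt0// mulr_gt0.
have a0 : 0 < k%:R / gam by rewrite divr_gt0.
apply: ler_pM.
- exact: (exp_remainder_ge0_le M t0).1.
- by rewrite invr_ge0 addr_ge0// powR_ge0.
- by apply: le_trans (exp_remainder_le_exp _ t0) _; rewrite ler_expR ltW.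
have -> : (gam / k%:R) `^ (p * iq) = ((k%:R / gam) `^ (p * iq))^-1.
  by rewrite -(invf_div k%:R gam) -(powR_inv1 (ltW a0)) -powRrM mulN1r powRN.
have D0 : 0 < 1 + `|u x| `^ b by apply: lt_le_trans ltr01 _; rewrite lerDl powR_ge0.
rewrite lef_pV2 ?posrE ?powR_gt0//.
apply: (@le_trans _ _ (`|u x| `^ b)); last by rewrite lerDr.
have -> : (k%:R / gam) `^ (p * iq) = ((k%:R / gam) `^ iq') `^ b.
  by rewrite -powRrM; congr (_ `^ _); rewrite /b; field; rewrite !gt_eqF.
by apply: (ge0_ler_powR (ltW b0)); rewrite ?nnegrE ?powR_ge0//; exact: level_set_ge.
Qed.

Lemma adams_exact_growth_gamma_const : exists C : R, adams_exact_growth n alpha p gam C.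
Proof.
have [K K0 LS] := level_set_system.
have [C C0 LSum] := level_sum iq0 iq'0 iqD K0 (ltW piq0).
have L1 : 1 <= lambda0 by rewrite lerDl powR_ge0.
have L0 : 0 < lambda0 by exact: lt_le_trans L1.
pose B0 := expR 1 * gam `^ (p * iq').
have B00 : 0 <= B0 by rewrite mulr_ge0 ?expR_ge0 ?powR_ge0.
have B0E : (0 <= B0%:E)%E by rewrite lee_fin.
(* The factor e comes from exp(k + 1), and gamma^(p/q) lambda0 is what remains when the powers of k
   cancel. *)
pose c := expR 1 * gam `^ (p * iq) * lambda0.
have c0 : 0 <= c by rewrite !mulr_ge0 ?expR_ge0 ?powR_ge0 ?(ltW L0).
have cC0 : 0 <= c * C by rewrite mulr_ge0.
pose C1 := B0 + c * C + 1.
have C10 : 0 < C1 by rewrite ltr_wpDl// addr_ge0.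
exists C1 => u _ F wu F1; cbv zeta.
have [[mu _] locF _] := wu.
rewrite Lnorm_power_integral//.
have F2 := energy_le1 F1.
have mup := @measurable_powR_norm R n u p mu.
have up0 x : (0 <= (`|u x| `^ p)%:E)%E by rewrite lee_fin powR_ge0.
(* The scales tau require a positive Q, while the norm may be 0; hence a bound for every Q > 0 above
   its p-th power, applied to that power plus e / C1. C1 > 0 also settles an infinite norm. *)
suff H Q : 0 < Q -> (\int[leb]_x (`|u x| `^ p)%:E <= Q%:E)%E ->
    (\int[leb]_x (adams_integrand gam u x)%:E <= (C1 * Q)%:E)%E.
  have J0 : (0 <= \int[leb]_x (`|u x| `^ p)%:E)%E by exact: integral_ge0.
  case EJ : (\int[leb]_x (`|u x| `^ p)%:E)%E J0 => [r| |]// J0; last first.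
    by rewrite gt0_muley ?lte_fin// leey.
  apply/lee_addgt0Pr => e e0; move: J0; rewrite lee_fin => r0.
  have Q0 : 0 < r + e / C1 by rewrite ltr_wpDl// divr_gt0.
  have rQ : (\int[leb]_x (`|u x| `^ p)%:E <= (r + e / C1)%:E)%E.
    by rewrite EJ lee_fin lerDl divr_ge0 ?(ltW C10)// ltW.
  apply: le_trans (H _ Q0 rQ) _; rewrite -EFinM -EFinD lee_fin mulrDr.
  by rewrite (mulrC C1 (e / C1)) divfK// gt_eqF.
move=> Q0 uQ; have mG := measurable_adams_integrand gam mu.
have G0 x : 0 <= adams_integrand gam u x by apply: adams_integrand_ge0; exact: ltW.
pose s k := fine (leb (level_set u k)).
have [e] := LS u F Q wu Q0 uQ F2; rewrite -/s.
set A : pred nat := fun k => _; set T : nat -> R := fun k => _ => LSe.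
have sE k : (0 < k)%N -> (leb (level_set u k) = (s k)%:E)%E.
  move=> k0; rewrite /s fineK// ge0_fin_numE//.
  exact: le_lt_trans (level_set_measure mu uQ k0) (ltry _).
(* Level 0 is bounded by the L^p norm, a level of positive measure by its term in [level_sum], and a
   null level contributes nothing. *)
pose d (k : nat) : R := (k == 0)%N%:R * (B0 * Q) + (if A k then c * Q * expR (k%:R - T k) else 0).
have piece k : (\int[leb]_(x in level_set u k) (adams_integrand gam u x)%:E <= (d k)%:E)%E.
  have mS := measurable_level_set k mu.
  have [k0|k0] := posnP k.
    rewrite k0 in mS *; rewrite /d /A/= mul1r addr0.
    apply: (@le_trans _ _ (\int[leb]_(x in level_set u 0) (B0%:E * (`|u x| `^ p)%:E)%E)%E).
      apply: ge0_le_integral => //.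
      - by move=> x _; rewrite lee_fin.
      - by apply/measurable_EFinP; apply: measurable_funTS; exact: mG.
      - by apply: measurable_funeM; apply: measurable_funTS; exact: mup.
      - by move=> x Sx; rewrite -EFinM lee_fin; exact: adams_integrand_le_small.
    rewrite (ge0_integralZl leb mS (measurable_funTS mup) (fun y _ => up0 y) B0E).
    have sub : (\int[leb]_(x in level_set u 0) (`|u x| `^ p)%:E <= Q%:E)%E.
      by apply: le_trans uQ; exact: ge0_subset_integral.
    by have := @lee_wpmul2l R B0%:E B0E _ _ sub; rewrite -EFinM.
  have kR : (0 : R) < k%:R by rewrite ltr0n.
  have h : (\int[leb]_(x in level_set u k) (adams_integrand gam u x)%:E <=
      (expR k.+1%:R * (gam / k%:R) `^ (p * iq) * s k)%:E)%E.
    rewrite (EFinM _ (s k)) -(sE k k0) -integral_cst//.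
    apply: ge0_le_integral => //.
    - by move=> x _; rewrite lee_fin.
    - by apply/measurable_EFinP; apply: measurable_funTS; exact: mG.
    - by move=> x Sx; rewrite lee_fin; exact: adams_integrand_le_level.
  apply: le_trans h _; rewrite lee_fin /d gtn_eqF// mul0r add0r /A k0/=.
  case: ltP => [sk|sk]; last by rewrite mulr_ge0_le0// mulr_ge0 ?expR_ge0 ?powR_ge0.
  have tau0 : 0 < lambda0 * Q * k%:R `^ (p * iq) by rewrite mulr_gt0 ?powR_gt0// mulr_gt0.
  rewrite /T expRD expRN lnK ?posrE ?divr_gt0// invf_div.
  rewrite powRM ?(ltW g0) ?invr_ge0 ?(ltW kR)// -(powR_inv1 (ltW kR)) -powRrM mulN1r powRN.
  rewrite -/(s k) -natr1 expRD /c le_eqVlt; apply/orP; left; apply/eqP.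
  have kp : 0 < k%:R `^ (p * iq) by rewrite powR_gt0.
  move: (k%:R `^ (p * iq)) kp => kk kk0.
  move: (gam `^ (p * iq)) (gam `^ (p * iq')) L0 => g1 g2 g20.
  by field; rewrite !gt_eqF.
have CS M : \sum_(0 <= k < M) d k <= C1 * Q.
  rewrite big_split/=.
  have a1 : \sum_(0 <= k < M) (k == 0)%N%:R * (B0 * Q) <= B0 * Q.
    case: M => [|M]; first by rewrite big_geq// mulr_ge0// ltW.
    by rewrite big_nat_recl// big1 ?addr0 ?mul1r// => i _; rewrite mul0r.
  have a2 : \sum_(0 <= k < M) (if A k then c * Q * expR (k%:R - T k) else 0) <= c * C * Q.
    rewrite -big_mkcond/= -mulr_sumr (mulrAC c C Q); apply: ler_wpM2l.
      by rewrite mulr_ge0// ltW.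
    by have := LSum A T e M LSe; rewrite /index_iota subn0.
  apply: le_trans (lerD a1 a2) _.
  by rewrite /C1 [leRHS]mulrDl mul1r (mulrDl B0 (c * C) Q) lerDl ltW.
have -> : (\int[leb]_x (adams_integrand gam u x)%:E =
    \int[leb]_(x in \bigcup_k level_set u k) (adams_integrand gam u x)%:E)%E by rewrite bigcup_level_set.
rewrite ge0_integral_bigcup//; first last.
- exact: trivIset_level_set.
- by move=> x _; rewrite lee_fin.
- by rewrite bigcup_level_set; apply/measurable_EFinP.
- by move=> k; exact: measurable_level_set.
apply: lime_le.
  by apply: is_cvg_nneseries => k _ _; apply: integral_ge0 => x _; rewrite lee_fin.
apply: nearW => M; apply: le_trans (_ : (_ <= (\sum_(0 <= k < M) d k)%:E)%E) _; last by rewrite lee_fin.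
by rewrite -sumEFin; apply: lee_sum => k _; exact: piece.
Qed.

End existence.

(** * Sharpness *)

Section integration_by_parts.
Context {R : realType}.
Variable n : nat.
Implicit Types f g h : 'rV[R]_n -> R.
Notation leb := (@lebesgue_rV R n).

(** Sums and products of smooth functions form a class closed under partial derivatives, so
    smoothness of a product follows by induction on the list of derivatives. *)
Inductive smooth_alg : ('rV[R]_n -> R) -> Prop :=
 | smooth_alg_base f : smooth f -> smooth_alg f
 | smooth_alg_add f g : smooth_alg f -> smooth_alg g -> smooth_alg (fun x => f x + g x)
 | smooth_alg_mul f g : smooth_alg f -> smooth_alg g -> smooth_alg (fun x => f x * g x).

Lemma is_derive_partial f (x : 'rV[R]_n) i : differentiable f x ->
  is_derive x (delta_mx ord0 i) f (partial i f x).
Proof. by move=> df; apply: DeriveDef => //; exact: diff_derivable. Qed.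

Lemma partialM f g (x : 'rV[R]_n) i : differentiable f x -> differentiable g x ->
  partial i (fun x => f x * g x) x = partial i f x * g x + f x * partial i g x.
Proof.
move=> df dg; rewrite [LHS]/partial.
by have [_ ->] := is_derive_mulR (is_derive_partial i df) (is_derive_partial i dg).
Qed.

Lemma smooth_alg_diff f : smooth_alg f ->
  (forall x, differentiable f x) /\ forall i, smooth_alg (partial i f).
Proof.
elim=> [{}f sf|f1 f2 c1 [d1 p1] c2 [d2 p2]|f1 f2 c1 [d1 p1] c2 [d2 p2]].
- split => [x|i]; first exact: (sf [::] x).
  by apply: smooth_alg_base; exact: smooth_partial.
- split => [x|i]; first exact: differentiableD.
  rewrite (_ : partial i _ = fun x => partial i f1 x + partial i f2 x).
    exact: smooth_alg_add.
  apply/funext => x; rewrite [LHS]/partial.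
  by have [_ ->] := is_derive_addR (is_derive_partial i (d1 x)) (is_derive_partial i (d2 x)).
- split => [x|i]; first exact: differentiableM.
  rewrite (_ : partial i _ = fun x => partial i f1 x * f2 x + f1 x * partial i f2 x).
    by apply: smooth_alg_add; apply: smooth_alg_mul.
  by apply/funext => x; exact: partialM.
Qed.

Lemma smoothM f g : smooth f -> smooth g -> smooth (fun x => f x * g x).
Proof.
move=> sf sg s x.
have : smooth_alg (iter_partial s (fun x => f x * g x)).
  elim: s => [|i s IH]; last by have [_] := smooth_alg_diff IH; exact.
  by apply: smooth_alg_mul; exact: smooth_alg_base.
by case/smooth_alg_diff.
Qed.

Lemma test_functionM f g : test_function f -> smooth g -> test_function (fun x => f x * g x).
Proof.
move=> [sf cf] sg; split; first exact: smoothM.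
apply: (closure_support_sub cf) => x /= fg; apply: subset_closure => /=.
by apply: contraNneq fg => ->; rewrite mul0r.
Qed.

Lemma continuous_sqn : continuous (@sqn R n).
Proof.
move=> x; apply: differentiable_continuous.
have := differentiable_sqn_at 0 x; congr (differentiable _ _).
by apply/funext => z; rewrite subr0.
Qed.

Lemma compact_sub_sqn_ball (K : set 'rV[R]_n) : compact K -> exists s, K `<=` sqn_ball s.
Proof.
move=> cK; have [K0|/set0P K0] := eqVneq K set0; first by exists 0; rewrite K0.
have cs : {within K, continuous (@sqn R n)} by exact: continuous_subspaceT continuous_sqn.
have [c _ hc] := EVT_max_rV K0 cK cs.
exists (sqn c + 1) => x Kx; rewrite /sqn_ball/=.
by have := hc x; rewrite inE => /(_ Kx) h'; rewrite (le_lt_trans h')// ltrDl.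
Qed.

Lemma test_function_sqn_bounded f : test_function f -> exists r, forall x, r <= sqn x -> f x = 0.
Proof.
move=> [_ cK]; have [s Ks] := compact_sub_sqn_ball cK; exists s => x sx.
apply/eqP/negPn/negP => fx; have /Ks : closure [set x | f x != 0] x by exact: subset_closure.
by rewrite /sqn_ball/= ltNge sx.
Qed.

Lemma bounded_locally_integrable f M : measurable_fun setT f -> (forall x, `|f x| <= M) ->
  locally_integrable_rV f.
Proof.
move=> mf fM; split => // K cK; have mK := compact_measurable_rV cK.
have M0 : 0 <= M by exact: le_trans (normr_ge0 _) (fM 0).
have [s Ks] := compact_sub_sqn_ball cK.
apply: (@le_lt_trans _ _ (\int[leb]_(x in K) M%:E)%E).
  apply: ge0_le_integral => //.
  - by apply/measurable_EFinP; apply: measurable_funTS; exact: measurableT_comp.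
  - by move=> x _; rewrite lee_fin.
rewrite integral_cst// lte_mul_pinfty ?lee_fin//.
apply: (@le_lt_trans _ _ (leb (sqn_ball s : set 'rV[R]_n))); last exact: sqn_ball_fin.
apply: le_measure => //; rewrite inE//.
exact: measurable_sqn_ball.
Qed.

Lemma test_function_locally_integrable f : test_function f -> locally_integrable_rV f.
Proof.
move=> tf; have cf := test_function_continuous tf.
have [M _ fM] := compact_support_bounded cf tf.2.
exact: bounded_locally_integrable (continuous_measurable_rV cf) fM.
Qed.

Lemma test_function_integrable f : test_function f -> leb.-integrable setT (EFin \o f).
Proof.
move=> tf; have cf := test_function_continuous tf.
have l1 : locally_integrable_rV (fun _ : 'rV[R]_n => 1 : R).
  by apply: (@bounded_locally_integrable _ 1) => // x; rewrite normr1.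
have := integrable_mul_compact_support l1 cf tf.2; congr (_.-integrable _ _).
by apply/funext => x /=; rewrite mul1r.
Qed.

Lemma is_derive_line f (e x : 'rV[R]_n) (t : R) : differentiable f (x + t *: e) ->
  is_derive t 1 (fun s : R => f (x + s *: e)) ('D_e f (x + t *: e)).
Proof.
move=> df; have E : (fun s : R => s^-1 *: (((fun s : R => f (x + s *: e)) \o shift t) (s *: (1 : R)) -
    f (x + t *: e))) = (fun s : R => s^-1 *: ((f \o shift (x + t *: e)) (s *: e) - f (x + t *: e))).
  apply/funext => s /=; congr (_ *: (f _ - _)).
  by rewrite /GRing.scale/= mulr1 addrCA addrC -scalerDl addrC.
apply: DeriveDef; first by rewrite /derivable E; exact: (diff_derivable df).
by rewrite /derive E.
Qed.

Lemma sqn_delta (i : 'I_n) : sqn (delta_mx ord0 i : 'rV[R]_n) = 1.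
Proof.
rewrite /sqn (bigD1 i)//= big1 ?addr0 ?mxE ?eqxx ?expr1n// => j ji.
by rewrite mxE/= (negPf ji) expr0n.
Qed.

(** Difference quotients integrate to 0 by translation invariance. They converge to the derivative
    and are dominated, by the mean value theorem, by a multiple of the indicator of a fixed ball. *)
Lemma integral_partial h i : test_function h -> (\int[leb]_x (partial i h x)%:E = 0)%E.
Proof.
move=> th; have tp := test_function_partial i th.
have [sh cK] := th; have dh x : differentiable h x by exact: (sh [::] x).
have ch := test_function_continuous th; have mh := continuous_measurable_rV ch.
have mp := continuous_measurable_rV (test_function_continuous tp).
have [M M0 hM] := compact_support_bounded (test_function_continuous tp) tp.2.
have [r hr] := test_function_sqn_bounded th.
set e : 'rV[R]_n := delta_mx ord0 i.
pose tk (k : nat) : R := k.+1%:R^-1.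
have tk0 k : 0 < tk k by rewrite invr_gt0.
have tk1 k : tk k <= 1 by rewrite invf_le1// ler1n.
pose g (k : nat) (x : 'rV[R]_n) := k.+1%:R * (h (x + tk k *: e) - h x).
(* Outside this ball x and x + t e both have squared norm at least r for 0 < t <= 1, because |x|^2
   <= 2 |x + t e|^2 + 2 t^2. *)
pose B : set 'rV[R]_n := sqn_ball (2 * `|r| + 2).
have ih := test_function_integrable th.
have ihk k : leb.-integrable setT (fun x => (h (x + tk k *: e))%:E).
  exact: (integrable_translate (f := EFin \o h)).
have Ig k : (\int[leb]_x (g k x)%:E = 0)%E.
  transitivity ((k.+1%:R)%:E * (\int[leb]_x ((h (x + tk k *: e))%:E - (h x)%:E)))%E.
    rewrite -(integralZl measurableT (integrableB measurableT (ihk k) ih)).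
    by apply: eq_integral => x _; rewrite /g EFinM EFinB.
  rewrite integralB// (integral_translate_signed (f := EFin \o h))//; last exact/measurable_EFinP.
  by rewrite subee ?mule0//; exact: integrable_fin_num.
have gM k x : `|g k x| <= M * \1_B x.
  rewrite indicE mem_sqn_ball; case: ltP => xB; last first.
    have rr : r <= `|r| by exact: ler_norm.
    have r0 : 0 <= `|r| by [].
    rewrite mulr0 /g (hr x) ?subr0; last by lra.
    rewrite (hr (x + tk k *: e)) ?mulr0 ?normr0//.
    have := sqnD_le (x + tk k *: e) (- (tk k *: e)).
    rewrite addrK sqnN sqnZ sqn_delta mulr1.
    have : tk k ^+ 2 <= 1 by rewrite expr_le1// ltW.
    by lra.
  rewrite mulr1 /g.
  have dl (t : R) : is_derive t 1 (fun s : R => h (x + s *: e)) ('D_e h (x + t *: e)).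
    exact: is_derive_line.
  have cl : {within `[0, tk k], continuous (fun s : R => h (x + s *: e))}.
    by apply: continuous_subspaceT => t; exact: derive_continuous (dl t).
  have [c _] := MVT_segment (ltW (tk0 k)) (fun t _ => dl t) cl.
  rewrite scale0r addr0 subr0 => ->.
  rewrite mulrCA /tk divff ?pnatr_eq0// mulr1; exact: hM.
have tkcvg : tk k @[k --> \oo] --> (0 : R) by exact: cvg_harmonic.
have cvg_g x : (g k x)%:E @[k --> \oo] --> (partial i h x)%:E.
  apply/cvg_EFin; first by near=> k.
  have dc : (s^-1 *: ((h \o shift x) (s *: e) - h x)) @[s --> (0 : R)^'] --> partial i h x.
    exact: (diff_derivable (v := e) (dh x)).
  have tkn k : tk k != 0 by rewrite gt_eqF.
  have := (cvgr_dnbhsP _ _ _).1 dc tk (conj tkn tkcvg).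
  set G := (G in G @ _ --> _ -> _) => hG.
  suff -> : fine \o (fun k => (g k x)%:E) = G by [].
  by apply/funext => k /=; rewrite /G /g /tk invrK /GRing.scale/= (addrC _ x).
have mB : measurable B := measurable_sqn_ball _.
have iB : leb.-integrable setT (fun x => (M * \1_B x)%:E).
  apply/integrableP; split.
    by apply/measurable_EFinP; apply: measurable_funM => //; exact: measurable_indic.
  under eq_integral => x _ do rewrite gee0_abs ?lee_fin ?mulr_ge0// EFinM.
  rewrite ge0_integralZl//; last by apply/measurable_EFinP; exact: measurable_indic.
  rewrite integral_indic// setIT lte_mul_pinfty ?lee_fin//; exact: sqn_ball_fin.
have := @dominated_cvg _ _ R leb setT measurableT (fun k x => (g k x)%:E)
  (fun x => (partial i h x)%:E) (fun x => (M * \1_B x)%:E)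
  _ (fun x _ => cvg_g x) (fun x _ => erefl) iB _.
have E : (fun k => (\int[leb]_x (g k x)%:E)%E) = (fun=> 0%E) by apply/funext => k.
rewrite E => D; apply: (@cvg_unique _ _ (fmap (fun _ : nat => 0%E) \oo)) => //.
- apply: D => [k|k x _]; last by rewrite lee_fin; exact: gM.
  apply/measurable_EFinP; apply: measurable_funM => //; apply: measurable_funB => //.
  exact: measurable_translate.
- exact: cvg_cst.
Unshelve. all: by end_near. Qed.

Lemma Rintegral_partial h i : test_function h -> \int[leb]_x (partial i h x) = 0.
Proof. by move=> th; rewrite /Rintegral integral_partial. Qed.

Lemma integration_by_parts f g i : test_function f -> smooth g ->
  \int[leb]_x (partial i f x * g x) = - \int[leb]_x (f x * partial i g x).
Proof.
move=> tf sg; have [sf _] := tf.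
have t1 := test_functionM (test_function_partial i tf) sg.
have t2 := test_functionM tf (smooth_partial i sg).
apply/eqP; rewrite -addr_eq0; apply/eqP.
rewrite -RintegralD//; [|exact: test_function_integrable..].
rewrite -(Rintegral_partial i (test_functionM tf sg)).
by apply: eq_Rintegral => x _; rewrite partialM//; [exact: (sf [::] x)|exact: (sg [::] x)].
Qed.

Lemma Rintegral_sum_test (I : Type) (s : seq I) (F : I -> 'rV[R]_n -> R) :
  (forall i, test_function (F i)) ->
  \int[leb]_x (\sum_(i <- s) F i x) = \sum_(i <- s) \int[leb]_x F i x.
Proof.
move=> tF; elim: s => [|i s IH].
  rewrite big_nil -[RHS](mul0r (\int[leb]_x (0 : R))) -RintegralZl//.
    by apply: eq_Rintegral => x _; rewrite big_nil mul0r.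
  exact: (test_function_integrable (test_function0 n)).
rewrite big_cons -IH -RintegralD//.
- by apply: eq_Rintegral => x _; rewrite big_cons.
- exact: test_function_integrable.
- by apply: test_function_integrable; exact: test_function_sum.
Qed.

Lemma neg_laplacian_adjoint f g : test_function f -> smooth g ->
  \int[leb]_x (neg_laplacian f x * g x) = \int[leb]_x (f x * neg_laplacian g x).
Proof.
move=> tf sg; have t1 i := test_functionM (test_function_partial i (test_function_partial i tf)) sg.
have t2 i := test_functionM tf (smooth_partial i (smooth_partial i sg)).
have N (F : 'I_n -> 'rV[R]_n -> R) : (forall i, test_function (F i)) ->
    \int[leb]_x (- \sum_i F i x) = - \sum_i \int[leb]_x F i x.
  move=> tF; rewrite -Rintegral_sum_test// -mulN1r -RintegralZl//.
    by apply: eq_Rintegral => x _; rewrite mulN1r.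
  by apply: test_function_integrable; exact: test_function_sum.
transitivity (- \sum_i \int[leb]_x (partial i (partial i f) x * g x)).
  by rewrite -N//; apply: eq_Rintegral => x _; rewrite /neg_laplacian mulNr mulr_suml.
transitivity (- \sum_i \int[leb]_x (f x * partial i (partial i g) x)).
  congr (- _); apply: eq_bigr => i _.
  rewrite integration_by_parts//; last exact: test_function_partial.
  by rewrite integration_by_parts ?opprK//; exact: smooth_partial.
by rewrite -N//; apply: eq_Rintegral => x _; rewrite /neg_laplacian mulrN mulr_sumr.
Qed.

Lemma iter_neg_laplacian_adjoint m f g : test_function f -> test_function g ->
  \int[leb]_x (iter m (@neg_laplacian R n) f x * g x) =
  \int[leb]_x (f x * iter m (@neg_laplacian R n) g x).
Proof.
move=> tf tg; elim: m f tf => [//|m IH] f tf; rewrite iterSr.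
rewrite (IH _ (test_function_iter_neg_laplacian 1 tf)).
exact: (neg_laplacian_adjoint tf (test_function_iter_neg_laplacian m tg).1).
Qed.

End integration_by_parts.

Section radial_weak_gradient.
Context {R : realType}.
Variables (n alpha : nat).
Hypothesis alpha_gt0 : (0 < alpha)%N.
Notation leb := (@lebesgue_rV R n).
Notation m := (half_order alpha).

(** The profile h with (-Delta)^m (- grad u) = x h(|x|^2) for u(x) = H(|x|^2). Up to sign this field
    is nabla^alpha u for odd alpha, and its divergence is nabla^alpha u for even alpha. *)
Definition radial_nabla (H : nat -> R -> R) : nat -> R -> R :=
  iter m (Ljet (n%:R + 2)) (jscale (- 2) (jshift H)).

Definition radial_nabla_norm (H : nat -> R -> R) (s : R) : R :=
  if odd alpha then Num.sqrt s * `|radial_nabla H 0 s| else `|divjet n%:R (radial_nabla H) 0 s|.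

Lemma jet_radial_nabla H : jet H -> jet (radial_nabla H).
Proof. by move=> jH; apply: iter_jet_Ljet; apply: jet_scale; exact: jet_shift. Qed.

Lemma vanishes_radial_nabla r H : vanishes_beyond r H -> vanishes_beyond r (radial_nabla H).
Proof.
move=> vH; rewrite /radial_nabla; elim: m => [k s rs|j IH] /=; last exact: vanishes_Ljet.
by rewrite /jscale /jshift vH// mulr0.
Qed.

Lemma test_function_rad (H : nat -> R -> R) r : jet H -> vanishes_beyond r H ->
  test_function (rad H 0 (0 : 'rV[R]_n)).
Proof.
move=> jH vH; apply: (@test_function_radial _ _ _ H 0 r) => //; first by constructor.
by move=> x h; rewrite /rad vH.
Qed.

Lemma test_function_coord_rad (H : nat -> R -> R) r j : jet H -> vanishes_beyond r H ->
  test_function (fun x => coord_at j (0 : 'rV[R]_n) x * rad H 0 (0 : 'rV[R]_n) x).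
Proof.
move=> jH vH; apply: (@test_function_radial _ _ _ H 0 r) => //; first by do !constructor.
by move=> x h; rewrite /rad vH// mulr0.
Qed.

(** For a test function the weak and the classical nabla^alpha coincide: the Laplacians are moved to
    u by self-adjointness, and for odd alpha one integration by parts supplies the sign. *)
Lemma weak_nabla_rad (H : nat -> R -> R) r : jet H -> vanishes_beyond r H ->
  exists2 F, weak_nabla alpha (rad H 0 (0 : 'rV[R]_n)) F &
    forall x, enorm (F x) = radial_nabla_norm H (sqn x).
Proof.
move=> jH vH; have tu := test_function_rad jH vH; set u := rad H 0 0 in tu *.
have jW : jet (jscale (- 2) (jshift H)) by apply: jet_scale; exact: jet_shift.
have vW : vanishes_beyond r (jscale (- 2) (jshift H)).
  by move=> k s rs; rewrite /jscale /jshift vH// mulr0.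
have jN := jet_radial_nabla jH; have vN := vanishes_radial_nabla vH.
have ha : alpha./2 = if odd alpha then m else m.+1.
  rewrite /half_order -[in LHS](prednK alpha_gt0) -uphalfE uphalf_half.
  by rewrite -[in RHS](prednK alpha_gt0) /=; case: (odd _).
rewrite /weak_nabla /nabla /nabla_dim /radial_nabla_norm; move: ha.
have -> : (-1) ^+ alpha = (if odd alpha then -1 else 1) :> R.
  by rewrite -signr_odd; case: (odd alpha).
case: (odd alpha) => /= ->.
- exists (fun x => \row_j (- (coord_at j 0 x * rad (radial_nabla H) 0 0 x))); last first.
    move=> x; rewrite /enorm -(sqrtr_sqr (radial_nabla H 0 (sqn x))) -sqrtrM ?sqn_ge0//.
    congr Num.sqrt; rewrite {1}/sqn mulr_suml; apply: eq_bigr => j _.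
    by rewrite mxE sqrrN exprMn /coord_at /rad mxE !subr0.
  have tF j := test_function_coord_rad j jN vN.
  have tW j := test_function_coord_rad j jW vW.
  have EF j : (fun x => (\row_j0 (- (coord_at j0 0 x * rad (radial_nabla H) 0 0 x)) : 'rV_n) ord0 j) =
      (fun x => - (coord_at j 0 x * rad (radial_nabla H) 0 0 x)).
    by apply/funext => x; rewrite mxE.
  split; first exact: test_function_locally_integrable.
    by move=> j; rewrite EF; apply: test_function_locally_integrable; exact: test_functionN.
  move=> phi tphi j; have tphi' := test_function_iter_neg_laplacian m tphi.
  have pu x : partial j u x = - (coord_at j 0 x * rad (jscale (- 2) (jshift H)) 0 0 x).
    rewrite /partial /u; have [_ ->] := is_derive_rad 0 (0 : 'rV[R]_n) x j jH.
    by rewrite /rad /jscale /jshift; ring.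
  transitivity (- \int[leb]_x (coord_at j 0 x * rad (radial_nabla H) 0 0 x * phi x)).
    rewrite -mulN1r -RintegralZl//.
      by apply: eq_Rintegral => x _; rewrite mxE; ring.
    by apply: test_function_integrable; apply: test_functionM => //; case: tphi.
  have -> : \int[leb]_x (coord_at j 0 x * rad (radial_nabla H) 0 0 x * phi x) =
      \int[leb]_x (coord_at j 0 x * rad (jscale (- 2) (jshift H)) 0 0 x *
        iter m (@neg_laplacian R n) phi x).
    rewrite -(iter_neg_laplacian_adjoint m (tW j) tphi).
    by apply: eq_Rintegral => x _; rewrite iter_neg_laplacian_coord_rad.
  have -> : \int[leb]_x (u x * gradient (iter m (@neg_laplacian R n) phi) x ord0 j) =
      \int[leb]_x (u x * partial j (iter m (@neg_laplacian R n) phi) x).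
    by apply: eq_Rintegral => x _; rewrite mxE.
  rewrite mulN1r -(integration_by_parts j tu tphi'.1) -[LHS]mulN1r -RintegralZl//.
    by apply: eq_Rintegral => x _; rewrite pu; ring.
  by apply: test_function_integrable; apply: test_functionM => //; case: tphi'.
- exists (fun x => const_mx (rad (divjet n%:R (radial_nabla H)) 0 0 x)); last first.
    move=> x; rewrite /enorm big_ord_recl big_ord0 addr0 mxE sqrtr_sqr /rad subr0.
    by [].
  have EF j : (fun x => (const_mx (rad (divjet n%:R (radial_nabla H)) 0 0 x) : 'rV_1) ord0 j) =
      rad (divjet n%:R (radial_nabla H)) 0 (0 : 'rV[R]_n) by apply/funext => x; rewrite mxE.
  have tF : test_function (rad (divjet n%:R (radial_nabla H)) 0 (0 : 'rV[R]_n)).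
    by apply: (@test_function_rad _ r); [exact: jet_divjet|exact: vanishes_divjet].
  split; first exact: test_function_locally_integrable.
    by move=> j; rewrite EF; exact: test_function_locally_integrable.
  move=> phi tphi j; rewrite mul1r.
  transitivity (\int[leb]_x (iter m.+1 (@neg_laplacian R n) u x * phi x)).
    by apply: eq_Rintegral => x _; rewrite mxE iter_neg_laplacian_rad// iter_Ljet_div.
  rewrite iter_neg_laplacian_adjoint//.
  by apply: eq_Rintegral => x _; rewrite mxE.
Qed.

End radial_weak_gradient.

(** * The truncated logarithm *)

Section log_jet.
Context {R : realType}.

(* r is a scale parameter; the function itself is [- ln ((s + d) / r)] *)
Definition log_jet (r d : R) : nat -> R -> R := fun k s =>
  if k is j.+1 then - pow_jet 1 d j s else - ln ((s + d) / r).

Lemma jet_log r d : 0 < r -> 0 < d -> jet (log_jet r d).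
Proof.
move=> r0 d0 [|k] s s0; last by have h := jet_pow 1 d0 k s0; exact: is_derive_oppR.
have sd : 0 < s + d by rewrite ltr_wpDl.
have sr : 0 < (s + d) / r by rewrite divr_gt0.
have h1 : is_derive s 1 (fun s => (s + d) / r) r^-1.
  have h := is_derive_scaleR r^-1 (is_derive_addR (is_derive_id s (1 : R)) (is_derive_cst d s (1 : R))).
  have -> : (fun s => (s + d) / r) = (fun s => r^-1 * (id s + cst d s)).
    by apply/funext => t; rewrite mulrC.
  by apply: (is_derive_value h); rewrite addr0 mulr1.
have sr' : is_derive ((fun s => (s + d) / r) s) 1 (@ln R) ((s + d) / r)^-1 by exact: is_derive1_ln.
have h2 := @is_derive1_comp R (@ln R) (fun s => (s + d) / r) s _ _ sr' h1.
have h3 := is_derive_oppR h2.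
apply: (is_derive_value h3).
rewrite /log_jet /pow_jet/= mul1r addr0 powR_inv1 ?(ltW sd)//.
by congr (- _); field; rewrite !gt_eqF.
Qed.

Lemma homog_bound_log : homog_bound 0 log_jet.
Proof.
move=> [|k].
  exists (ln 4) => r d s d0 dr /andP[rs sr]; rewrite subr0 powRr0 mulr1.
  have r0 : 0 < r by exact: lt_le_trans dr.
  have s0 : 0 < s by apply: lt_le_trans rs; rewrite divr_gt0.
  have l1 : 4^-1 <= (s + d) / r.
    rewrite ler_pdivlMr// mulrC; apply: le_trans rs _.
    by rewrite lerDl ltW.
  have l2 : (s + d) / r <= 4 by rewrite ler_pdivrMr//; lra.
  have p0 : 0 < (s + d) / r by apply: lt_le_trans l1.
  rewrite /log_jet normrN ler_norml; apply/andP; split.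
    by rewrite -lnV ?posrE// ler_ln ?posrE.
  by rewrite ler_ln ?posrE.
have [C hC] := homog_bound_pow (ler01 : 0 <= 1 :> R) k; exists C => r d s d0 dr sr.
rewrite /log_jet normrN; apply: le_trans (hC _ _ _ d0 dr sr) _.
by rewrite le_eqVlt; apply/orP; left; apply/eqP; congr (_ * _ `^ _); rewrite -natr1; ring.
Qed.

End log_jet.

Section log_profile.
Context {R : realType}.
Variables (n alpha : nat).
Hypotheses (alpha_gt0 : (0 < alpha)%N) (alpha_lt_n : (alpha < n)%N).
Notation V := (@unit_ball_volume R n).
Notation m := (half_order alpha).
Variable X : nat -> R -> R.
Hypotheses (dX : forall k (x : R), is_derive x 1 (X k) (X k.+1 x))
  (X1 : forall s, s <= 4^-1 -> X 0%N s = 1) (X1' : forall k s, s <= 4^-1 -> X k.+1 s = 0)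
  (X0 : forall k s, 1 <= s -> X k s = 0).

Definition log_cutoff (d : R) : nat -> R -> R := jmul (log_jet 1 d) (jdilate X 1).

Lemma jdilate1 : jdilate X 1 = X.
Proof. by apply/funext => k; apply/funext => s; rewrite /jdilate invr1 expr1n mul1r mulr1. Qed.

Lemma jet_log_cutoff d : 0 < d -> jet (log_cutoff d).
Proof. by move=> d0; apply: jet_mul; [exact: jet_log|exact: jet_dilate]. Qed.

Lemma vanishes_log_cutoff d : vanishes_beyond 1 (log_cutoff d).
Proof.
move=> k s s1; rewrite /log_cutoff jdilate1.
by rewrite (jmul_cst (c := 0) _ (X0 0 s1)) ?mul0r// => j; exact: X0.
Qed.

Lemma log_cutoff_near d k s : s <= 4^-1 -> log_cutoff d k s = log_jet 1 d k s.
Proof.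
move=> s4; rewrite /log_cutoff jdilate1 (jmul_cst (c := 1) _ (X1 s4)) ?mul1r// => j.
exact: X1'.
Qed.

Lemma log_cutoff_far k : exists2 C, 0 <= C & forall d s, 0 < d -> d <= 1 -> 4^-1 <= s <= 1 ->
  `|log_cutoff d k s| <= C.
Proof.
have [C C0 hC] := homog_boundP k (homog_bound_mul (@homog_bound_log R) (homog_bound_dilate dX)).
exists C => // d s d0 d1 sr; have := hC 1 d s d0 d1; rewrite mul1r => /(_ sr).
have h1 e : 1 `^ e = 1 :> R by rewrite powR1.
by rewrite h1 mulr1.
Qed.

(** The divergence of z (s + d)^(-a) with a = 1 + m + i is (s + d)^(-a) (n - 2a + 2a th), where th =
    d/(s + d) and s/(s + d) = 1 - th. For odd alpha no divergence is taken. *)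
Definition gradient_weight (i : nat) (th : R) : R :=
  if odd alpha then 1 else n%:R - 2 * (1 + m%:R + i%:R) + 2 * (1 + m%:R + i%:R) * th.

Lemma radial_nabla_near d k s : 0 < s + d -> s <= 4^-1 -> radial_nabla n alpha (log_cutoff d) k s =
  2 * \sum_(i < m.+1) iter_coef (n%:R + 2) 1 m i * d ^+ i * pow_jet (1 + m%:R + i%:R) d k s.
Proof.
move=> sd s4; apply: iter_Ljet_pow => // j.
by rewrite /jscale /jshift log_cutoff_near// /log_jet; ring.
Qed.

Lemma exponent_parity : (alpha%:R / 2 : R) = (1 + m%:R) - (if odd alpha then 2^-1 else 0).
Proof.
have [ao|ao] := boolP (odd alpha).
  by rewrite [X in X%:R](half_order_odd ao) -natr1 -muln2 natrM; field.
by rewrite [X in X%:R](half_order_even alpha_gt0 ao) -!natr1 -muln2 natrM; field.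
Qed.

Lemma radial_nabla_norm_nearE d s : 0 < d -> 0 <= s -> s <= 4^-1 ->
  radial_nabla_norm n alpha (log_cutoff d) s <= (s + d) `^ (- (alpha%:R / 2)) *
    `|2 * \sum_(i < m.+1) iter_coef (n%:R + 2) 1 m i * (d / (s + d)) ^+ i *
      gradient_weight i (d / (s + d))|.
Proof.
move=> d0 s0 s4; have sd : 0 < s + d by rewrite ltr_wpDl.
rewrite /radial_nabla_norm /gradient_weight; have := exponent_parity.
set th := d / (s + d); set x := (s + d) `^ (- (1 + m%:R)).
have x0 : 0 <= x by exact: powR_ge0.
have P0 (i : nat) : d ^+ i * pow_jet (1 + m%:R + i%:R) d 0 s = x * th ^+ i.
  rewrite /pow_jet/= mul1r addr0 opprD powRD; last by rewrite (gt_eqF sd) implybT.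
  by rewrite (powRN (s + d) i%:R) powR_mulrn ?(ltW sd)// /th expr_div_n -/x; ring.
case: (odd alpha) => E.
  rewrite radial_nabla_near//.
  have -> : \sum_(i < m.+1) iter_coef (n%:R + 2) 1 m i * d ^+ i * pow_jet (1 + m%:R + i%:R) d 0 s =
      x * \sum_(i < m.+1) iter_coef (n%:R + 2) 1 m i * th ^+ i * 1.
    by rewrite mulr_sumr; apply: eq_bigr => i _; rewrite -mulrA P0; ring.
  rewrite mulrCA normrM (ger0_norm x0) mulrA; apply: ler_wpM2r => //.
  have -> : (s + d) `^ (- (alpha%:R / 2)) = Num.sqrt (s + d) * x.
    rewrite -powR12_sqrt ?(ltW sd)// /x -powRD; last by rewrite (gt_eqF sd) implybT.
    by congr (_ `^ _); rewrite E; ring.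
  (* The only loss: |x| is replaced by the square root of |x|^2 + d. *)
  by apply: ler_wpM2r => //; rewrite ler_sqrt ?(ltW sd)// lerDl ltW.
rewrite /divjet !radial_nabla_near//.
have -> : (s + d) `^ (- (alpha%:R / 2)) = x by rewrite E subr0.
have P1 (i : nat) : s * (d ^+ i * pow_jet (1 + m%:R + i%:R) d 1 s) =
    - (1 + m%:R + i%:R) * (1 - th) * (x * th ^+ i).
  have -> : pow_jet (1 + m%:R + i%:R) d 1 s = - (1 + m%:R + i%:R) * (pow_jet (1 + m%:R + i%:R) d 0 s / (s + d)).
    rewrite /pow_jet/= !addr0 !mul1r (opprD (1 + m%:R + i%:R) 1) powRD; last by rewrite (gt_eqF sd) implybT.
    by rewrite powR_inv1 ?ltW.
  rewrite -P0 /th; field; exact: lt0r_neq0.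
rewrite -(ger0_norm x0) -normrM le_eqVlt; apply/orP; left; apply/eqP; congr `|_|.
rewrite (mulrCA x) mulrA mulrCA -!mulrA mulrCA.
transitivity (2 * (\sum_(i < m.+1) (n%:R * (iter_coef (n%:R + 2) 1 m i * d ^+ i * pow_jet (1 + m%:R + i%:R) d 0 s)
   + 2 * s * (iter_coef (n%:R + 2) 1 m i * d ^+ i * pow_jet (1 + m%:R + i%:R) d 1 s)))).
  by rewrite big_split/= -!mulr_sumr; ring.
congr (_ * _); rewrite mulr_sumr; apply: eq_bigr => i _.
have -> : 2 * s * (iter_coef (n%:R + 2) 1 m i * d ^+ i * pow_jet (1 + m%:R + i%:R) d 1 s) =
   2 * iter_coef (n%:R + 2) 1 m i * (s * (d ^+ i * pow_jet (1 + m%:R + i%:R) d 1 s)) by ring.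
rewrite P1 -[iter_coef _ _ _ _ * _ * pow_jet _ _ _ _]mulrA P0; ring.
Qed.

(** The factors 2 x (n - 2 x) are invariant under x -> n/2 - x, which maps the exponents 1 + l for
    the logarithm to those for the fundamental solution in reverse order. *)
Lemma iter_coef0_symm :
  iter_coef (n%:R + 2) 1 m 0 = iter_coef (n%:R + 2) (@profile_exp R n alpha) m 0.
Proof.
rewrite !iter_coef0 [RHS](reindex_inj rev_ord_inj)/=; apply: eq_bigr => l _.
rewrite /profile_exp natrB ?ltn_ord// -natr1.
by field.
Qed.

(** By this symmetry the coefficient is the one in the flux identity. For even alpha the weight n -
    2 (1 + m) equals the extra factor of [profile_coef]. *)
Lemma leading_coef : 2 * (iter_coef (n%:R + 2) 1 m 0 * gradient_weight 0 0) =
  2 / (@adams_c R n alpha * n%:R * V).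
Proof.
have n0 : (0 : R) < n%:R by rewrite ltr0n (leq_trans _ alpha_lt_n).
have := profile_flux (R := R) alpha_gt0 alpha_lt_n; rewrite -iter_coef0_symm.
have c0 := adams_c_gt0 (R := R) alpha_gt0 alpha_lt_n; have V0 := V_gt0 (R := R) n.
rewrite /gradient_weight /profile_coef; set c := adams_c n alpha in c0 *.
move: V (iter_coef _ _ _ _) V0 => v ic v0.
have cnv : c * n%:R * v != 0 by rewrite !mulf_neq0// gt_eqF.
case: (odd alpha) => H; apply: (mulIf cnv); rewrite divfK//.
  by have -> : 2 * (ic * 1) * (c * n%:R * v) = 2 * (n%:R * v * (c * ic)) by [ring]; rewrite H mulr1.
transitivity (2 * (n%:R * v * (2 * c * (n%:R / 2 - m%:R - 1) * ic))); first by field.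
by rewrite H mulr1.
Qed.

Lemma sum_near_bound (k : nat) (a u v : nat -> R) : exists2 C, 0 <= C & forall th, 0 <= th <= 1 ->
  `|\sum_(i < k.+1) a i * th ^+ i * (u i + v i * th)| <= `|a 0%N * u 0%N| + C * th.
Proof.
pose D i := `|a i| * (`|u i| + `|v i|).
have D0 i : 0 <= D i by rewrite mulr_ge0// addr_ge0.
exists (\sum_(i < k.+1) D i); first by apply: sumr_ge0 => i _.
move=> th /andP[t0 t1]; rewrite big_ord_recl [in leRHS]big_ord_recl mulrDl addrA.
have uv i : `|u i + v i * th| <= `|u i| + `|v i|.
  apply: le_trans (ler_normD _ _) _; rewrite lerD2l normrM (ger0_norm t0).
  by rewrite ler_piMr.
apply: le_trans (ler_normD _ _) _; apply: lerD.
  rewrite expr0 mulr1 mulrDr; apply: le_trans (ler_normD _ _) _; rewrite lerD2l.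
  rewrite mulrA normrM (ger0_norm t0); apply: ler_wpM2r => //.
  by rewrite /D normrM ler_wpM2l// lerDr.
rewrite mulr_suml; apply: le_trans (ler_norm_sum _ _ _) _; apply: ler_sum => i _.
rewrite lift0 normrM normrM mulrAC; apply: ler_pM; rewrite ?mulr_ge0//.
  by rewrite /D ler_wpM2l.
by rewrite ger0_norm ?exprn_ge0// exprS ler_piMr// exprn_ile1.
Qed.

Lemma radial_nabla_norm_near : exists2 C, 0 <= C & forall d s, 0 < d -> 0 <= s -> s <= 4^-1 ->
  radial_nabla_norm n alpha (log_cutoff d) s <= (s + d) `^ (- (alpha%:R / 2)) *
    (2 / (@adams_c R n alpha * n%:R * V) + C * (d / (s + d))).
Proof.
pose v (i : nat) : R := if odd alpha then 0 else 2 * (1 + m%:R + i%:R).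
have [C C0 hC] := sum_near_bound m (fun i => iter_coef (n%:R + 2) 1 m i)
  (fun i => gradient_weight i 0) v.
exists (2 * C); first by rewrite mulr_ge0.
move=> d s d0 s0 s4; apply: le_trans (radial_nabla_norm_nearE d0 s0 s4) _.
have sd : 0 < s + d by rewrite ltr_wpDl.
apply: ler_wpM2l; first exact: powR_ge0.
have t0 : 0 <= d / (s + d) <= 1.
  by rewrite divr_ge0 ?(ltW d0) ?(ltW sd)//= ler_pdivrMr// mul1r lerDr.
have L0 : 0 <= 2 / (@adams_c R n alpha * n%:R * V).
  rewrite divr_ge0// mulr_ge0 ?(ltW (V_gt0 n))// mulr_ge0//.
  exact: ltW (adams_c_gt0 alpha_gt0 alpha_lt_n).
have := hC _ t0; set th := d / (s + d).
have -> : \sum_(i < m.+1) iter_coef (n%:R + 2) 1 m i * th ^+ i * (gradient_weight i 0 + v i * th) =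
    \sum_(i < m.+1) iter_coef (n%:R + 2) 1 m i * th ^+ i * gradient_weight i th.
  apply: eq_bigr => i _; congr (_ * _); rewrite /gradient_weight /v.
  by case: (odd alpha); ring.
move=> h; rewrite normrM (ger0_norm (ler0n _ 2)).
apply: le_trans (ler_wpM2l (ler0n _ 2) h) _.
rewrite mulrDr mulrA lerD2r -{1}(ger0_norm (ler0n R 2)) -normrM leading_coef.
by rewrite ger0_norm.
Qed.

Lemma radial_nabla_norm_far : exists2 C, 0 <= C & forall d s, 0 < d -> d <= 1 -> 4^-1 <= s <= 1 ->
  radial_nabla_norm n alpha (log_cutoff d) s <= C.
Proof.
pose H (r d : R) := jmul (log_jet r d) (jdilate X r).
have hH : homog_bound (0 + 0) H := homog_bound_mul (@homog_bound_log R) (homog_bound_dilate dX).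
have hQ := homog_bound_iter (n%:R + 2) m (homog_bound_scale (- 2) (homog_bound_shift hH)).
have h1 e : 1 `^ e = 1 :> R by rewrite powR1.
have [C1 C10 b1] := homog_boundP 0 hQ.
have [C2 C20 b2] := homog_boundP 0 (homog_bound_divjet n%:R hQ).
exists (C1 + C2); first exact: addr_ge0.
move=> d s d0 d1 s1; have s1' : 1 / 4 <= s <= 1 by rewrite mul1r.
have := b1 1 d s d0 d1 s1'; have := b2 1 d s d0 d1 s1'; rewrite !h1 !mulr1 => B2 B1.
rewrite /radial_nabla_norm; case: (odd alpha).
  apply: (@le_trans _ _ (1 * C1)); last by rewrite mul1r lerDl.
  apply: ler_pM; rewrite ?sqrtr_ge0//.
  by case/andP: s1 => _ s1; rewrite -sqrtr1 ler_sqrt.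
by apply: le_trans B2 _; rewrite lerDr.
Qed.

End log_profile.

Section log_energy.
Context {R : realType}.
Variables (n alpha : nat).
Hypotheses (alpha_gt0 : (0 < alpha)%N) (alpha_lt_n : (alpha < n)%N).
Notation leb := (@lebesgue_rV R n).
Notation gam := (@gamma_const R n alpha).
Notation iq := (alpha%:R / n%:R : R).
Notation iq' := ((n%:R - alpha%:R) / n%:R : R).
Notation q := (n%:R / alpha%:R : R).
Notation q' := (n%:R / (n%:R - alpha%:R) : R).

Let n0 : (0 < n)%N. Proof. exact: leq_trans alpha_lt_n. Qed.
Let n0' : (0 : R) < n%:R. Proof. by rewrite ltr0n. Qed.
Let al0 : (0 : R) < alpha%:R. Proof. by rewrite ltr0n. Qed.
Let na0 : (0 : R) < n%:R - alpha%:R. Proof. by rewrite subr_gt0 ltr_nat. Qed.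
Let iq0 : 0 < iq. Proof. by rewrite divr_gt0. Qed.
Let iq'0 : 0 < iq'. Proof. by rewrite divr_gt0. Qed.
Let q0 : 0 < q. Proof. by rewrite divr_gt0. Qed.
Let q1 : 1 <= q. Proof. by rewrite ler_pdivlMr// mul1r ler_nat ltnW. Qed.
Let q'0 : 0 < q'. Proof. by rewrite divr_gt0. Qed.
Let g0 : 0 < gam := gamma_const_gt0 alpha_gt0 alpha_lt_n.

Notation V := (@unit_ball_volume R n).
Notation N2 := (n%:R / 2 : R).

Let N20 : 0 < N2. Proof. by rewrite divr_gt0. Qed.
Let V0 : 0 < V. Proof. exact: V_gt0. Qed.

(** For |x|^2 < d the integrand is at most d^(-n/2), which contributes V; elsewhere it is at most
    |x|^(-n) = V / [bvol x], whose integral is V times the logarithm of the ratio of volumes. *)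
Lemma inv_kernel_integral d T : 0 < d -> 0 < T ->
  (\int[leb]_x ((sqn x + d) `^ (- N2) * \1_(sqn_ball T : set 'rV[R]_n) x)%:E <=
   (V * (1 + N2 * Num.max 0 (ln (T / d))))%:E)%E.
Proof.
move=> d0 T0; pose tau := V * d `^ N2; pose T' := V * T `^ N2.
have dp : 0 < d `^ N2 by rewrite powR_gt0.
have Tp : 0 < T `^ N2 by rewrite powR_gt0.
have tau0 : 0 < tau by rewrite mulr_gt0.
pose I : set R := `[tau, T'[%classic.
pose g1 (x : 'rV[R]_n) : R := \1_(`]-oo, tau[%classic) (bvol (x - 0)).
pose g2 (t : R) : R := t `^ (-1) * \1_I t.
have mI : measurable I by exact: measurable_itv.
have mg2 : measurable_fun setT g2.
  by apply: measurable_funM; [exact: measurable_powR|exact: measurable_indic].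
have mg1 : measurable_fun setT g1.
  have mi : measurable_fun setT (\1_(`]-oo, tau[%classic) : R -> R) by exact: measurable_indic.
  apply: (measurableT_comp mi).
  by apply: measurable_translate; exact: measurable_bvol.
have g10 x : 0 <= g1 x by [].
have g20 t : 0 <= g2 t by rewrite mulr_ge0// powR_ge0.
have mg2b : measurable_fun setT (fun x : 'rV[R]_n => g2 (bvol x)).
  by apply: (measurableT_comp mg2); exact: measurable_bvol.
have E2 : (\int[leb]_x (g2 (bvol x))%:E = (Num.max 0 (ln (T' / tau)))%:E)%E.
  rewrite (@integral_bvol R n (EFin \o g2))//; last exact/measurable_EFinP.
  rewrite -integral_inv_itv//.
  have -> : `[tau, T'[%classic = `]0, +oo[%classic `&` I :> set R.
    apply/seteqP; split => t /=; rewrite !in_itv/= andbT; last by case.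
    by move=> /andP[t1 t2]; split; [exact: lt_le_trans t1|rewrite /I/= in_itv/= t1 t2].
  rewrite integral_mkcondr; apply: eq_integral => t _.
  by rewrite patchE /= /g2 indicE; case: ifP => _; rewrite ?mulr1 ?mulr0.
have ratio : Num.max 0 (ln (T' / tau)) = N2 * Num.max 0 (ln (T / d)).
  have -> : T' / tau = (T / d) `^ N2.
    rewrite /T' /tau -mulf_div divff ?gt_eqF// mul1r powRM ?(ltW T0) ?invr_ge0 ?(ltW d0)//.
    by rewrite -(powR_inv1 (ltW d0)) -powRrM mulN1r powRN.
  by rewrite ln_powR maxr_pMr ?(ltW N20)// mulr0.
apply: (@le_trans _ _ (\int[leb]_x ((V * tau^-1)%:E * (g1 x)%:E + V%:E * (g2 (bvol x))%:E))%E).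
  apply: ge0_le_integral => //.
  - by move=> x _; rewrite lee_fin mulr_ge0// powR_ge0.
  - apply/measurable_EFinP; apply: measurable_funM; last first.
      by apply: measurable_indic; exact: measurable_sqn_ball.
    apply: (measurableT_comp (measurable_powR _)); apply: measurable_funD => //.
    exact: measurable_sqn.
  - by apply: emeasurable_funD; apply: measurable_funeM; exact/measurable_EFinP.
  move=> x _; rewrite -!EFinM -EFinD lee_fin indicE mem_sqn_ball.
  have s0 := sqn_ge0 x; have sd : 0 < sqn x + d by rewrite ltr_wpDl.
  have h1 : 0 <= V * tau^-1 * g1 x by rewrite mulr_ge0// mulr_ge0 ?(ltW V0)// invr_ge0 ltW.
  have h2 : 0 <= V * g2 (bvol x) by rewrite mulr_ge0// ltW.
  case: ltP => sT; last by rewrite mulr0 addr_ge0.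
  rewrite mulr1; have [bt|bt] := ltP (bvol x) tau.
    apply: (@le_trans _ _ (V * tau^-1 * g1 x)); last by rewrite lerDl.
    rewrite /g1 subr0 indicE mem_set/= ?in_itv//= mulr1 /tau invfM mulrA divff ?gt_eqF// mul1r.
    rewrite powRN lef_pV2 ?posrE ?powR_gt0//.
    by apply: (ge0_ler_powR (ltW N20)); rewrite ?nnegrE ?(ltW d0) ?(ltW sd)// lerDr.
  apply: (@le_trans _ _ (V * g2 (bvol x))); last by rewrite lerDr.
  have b0 : 0 < bvol x by exact: lt_le_trans bt.
  have bT : bvol x < T'.
    by rewrite /bvol ltr_pM2l//; apply: (gt0_ltr_powR N20); rewrite ?nnegrE ?(ltW T0).
  have bI : bvol x \in I by rewrite inE /I/= in_itv/= bt.
  rewrite /g2 indicE bI/= mulr1 powR_inv1 ?(ltW b0)//.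
  have sp : 0 < sqn x `^ N2 by move: b0; rewrite /bvol pmulr_rgt0.
  have sx : 0 < sqn x.
    rewrite lt_neqAle s0 andbT eq_sym; apply: contraTneq sp => ->.
    by rewrite powR0 ?ltxx// gt_eqF.
  rewrite /bvol invfM mulrA divff ?gt_eqF// mul1r powRN lef_pV2 ?posrE ?powR_gt0//.
  by apply: (ge0_ler_powR (ltW N20)); rewrite ?nnegrE ?(ltW sd)// lerDl ltW.
have c1 : (0 <= (V * tau^-1)%:E)%E by rewrite lee_fin mulr_ge0 ?(ltW V0)// invr_ge0 ltW.
have c2 : (0 <= V%:E)%E by rewrite lee_fin ltW.
have m1 : measurable_fun setT (fun x => (g1 x)%:E) by exact/measurable_EFinP.
have m2 : measurable_fun setT (fun x : 'rV[R]_n => (g2 (bvol x))%:E) by exact/measurable_EFinP.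
have p1 x : setT x -> (0 <= (g1 x)%:E)%E by rewrite lee_fin.
have p2 (x : 'rV[R]_n) : setT x -> (0 <= (g2 (bvol x))%:E)%E by rewrite lee_fin.
rewrite (ge0_integralD leb measurableT (fun x h => mule_ge0 c1 (p1 x h)) (measurable_funeM _ m1)
  (fun x h => mule_ge0 c2 (p2 x h)) (measurable_funeM _ m2)).
rewrite (ge0_integralZl leb measurableT m1 p1 c1) (ge0_integralZl leb measurableT m2 p2 c2).
rewrite E2 /g1 (integral_bvol_indic alpha_lt_n)// ratio -!EFinM -EFinD lee_fin.
by rewrite mulfVK ?gt_eqF// [leRHS]mulrDr mulr1.
Qed.

(** Convexity on the segment from L to L + C. The term L^q keeps the coefficient 1, as the sharp
    constant demands. *)
Lemma powR_segment (L C th : R) : 0 <= L -> 0 <= C -> 0 <= th <= 1 ->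
  (L + C * th) `^ q <= L `^ q + th * (L + C) `^ q.
Proof.
move=> L0 C0 /andP[t0 t1].
have LC : 0 <= L + C by exact: addr_ge0.
have h0 : L + C \in (`[0, +oo[%classic : set R) by rewrite inE/= in_itv/= LC.
have h1 : L \in (`[0, +oo[%classic : set R) by rewrite inE/= in_itv/= L0.
have h := convex_powR q1 (Itv01 t0 t1) h0 h1.
rewrite convRE [X in X `^ _ <= _]convRE /= /unstable.onem in h; move: h.
have -> : th * (L + C) + (1 - th) * L = L + C * th by ring.
move=> /le_trans; apply; rewrite addrC lerD2r ler_piMl ?powR_ge0//.
by rewrite gerBl.
Qed.

Variable X : nat -> R -> R.
Hypotheses (dX : forall k (x : R), is_derive x 1 (X k) (X k.+1 x))
  (X1 : forall s, s <= 4^-1 -> X 0%N s = 1) (X1' : forall k s, s <= 4^-1 -> X k.+1 s = 0)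
  (X0 : forall k s, 1 <= s -> X k s = 0).
Notation L := (2 / (@adams_c R n alpha * n%:R * V)).
Notation U := (log_cutoff X).

Lemma L_gt0 : 0 < L.
Proof. by rewrite divr_gt0// mulr_gt0// mulr_gt0//; exact: adams_c_gt0. Qed.

Lemma radial_nabla_norm_ge0 (H : nat -> R -> R) (s : R) : 0 <= radial_nabla_norm n alpha H s.
Proof. by rewrite /radial_nabla_norm; case: (odd alpha) => //; rewrite mulr_ge0 ?sqrtr_ge0. Qed.

(** Where s >= M d one has th <= 1/M, so the excess over L^q is at most D/M. For s < M d the excess
    is D, on a ball whose energy does not depend on d; the zone of the cut-off contributes a
    constant. *)
Lemma log_energy_pointwise : exists D C : R, [/\ 0 <= D, 0 <= C & forall d M s, 0 < d -> d <= 1 -> 1 <= M -> 0 <= s ->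
  radial_nabla_norm n alpha (U d) s `^ q <=
  (L `^ q + D / M) * ((s + d) `^ (- N2) * (s < 1)%R%:R) +
  D * ((s + d) `^ (- N2) * (s < M * d)%R%:R) + C * (s < 2)%R%:R].
Proof.
have [C1 C10 near1] := radial_nabla_norm_near alpha_gt0 alpha_lt_n X1 X1'.
have [C2 C20 far2] := radial_nabla_norm_far n alpha dX.
have L0 := ltW L_gt0.
pose D := (L + C1) `^ q.
have D0 : 0 <= D by exact: powR_ge0.
exists D, (C2 `^ q); split => //; first exact: powR_ge0.
move=> d M s d0 d1 M1 s0; have sd : 0 < s + d by rewrite ltr_wpDl.
have M0 : 0 < M by exact: lt_le_trans M1.
have LD : 0 <= L `^ q + D / M by rewrite addr_ge0 ?powR_ge0// divr_ge0// ltW.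
set k := (s + d) `^ (- N2); have k0 : 0 <= k by exact: powR_ge0.
have A0 : 0 <= (L `^ q + D / M) * (k * (s < 1)%R%:R) by rewrite mulr_ge0// mulr_ge0.
have B0 : 0 <= D * (k * (s < M * d)%R%:R) by rewrite mulr_ge0// mulr_ge0.
have C0 : 0 <= C2 `^ q * (s < 2)%R%:R by rewrite mulr_ge0 ?powR_ge0.
have [s4|s4] := leP s 4^-1.
  have s1 : s < 1 by lra.
  apply: (@le_trans _ _ ((L `^ q + D / M) * (k * (s < 1)%R%:R) + D * (k * (s < M * d)%R%:R))); last by rewrite lerDl.
  have := near1 d s d0 s0 s4; set th := d / (s + d) => h.
  have t01 : 0 <= th <= 1.
    by rewrite divr_ge0 ?(ltW d0) ?(ltW sd)//= ler_pdivrMr// mul1r lerDr.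
  have th0 : 0 <= L + C1 * th by rewrite addr_ge0// mulr_ge0//; case/andP: t01.
  have h' : radial_nabla_norm n alpha (U d) s `^ q <= k * (L `^ q + th * D).
    apply: (@le_trans _ _ (((s + d) `^ (- (alpha%:R / 2)) * (L + C1 * th)) `^ q)).
      have h0 : 0 <= (s + d) `^ (- (alpha%:R / 2)) * (L + C1 * th) by rewrite mulr_ge0// powR_ge0.
      by apply: (ge0_ler_powR (ltW q0) _ _ h); rewrite nnegrE// radial_nabla_norm_ge0.
    rewrite powRM ?powR_ge0// -powRrM.
    have -> : - (alpha%:R / 2) * q = - N2 by field; rewrite gt_eqF.
    by apply: ler_wpM2l => //; exact: powR_segment.
  apply: le_trans h' _; rewrite s1 mulr1.
  have [sM|sM] := ltP s (M * d).
    rewrite mulr1 mulrC -mulrDl; apply: ler_wpM2r => //.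
    have DM : 0 <= D / M by rewrite divr_ge0// ltW.
    have : th * D <= D by rewrite ler_piMl//; case/andP: t01.
    by lra.
  rewrite mulr0 mulr0 addr0 mulrC; apply: ler_wpM2r => //; rewrite lerD2l mulrC.
  apply: ler_wpM2l => //; rewrite /th ler_pdivrMr// mulrC ler_pdivlMr// mulrC.
  by apply: le_trans sM _; rewrite lerDl ltW.
apply: (@le_trans _ _ (C2 `^ q * (s < 2)%R%:R)); last by rewrite lerDr addr_ge0.
have [s1|s1] := leP s 1.
  rewrite (le_lt_trans s1 (ltr1n R 2))// mulr1.
  apply: (ge0_ler_powR (ltW q0)); rewrite ?nnegrE ?radial_nabla_norm_ge0//.
  by apply: far2 => //; rewrite (ltW s4) s1.
have vN := vanishes_radial_nabla n alpha (vanishes_log_cutoff X0 d).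
have -> : radial_nabla_norm n alpha (U d) s = 0.
  rewrite /radial_nabla_norm; case: (odd alpha); first by rewrite vN ?(ltW s1)// normr0 mulr0.
  by rewrite (vanishes_divjet _ vN) ?(ltW s1)// normr0.
by rewrite powR0 ?gt_eqF.
Qed.

Lemma measurable_radial (h : R -> R) : (forall s, 0 <= s -> {for s, continuous h}) ->
  measurable_fun setT (fun x : 'rV[R]_n => h (sqn x)).
Proof.
move=> ch; have := measurableT_comp (measurable_max0 ch) (@measurable_sqn R n).
by congr measurable_fun; apply/funext => x /=; rewrite (max_idPr (sqn_ge0 x)).
Qed.

Lemma measurable_radial_nabla_norm (H : nat -> R -> R) : jet H ->
  measurable_fun setT (fun x : 'rV[R]_n => radial_nabla_norm n alpha H (sqn x)).
Proof.
move=> jH; have jN := jet_radial_nabla n alpha jH.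
apply: measurable_radial => s s0; rewrite /radial_nabla_norm; case: (odd alpha).
  apply: continuousM; first exact: sqrt_continuous.
  apply: continuous_comp; last exact: norm_continuous.
  exact: derive_continuous (jN 0%N s s0).
apply: continuous_comp; last exact: norm_continuous.
by have h := jet_divjet n%:R jN 0%N s0; exact: (derive_continuous h).
Qed.

Lemma log_energy (rho : R) : 1 < rho -> exists2 l0, 0 < l0 & forall l, l0 <= l ->
  (\int[leb]_x (radial_nabla_norm n alpha (U (expR (- l))) (sqn x) `^ q)%:E <=
   (rho * (L `^ q * V * N2) * l)%:E)%E.
Proof.
move=> rho1; have [D [C [D0 C0 PW]]] := log_energy_pointwise.
have Lq : 0 < L `^ q by rewrite powR_gt0// L_gt0.
have r1 : 0 < (rho - 1) / 2 by rewrite divr_gt0// subr_gt0.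
(* Makes the excess D/M at most (rho - 1)/2 times L^q; the other half of rho - 1 is kept for the
   terms that do not grow. *)
pose M := 1 + D / ((rho - 1) / 2 * L `^ q).
have rL : 0 < (rho - 1) / 2 * L `^ q by rewrite mulr_gt0.
have M1 : 1 <= M by rewrite lerDl divr_ge0// ltW.
have M0 : 0 < M by exact: lt_le_trans M1.
have DM : D / M <= (rho - 1) / 2 * L `^ q.
  rewrite ler_pdivrMr// /M mulrDr mulr1 (mulrC _ (D / _)) divfK ?gt_eqF//.
  by rewrite lerDr ltW.
have kap0 : 0 < L `^ q * V * N2 by rewrite !mulr_gt0.
pose B2 := fine (leb (sqn_ball 2 : set 'rV[R]_n)).
have lB2 : (leb (sqn_ball 2 : set 'rV[R]_n) = B2%:E)%E.
  by rewrite /B2 fineK// ge0_fin_numE//; exact: sqn_ball_fin.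
have B20 : 0 <= B2 by rewrite fine_ge0.
have lnM : 0 <= ln M by exact: ln_ge0.
(* Everything that is not multiplied by l = ln (1/d); it is absorbed once l is large. *)
pose K := (1 + (rho - 1) / 2) * (L `^ q * V) + D * (V * (1 + N2 * ln M)) + C * B2.
exists (1 + `|K| / ((rho - 1) / 2 * (L `^ q * V * N2))).
  by rewrite ltr_wpDr// divr_ge0// mulr_ge0// ltW.
move=> l l0; set d := expR (- l).
have rk : 0 < (rho - 1) / 2 * (L `^ q * V * N2) by rewrite mulr_gt0.
have l1 : 1 <= l by apply: le_trans l0; rewrite lerDl divr_ge0// ltW.
have lp : 0 <= l by exact: le_trans l1.
have d0 : 0 < d by exact: expR_gt0.
have d1 : d <= 1 by rewrite /d -[leRHS]expR0 ler_expR oppr_le0.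
pose k1 (x : 'rV[R]_n) : R := (sqn x + d) `^ (- N2) * \1_(sqn_ball 1 : set 'rV[R]_n) x.
pose k2 (x : 'rV[R]_n) : R := (sqn x + d) `^ (- N2) * \1_(sqn_ball (M * d) : set 'rV[R]_n) x.
pose k3 (x : 'rV[R]_n) : R := \1_(sqn_ball 2 : set 'rV[R]_n) x.
have mk T : measurable_fun setT (fun x : 'rV[R]_n => (sqn x + d) `^ (- N2) * \1_(sqn_ball T : set 'rV[R]_n) x).
  apply: measurable_funM; last by apply: measurable_indic; exact: measurable_sqn_ball.
  by apply: (measurableT_comp (measurable_powR _)); apply: measurable_funD => //; exact: measurable_sqn.
have m1 : measurable_fun setT (fun x => (k1 x)%:E) by apply/measurable_EFinP; exact: mk.
have m2 : measurable_fun setT (fun x => (k2 x)%:E) by apply/measurable_EFinP; exact: mk.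
have m3 : measurable_fun setT (fun x => (k3 x)%:E).
  by apply/measurable_EFinP; apply: measurable_indic; exact: measurable_sqn_ball.
have p1 x : setT x -> (0 <= (k1 x)%:E)%E by rewrite lee_fin mulr_ge0// powR_ge0.
have p2 x : setT x -> (0 <= (k2 x)%:E)%E by rewrite lee_fin mulr_ge0// powR_ge0.
have p3 x : setT x -> (0 <= (k3 x)%:E)%E by rewrite lee_fin.
pose a := L `^ q + D / M.
have a0 : 0 <= a by rewrite addr_ge0 ?powR_ge0// divr_ge0// ltW.
have ca : (0 <= a%:E)%E by rewrite lee_fin.
have cD : (0 <= D%:E)%E by rewrite lee_fin.
have cC : (0 <= C%:E)%E by rewrite lee_fin.
have I1 : (\int[leb]_x (k1 x)%:E <= (V * (1 + N2 * l))%:E)%E.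
  have := inv_kernel_integral d0 ltr01; rewrite div1r /d -expRN opprK expRK.
  by rewrite (max_idPr lp).
have I2 : (\int[leb]_x (k2 x)%:E <= (V * (1 + N2 * ln M))%:E)%E.
  have := inv_kernel_integral d0 (mulr_gt0 M0 d0); rewrite mulfK ?gt_eqF//.
  by rewrite (max_idPr lnM).
have I3 : (\int[leb]_x (k3 x)%:E = B2%:E)%E.
  by rewrite integral_indic ?setIT//; exact: measurable_sqn_ball.
apply: (@le_trans _ _ (\int[leb]_x (a%:E * (k1 x)%:E + D%:E * (k2 x)%:E + C%:E * (k3 x)%:E))%E).
  apply: ge0_le_integral => //.
  - by move=> x _; rewrite lee_fin powR_ge0.
  - apply/measurable_EFinP; apply: (measurableT_comp (measurable_powR _)).
    by apply: measurable_radial_nabla_norm; exact: jet_log_cutoff.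
  - by do 2?[apply: emeasurable_funD]; apply: measurable_funeM.
  move=> x _; rewrite -!EFinM -!EFinD lee_fin /k1 /k2 /k3 !indicE !mem_sqn_ball.
  by apply: PW => //; exact: sqn_ge0.
rewrite (ge0_integralD leb measurableT
  (fun x h => adde_ge0 (mule_ge0 ca (p1 x h)) (mule_ge0 cD (p2 x h)))
  (emeasurable_funD (measurable_funeM _ m1) (measurable_funeM _ m2))
  (fun x h => mule_ge0 cC (p3 x h)) (measurable_funeM _ m3)).
rewrite (ge0_integralD leb measurableT (fun x h => mule_ge0 ca (p1 x h)) (measurable_funeM _ m1)
  (fun x h => mule_ge0 cD (p2 x h)) (measurable_funeM _ m2)).
rewrite (ge0_integralZl leb measurableT m1 p1 ca) (ge0_integralZl leb measurableT m2 p2 cD).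
rewrite (ge0_integralZl leb measurableT m3 p3 cC) I3.
apply: (@le_trans _ _ (a * (V * (1 + N2 * l)) + D * (V * (1 + N2 * ln M)) + C * B2)%:E).
  rewrite !EFinD [X in (_ <= X + _ + _)%E]EFinM [X in (_ <= _ + X + _)%E]EFinM [X in (_ <= _ + _ + X)%E]EFinM.
  apply: leeD => //; apply: leeD; [exact: lee_wpmul2l ca _ _ I1|exact: lee_wpmul2l cD _ _ I2].
rewrite lee_fin.
have aL : a <= (1 + (rho - 1) / 2) * L `^ q by rewrite [leRHS]mulrDl mul1r /a lerD2l.
have V1 : 0 <= V * (1 + N2 * l) by rewrite mulr_ge0 ?(ltW V0)// addr_ge0// mulr_ge0// ltW.
have h1 := ler_wpM2r V1 aL.
have Kl : K <= (rho - 1) / 2 * (L `^ q * V * N2) * l.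
  apply: le_trans (ler_norm K) _; rewrite -ler_pdivrMl// mulrC.
  by apply: le_trans l0; rewrite lerDr.
move: Kl h1; rewrite /K; move: (L `^ q) (D * _) (C * B2) => z1 z2 z3 Kl h1.
apply: (@le_trans _ _ ((1 + (rho - 1) / 2) * z1 * (V * (1 + N2 * l)) + z2 + z3)).
  by rewrite !lerD2r.
apply: (@le_trans _ _ ((1 + (rho - 1) / 2) * (z1 * V * N2) * l + (rho - 1) / 2 * (z1 * V * N2) * l)).
  have -> : (1 + (rho - 1) / 2) * z1 * (V * (1 + N2 * l)) + z2 + z3 =
    (1 + (rho - 1) / 2) * (z1 * V * N2) * l + ((1 + (rho - 1) / 2) * (z1 * V) + z2 + z3) by ring.
  by rewrite lerD2l.
by rewrite le_eqVlt; apply/orP; left; apply/eqP; field.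
Qed.

End log_energy.

Section exponential_growth.
Context {R : realType}.

Lemma exp_poly_lt (a C K l0 : R) j : 0 < a -> 0 <= C -> 0 <= K ->
  exists2 l, l0 <= l & C * (l + K) ^+ j < expR (a * l).
Proof.
(* B is such that the term of order j + 1 of the exponential series at a (l + K) equals exp(a K) (l
   + K)^(j+1) / B. *)
move=> a0 C0 K0; pose B := expR (a * K) * j.+1`!%:R / a ^+ j.+1.
have f0 : (0 : R) < j.+1`!%:R by rewrite ltr0n fact_gt0.
have aj : 0 < a ^+ j.+1 by rewrite exprn_gt0.
have B0 : 0 < B by rewrite divr_gt0// mulr_gt0// expR_gt0.
have CB : 0 <= C * B by rewrite mulr_ge0// ltW.
exists (`|l0| + 1 + C * B).
  by apply: le_trans (ler_norm _) _; rewrite -addrA lerDl addr_ge0.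
set l := `|l0| + 1 + C * B; have l1 : C * B + 1 <= l by rewrite /l -addrA (addrC 1) lerDr.
have x0 : 0 < l + K by apply: ltr_wpDr => //; apply: lt_le_trans l1; rewrite ltr_wpDl.
have Cx : C < (l + K) / B by rewrite ltr_pdivlMr//; lra.
apply: (@lt_le_trans _ _ ((l + K) / B * (l + K) ^+ j)).
  by rewrite ltr_pM2r// exprn_gt0.
have ax : 0 <= a * (l + K) by rewrite mulr_ge0// ltW.
have := expR_ge1Dxn j ax; rewrite exprMn => h.
have -> : a * l = a * (l + K) - a * K by ring.
rewrite expRD expRN ler_pdivlMr ?expR_gt0//; apply: le_trans h.
rewrite -[leLHS]add0r; apply: lerD => //; rewrite le_eqVlt; apply/orP; left; apply/eqP.
have aj' : 0 < a ^+ j by rewrite exprn_gt0.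
rewrite /B !exprS; have e0 := expR_gt0 (a * K).
by field; rewrite !gt_eqF.
Qed.

(** The Taylor polynomial of degree N at t is at most 2^N times the one at t/2, hence at most 2^N
    exp(t/2), which the hypothesis makes at most half of exp(t). *)
Lemma exp_remainder_half N (t : R) : 0 <= t -> 2 ^+ N.+1 <= expR (t / 2) ->
  expR t / 2 <= exp_remainder N t.
Proof.
move=> t0 h; have t2 : 0 <= t / 2 by rewrite divr_ge0.
have [r0 _] := exp_remainder_ge0_le N t2.
have S : \sum_(0 <= j < N.+1) t ^+ j / j`!%:R <= 2 ^+ N * \sum_(0 <= j < N.+1) (t / 2) ^+ j / j`!%:R.
  rewrite mulr_sumr !big_mkord; apply: ler_sum => j _.
  rewrite mulrA; apply: ler_wpM2r; first by rewrite invr_ge0.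
  have -> : t ^+ j = 2 ^+ j * (t / 2) ^+ j by rewrite -exprMn mulrC divfK.
  apply: ler_wpM2r; first exact: exprn_ge0.
  by apply: ler_weXn2l; [rewrite ler1n|rewrite -ltnS].
have E : expR t = expR (t / 2) * expR (t / 2) by rewrite -expRD; congr expR; field.
have e0 : 0 <= expR (t / 2) by exact: expR_ge0.
have := ler_wpM2r e0 h; rewrite -E exprS -mulrA => h'.
have : 2 ^+ N * \sum_(0 <= j < N.+1) (t / 2) ^+ j / j`!%:R <= 2 ^+ N * expR (t / 2).
  by apply: ler_wpM2l; [exact: exprn_ge0|rewrite -subr_ge0].
rewrite /exp_remainder; lra.
Qed.

Lemma quarter_lt2 : 4^-1 < 2 :> R.
Proof. by lra. Qed.

Lemma quarterD_le1 (s d : R) : s <= 4^-1 -> d <= 4^-1 -> s + d <= 1.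
Proof. by lra. Qed.

Lemma half_le_mul (x y : R) : 1 <= x * y -> 2^-1 <= x / 2 * y.
Proof. by lra. Qed.

Lemma quarter_le_half (x l t : R) : 4 * x <= l -> l / 2 <= t -> x <= t / 2.
Proof. by lra. Qed.

End exponential_growth.

(** * Failure for larger constants *)

Section sharpness.
Context {R : realType}.
Variables (n alpha : nat).
Hypotheses (alpha_gt0 : (0 < alpha)%N) (alpha_lt_n : (alpha < n)%N).
Notation leb := (@lebesgue_rV R n).
Notation gam := (@gamma_const R n alpha).
Notation iq := (alpha%:R / n%:R : R).
Notation iq' := ((n%:R - alpha%:R) / n%:R : R).
Notation q := (n%:R / alpha%:R : R).
Notation q' := (n%:R / (n%:R - alpha%:R) : R).

Let n0 : (0 < n)%N. Proof. exact: leq_trans alpha_lt_n. Qed.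
Let n0' : (0 : R) < n%:R. Proof. by rewrite ltr0n. Qed.
Let al0 : (0 : R) < alpha%:R. Proof. by rewrite ltr0n. Qed.
Let na0 : (0 : R) < n%:R - alpha%:R. Proof. by rewrite subr_gt0 ltr_nat. Qed.
Let iq0 : 0 < iq. Proof. by rewrite divr_gt0. Qed.
Let iq'0 : 0 < iq'. Proof. by rewrite divr_gt0. Qed.
Let q0 : 0 < q. Proof. by rewrite divr_gt0. Qed.
Let q1 : 1 <= q. Proof. by rewrite ler_pdivlMr// mul1r ler_nat ltnW. Qed.
Let q'0 : 0 < q'. Proof. by rewrite divr_gt0. Qed.
Let g0 : 0 < gam := gamma_const_gt0 alpha_gt0 alpha_lt_n.

Notation V := (@unit_ball_volume R n).
Notation N2 := (n%:R / 2 : R).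
Notation L := (2 / (@adams_c R n alpha * n%:R * V)).
Variable p : R.
Hypothesis p1 : 1 <= p.

Let p0 : 0 < p. Proof. exact: lt_le_trans p1. Qed.
Let N20 : 0 < N2. Proof. by rewrite divr_gt0. Qed.
Let V0 : 0 < V. Proof. exact: V_gt0. Qed.
Let L0 : 0 < L. Proof. exact: L_gt0. Qed.

Lemma mem_Lfun (r : R) (f : 'rV[R]_n -> R) : 0 < r -> measurable_fun setT f ->
  (\int[leb]_x (`|f x| `^ r)%:E < +oo)%E -> f \in Lfun leb r%:E.
Proof.
move=> r0 mf fi; rewrite inE; apply/andP; split; first by rewrite inE/=.
rewrite inE/= /finite_norm ltNge leye_eq; apply/eqP => N.
have := Lnorm_power_integral f r0.
by rewrite N poweRyr ?gt_eqF// => E; move: fi; rewrite -E ltxx.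
Qed.

Lemma Lnorm_le1 (r : R) (f : 'rV[R]_n -> R) : 0 < r ->
  (\int[leb]_x (`|f x| `^ r)%:E <= 1)%E -> ('N[leb]_(r%:E)[(fun x => (f x)%:E)] <= 1)%E.
Proof.
move=> r0; rewrite -(Lnorm_power_integral f r0).
have N0 := Lnorm_ge0 leb r%:E (fun x => (f x)%:E); set N := ('N[_]_ _ [_])%E in N0 *.
move=> h; have ri : 0 <= r^-1 by rewrite invr_ge0 ltW.
have a1 : (N `^ r)%E \in `[0%E, +oo%E] by rewrite in_itv/= poweR_ge0 leey.
have a2 : 1%E \in `[0%E, +oo%E : \bar R] by rewrite in_itv/= lee01 leey.
have := gt0_ler_poweR ri a1 a2 h; rewrite poweR1r.
by rewrite -poweRrM divff ?gt_eqF// poweRe1.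
Qed.

Lemma radial_nabla_norm_scale (A s : R) (H : nat -> R -> R) : 0 <= A ->
  radial_nabla_norm n alpha (jscale A H) s = A * radial_nabla_norm n alpha H s.
Proof.
move=> A0; have E : radial_nabla n alpha (jscale A H) = jscale A (radial_nabla n alpha H).
  rewrite /radial_nabla; have -> : jscale (- 2) (jshift (jscale A H)) = jscale A (jscale (- 2) (jshift H)).
    by apply/funext => k; apply/funext => t; rewrite /jscale /jshift; ring.
  elim: (half_order alpha) => [//|m IH]; rewrite !iterS IH.
  by apply/funext => k; apply/funext => t; rewrite /Ljet /jscale; ring.
rewrite /radial_nabla_norm E; case: (odd alpha).
  by rewrite /jscale normrM (ger0_norm A0); ring.
rewrite -{2}(ger0_norm A0) -normrM; congr `|_|; rewrite /divjet /jscale; ring.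
Qed.

(** The critical balance: for A = (kappa l)^(-1/q) with kappa = L^q V n/2, the height A l satisfies
    gamma (A l)^q' = (n/2) l, and exp(-(n/2) l) is the order of the measure of the set |x|^2 <
    exp(-l). The identity is checked on logarithms. *)
Lemma gamma_const_critical :
  gam * (L `^ q * V * N2) `^ (- (alpha%:R / (n%:R - alpha%:R))) = N2.
Proof.
have c0 : 0 < @adams_c R n alpha by exact: adams_c_gt0.
have Lq : 0 < L `^ q by rewrite powR_gt0.
have VN : 0 < L `^ q * V by rewrite mulr_gt0.
have K0 : 0 < L `^ q * V * N2 by rewrite mulr_gt0.
have gE : gam = @adams_c R n alpha `^ (- q') * V^-1 by [].
have cp : 0 < @adams_c R n alpha `^ (- q') by rewrite powR_gt0.
have Vi : 0 < V^-1 by rewrite invr_gt0.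
apply: ln_inj; rewrite ?posrE// ?mulr_gt0 ?powR_gt0//.
rewrite lnM ?posrE ?powR_gt0// ln_powR lnM ?posrE// (lnM (x := L `^ q))// ?posrE// ln_powR.
have -> : ln L = - (ln (@adams_c R n alpha) + ln N2 + ln V).
  have cN : 0 < @adams_c R n alpha * N2 by rewrite mulr_gt0.
  have -> : L = (@adams_c R n alpha * N2 * V)^-1 by field; rewrite !gt_eqF.
  by rewrite lnV ?posrE ?mulr_gt0// lnM ?posrE// lnM ?posrE.
rewrite gE lnM ?posrE// ln_powR lnV ?posrE//.
by field; rewrite !gt_eqF.
Qed.

Lemma adams_exact_growth_sharp (gamma' C : R) : gam < gamma' ->
  ~ adams_exact_growth n alpha p gamma' C.
Proof.
move=> gg AEG; have gp : 0 < gamma' by exact: lt_trans gg.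
have [X [dX X1 X1' X0]] := @exists_cutoff_jet R.
(* Thus gamma' = gamma rho^(2 q'). The height l/rho in place of l costs rho^q', the energy excess
   rho costs rho^(q'/q), and since q' - q'/q = 1 exactly one factor rho is left in the exponent. *)
pose rho := (gamma' / gam) `^ ((2 * q')^-1).
have q2 : 0 < (2 * q')^-1 by rewrite invr_gt0 mulr_gt0.
have ggr : 0 < gamma' / gam by rewrite divr_gt0.
have rho1 : 1 < rho.
  have h1 : 1 `^ ((2 * q')^-1) = 1 :> R by rewrite powR1.
  rewrite -h1 /rho; apply: (gt0_ltr_powR q2); rewrite ?nnegrE ?(ltW ggr)//.
  by rewrite ltr_pdivlMr// mul1r.
have rho0 : 0 < rho by exact: lt_trans rho1.
have lnrho : ln gamma' = ln gam + 2 * q' * ln rho.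
  rewrite /rho ln_powR ln_div ?posrE//; field.
  by rewrite !gt_eqF.
have [l0 l00 hE] := log_energy alpha_gt0 alpha_lt_n dX X1 X1' X0 rho1.
have [C3 C30 far3] := log_cutoff_far dX 0.
have kap00 : 0 < L `^ q * V * N2 by rewrite !mulr_gt0// powR_gt0.
set kap0 := L `^ q * V * N2 in kap00 hE.
have kap : 0 < rho * kap0 by rewrite mulr_gt0.
set N := `|Num.ceil (p * iq' - 1)|%N.
pose b := p * alpha%:R / (n%:R - alpha%:R).
have b0 : 0 <= b by rewrite divr_ge0 ?(ltW na0)// mulr_ge0// ltW.
(* A natural exponent k + 1 above both p and b, so that the norm and the denominator are bounded by
   natural powers of l + C3. *)
pose k := Num.truncn (p + b); pose B2 := fine (leb (sqn_ball 2 : set 'rV[R]_n)).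
have lB2 : (leb (sqn_ball 2 : set 'rV[R]_n) = B2%:E)%E.
  by rewrite /B2 fineK// ge0_fin_numE//; exact: sqn_ball_fin.
have B20 : 0 <= B2 by rewrite fine_ge0.
have pk : p <= k.+1%:R by apply: le_trans (ltW (truncnS_gt (p + b))); rewrite lerDl.
have bk : b <= k.+1%:R by apply: le_trans (ltW (truncnS_gt (p + b))); rewrite lerDr ltW.
have a0 : 0 < N2 * (rho - 1) by rewrite mulr_gt0// subr_gt0.
have D0 : 0 <= 4 * `|C| * B2 / V by rewrite divr_ge0 ?(ltW V0)// mulr_ge0// mulr_ge0.
(* The summands ensure in turn: the energy estimate, A <= 1, l - ln 2 >= l/rho, half of the
   exponential in the remainder, d <= 1/4, and l >= 1. *)
pose lmin := l0 + (rho * kap0)^-1 + ln 2 / (1 - rho^-1) + 4 * ln (2 ^+ N.+1) + ln 4 + 1.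
have ri : 0 < 1 - rho^-1 by rewrite subr_gt0 invf_lt1.
have ln2 : 0 <= ln 2 :> R by rewrite ln_ge0// ler1n.
have lnN : 0 <= ln (2 ^+ N.+1) :> R by rewrite ln_ge0// exprn_ege1// ler1n.
have ln4 : 0 <= ln 4 :> R by rewrite ln_ge0// ler1n.
have z1 : 0 <= (rho * kap0)^-1 by rewrite invr_ge0 ltW.
have z2 : 0 <= ln 2 / (1 - rho^-1) by rewrite divr_ge0// ltW.
(* One power of order k + 1 comes from the denominator and one from the L^p norm; 4/V collects the
   two halvings and the volume of the small ball. *)
have [l lm hl] := @exp_poly_lt R _ _ C3 lmin (k.+1 + k.+1) a0 D0 C30.
have ll0 : l0 <= l by apply: le_trans lm; rewrite /lmin; lra.
have lk : (rho * kap0)^-1 <= l by apply: le_trans lm; rewrite /lmin; lra.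
have l2 : ln 2 / (1 - rho^-1) <= l by apply: le_trans lm; rewrite /lmin; lra.
have lN : 4 * ln (2 ^+ N.+1) <= l by apply: le_trans lm; rewrite /lmin; lra.
have l4 : ln 4 <= l by apply: le_trans lm; rewrite /lmin; lra.
have l1 : 1 <= l by apply: le_trans lm; rewrite /lmin; lra.
clearbody lmin; clear lm z1 z2.
have lp : 0 < l by exact: lt_le_trans l1.
set d := expR (- l); have d0 : 0 < d by exact: expR_gt0.
have d4 : d <= 4^-1.
  by rewrite -[leRHS]lnK ?posrE// lnV ?posrE// ler_expR lerN2.
have kl1 : 1 <= rho * kap0 * l by rewrite -ler_pdivrMl// mulr1.
have kl0 : 0 < rho * kap0 * l by exact: lt_le_trans kl1.
(* Normalises the energy, which is at most rho kap0 l before scaling, to at most 1. *)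
pose A := (rho * kap0 * l) `^ (- iq).
have A0 : 0 < A by rewrite powR_gt0.
have A1 : A <= 1.
  by rewrite /A powRN invf_le1 ?powR_gt0// -[leLHS](powRr0 (rho * kap0 * l)) ler_powR// ltW.
pose U := log_cutoff X d.
have jU : jet U := jet_log_cutoff dX d0.
have jH : jet (jscale A U) := jet_scale A jU.
have vH : vanishes_beyond 1 (jscale A U).
  by move=> i s s1; rewrite /jscale /U (vanishes_log_cutoff X0 d i s1) mulr0.
set u := rad (jscale A U) 0 (0 : 'rV[R]_n).
have uE x : u x = A * U 0%N (sqn x) by rewrite /u /rad subr0.
have [F wF eF] := weak_nabla_rad n alpha_gt0 jH vH.
have tu : test_function u := test_function_rad n jH vH.
have mu : measurable_fun setT u := continuous_measurable_rV (test_function_continuous tu).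
have mF : measurable_fun setT (fun x => enorm (F x)).
  by have [_ locF _] := wF; apply: measurable_enorm => j; case: (locF j).
have EF : (\int[leb]_x (`|enorm (F x)| `^ q)%:E <= 1)%E.
  have mR : measurable_fun setT (fun x : 'rV[R]_n => (radial_nabla_norm n alpha U (sqn x) `^ q)%:E).
    apply/measurable_EFinP; apply: (measurableT_comp (measurable_powR _)).
    exact: measurable_radial_nabla_norm.
  have nR (x : 'rV[R]_n) : setT x -> (0 <= (radial_nabla_norm n alpha U (sqn x) `^ q)%:E)%E.
    by rewrite lee_fin powR_ge0.
  have cA : (0 <= (A `^ q)%:E)%E by rewrite lee_fin powR_ge0.
  have -> : (\int[leb]_x (`|enorm (F x)| `^ q)%:E =
      \int[leb]_x ((A `^ q)%:E * (radial_nabla_norm n alpha U (sqn x) `^ q)%:E))%E.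
    apply: eq_integral => x _; rewrite eF radial_nabla_norm_scale ?(ltW A0)//.
    rewrite ger0_norm ?mulr_ge0 ?(ltW A0) ?radial_nabla_norm_ge0//.
    by rewrite powRM ?(ltW A0) ?radial_nabla_norm_ge0.
  rewrite (ge0_integralZl leb measurableT mR nR cA).
  apply: le_trans (lee_wpmul2l cA (hE l ll0)) _; rewrite -EFinM lee_fin /A -powRrM.
  have -> : - iq * q = -1 by field; rewrite !gt_eqF.
  by rewrite powR_inv1 ?(ltW kl0)// mulVf// gt_eqF.
have Ubd (s : R) : 0 <= s -> `|U 0%N s| <= (l + C3) * (s < 2)%R%:R.
  move=> s0; have sd : 0 < s + d by rewrite ltr_wpDl.
  have [s4|s4] := leP s 4^-1.
    have -> : s < 2 by exact: le_lt_trans s4 quarter_lt2.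
    rewrite mulr1 /U log_cutoff_near// /log_jet divr1 normrN.
    apply: (@le_trans _ _ l); last by rewrite lerDl.
    rewrite ler_norml; apply/andP; split.
      by rewrite -[leLHS]expRK ler_ln ?posrE ?expR_gt0// lerDr.
    by apply: (@le_trans _ _ 0); [apply: ln_le0; exact: quarterD_le1|exact: ltW].
  have [s1|s1] := leP s 1; last by rewrite /U (vanishes_log_cutoff X0 d 0%N (ltW s1)) normr0 mulr_ge0// addr_ge0// ltW.
  have -> : s < 2 by exact: le_lt_trans s1 (ltr1n R 2).
  rewrite mulr1; apply: (@le_trans _ _ C3); last by rewrite lerDr ltW.
  by apply: far3 => //; [rewrite (le_trans d4)// invf_le1// ler1n|rewrite (ltW s4)].
have lC1 : 1 <= l + C3 by rewrite (le_trans l1)// lerDl.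
have lC0 : 0 <= l + C3 by exact: le_trans lC1.
have upE : (\int[leb]_x (`|u x| `^ p)%:E <= ((l + C3) ^+ k.+1 * B2)%:E)%E.
  rewrite EFinM -lB2.
  have mB := measurable_sqn_ball 2 : measurable (sqn_ball 2 : set 'rV[R]_n).
  rewrite -(setIT (sqn_ball 2)) -integral_indic//.
  have m1 : measurable_fun setT (fun x => (\1_(sqn_ball 2 : set 'rV[R]_n) x : R)%:E).
    by apply/measurable_EFinP; exact: measurable_indic.
  have n1 (x : 'rV[R]_n) : setT x -> (0 <= (\1_(sqn_ball 2 : set 'rV[R]_n) x : R)%:E)%E by rewrite lee_fin.
  have c1 : (0 <= ((l + C3) ^+ k.+1)%:E)%E by rewrite lee_fin exprn_ge0.
  rewrite -(ge0_integralZl leb measurableT m1 n1 c1).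
  apply: ge0_le_integral => //.
  - exact: measurable_powR_norm.
  - exact: measurable_funeM.
  move=> x _; rewrite -EFinM lee_fin indicE mem_sqn_ball.
  have h : `|u x| <= (l + C3) * (sqn x < 2)%R%:R.
    rewrite uE normrM (gtr0_norm A0); apply: le_trans (Ubd _ (sqn_ge0 x)).
    by rewrite ler_piMl.
  move: h; case: (sqn x < 2); rewrite ?mulr1 ?mulr0 => h.
    rewrite -powR_mulrn//; apply: (@le_trans _ _ ((l + C3) `^ p)); last by rewrite ler_powR.
    by apply: (ge0_ler_powR (ltW p0)); rewrite ?nnegrE.
  have -> : `|u x| = 0 by apply/eqP; rewrite eq_le h normr_ge0.
  by rewrite powR0// gt_eqF.
have uL : mixed_sobolev alpha q p u.
  split; first by apply: mem_Lfun => //; exact: le_lt_trans upE (ltry _).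
  exists F => //; apply: mem_Lfun => //; exact: le_lt_trans EF (ltry _).
have N1 : ('N[leb]_(q%:E)[(fun x => (enorm (F x))%:E)] <= 1)%E by exact: Lnorm_le1.
have := AEG u uL F wF N1; cbv zeta; rewrite (Lnorm_power_integral u p0) => main.
have up0 : (0 <= \int[leb]_x (`|u x| `^ p)%:E)%E.
  by apply: integral_ge0 => x _; rewrite lee_fin powR_ge0.
have R1 : (C%:E * \int[leb]_x (`|u x| `^ p)%:E <= (`|C| * ((l + C3) ^+ k.+1 * B2))%:E)%E.
  apply: (@le_trans _ _ ((`|C|)%:E * \int[leb]_x (`|u x| `^ p)%:E)%E).
    by apply: lee_wpmul2r => //; rewrite lee_fin ler_norm.
  by rewrite EFinM; apply: lee_wpmul2l => //; rewrite lee_fin.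
(* On |x|^2 < d the numerator is at least half an exponential and the denominator at most 2 (l +
   C3)^(k+1). *)
pose v0 := expR (N2 * rho * l) / 2 / (2 * (l + C3) ^+ k.+1).
have LB (x : 'rV[R]_n) : sqn x < d -> v0 <= adams_integrand alpha p gamma' u x.
  move=> sx; have s0 := sqn_ge0 x; have sd : 0 < sqn x + d by rewrite ltr_wpDl.
  have s4 : sqn x <= 4^-1 by apply: le_trans d4; exact: ltW.
  (* There s + d < 2 d, so doubling costs only ln 2, and the choice of [lmin] turns this into the
     factor 1/rho. *)
  have U1 : l - ln 2 <= U 0%N (sqn x).
    rewrite /U log_cutoff_near// /log_jet divr1 lerNr opprB.
    have -> : ln 2 - l = ln (2 * d) by rewrite lnM ?posrE// expRK.
    by rewrite ler_ln ?posrE ?mulr_gt0// mulr_natl mulr2n lerD2r ltW.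
  have U2 : l / rho <= U 0%N (sqn x).
    by apply: le_trans U1; move: l2; rewrite ler_pdivrMr// mulrBr mulr1 lerBrDr lerBrDl.
  have lr0 : 0 < l / rho by rewrite divr_gt0.
  have Upos : 0 <= U 0%N (sqn x) by apply: le_trans U2; exact: ltW.
  have uA : `|u x| = A * U 0%N (sqn x) by rewrite uE ger0_norm// mulr_ge0// ltW.
  have ul : `|u x| <= l + C3.
    rewrite uA; apply: (@le_trans _ _ (U 0%N (sqn x))); first by rewrite ler_piMl.
    apply: le_trans (ler_norm _) _; apply: le_trans (Ubd _ s0) _.
    by rewrite ler_piMr//; case: (_ < _).
  have tE : gamma' * (A * (l / rho)) `^ q' = N2 * rho * l.
    have Alr : 0 < A * (l / rho) by rewrite mulr_gt0.
    have NR : 0 < N2 * rho by rewrite mulr_gt0.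
    apply: ln_inj; rewrite ?posrE ?mulr_gt0 ?powR_gt0//.
    rewrite lnM ?posrE ?powR_gt0// ln_powR lnM ?posrE// ln_div ?posrE//.
    rewrite /A ln_powR lnM ?posrE// lnM ?posrE// lnrho (lnM (x := N2 * rho)) ?posrE// (lnM (x := N2)) ?posrE//.
    have <- : ln (gam * kap0 `^ (- (alpha%:R / (n%:R - alpha%:R)))) = ln N2.
      by rewrite gamma_const_critical.
    rewrite lnM ?posrE ?powR_gt0// ln_powR.
    by move: (ln gam) (ln rho) (ln kap0) (ln l) => *; field; rewrite !gt_eqF.
  have Alr0 : 0 <= A * (l / rho) by rewrite mulr_ge0 ?ltW.
  have tlb : N2 * rho * l <= gamma' * `|u x| `^ q'.
    rewrite -tE ler_pM2l//; apply: (ge0_ler_powR (ltW q'0)); rewrite ?nnegrE//.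
    by rewrite uA ler_pM2l.
  have N1' : 1 <= n%:R :> R by rewrite ler1n.
  have t0 : 0 <= gamma' * `|u x| `^ q' by rewrite mulr_ge0 ?powR_ge0// ltW.
  have lt2 : l / 2 <= gamma' * `|u x| `^ q'.
    apply: le_trans tlb; rewrite mulrC; apply: ler_wpM2r; first exact: ltW.
    by apply: half_le_mul; rewrite -[leLHS]mulr1; apply: ler_pM => //; exact: ltW.
  have eh : expR (N2 * rho * l) / 2 <= exp_remainder N (gamma' * `|u x| `^ q').
    apply: le_trans (exp_remainder_half (N := N) t0 _); last first.
      by rewrite -[leLHS]lnK ?posrE ?exprn_gt0// ler_expR; exact: quarter_le_half lN lt2.
    by apply: ler_wpM2r; [rewrite invr_ge0|rewrite ler_expR].
  have Den : 1 + `|u x| `^ b <= 2 * (l + C3) ^+ k.+1.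
    have e1 : 1 <= (l + C3) ^+ k.+1 by exact: exprn_ege1.
    rewrite mulr_natl mulr2n; apply: lerD => //.
    rewrite -powR_mulrn//; apply: (@le_trans _ _ ((l + C3) `^ b)); last by rewrite ler_powR.
    by apply: (ge0_ler_powR b0); rewrite ?nnegrE.
  have Dpos : 0 < 1 + `|u x| `^ b by rewrite ltr_wpDr ?powR_ge0.
  rewrite /v0 /adams_integrand -/N -/b; apply: ler_pM => //.
  - by rewrite invr_ge0 mulr_ge0// exprn_ge0.
  - by rewrite lef_pV2 ?posrE// mulr_gt0// exprn_gt0// (lt_le_trans ltr01).
have lbd : (leb (sqn_ball d : set 'rV[R]_n) = (V * expR (- (N2 * l)))%:E)%E.
  rewrite /sqn_ball lebesgue_ball//; congr ((_ * _)%:E).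
  by rewrite /d -expRM; congr expR; ring.
have low : ((v0 * (V * expR (- (N2 * l))))%:E <= `|C|%:E * ((l + C3) ^+ k.+1 * B2)%:E)%E.
  apply: le_trans R1; apply: le_trans main; rewrite EFinM -lbd -integral_cst; last exact: measurable_sqn_ball.
  have nI x : (0 <= (adams_integrand alpha p gamma' u x)%:E)%E.
    by rewrite lee_fin adams_integrand_ge0// ltW.
  have mI : measurable_fun setT (fun x => (adams_integrand alpha p gamma' u x)%:E).
    by apply/measurable_EFinP; exact: measurable_adams_integrand.
  apply: (@le_trans _ _ (\int[leb]_(x in sqn_ball d) (adams_integrand alpha p gamma' u x)%:E)%E).
    apply: ge0_le_integral => //.
    - exact: measurable_sqn_ball.
    - move=> x _; rewrite lee_fin /v0 divr_ge0 ?divr_ge0 ?expR_ge0//.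
      by rewrite mulr_ge0// exprn_ge0.
    - exact: measurable_funTS.
  by apply: ge0_subset_integral => //; exact: measurable_sqn_ball.
(* The volume of the small ball brings exp(-(n/2) l), so exp((n/2)(rho - 1) l) would be at most a
   polynomial in l, against the choice of l. *)
move: low; rewrite -EFinM lee_fin /v0; set P := (l + C3) ^+ k.+1.
have P0 : 0 < P by rewrite exprn_gt0// (lt_le_trans ltr01).
move: hl; rewrite exprD -/P.
have -> : expR (N2 * (rho - 1) * l) = expR (N2 * rho * l) * expR (- (N2 * l)).
  by rewrite -expRD; congr expR; ring.
move: (expR (N2 * rho * l)) (expR (- (N2 * l))) => e1 e2 h1 h2.
have : e1 * e2 <= 4 * `|C| * B2 / V * (P * P).
  have -> : e1 * e2 = (e1 / 2 / (2 * P) * (V * e2)) * (4 * P / V) by field; rewrite !gt_eqF.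
  have -> : 4 * `|C| * B2 / V * (P * P) = (`|C| * (P * B2)) * (4 * P / V) by field; rewrite !gt_eqF.
  by apply: ler_wpM2r => //; rewrite divr_ge0 ?(ltW V0)// mulr_ge0// ltW.
by rewrite leNgt h1.
Qed.

End sharpness.

Theorem theorem3 (R : realType) (n alpha : nat) (p : R)
    (alpha_gt0 : (0 < alpha)%N) (alpha_lt_n : (alpha < n)%N) (p_ge1 : 1 <= p) :
  (exists C : R, adams_exact_growth n alpha p (gamma_const n alpha) C) /\
  (forall gamma' : R, gamma_const n alpha < gamma' ->
     forall C : R, ~ adams_exact_growth n alpha p gamma' C).
Proof.
split; first exact: adams_exact_growth_gamma_const.
by move=> gamma' gg C; exact: adams_exact_growth_sharp.
Qed.
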